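(* Let $f_{4,2}\in\mathfrak{sl}_6$ be a nilpotent element with Jordan type $(4,2)$, and let $k\neq-6$, $k\ne-\frac92$. Let $M(k)$ be the Heisenberg vertex subalgebra generated by the weight-one field $J$ of $\mathcal{W}_k(\mathfrak{sl}_6,f_{4,2})$. Then: (1) the embedding $M(k)\hookrightarrow\mathcal{W}_k(\mathfrak{sl}_6,f_{4,2})$ is conformal if and only if $k=-\frac{13}{3}$; (2) the embedding $M(k)\hookrightarrow\mathcal{W}_k(\mathfrak{sl}_6,f_{4,2})$ is not conformal for $k=-\frac{45}{11}$.
   Context: $\mathcal{W}^k(\mathfrak{sl}_6,f_{4,2})$ is the universal affine $\mathcal{W}$-algebra at level $k$ and $\mathcal{W}_k(\mathfrak{sl}_6,f_{4,2})$ its simple quotient. Its central charge is $\frac{35k}{k+6}-66k-194$. The centralizer of the $\mathfrak{sl}_2$-triple of $f_{4,2}$ is one-dimensional and the weight-one space is spanned by a Heisenberg field $J$ of level $4(k+\frac92)$; for $k\neq-\frac92$ the Heisenberg vertex algebra $M(k)$ generated by $J$ has its standard conformal vector, of central charge $1$. The embedding is conformal if this conformal vector equals the conformal vector of $\mathcal{W}_k(\mathfrak{sl}_6,f_{4,2})$. *)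

(* Defs.v *)
From HB Require Import structures.
From mathcomp Require Import all_boot all_order all_algebra.
From mathcomp Require Import reals complex.

Set Implicit Arguments.
Unset Strict Implicit.
Unset Printing Implicit Defensive.

Import GRing.Theory.
Local Open Scope ring_scope.

(** * Vertex superalgebras *)

(* [vprod n a b] is the n-th product a_(n) b, i.e. the coefficient of z^(-n-1)
   in Y(a,z)b; [vpar false] and [vpar true] are the even and the odd part.
   The translation operator is T a = a_(-2)|0>, which the axioms of a vertex
   algebra force.  [vlocal] is the coefficient of z^(-m-1) w^(-n-1) in
   (z-w)^N [Y(a,z), Y(b,w)] c = 0. *)
HB.mixin Record isVertexSuperAlgebra (F : fieldType) V
    of GRing.Lmodule F V := {
  vac : V;
  vprod : int -> V -> V -> V;
  vpar : bool -> V -> Prop;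
  vpar_linear : forall p (c : F) (u v : V),
    vpar p u -> vpar p v -> vpar p (c *: u + v);
  vpar_sum : forall v : V,
    exists v0 v1, [/\ vpar false v0, vpar true v1 & v = v0 + v1];
  vpar_direct : forall v : V, vpar false v -> vpar true v -> v = 0;
  vprod_linearl : forall n b (c : F) (u v : V),
    vprod n (c *: u + v) b = c *: vprod n u b + vprod n v b;
  vprod_linearr : forall n a (c : F) (u v : V),
    vprod n a (c *: u + v) = c *: vprod n a u + vprod n a v;
  vac_even : vpar false vac;
  vprod_par : forall p q n (a b : V),
    vpar p a -> vpar q b -> vpar (p (+) q) (vprod n a b);
  vprod_field : forall a b : V,
    exists N : nat, forall n : nat, (N <= n)%N -> vprod n%:Z a b = 0;
  vac_prod : forall n (a : V), vprod n vac a = (n == -1)%:R *: a;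
  vprod_vac : forall a : V, vprod (-1) a vac = a;
  vprod_vac_ge0 : forall (n : nat) (a : V), vprod n%:Z a vac = 0;
  vtranslation : forall n (a b : V),
    vprod (-2) (vprod n a b) vac - vprod n a (vprod (-2) b vac) =
      - (n%:~R *: vprod (n - 1) a b);
  vlocal : forall p q (a b : V), vpar p a -> vpar q b ->
    exists N : nat, forall (m n : int) (c : V),
      \sum_(j < N.+1) ((-1) ^+ j * 'C(N, j)%:R) *:
        (vprod (m + N%:Z - j%:Z) a (vprod (n + j%:Z) b c)
         - (-1) ^+ (p && q) *:
           vprod (n + j%:Z) b (vprod (m + N%:Z - j%:Z) a c)) = 0
}.

#[short(type="vertexSuperAlgType")]
HB.structure Definition VertexSuperAlgebra (F : fieldType) :=
  {V of GRing.Lmodule F V & isVertexSuperAlgebra F V}.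

Section VertexTheory.
Variable F : fieldType.
Implicit Types U V : vertexSuperAlgType F.

Definition vT V (a : V) : V := vprod (-2) a vac.

Definition vnop V (a b : V) : V := vprod (-1) a b.

(* [a_lambda b] = \sum_n s_n lambda^n / n!, where s_n = 0 for n >= size s. *)
Definition ope V (a b : V) (s : seq V) : Prop :=
  forall n : nat, vprod n%:Z a b = nth 0 s n.

Record vertex_hom U V (phi : U -> V) : Prop := {
  vhom_linear : forall (c : F) u v, phi (c *: u + v) = c *: phi u + phi v;
  vhom_vac : phi vac = vac;
  vhom_prod : forall n u v, phi (vprod n u v) = vprod n (phi u) (phi v);
  vhom_par : forall p u, vpar p u -> vpar p (phi u)
}.

Record vertex_ideal V (I : V -> Prop) : Prop := {
  videal0 : I 0;
  videal_linear : forall (c : F) u v, I u -> I v -> I (c *: u + v);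
  videal_graded : forall u v,
    vpar false u -> vpar true v -> I (u + v) -> I u /\ I v;
  videal_left : forall n u v, I v -> I (vprod n u v);
  videal_right : forall n u v, I u -> I (vprod n u v)
}.

Definition vertex_simple V : Prop :=
  (exists v : V, v <> 0) /\
  forall I : V -> Prop, vertex_ideal I ->
    (forall v, I v -> v = 0) \/ (forall v, I v).

Definition simple_quotient U V (phi : U -> V) : Prop :=
  [/\ vertex_hom phi, forall v, exists u, phi u = v & vertex_simple V].

Inductive vgenerated V (S : V -> Prop) : V -> Prop :=
| vgen_in v of S v : vgenerated S v
| vgen_vac : vgenerated S vac
| vgen_linear (c : F) u v of vgenerated S u & vgenerated S v :
    vgenerated S (c *: u + v)
| vgen_prod n u v of vgenerated S u & vgenerated S v :
    vgenerated S (vprod n u v).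

(* The subalgebra A of V, with conformal vector wA, is conformally embedded in
   V, with conformal vector w. *)
Definition conformal_embedding V (A : V -> Prop) (wA w : V) : Prop :=
  A wA /\ wA = w.

Definition heisenberg_field V (J : V) (l : F) : Prop :=
  ope J J [:: 0; l *: vac].

Definition heisenberg_algebra V (J : V) : V -> Prop :=
  vgenerated (fun v => v = J).

Definition heisenberg_conformal V (J : V) (l : F) : V :=
  (2 * l)^-1 *: vnop J J.

(* V is freely generated by the ordered family g, where pg i is the parity of
   g i: the monomials (g i1)_(-n1-1) ... (g is)_(-ns-1) |0>, with the pairs
   (i, n) in increasing order and without repetition for odd g i, are a basis
   of V. *)
Definition gen_le r (pg : 'I_r -> bool) : rel ('I_r * nat) := fun x y =>
  (x.1 < y.1)%N ||
  (x.1 == y.1) && (if pg x.1 then (x.2 < y.2)%N else (x.2 <= y.2)%N).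

Definition gen_monomial V r (g : 'I_r -> V) (w : seq ('I_r * nat)) : V :=
  foldr (fun x v => vprod (- (x.2.+1)%:Z) (g x.1) v) vac w.

Definition freely_generated V r (pg : 'I_r -> bool) (g : 'I_r -> V) : Prop :=
  [/\ forall i, vpar (pg i) (g i),
      forall v : V, exists (s : seq (seq ('I_r * nat))) (c : _ -> F),
        all (sorted (gen_le pg)) s /\
        v = \sum_(w <- s) c w *: gen_monomial g w &
      forall (s : seq (seq ('I_r * nat))) (c : _ -> F),
        uniq s -> all (sorted (gen_le pg)) s ->
        \sum_(w <- s) c w *: gen_monomial g w = 0 ->
        forall w, w \in s -> c w = 0].

End VertexTheory.

(** * Nilpotent elements of sl_n *)

Section NilpotentData.
Variable F : fieldType.

Definition lie n (a b : 'M[F]_n) : 'M[F]_n := a *m b - b *m a.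

Definition sl2_triple n (e h f : 'M[F]_n) : Prop :=
  [/\ lie h e = 2 *: e, lie h f = - (2 *: f) & lie e f = h].

Definition jordan_block r : 'M[F]_r := \matrix_(i, j) (i.+1 == j)%:R.

Definition jordan_type_4_2 (f : 'M[F]_6) : Prop :=
  exists2 P : 'M[F]_(4 + 2), P \in unitmx &
    f = invmx P *m block_mx (jordan_block 4) 0 0 (jordan_block 2) *m P.

(* A basis of sl_n with its dual basis for the form (a|b) = tr(ab), and a basis
   u of g_+ = sum_{m > 0} g_m, with its dual basis u' of g_-, homogeneous for
   the Dynkin grading g_m = {a | [h/2, a] = m a}.  Only integral degrees are
   taken into account: all parts of (4,2) have the same parity, so its Dynkin
   grading is even. *)
Record dynkin_bases n (h : 'M[F]_n) := DynkinBases {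
  dim_g : nat;
  bg : 'I_dim_g -> 'M[F]_n;
  bg' : 'I_dim_g -> 'M[F]_n;
  bg_sl : forall i, \tr (bg i) = 0;
  bg'_sl : forall i, \tr (bg' i) = 0;
  bg_dual : forall i j, \tr (bg i *m bg' j) = (i == j)%:R;
  bg_span : forall a, \tr a = 0 ->
    a = \sum_i \tr (a *m bg' i) *: bg i;
  dim_p : nat;
  up : 'I_dim_p -> 'M[F]_n;
  up' : 'I_dim_p -> 'M[F]_n;
  udeg : 'I_dim_p -> nat;
  udeg_gt0 : forall i, (0 < udeg i)%N;
  up_deg : forall i, lie h (up i) = (2 * udeg i)%:R *: up i;
  up'_deg : forall i, lie h (up' i) = - ((2 * udeg i)%:R *: up' i);
  up_dual : forall i j, \tr (up i *m up' j) = (i == j)%:R;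
  up_span : forall (m : nat) a, (0 < m)%N -> lie h a = (2 * m)%:R *: a ->
    a = \sum_i \tr (a *m up' i) *: up i
}.

End NilpotentData.

Arguments bg {F n h} d : rename.
Arguments bg' {F n h} d : rename.
Arguments up {F n h} d : rename.
Arguments up' {F n h} d : rename.
Arguments udeg {F n h} d : rename.

(** * Affine W-algebras of sl_n (even Dynkin grading) *)

(* The BRST complex of Kac-Roan-Wakimoto is C = V^k(sl_n) (x) F(A_ch), where
   F(A_ch) is the algebra of charged fermions phi_i, phi^i attached to
   g_+ + g_+^* with parity reversed; the neutral fermions attached to g_{1/2}
   are absent as the grading is even.  C is the vertex superalgebra freely
   generated by sl_n, the phi_i and the phi^i with the OPEs below, and it is
   determined by this up to a unique isomorphism.  [cur] is only meaningful on
   traceless matrices. *)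
Record brst_complex (F : fieldType) n (k : F) (h : 'M[F]_n)
    (D : dynkin_bases h) := BrstComplex {
  brst :> vertexSuperAlgType F;
  cur : {linear 'M[F]_n -> brst};
  phi : 'I_(dim_p D) -> brst;
  phis : 'I_(dim_p D) -> brst;
  ope_cur_cur : forall a b, \tr a = 0 -> \tr b = 0 ->
    ope (cur a) (cur b) [:: cur (lie a b); (k * \tr (a *m b)) *: vac];
  ope_cur_phi : forall a i, \tr a = 0 -> ope (cur a) (phi i) [::];
  ope_cur_phis : forall a i, \tr a = 0 -> ope (cur a) (phis i) [::];
  ope_phi_phi : forall i j, ope (phi i) (phi j) [::];
  ope_phis_phis : forall i j, ope (phis i) (phis j) [::];
  ope_phi_phis : forall i j, ope (phi i) (phis j) [:: (i == j)%:R *: vac];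
  brst_free : freely_generated
    (fun i : 'I_(dim_g D + (dim_p D + dim_p D)) =>
       if split i is inl _ then false else true)
    (fun i : 'I_(dim_g D + (dim_p D + dim_p D)) =>
       match split i with
       | inl j => cur (bg D j)
       | inr j => match split j with inl l => phi l | inr l => phis l end
       end)
}.

Arguments cur {F n k h D} b : rename.
Arguments phi {F n k h D} b : rename.
Arguments phis {F n k h D} b : rename.

Section WAlgebra.
Variables (F : fieldType) (n : nat) (k : F) (h : 'M[F]_n).
Variables (D : dynkin_bases h) (C : brst_complex k D).
Local Notation u := (up D).
Local Notation u' := (up' D).
Local Notation m := (udeg D).
Local Notation cur := (cur C).
Local Notation phi := (phi C).
Local Notation phis := (phis C).

(* d = sum_i :u_i phi^i: - 1/2 sum_{i,j,l} c_{ij}^l :phi_l phi^i phi^j: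
       + sum_i (f|u_i) phi^i, with [u_i, u_j] = sum_l c_{ij}^l u_l. *)
Definition brst_vector (f : 'M[F]_n) : C :=
  \sum_i vnop (cur (u i)) (phis i)
  - 2^-1 *: (\sum_i \sum_j \sum_l
      \tr (lie (u i) (u j) *m u' l) *: vnop (phi l) (vnop (phis i) (phis j)))
  + \sum_i \tr (f *m u i) *: phis i.

Definition brst_diff (f : 'M[F]_n) (v : C) : C := vprod 0 (brst_vector f) v.

(* The phi^i have charge 1, the phi_i have charge -1 and sl_n has charge 0. *)
Definition has_charge (c : F) (v : C) : Prop :=
  vprod 0 (\sum_i vnop (phis i) (phi i)) v = c *: v.

Definition cocycle0 (f : 'M[F]_n) (v : C) : Prop :=
  has_charge 0 v /\ brst_diff f v = 0.

Definition coboundary0 (f : 'M[F]_n) (v : C) : Prop :=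
  exists2 w : C, has_charge (-1) w & v = brst_diff f w.

(* W = W^k(sl_n, f) = H^0(C, d), where cl sends a cocycle of charge 0 to its
   class (and is irrelevant on other elements of C). *)
Record universal_W (f : 'M[F]_n) (W : vertexSuperAlgType F) (cl : C -> W) :
    Prop := {
  cl_linear : forall (c : F) v w, cocycle0 f v -> cocycle0 f w ->
    cl (c *: v + w) = c *: cl v + cl w;
  cl_vac : cl vac = vac;
  cl_prod : forall r v w, cocycle0 f v -> cocycle0 f w ->
    cl (vprod r v w) = vprod r (cl v) (cl w);
  cl_par : forall p v, cocycle0 f v -> vpar p v -> vpar p (cl v);
  cl_surj : forall w, exists2 v, cocycle0 f v & cl v = w;
  cl_ker : forall v, cocycle0 f v -> (cl v = 0 <-> coboundary0 f v)
}.

(* L = L_Sugawara + T x + L_ch with x = h/2; the dual Coxeter number is n. *)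
Definition sugawara : C :=
  (2 * (k + n%:R))^-1 *: \sum_i vnop (cur (bg D i)) (cur (bg' D i)).

Definition conformal_ch : C :=
  \sum_i (- ((m i)%:R *: vnop (phis i) (vT (phi i)))
          + (1 - (m i)%:R) *: vnop (vT (phis i)) (phi i)).

Definition brst_conformal : C :=
  sugawara + vT (cur (2^-1 *: h)) + conformal_ch.

End WAlgebra.

(* Main.v *)
Require Import Defs.
From HB Require Import structures.
From mathcomp Require Import all_boot all_order all_algebra.
From mathcomp Require Import boolp zify ring.
From mathcomp Require reals complex.

(** The embedding is conformal exactly when one vector of weight two vanishes
in the simple quotient, and everything needed about that vector can be read off
from cocycles of conformal weight at most two.

Normal form.  By sl_2-theory ([normal_form]) a pair (h, f) with f of Jordan
type (4,2) is conjugate to the fixed pair given by [f0] and by the levels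
[lev6], and the BRST complex depends on the bases only through fields [Kf],
[pf], [sf] indexed by matrices ([ops]).  All later computations therefore take
place with elementary 6 x 6 matrices.

Cohomology in low weight.  The hatted currents [hJ a] = K a + (fermion
bilinears) with a in g_{<= 0} are the building blocks of the zeroth cohomology.
A linear map H that turns one current K into the corresponding ghost p
([homotopy]) is a homotopy for the leading part of the differential: on words
in [hJ], s, p and d p the operator d H + H d counts the letters p and d p up to
terms of lower filtration ([EE_nx]).  Consequently a cocycle of charge 0 and of
weight at most two is, modulo coboundaries, a word in hatted currents of
nonpositive degree ([low_weight]).  It follows that the W-algebra has
nonnegative integral weights, that its weight-zero part is the line of the
vacuum and its weight-one part the line of the cocycle [J0], because f0 has a
one-dimensional centralizer in sl_6 of degree 0 ([centralizer]).  Comparing the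
second-order poles identifies the given field J with a multiple of the class
of [J0] ([J_J0]).  So, with [omt] the conformal vector of the complex minus
r J0 J0, where r^-1 = 24 k + 108 is twice the level of [J0], the embedding is
conformal if and only if the class of [omt] in the simple quotient is zero.

Necessity.  There is a cocycle [W2] of weight two, depending polynomially on k,
with omt_(3) W2 = 39/2 (k + 13/3) |0> ([omt_W2]).  If the class of [omt] is
zero then so is this scalar, since the vacuum of a simple quotient is nonzero.
In particular the level -45/11 is excluded.

Sufficiency.  At k = -13/3 the functional u |-> omt_(3) u on words of weight two
factors through the differential: it equals [Fop (dv u)] for an explicit linear
functional [Fop] ([special_pairing]).  It hence vanishes on cocycles, so the
class of [omt] is orthogonal to the whole weight-two space, and then the ideal
that it generates does not meet the line of the vacuum ([pairing]).  Simplicity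
makes this ideal zero ([conformal_special]). *)

Set Implicit Arguments.
Unset Strict Implicit.
Unset Printing Implicit Defensive.

Import Order.TTheory GRing.Theory Num.Theory.
Local Open Scope ring_scope.

(** * Modes of a vertex superalgebra and the Borcherds identity *)
Module VertexCalculus.
Section LModTactic.
Variables (F : fieldType) (V : lmodType F).
Inductive lexp := LVar of nat | LZero | LAdd of lexp & lexp | LOpp of lexp | LScale of F & lexp.
Fixpoint leval (e : seq V) x := match x with
  | LVar i => nth 0 e i | LZero => 0 | LAdd a b => leval e a + leval e b
  | LOpp a => - leval e a | LScale c a => c *: leval e a end.
Fixpoint lcoef (i : nat) x : F := match x with
  | LVar j => if Nat.eqb i j then 1 else 0 | LZero => 0 | LAdd a b => lcoef i a + lcoef i b
  | LOpp a => - lcoef i a | LScale c a => c * lcoef i a end.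
Fixpoint lall (n : nat) (P : nat -> Prop) : Prop :=
  match n with 0 => True | m.+1 => P m /\ lall m P end.
Fixpoint lwf (n : nat) x : bool := match x with
  | LVar j => (j < n)%N | LZero => true | LAdd a b => lwf n a && lwf n b
  | LOpp a => lwf n a | LScale c a => lwf n a end.
Lemma leval_sum e x : lwf (size e) x -> leval e x = \sum_(i < size e) lcoef i x *: nth 0 e i.
Proof.
elim: x => [j||a IHa b IHb|a IHa|c a IHa] /=.
- move=> lt; rewrite (bigD1 (Ordinal lt)) //= PeanoNat.Nat.eqb_refl scale1r.
  rewrite big1 ?addr0 // => i /eqP ne.
  case: (PeanoNat.Nat.eqb_spec i j) => [e'|]; last by rewrite scale0r.
  by case: ne; apply: val_inj.
- by rewrite big1 // => i _; rewrite scale0r.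
- by case/andP=> /IHa -> /IHb ->; rewrite -big_split; apply: eq_bigr => i _; rewrite scalerDl.
- by move/IHa=> ->; rewrite -sumrN; apply: eq_bigr => i _; rewrite scaleNr.
- by move/IHa=> ->; rewrite scaler_sumr; apply: eq_bigr => i _; rewrite scalerA.
Qed.
(** The atoms need not be independent, so equality of the coefficients is only
sufficient; it is what the tactic [lmod] leaves to [ring]. *)
Lemma lmod_eq e x y : lwf (size e) x && lwf (size e) y ->
  lall (size e) (fun i => lcoef i x = lcoef i y) -> leval e x = leval e y.
Proof.
case/andP=> /leval_sum -> /leval_sum -> h; apply: eq_bigr => i _; congr (_ *: _).
suff: forall n (P : nat -> Prop), lall n P -> forall j, (j < n)%N -> P j by move=> /(_ _ _ h i (ltn_ord i)).
elim=> // n IH P [h0 h1] j; rewrite ltnS leq_eqVlt => /orP[/eqP -> //|]; exact: IH.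
Qed.
End LModTactic.

Ltac lm_same x y := match constr:(Set) with
  | _ => let _ := match constr:(Set) with _ => constr_eq x y end in constr:(true)
  | _ => let _ := match constr:(Set) with _ => unify x y end in constr:(true)
  | _ => constr:(false) end.
Ltac lm_in x l := lazymatch l with
  | @nil _ => constr:(false)
  | @cons _ ?y ?t => let b := lm_same x y in
      lazymatch b with true => constr:(true) | _ => lm_in x t end end.
Ltac lm_idx x l := lazymatch l with
  | @cons _ ?y ?t => let b := lm_same x y in
      lazymatch b with true => constr:(0%N)
      | _ => let n := lm_idx x t in constr:(n.+1) end end.
Ltac lm_atoms W t l := lazymatch t with
  | 0%R => l
  | (?a + ?b)%R => let l1 := lm_atoms W a l in lm_atoms W b l1
  | (- ?a)%R => lm_atoms W a l | (?c *: ?a)%R => lm_atoms W a l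
  | (?a *+ ?n)%R => lm_atoms W a l
  | ?x => let b := lm_in x l in
          lazymatch b with true => l | false => constr:(@cons W x l) end end.
Ltac lm_reify F t l := lazymatch t with
  | 0%R => constr:(@LZero F)
  | (?a + ?b)%R => let x := lm_reify F a l in let y := lm_reify F b l in constr:(@LAdd F x y)
  | (- ?a)%R => let x := lm_reify F a l in constr:(@LOpp F x)
  | (?c *: ?a)%R => let x := lm_reify F a l in constr:(@LScale F c x)
  | (?a *+ ?n)%R => let x := lm_reify F a l in constr:(@LScale F (n%:R) x)
  | ?x => let i := lm_idx x l in constr:(@LVar F i) end.
Ltac lmod_on F V W tac :=
  lazymatch goal with |- @eq ?T ?a ?b =>
    let l0 := constr:(@nil W) in
    let l1 := lm_atoms W a l0 in let l := lm_atoms W b l1 in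
    let x := lm_reify F a l in let y := lm_reify F b l in
    change (@leval F V l x = @leval F V l y);
    apply: lmod_eq; [exact: isT | rewrite /lall /lcoef /=; repeat split; tac]
  end.
Ltac lmod_of V tac := lazymatch type of V with
  | VertexSuperAlgebra.type ?F =>
    lmod_on F V constr:(@VertexSuperAlgebra.sort F V) tac
  | _ => lazymatch type of V with context [GRing.Lmodule.type ?F] =>
     lmod_on F V constr:(GRing.Lmodule.sort V) tac end
  end.
Ltac lmod_by tac := rewrite -?scaler_nat; lazymatch goal with
  | |- @eq (@VertexSuperAlgebra.sort ?F ?V) _ _ => lmod_of V tac
  | _ => match goal with V : VertexSuperAlgebra.type ?F |- _ => lmod_of V tac end
  end.
Ltac lmod := lmod_by ltac:(ring).
(** The binomial coefficient of an integer m over j: the modes of the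
Borcherds identity are expanded with arbitrary integral exponents. *)
Definition binz (m : int) (j : nat) : int :=
  match m with
  | Posz n => 'C(n, j)%:Z
  | Negz n => (-1) ^+ j * 'C(n + j, j)%:Z
  end.

Lemma binz0 m : binz m 0 = 1.
Proof. by case: m => n /=; rewrite ?addn0 bin0 ?mulr1. Qed.

Lemma binz0n j : binz 0 j = (j == 0)%:R.
Proof. by case: j. Qed.

Lemma binzS m j : binz (m + 1) j.+1 = binz m j.+1 + binz m j.
Proof.
case: m => [n | [|n]].
- by rewrite -PoszD /= addn1 binS PoszD.
- by rewrite /= !add0n !binn !mulr1 exprS mulN1r addNr.
- have -> : Negz n.+1 + 1 = Negz n by lia.
  rewrite /=; have -> : (n.+1 + j.+1 = (n + j.+1).+1)%N by lia.
  have -> : (n.+1 + j = n + j.+1)%N by lia.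
  by rewrite binS PoszD exprS; ring.
Qed.

Lemma binzN1 j : binz (-1) j = (-1) ^+ j.
Proof. by rewrite /= add0n binn mulr1. Qed.

Lemma binzN2 j : binz (-2) j = (-1) ^+ j * j.+1%:Z.
Proof. by rewrite /= add1n binSn. Qed.

Lemma int_ind2 (P : int -> Prop) : P 0 -> (forall m, P m <-> P (m + 1)) ->
  forall m, P m.
Proof.
move=> P0 PS; case=> n; first by elim: n => // n IH; rewrite -addn1; apply/(PS n).
elim: n => [|n IH]; first by apply/PS.
by apply/PS; have -> : Negz n.+1 + 1 = Negz n by lia.
Qed.

Section OneSided.
Variables (F : numFieldType) (V : lmodType F).
Implicit Types (X Y : int -> int -> V) (g : int -> V).

Definition diff1 g (m : int) := g (m + 1) - g m.

(** A function killed by an iterated difference is a polynomial, hence given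
by its Newton expansion at 0. This turns locality into the commutator formula.
*)
Lemma newton_interp N g : (forall m, iter N diff1 g m = 0) ->
  forall m, g m = \sum_(j < N) (binz m j)%:~R *: iter j diff1 g 0.
Proof.
elim: N g => [|N IH] g gN m; first by rewrite big_ord0; exact: gN.
rewrite -[LHS]subr0; apply/eqP; rewrite -subr_eq0 addrAC subr0; apply/eqP.
elim/int_ind2: m => [|m].
  rewrite big_ord_recl binz0 scale1r /= big1 ?addr0 ?subrr // => j _.
  by rewrite scale0r.
suff -> : g (m + 1) - \sum_(j < N.+1) (binz (m + 1) j)%:~R *: iter j diff1 g 0 =
  g m - \sum_(j < N.+1) (binz m j)%:~R *: iter j diff1 g 0 by [].
have: diff1 g m = \sum_(j < N) (binz m j)%:~R *: iter j diff1 (diff1 g) 0.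
  by apply: IH => i; rewrite -iterSr gN.
rewrite /diff1 => /eqP; rewrite subr_eq => /eqP ->.
rewrite [in LHS]big_ord_recl [in RHS]big_ord_recl !binz0 /=.
have -> : \sum_(i < N) (binz (m + 1) (bump 0 i))%:~R *: iter (bump 0 i) diff1 g 0 =
    \sum_(i < N) (binz m (bump 0 i))%:~R *: iter (bump 0 i) diff1 g 0 +
    \sum_(i < N) (binz m i)%:~R *: iter i diff1 (diff1 g) 0.
  rewrite -big_split; apply: eq_bigr => i _.
  by rewrite /bump /= add1n binzS rmorphD /= scalerDl -iterSr.
set A := \sum_(j < N) _; set B := \sum_(j < N) _.
by lmod_on F V V ltac:(ring).
Qed.

(** Multiplication of a formal distribution in z and w by z - w, on
coefficients. *)
Definition dop X (m n : int) := X (m + 1) n - X m (n + 1).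

Definition nbound X := exists n0 : int, forall m n, n0 <= n -> X m n = 0.


Lemma iter_dop_ext N X Y : (forall m n, X m n = Y m n) ->
  forall m n, iter N dop X m n = iter N dop Y m n.
Proof. by move=> e; elim: N => //= N IH m n; rewrite /dop !IH. Qed.

Lemma nbound_dop X : nbound X -> nbound (dop X).
Proof.
by case=> n0 h; exists n0 => m n le; rewrite /dop !h ?subrr //; lia.
Qed.

Lemma nbound_iter N X : nbound X -> nbound (iter N dop X).
Proof. by move=> h; elim: N => //= N IH; apply: nbound_dop. Qed.

Lemma nboundB X Y : nbound X -> nbound Y -> nbound (fun m n => X m n - Y m n).
Proof.
case=> a ha [b hb]; exists (Num.max a b) => m n.
by rewrite ge_max => /andP[h1 h2]; rewrite ha // hb // subrr.
Qed.

(** Multiplication by z - w is injective on series that are bounded in one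
variable; locality alone does not give this, the bound on one side does. *)
Lemma dop_inj X : nbound X -> (forall m n, dop X m n = 0) -> forall m n, X m n = 0.
Proof.
case=> n0 h d0 m n.
have e i : X m n = X (m - i%:Z) (n + i%:Z).
  elim: i => [|i ->]; first by rewrite subr0 addr0.
  have /eqP := d0 (m - i.+1%:Z) (n + i%:Z); rewrite /dop subr_eq0 => /eqP.
  have -> : m - i.+1%:Z + 1 = m - i%:Z by lia.
  by have -> : n + i%:Z + 1 = n + i.+1%:Z by lia.
by rewrite (e `|n0 - n|%N) h //; lia.
Qed.

Lemma iter_dop_inj N X : nbound X -> (forall m n, iter N dop X m n = 0) ->
  forall m n, X m n = 0.
Proof.
move=> nb; elim: N => //= N IH h; apply: IH; apply: dop_inj h.
exact: nbound_iter.
Qed.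

Lemma iter_dopE N X m n : iter N dop X m n =
  \sum_(j < N.+1) ((-1) ^+ j * 'C(N, j)%:R) *: X (m + N%:Z - j%:Z) (n + j%:Z).
Proof.
elim: N m n => [|N IH] m n.
  by rewrite big_ord1 /= mulr1 scale1r subr0 !addr0.
rewrite iterS /dop !IH big_ord_recl [RHS]big_ord_recl /= !bin0 -addrA; congr (_ + _).
  by congr (_ *: X _ _); lia.
rewrite [X in _ - X]big_ord_recr [RHS]big_ord_recr /= opprD addrA.
rewrite -sumrN -big_split /=; congr (_ + _).
  apply: eq_bigr => i _; rewrite /bump /= !add1n binS natrD exprS mulN1r.
  rewrite -scaleNr mulrDr scalerDl.
  congr (_ *: X _ _ + _); [by lia | ].
  by rewrite -mulNr; congr (_ *: X _ _); lia.
rewrite /bump /= !add1n !binn -scaleNr exprS mulN1r mulr1 mulNr mulr1.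
by congr (_ *: X _ _); lia.
Qed.

Lemma iter_diff1_line N X m n : iter N diff1 (fun i => X i (n - i)) m =
  iter N dop X m (n - m - N%:Z).
Proof.
elim: N m => [|N IH] m /=; first by rewrite subr0.
rewrite /diff1 !IH /dop; congr (iter N dop X _ _ - iter N dop X _ _); lia.
Qed.

Definition dsum (r : int) X (K : nat) (m n : int) :=
  \sum_(j < K) ((-1) ^+ j * (binz r j)%:~R) *: X (m + r - j%:Z) (n + j%:Z).

Lemma dsum_stable r X n0 K K' m n : (forall m n, n0 <= n -> X m n = 0) ->
  n0 <= n + K%:Z -> (K <= K')%N -> dsum r X K' m n = dsum r X K m n.
Proof.
move=> h0 leK leKK; rewrite /dsum [RHS](big_ord_widen K' (fun j : nat =>
  ((-1) ^+ j * (binz r j)%:~R) *: X (m + r - j%:Z) (n + j%:Z))) //.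
rewrite [RHS]big_mkcond; apply: eq_bigr => j _; case: ltnP => // leKj.
by rewrite h0 ?scaler0 //; lia.
Qed.

Lemma dsumS r X K m n : dsum (r + 1) X K.+1 m n =
  dsum r X K.+1 (m + 1) n - dsum r X K m (n + 1).
Proof.
rewrite /dsum !big_ord_recl !binz0 /= -[RHS]addrA; congr (_ + _).
  by congr (_ *: X _ _); lia.
rewrite -sumrN -big_split /=; apply: eq_bigr => i _.
rewrite /bump /= !add1n binzS rmorphD mulrDr scalerDl.
congr (_ *: X _ _ + _); [by lia | ].
rewrite exprS mulN1r mulNr scaleNr; congr (- (_ *: X _ _)); lia.
Qed.

(** Multiplication by (z - w)^r for any integer r, expanded in the domain
where the support condition [X0] makes the sum finite. *)
Definition dpow X n0 (r : int) (m n : int) := dsum r X `|n0 - n|.+1 m n.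

Section Dpow.
Variables (X : int -> int -> V) (n0 : int).
Hypothesis X0 : forall m n, n0 <= n -> X m n = 0.

Lemma dpowE r m n K : n0 < n + K%:Z -> dpow X n0 r m n = dsum r X K m n.
Proof.
move=> leK; rewrite /dpow; have [le|lt] := leqP `|n0 - n|.+1 K.
  by rewrite -(dsum_stable r _ X0 _ le) //; lia.
by apply: (dsum_stable _ _ X0 _ (ltnW lt)); lia.
Qed.

Lemma dpow0 m n : dpow X n0 0 m n = X m n.
Proof.
rewrite /dpow /dsum big_ord_recl binz0 /= mulr1 scale1r big1 => [|j _].
  by rewrite addr0 subr0 !addr0.
by rewrite mulr0 scale0r.
Qed.

Lemma dpow_nb r : nbound (dpow X n0 r).
Proof.
exists n0 => m n le; rewrite /dpow /dsum big1 // => j _.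
by rewrite X0 ?scaler0 //; lia.
Qed.

Lemma dop_dpow r m n : dop (dpow X n0 r) m n = dpow X n0 (r + 1) m n.
Proof.
pose K := (`|n0 - n| + `|n|).+1.
rewrite /dop (@dpowE _ _ _ K.+1); last by lia.
rewrite (@dpowE _ _ _ K); last by lia.
by rewrite (@dpowE _ _ _ K.+1); [rewrite dsumS | lia].
Qed.


End Dpow.
End OneSided.
Arguments dop {F V} X m n.
Arguments diff1 {F V} g m.
Arguments vpar_linear {F s p} c {u v}.
Arguments vprod_par {F s p q} n {a b}.
Arguments vlocal {F s p q a b}.
Arguments vpar_direct {F s v}.
Section Vertex.
Variables (F : numFieldType) (V : vertexSuperAlgType F).
Implicit Types a b c u v : V.

Lemma vprodDl n u v b : vprod n (u + v) b = vprod n u b + vprod n v b.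
Proof. by have := vprod_linearl n b 1 u v; rewrite !scale1r. Qed.
Lemma vprodDr n a u v : vprod n a (u + v) = vprod n a u + vprod n a v.
Proof. by have := vprod_linearr n a 1 u v; rewrite !scale1r. Qed.
Lemma vprod0l n b : vprod n 0 b = 0 :> V.
Proof. by apply: (addIr (vprod n 0 b)); rewrite -vprodDl !add0r. Qed.
Lemma vprod0r n a : vprod n a 0 = 0 :> V.
Proof. by apply: (addIr (vprod n a 0)); rewrite -vprodDr !add0r. Qed.
Lemma vprodZl n (x : F) u b : vprod n (x *: u) b = x *: vprod n u b.
Proof. by rewrite -[x *: u]addr0 vprod_linearl vprod0l addr0. Qed.
Lemma vprodZr n (x : F) a u : vprod n a (x *: u) = x *: vprod n a u.
Proof. by rewrite -[x *: u]addr0 vprod_linearr vprod0r addr0. Qed.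
Lemma vprodNl n u b : vprod n (- u) b = - vprod n u b.
Proof. by rewrite -scaleN1r vprodZl scaleN1r. Qed.
Lemma vprodNr n a u : vprod n a (- u) = - vprod n a u.
Proof. by rewrite -scaleN1r vprodZr scaleN1r. Qed.
Lemma vprodBl n u v b : vprod n (u - v) b = vprod n u b - vprod n v b.
Proof. by rewrite vprodDl vprodNl. Qed.
Lemma vprodBr n a u v : vprod n a (u - v) = vprod n a u - vprod n a v.
Proof. by rewrite vprodDr vprodNr. Qed.
Lemma vprod_suml I (r : seq I) (P : pred I) (f : I -> V) n b :
  vprod n (\sum_(i <- r | P i) f i) b = \sum_(i <- r | P i) vprod n (f i) b.
Proof. by apply: (big_morph (fun u => vprod n u b)) => [u v|]; rewrite ?vprodDl ?vprod0l. Qed.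
Lemma vprod_sumr I (r : seq I) (P : pred I) (f : I -> V) n a :
  vprod n a (\sum_(i <- r | P i) f i) = \sum_(i <- r | P i) vprod n a (f i).
Proof. by apply: (big_morph (vprod n a)) => [u v|]; rewrite ?vprodDr ?vprod0r. Qed.

Definition vord a b : nat := sval (cid (vprod_field a b)).
Lemma vordP a b n : (vord a b)%:Z <= n -> vprod n a b = 0.
Proof.
rewrite /vord; case: cid => N /= h le; have := h `|n|%N.
have -> : `|n|%N%:Z = n by lia.
by apply; lia.
Qed.

Lemma vprod_nvac n a : 0 <= n -> vprod n a vac = 0.
Proof. by case: n => // n _; apply: vprod_vac_ge0. Qed.

Lemma vpar0 p : vpar p (0 : V).
Proof.
case: p; last by have := vpar_linear (-1) (@vac_even F V) (@vac_even F V); rewrite scaleN1r addNr.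
case: (vpar_sum (0 : V)) => v0 [v1 [_ h1 _]].
by have := vpar_linear (-1) h1 h1; rewrite scaleN1r addNr.
Qed.
Lemma vparZ p (x : F) a : vpar p a -> vpar p (x *: a).
Proof. by move=> h; rewrite -[x *: a]addr0; apply: vpar_linear (vpar0 p). Qed.
Lemma vparD p a b : vpar p a -> vpar p b -> vpar p (a + b).
Proof. by move=> ha hb; rewrite -[a]scale1r; apply: vpar_linear. Qed.
Lemma vparN p a : vpar p a -> vpar p (- a).
Proof. by rewrite -scaleN1r; apply: vparZ. Qed.
Lemma vpar_bigsum p I (r : seq I) (P : pred I) (f : I -> V) :
  (forall i, P i -> vpar p (f i)) -> vpar p (\sum_(i <- r | P i) f i).
Proof. by move=> h; elim/big_ind: _ => //; [exact: vpar0 | exact: vparD]. Qed.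

Definition vsgn (p q : bool) : F := (-1) ^+ (p && q).

Definition fun3 := int -> int -> int -> V.
Implicit Types Y Z : fun3.
Definition d13 Y : fun3 := fun m n t => Y (m + 1) n t - Y m n (t + 1).
Definition d12 Y : fun3 := fun m n t => Y (m + 1) n t - Y m (n + 1) t.
Definition d23 Y : fun3 := fun m n t => Y m (n + 1) t - Y m n (t + 1).
Definition zero3 : fun3 := fun _ _ _ => 0.
Definition sub3 Y Z : fun3 := fun m n t => Y m n t - Z m n t.
Lemma fun3P Y Z : (forall m n t, Y m n t = Z m n t) -> Y = Z.
Proof. by move=> h; apply/funext => m; apply/funext => n; apply/funext => t. Qed.

Lemma d13_23 Y : d13 (d23 Y) = d23 (d13 Y).
Proof. by apply: fun3P => m n t; rewrite /d13 /d23; lmod. Qed.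
Lemma d13_12 Y : d13 (d12 Y) = d12 (d13 Y).
Proof. by apply: fun3P => m n t; rewrite /d13 /d12; lmod. Qed.
Lemma d23_12 Y : d23 (d12 Y) = d12 (d23 Y).
Proof. by apply: fun3P => m n t; rewrite /d23 /d12; lmod. Qed.
Lemma d23E Y : d23 Y = sub3 (d13 Y) (d12 Y).
Proof. by apply: fun3P => m n t; rewrite /d13 /d12 /d23 /sub3; lmod. Qed.

Lemma iterC T (f g : T -> T) (fg : forall x, f (g x) = g (f x)) N x :
  f (iter N g x) = iter N g (f x).
Proof. by elim: N => //= N <-. Qed.
Lemma iterCC T (f g : T -> T) (fg : forall x, f (g x) = g (f x)) M N x :
  iter M f (iter N g x) = iter N g (iter M f x).
Proof. by elim: M => //= M ->; rewrite iterC. Qed.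

Definition add3 (f : fun3 -> fun3) := forall Y Z, f (sub3 Y Z) = sub3 (f Y) (f Z).
Lemma d13_sub : add3 d13. Proof. by move=> Y Z; apply: fun3P => m n t; rewrite /d13 /sub3; lmod. Qed.
Lemma d12_sub : add3 d12. Proof. by move=> Y Z; apply: fun3P => m n t; rewrite /d12 /sub3; lmod. Qed.
Lemma d23_sub : add3 d23. Proof. by move=> Y Z; apply: fun3P => m n t; rewrite /d23 /sub3; lmod. Qed.
Lemma iter_sub f N : add3 f -> add3 (iter N f).
Proof. by move=> h; elim: N => // N IH Y Z; rewrite !iterS IH h. Qed.
Lemma add3_0 f : add3 f -> f zero3 = zero3.
Proof.
move=> h; have z : zero3 = sub3 zero3 zero3 by apply: fun3P => *; rewrite /sub3 subrr.
by rewrite {1}z h; apply: fun3P => *; rewrite /sub3 subrr.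
Qed.
Lemma iter_zero f N : add3 f -> iter N f zero3 = zero3.
Proof. by move=> h; apply/add3_0/iter_sub. Qed.
Lemma iter_ge f M N Y : add3 f -> iter M f Y = zero3 -> (M <= N)%N -> iter N f Y = zero3.
Proof. by move=> hf h le; rewrite -(subnK le) iterD h iter_zero. Qed.

Lemma d23_kill p q Y : iter p d13 Y = zero3 -> iter q d12 Y = zero3 ->
  iter (p + q) d23 Y = zero3.
Proof.
have [s] := ubnP (p + q); elim: s p q Y => // s IH [|p] [|q] Y le hp hq.
- by [].
- by rewrite (hp : Y = zero3) iter_zero //; exact: d23_sub.
- by rewrite (hq : Y = zero3) iter_zero //; exact: d23_sub.
rewrite addSn iterSr d23E iter_sub; last exact: d23_sub.
have h1 : iter (p + q.+1) d23 (d13 Y) = zero3.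
  apply: IH; [by lia | by rewrite -iterSr | ].
  by rewrite -(iterC d13_12) hq (add3_0 d13_sub).
have h2 : iter (p.+1 + q) d23 (d12 Y) = zero3.
  apply: IH; [by lia | | by rewrite -iterSr].
  by rewrite -(iterC (fun x => esym (d13_12 x))) hp (add3_0 d12_sub).
by rewrite h1 -addSnnS h2; apply: fun3P => *; rewrite /sub3 subrr.
Qed.

(** The coefficients of (z-w)^r (a(z) b(w) - s b(w) a(z)) c, where for
negative r each of the two products is expanded in its own domain. For m = 0
these are the modes of the r-th product of a and b, which is what [vbr_assoc]
proves. *)
Definition vbr (s : F) (r : int) a b c (m n : int) : V :=
  dpow (fun m n => vprod m a (vprod n b c)) (vord b c) r m n -
  (s * (-1) ^ r) *: dpow (fun n m => vprod n b (vprod m a c)) (vord a c) r n m.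

Lemma vord2 a b c m n : (vord b c)%:Z <= n -> vprod m a (vprod n b c) = 0.
Proof. by move=> h; rewrite (vordP h) vprod0r. Qed.

Lemma signzS (r : int) : (-1 : F) ^ (r + 1) = - (-1) ^ r.
Proof. by rewrite exprzDr ?unitrN1 // expr1z mulrN1. Qed.

Lemma dop_vbr s r a b c m n : dop (vbr s r a b c) m n = vbr s (r + 1) a b c m n.
Proof.
rewrite /dop /vbr -(dop_dpow (@vord2 a b c)) -(dop_dpow (@vord2 b a c)) signzS /dop.
by lmod.
Qed.
Lemma iter_dop_vbr N s r a b c m n :
  iter N dop (vbr s r a b c) m n = vbr s (r + N%:Z) a b c m n.
Proof.
elim: N m n => [|N IH] m n /=; first by rewrite addr0.
by rewrite /dop !IH -/(dop (vbr s (r + N%:Z) a b c) m n) dop_vbr; congr vbr; lia.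
Qed.
Lemma vbr0 s a b c m n :
  vbr s 0 a b c m n = vprod m a (vprod n b c) - s *: vprod n b (vprod m a c).
Proof. by rewrite /vbr !dpow0 mulr1. Qed.

Lemma vlocalE p q a b : vpar p a -> vpar q b -> exists N, forall m n c,
  iter N dop (fun m n => vprod m a (vprod n b c) - vsgn p q *: vprod n b (vprod m a c)) m n = 0.
Proof.
move=> ha hb; have [N hN] := vlocal ha hb; exists N => m n c.
by rewrite iter_dopE -[RHS](hN m n c); apply: eq_bigr.
Qed.

Lemma vbr_eq0 p q a b : vpar p a -> vpar q b -> exists N : nat, forall r c m n,
  N%:Z <= r -> vbr (vsgn p q) r a b c m n = 0.
Proof.
move=> ha hb; have [N hN] := vlocalE ha hb; exists N => r c m n le.
have -> : r = 0 + (`|r|%N)%:Z by lia.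
rewrite -iter_dop_vbr -(subnK (n := `|r|%N) (m := N)); last by lia.
rewrite iterD; move: m n; set X := iter N _ _.
have X0 m n : X m n = 0.
  rewrite -[RHS](hN m n c); apply: iter_dop_ext => i j; exact: vbr0.
elim: (_ - N)%N => //= M IH m n; by rewrite /dop !IH subrr.
Qed.

Lemma vsgn_mul p q r : vsgn (p (+) q) r = vsgn p r * vsgn q r.
Proof. by case: p q r => [] [] []; rewrite /vsgn /= ?expr0 ?expr1 ?mulr1 ?mulrNN ?mul1r. Qed.
Lemma vsgn_sqr p q : vsgn p q * vsgn p q = 1.
Proof. by case: p q => [] []; rewrite /vsgn /= ?expr0 ?expr1 ?mulrNN ?mulr1. Qed.

Definition nbound3 Y := forall t, nbound (fun m n => Y m n t).
Lemma nbound3_d13 Y : nbound3 Y -> nbound3 (d13 Y).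
Proof.
move=> h t; have [a ha] := h t; have [b hb] := h (t + 1).
exists (Num.max a b) => m n; rewrite ge_max => /andP[h1 h2].
by rewrite /d13 ha // hb // subrr.
Qed.
Lemma nbound3_d23 Y : nbound3 Y -> nbound3 (d23 Y).
Proof.
move=> h t; have [a ha] := h t; have [b hb] := h (t + 1).
exists (Num.max a b) => m n; rewrite ge_max => /andP[h1 h2].
by rewrite /d23 ha ?hb ?subrr //; lia.
Qed.
Lemma nbound3_iter f N Y : (forall Z, nbound3 Z -> nbound3 (f Z)) ->
  nbound3 Y -> nbound3 (iter N f Y).
Proof. by move=> hf hY; elim: N => //= N; apply: hf. Qed.
Lemma iter_d12 N Y m n t : iter N d12 Y m n t = iter N dop (fun m n => Y m n t) m n.
Proof. by elim: N m n => //= N IH m n; rewrite /d12 /dop !IH. Qed.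

Section Dong.
Variables (pa pb pd : bool) (a b d : V).
Hypotheses (ha : vpar pa a) (hb : vpar pb b) (hd : vpar pd d).

Definition half3 (r : int) : fun3 := fun m n t =>
  dpow (fun m n => vprod m a (vprod n b (vprod t d vac))) (vord b (vprod t d vac)) r m n
  - (vsgn pa pd * vsgn pb pd) *:
    vprod t d (dpow (fun m n => vprod m a (vprod n b vac)) (vord b vac) r m n).

Lemma half3_nb r : nbound3 (half3 r).
Proof.
move=> t; apply: nboundB; first exact/dpow_nb/vord2.
have [n0 h0] := dpow_nb (@vord2 a b vac) r.
by exists n0 => m n le; rewrite h0 // vprod0r scaler0.
Qed.

Lemma half3_d12 r : d12 (half3 r) = half3 (r + 1).
Proof.
apply: fun3P => m n t; rewrite /half3.
rewrite -(dop_dpow (@vord2 a b (vprod t d vac))) -(dop_dpow (@vord2 a b vac)).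
by rewrite /d12 /dop vprodBr; lmod.
Qed.

Lemma half3_iter N r : iter N d12 (half3 r) = half3 (r + N%:Z).
Proof.
elim: N => [|N IH] /=; first by rewrite addr0.
by rewrite IH half3_d12; congr half3; lia.
Qed.

Lemma half3_kill : exists N, forall r, iter N d13 (iter N d23 (half3 r)) = zero3.
Proof.
have [N1 h1] := vlocalE ha hd; have [N2 h2] := vlocalE hb hd.
exists (N1 + N2)%N; set N := (N1 + N2)%N.
pose U1 : fun3 := fun m n t => vprod m a (vprod n b (vprod t d vac)
   - vsgn pb pd *: vprod t d (vprod n b vac)).
pose U2 : fun3 := fun m n t => vprod m a (vprod t d (vprod n b vac))
   - vsgn pa pd *: vprod t d (vprod m a (vprod n b vac)).
have k1 : iter N d23 U1 = zero3.
  apply: (iter_ge (M := N2) d23_sub); last exact: leq_addl.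
  apply: fun3P => m n t.
  have -> : iter N2 d23 U1 m n t = vprod m a (iter N2 dop (fun n t => vprod n b (vprod t d vac)
   - vsgn pb pd *: vprod t d (vprod n b vac)) n t).
    by elim: (N2) n t => //= M IH n t; rewrite /d23 /dop !IH vprodBr.
  by rewrite h2 vprod0r.
have k2 : iter N d13 U2 = zero3.
  apply: (iter_ge (M := N1) d13_sub); last exact: leq_addr.
  apply: fun3P => m n t.
  have -> : iter N1 d13 U2 m n t = iter N1 dop (fun m t => vprod m a (vprod t d (vprod n b vac))
   - vsgn pa pd *: vprod t d (vprod m a (vprod n b vac))) m t.
    by elim: (N1) m t => //= M IH m t; rewrite /d13 /dop !IH.
  by rewrite h1.
have e0 : half3 0 = sub3 U1 (fun m n t => - vsgn pb pd *: U2 m n t).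
  apply: fun3P => m n t; rewrite /half3 !dpow0 /sub3 /U1 /U2 vprodBr vprodZr.
  by lmod.
have k2' : iter N d13 (fun m n t => - vsgn pb pd *: U2 m n t) = zero3.
  apply: fun3P => m n t.
  have -> : iter N d13 (fun m n t => - vsgn pb pd *: U2 m n t) m n t =
     - vsgn pb pd *: iter N d13 U2 m n t.
    by elim: (N) m n t => //= M IH m n t; rewrite /d13 !IH scalerBr.
  by rewrite k2 scaler0.
have z0 : iter N d13 (iter N d23 (half3 0)) = zero3.
  rewrite e0 (iter_sub _ d23_sub) k1 (iter_sub _ d13_sub) (iter_zero _ d13_sub).
  rewrite (iterCC d13_23) k2' (iter_zero _ d23_sub).
  by apply: fun3P => *; rewrite /sub3 subrr.
have com M Y : iter M d12 (iter N d13 (iter N d23 Y)) = iter N d13 (iter N d23 (iter M d12 Y)).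
  rewrite (iterCC (fun x => esym (d13_12 x))); congr iter.
  by rewrite (iterCC (fun x => esym (d23_12 x))).
move=> r; have [r0|r0] := leP 0 r.
  have -> : r = 0 + (`|r|%N)%:Z by lia.
  by rewrite -half3_iter -com z0 iter_zero //; exact: d12_sub.
have e : iter `|r| d12 (iter N d13 (iter N d23 (half3 r))) = zero3.
  by rewrite com half3_iter; have -> : r + (`|r|%N)%:Z = 0 by lia.
apply: fun3P => m n t.
apply: (@iter_dop_inj F V `|r| (fun m n => iter N d13 (iter N d23 (half3 r)) m n t)).
  have nb3 : nbound3 (iter N d13 (iter N d23 (half3 r))).
    apply: (nbound3_iter _ nbound3_d13); apply: (nbound3_iter _ nbound3_d23).
    exact: half3_nb.
  exact: nb3 t.
by move=> i j; rewrite -iter_d12 e.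
Qed.
End Dong.

Definition swap3 Y : fun3 := fun m n t => Y n m t.
Lemma swap3_d13 N Y : iter N d13 (swap3 Y) = swap3 (iter N d23 Y).
Proof. by elim: N => //= N ->. Qed.
Lemma swap3_d23 N Y : iter N d23 (swap3 Y) = swap3 (iter N d13 Y).
Proof. by elim: N => //= N ->. Qed.

Lemma vT_vac : vprod (-2) vac vac = 0 :> V.
Proof. by rewrite vac_prod scale0r. Qed.
Lemma vT_mode n u : vprod (-2) (vprod n u vac) vac = - n%:~R *: vprod (n - 1) u vac.
Proof.
by have := vtranslation n u vac; rewrite vT_vac vprod0r subr0 => ->; rewrite scaleNr.
Qed.


Lemma dpow_T a b r m n : let X := fun m n => vprod m a (vprod n b vac) in
  vprod (-2) (dpow X (vord b vac) r m n) vac =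
  - m%:~R *: dpow X (vord b vac) r (m - 1) n - n%:~R *: dpow X (vord b vac) r m (n - 1).
Proof.
move=> X.
pose G r m n : V := vprod (-2) (dpow X (vord b vac) r m n) vac -
  (- m%:~R *: dpow X (vord b vac) r (m - 1) n - n%:~R *: dpow X (vord b vac) r m (n - 1)).
suff: G r m n = 0 by move/eqP; rewrite subr_eq0 => /eqP.
have G0 i j : G 0 i j = 0.
  rewrite /G !dpow0 /X.
  have := vtranslation i a (vprod j b vac) => /eqP; rewrite subr_eq => /eqP ->.
  by rewrite vT_mode vprodZr; lmod.
have GS q i j : dop (G q) i j = G (q + 1) i j.
  rewrite /G -!(dop_dpow (@vord2 a b vac)) /dop vprodBl.
  have -> : i + 1 - 1 = i - 1 + 1 by lia.
  have -> : j + 1 - 1 = j - 1 + 1 by lia.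
  have e1 : i - 1 + 1 = i by lia. have e2 : j - 1 + 1 = j by lia.
  by rewrite e1 e2 !rmorphD /=; lmod.
have GN N q i j : iter N dop (G q) i j = G (q + N%:Z) i j.
  elim: N i j => [|N IH] i j /=; first by rewrite addr0.
  by rewrite /dop !IH -/(dop (G (q + N%:Z)) i j) GS; congr G; lia.
have Gnb q : nbound (G q).
  have [n0 h0] := dpow_nb (@vord2 a b vac) q; exists (n0 + 1) => i j le.
  by rewrite /G !h0 ?vprod0l ?scaler0 ?subrr ?subr0 //; lia.
have [r0|r0] := leP 0 r.
  have -> : r = 0 + (`|r|%N)%:Z by lia.
  rewrite -GN; elim: `|r|%N m n => [|N IH] m n /=; first exact: G0.
  by rewrite /dop !IH subrr.
apply: (iter_dop_inj (N := `|r|) (Gnb r)) => i j.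
by rewrite GN; have -> : r + (`|r|%N)%:Z = 0 by lia.
Qed.

Section Assoc.
Variables (pa pb : bool) (a b : V).
Hypotheses (ha : vpar pa a) (hb : vpar pb b).
Let s := vsgn pa pb.

(** Dong's lemma, evaluated on the vacuum: the field with modes [vbr s r a b]
is local with respect to every d. *)
Lemma vbr_local pd d r : vpar pd d -> exists N, forall n t,
  iter N dop (fun n t => vbr s r a b (vprod t d vac) 0 n
     - (vsgn pa pd * vsgn pb pd) *: vprod t d (vbr s r a b vac 0 n)) n t = 0.
Proof.
move=> hd; have [N1 h1] := half3_kill ha hb hd; have [N2 h2] := half3_kill hb ha hd.
have [M hM] := vbr_eq0 ha hb.
pose Y : fun3 := fun m n t => vbr s r a b (vprod t d vac) m n
     - (vsgn pa pd * vsgn pb pd) *: vprod t d (vbr s r a b vac m n).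
pose N := (N1 + N2)%N; pose M' := (M + `|r|)%N.
have eY : Y = sub3 (half3 pa pb pd a b d r)
    (fun m n t => (s * (-1) ^ r) *: swap3 (half3 pb pa pd b a d r) m n t).
  apply: fun3P => m n t; rewrite /Y /vbr /sub3 /swap3 /half3 vprodBr vprodZr.
  by lmod.
have mono N' Z : (N' <= N)%N -> iter N' d13 (iter N' d23 Z) = zero3 ->
    iter N d13 (iter N d23 Z) = zero3.
  move=> le /(iter_ge d13_sub)/(_ le); rewrite (iterCC d13_23) => /(iter_ge d23_sub)/(_ le).
  by rewrite (iterCC d13_23).
have kA : iter N d13 (iter N d23 Y) = zero3.
  rewrite eY (iter_sub _ d23_sub) (iter_sub _ d13_sub) (mono _ _ (leq_addr N2 N1) (h1 r)).
  have k2 : iter N d13 (iter N d23 (swap3 (half3 pb pa pd b a d r))) = zero3.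
    by rewrite swap3_d23 swap3_d13 -(iterCC d13_23) (mono _ _ (leq_addl N1 N2) (h2 r)).
  have -> : iter N d13 (iter N d23 (fun m n t => (s * (-1) ^ r) *: swap3 (half3 pb pa pd b a d r) m n t)) = zero3.
    apply: fun3P => m n t.
    have e2 P Z i j l : iter P d23 (fun m n t => (s * (-1) ^ r) *: Z m n t) i j l =
        (s * (-1) ^ r) *: iter P d23 Z i j l.
      by elim: P i j l => //= P IH i j l; rewrite /d23 !IH scalerBr.
    have -> : iter N d23 (fun m n t => (s * (-1) ^ r) *: swap3 (half3 pb pa pd b a d r) m n t) =
        (fun m n t => (s * (-1) ^ r) *: iter N d23 (swap3 (half3 pb pa pd b a d r)) m n t).
      by apply: fun3P => *; apply: e2.
    have e1 P Z i j l : iter P d13 (fun m n t => (s * (-1) ^ r) *: Z m n t) i j l =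
        (s * (-1) ^ r) *: iter P d13 Z i j l.
      by elim: P i j l => //= P IH i j l; rewrite /d13 !IH scalerBr.
    by rewrite e1 k2 scaler0.
  by apply: fun3P => *; rewrite /sub3 subrr.
have kB : iter M' d12 Y = zero3.
  apply: fun3P => m n t; rewrite iter_d12.
  have -> : iter M' dop (fun m n => Y m n t) m n =
     vbr s (r + M'%:Z) a b (vprod t d vac) m n - (vsgn pa pd * vsgn pb pd) *:
       vprod t d (vbr s (r + M'%:Z) a b vac m n).
    rewrite -!iter_dop_vbr; elim: M' m n => //= P IH m n.
    by rewrite /dop !IH /dop vprodBr; lmod.
  by rewrite !hM ?vprod0r ?scaler0 ?subrr //; rewrite /M'; lia.
exists (N + M' + N)%N => n t.
have := d23_kill (p := N) (q := M') (Y := iter N d23 Y) kA.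
rewrite -(iterCC d23_12) kB iter_zero; last exact: d23_sub.
move=> /(_ erefl); rewrite -iterD => hz; rewrite -[RHS]/(zero3 0 n t) -hz.
elim: (N + M' + N)%N n t => //= P IH n t; by rewrite /dop !IH.
Qed.

Lemma vbr_vac_nneg r n : 0 <= n -> vbr s r a b vac 0 n = 0.
Proof.
move=> le; rewrite /vbr /dpow /dsum big1 => [|j _]; last first.
  by rewrite vprod_nvac ?vprod0r ?scaler0 //; lia.
by rewrite sub0r big1 ?scaler0 ?oppr0 // => j _; rewrite vprod_nvac ?vprod0r ?scaler0 //; lia.
Qed.

Lemma vbr_vacN1 r : vbr s r a b vac 0 (-1) = vprod r a b.
Proof.
rewrite /vbr /dpow /dsum [X in _ - _ *: X]big1 => [|j _]; last first.
  by rewrite vprod_nvac ?vprod0r ?scaler0 //; lia.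
rewrite scaler0 subr0 big_ord_recl binz0 /= mulr1 scale1r big1 => [|j _].
  by rewrite !addr0 vprod_vac; congr vprod; lia.
by rewrite vprod_nvac ?vprod0r ?scaler0 // /bump; lia.
Qed.

(** Translation covariance of [vbr] on the vacuum, which together with its
constant term determines it ([vbr_vac]). *)
Lemma vbr_vacT r n : vprod (-2) (vbr s r a b vac 0 n) vac =
  - n%:~R *: vbr s r a b vac 0 (n - 1).
Proof. by rewrite /vbr vprodBl vprodZl !dpow_T; lmod. Qed.

Lemma vbr_vac r n : vbr s r a b vac 0 n = vprod n (vprod r a b) vac.
Proof.
have [le|lt] := leP 0 n; first by rewrite vbr_vac_nneg // vprod_nvac.
have -> : n = - 1 - (`|n|%N.-1)%:Z by lia.
elim: (`|n|.-1)%N => [|j IH]; first by rewrite subr0 vbr_vacN1 vprod_vac.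
have := congr1 (fun x => vprod (-2) x vac) IH; rewrite vbr_vacT vT_mode.
have -> : -1 - j%:Z - 1 = -1 - j.+1%:Z by lia.
apply: scalerI; rewrite oppr_eq0 intr_eq0; lia.
Qed.

(** Goddard's uniqueness argument: two fields that are local with respect to d
and agree on the vacuum agree on d. *)
Lemma vbr_assoc_hom pd d r n : vpar pd d -> vbr s r a b d 0 n = vprod n (vprod r a b) d.
Proof.
move=> hd; have [N1 h1] := vbr_local r hd.
have [N2 h2] := vlocalE (vprod_par r ha hb) hd.
pose Z n t := vbr s r a b (vprod t d vac) 0 n - vprod n (vprod r a b) (vprod t d vac).
suff: Z n (-1) = 0 by rewrite /Z vprod_vac => /eqP; rewrite subr_eq0 => /eqP.
have dd M M' X : (forall m n, iter M dop X m n = 0) -> (M <= M')%N ->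
    forall m n, iter M' dop X m n = 0 :> V.
  move=> h le; rewrite -(subnK le) iterD; elim: (_ - _)%N => //= K IH i j.
  by rewrite /dop !IH subrr.
apply: (iter_dop_inj (N := (N1 + N2)%N) (X := Z)).
  exists 0 => i j le; rewrite /Z (vprod_nvac d le) vprod0r subr0.
  rewrite /vbr /dpow /dsum !big1 ?scaler0 ?subrr // => l _; by rewrite !vprod0r ?scaler0.
move=> i j.
have := dd _ _ _ h1 (leq_addr N2 N1) i j.
have := dd _ _ _ (fun m n => h2 m n vac) (leq_addl N1 N2) i j.
have -> : iter (N1 + N2) dop Z i j =
  iter (N1 + N2) dop (fun n0 t => vbr s r a b (vprod t d vac) 0 n0 -
    (vsgn pa pd * vsgn pb pd) *: vprod t d (vbr s r a b vac 0 n0)) i j -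
  iter (N1 + N2) dop (fun m n0 => vprod m (vprod r a b) (vprod n0 d vac) -
    vsgn (pa (+) pb) pd *: vprod n0 d (vprod m (vprod r a b) vac)) i j.
  elim: (N1 + N2)%N i j => [|K IH] i j /=; last by rewrite /dop !IH; lmod.
  by rewrite /Z vbr_vac vsgn_mul; lmod.
by move=> -> ->; rewrite subrr.
Qed.

Lemma vbrDr r c c' m n : vbr s r a b (c + c') m n = vbr s r a b c m n + vbr s r a b c' m n.
Proof.
rewrite /vbr.
have e x y i j : dpow (fun m n => vprod m x (vprod n y (c + c'))) (vord y (c + c')) r i j =
   dpow (fun m n => vprod m x (vprod n y c)) (vord y c) r i j +
   dpow (fun m n => vprod m x (vprod n y c')) (vord y c') r i j.
  pose K := (vord y (c + c') + vord y c + vord y c' + `|j|).+1.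
  rewrite !(dpowE (@vord2 x y _) _ _ (K := K)); try lia.
  by rewrite /dsum -big_split; apply: eq_bigr => l _; rewrite !vprodDr scalerDr.
by rewrite !e; lmod.
Qed.

Lemma vbr_assoc d r n : vbr s r a b d 0 n = vprod n (vprod r a b) d.
Proof.
have [v0 [v1 [h0 h1 ->]]] := vpar_sum d.
by rewrite vbrDr (vbr_assoc_hom _ _ h0) (vbr_assoc_hom _ _ h1) vprodDr.
Qed.

Lemma vbr_expand c r m n : exists K0, forall K, (K0 <= K)%N ->
  vbr s r a b c m n = \sum_(j < K) (binz m j)%:~R *:
    vprod (m + n - j%:Z) (vprod (r + j%:Z) a b) c.
Proof.
have [N hN] := vbr_eq0 ha hb; exists (N + `|r|)%N => K le.
pose X := vbr s r a b c; pose g i := X i (m + n - i).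
rewrite -/X; have -> : X m n = g m by rewrite /g; congr X; lia.
rewrite (@newton_interp F V K g).
  apply: eq_bigr => j _; congr (_ *: _); rewrite /g iter_diff1_line iter_dop_vbr.
  by rewrite vbr_assoc; congr vprod; lia.
by move=> i; rewrite /g iter_diff1_line iter_dop_vbr hN //; lia.
Qed.

(** The axioms contain locality only; the associativity of [vbr_assoc] shifted
in m by Newton interpolation gives the full identity. The sums are finite for
every large enough cut-off K. *)
Theorem borcherds c r m n : exists K0, forall K, (K0 <= K)%N ->
  \sum_(j < K) (binz m j)%:~R *: vprod (m + n - j%:Z) (vprod (r + j%:Z) a b) c =
  \sum_(j < K) ((-1) ^+ j * (binz r j)%:~R) *:
    (vprod (m + r - j%:Z) a (vprod (n + j%:Z) b c) -
     (s * (-1) ^ r) *: vprod (n + r - j%:Z) b (vprod (m + j%:Z) a c)).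
Proof.
have [K0 h] := vbr_expand c r m n.
exists (K0 + vord b c + vord a c + `|m| + `|n|).+1 => K le.
rewrite -h; last by lia.
rewrite /vbr (@dpowE _ _ _ _ (@vord2 a b c) r m n K); last by lia.
rewrite (@dpowE _ _ _ _ (@vord2 b a c) r n m K); last by lia.
rewrite /dsum scaler_sumr -sumrN -big_split; apply: eq_bigr => j _ /=; lmod.
Qed.
End Assoc.

Section Consequences.
Variables (pa pb : bool) (a b : V).
Hypotheses (ha : vpar pa a) (hb : vpar pb b).
Let s := vsgn pa pb.

Lemma vcomm (m : nat) n c : vprod m%:Z a (vprod n b c) =
  s *: vprod n b (vprod m%:Z a c) +
  \sum_(j < m.+1) 'C(m, j)%:R *: vprod (m%:Z + n - j%:Z) (vprod j%:Z a b) c.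
Proof.
have [K0 h] := borcherds ha hb c 0 m%:Z n.
have e := h (K0 + m.+1)%N (leq_addr _ _).
rewrite (big_ord_widen (K0 + m.+1)%N
  (fun j : nat => 'C(m, j)%:R *: vprod (m%:Z + n - j%:Z) (vprod j%:Z a b) c)) ?leq_addl //.
rewrite [X in _ + X]big_mkcond /=; move: e.
have -> : \sum_(j < K0 + m.+1) (binz m%:Z j)%:~R *: vprod (m%:Z + n - j%:Z) (vprod (0 + j%:Z) a b) c =
  \sum_(i < K0 + m.+1) (if (i < m.+1)%N then
    'C(m, i)%:R *: vprod (m%:Z + n - i%:Z) (vprod i%:Z a b) c else 0).
  apply: eq_bigr => j _; rewrite add0r /= -pmulrn; case: ltnP => // h'.
  by rewrite bin_small // scale0r.
move=> ->; rewrite addnS big_ord_recl big1 => [|j _]; last by rewrite binz0n /= mulr0 scale0r.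
rewrite binz0 /= mulr1 scale1r !addr0 mulr1.
by rewrite /s; lmod.
Qed.

Lemma vcomm0 n c : vprod 0 a (vprod n b c) =
  s *: vprod n b (vprod 0 a c) + vprod n (vprod 0 a b) c.
Proof. by rewrite (vcomm 0) big_ord1 bin0 scale1r subr0 add0r. Qed.

Lemma vnop_mode n c : exists K0, forall K, (K0 <= K)%N ->
  vprod n (vprod (-1) a b) c =
  \sum_(j < K) (vprod (-1 - j%:Z) a (vprod (n + j%:Z) b c) +
     s *: vprod (n - 1 - j%:Z) b (vprod j%:Z a c)).
Proof.
have [K0 h] := borcherds ha hb c (-1) 0 n.
exists K0.+1 => K le; have := h K (ltnW le).
case: K le => // K le; rewrite big_ord_recl binz0 scale1r subr0 add0r addr0.
rewrite big1 => [|j _]; last by rewrite scale0r.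
rewrite addr0 => ->; apply: eq_bigr => j _.
rewrite binzN1 rmorphXn rmorphN1 -expr2 sqrr_sign scale1r add0r exprN1 invrN1 mulrN1.
by rewrite scaleNr opprK [0 + _]add0r.
Qed.

(** Skew-symmetry is the Borcherds identity with the vacuum as third argument.
*)
Lemma vskew r : exists K0, forall K, (K0 <= K)%N ->
  vprod r b a = - (s * (-1) ^ r) *:
    \sum_(j < K) (-1) ^+ j *: vprod (-1 - j%:Z) (vprod (r + j%:Z) a b) vac.
Proof.
have [K0 h] := borcherds ha hb vac r (-1) 0.
exists K0.+1 => K le; have := h K (ltnW le); case: K le => // K le.
have -> : \sum_(j < K.+1) ((-1) ^+ j * (binz r j)%:~R) *:
    (vprod (-1 + r - j%:Z) a (vprod (0 + j%:Z) b vac) -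
     (s * (-1) ^ r) *: vprod (0 + r - j%:Z) b (vprod (-1 + j%:Z) a vac)) =
   - (s * (-1) ^ r) *: vprod r b a.
  rewrite big_ord_recl big1 => [|j _]; last first.
    by rewrite !vprod_nvac ?vprod0r ?scaler0 ?subrr ?scaler0 //; rewrite /bump; lia.
  rewrite binz0 /= mulr1 scale1r addr0 vprod_nvac // vprod0r sub0r !addr0 vprod_vac.
  by rewrite add0r scaleNr.
have e : (s * (-1) ^ r) * (s * (-1) ^ r) = 1.
  by rewrite mulrACA vsgn_sqr mul1r -exprzMl ?unitrN1 // mulrNN mulr1 exp1rz.
move/(congr1 ( *:%R (- (s * (-1) ^ r)))); rewrite [RHS]scalerA mulrNN e scale1r => <-.
congr (_ *: _); apply: eq_bigr => j _; rewrite binzN1 rmorphXn rmorphN1 addr0.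
by congr (_ *: vprod _ _ _); lia.
Qed.
End Consequences.

Local Arguments binz : simpl never.

Lemma sign_binzN2 j : (-1) ^+ j * (binz (-2) j)%:~R = j.+1%:Z%:~R :> F.
Proof. by rewrite binzN2 rmorphM rmorphXn rmorphN1 mulrA -expr2 sqrr_sign mul1r. Qed.

Lemma vT_mode_l a n c : vprod n (vT a) c = - n%:~R *: vprod (n - 1) a c.
Proof.
have key p x : vpar p x -> vprod n (vT x) c = - n%:~R *: vprod (n - 1) x c.
  move=> hx; have [K0 h] := borcherds hx (@vac_even F V) c (-2) 0 n.
  pose K := (K0 + `|n|).+2; have := h K ltac:(lia); rewrite {1}/K.
  rewrite big_ord_recl binz0 scale1r subr0 add0r addr0 big1 => [|j _]; last by rewrite scale0r.
  rewrite addr0 -/(vT x) => ->.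
  under eq_bigr => j _ do rewrite !vac_prod.
  have [n0|n0] := ltP n 0.
    have lt : (`|n|.-1 < K)%N by rewrite /K; lia.
    rewrite (bigD1 (Ordinal lt)) //= big1 => [|j /eqP jn].
      have -> : (n + (`|n|.-1)%:Z == -1) = true by lia.
      have -> : (n + -2 - (`|n|.-1)%:Z == -1) = false by lia.
      rewrite scale0r scaler0 subr0 addr0 scale1r sign_binzN2.
      have -> : 0 + -2 - (`|n|.-1)%:Z = n - 1 by lia.
      by congr (_ *: _); rewrite -rmorphN; congr (_%:~R); lia.
    have -> : (n + j%:Z == -1) = false.
      by apply/eqP => e; apply: jn; apply: val_inj => /=; lia.
    have -> : (n + -2 - j%:Z == -1) = false by lia.
    by rewrite !scale0r vprod0r scaler0 subrr scaler0.
  have [n1|n1] := eqVneq n 0.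
    have -> : - n%:~R = 0 :> F by rewrite n1 mulr0z oppr0.
    rewrite scale0r; apply: big1 => j _.
    have -> : (n + j%:Z == -1) = false by lia.
    have -> : (n + -2 - j%:Z == -1) = false by lia.
    by rewrite !scale0r vprod0r scaler0 subrr scaler0.
  have lt : (`|n|.-1 < K)%N by rewrite /K; lia.
  rewrite (bigD1 (Ordinal lt)) //= big1 => [|j /eqP jn].
    have -> : (n + (`|n|.-1)%:Z == -1) = false by lia.
    have -> : (n + -2 - (`|n|.-1)%:Z == -1) = true by lia.
    rewrite scale0r vprod0r sub0r addr0 scale1r sign_binzN2 add0r.
    have -> : (`|n|.-1)%:Z = n - 1 by lia.
    rewrite scalerN scalerA -scaleNr; congr (_ *: _).
    have -> : (`|n|.-1).+1%:Z = n by lia.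
    have -> : (-1 : F) ^ (-2) = 1 by rewrite -[(-2)%R]/(Negz 1) /exprz sqrrN expr1n invr1.
    by rewrite /vsgn andbF expr0 !mulr1.
  have -> : (n + j%:Z == -1) = false by lia.
  have -> : (n + -2 - j%:Z == -1) = false.
    by apply/eqP => e; apply: jn; apply: val_inj => /=; lia.
  by rewrite !scale0r vprod0r scaler0 subrr scaler0.
have [v0 [v1 [h0 h1 ->]]] := vpar_sum a.
have -> : vT (v0 + v1) = vT v0 + vT v1 by rewrite /vT vprodDl.
by rewrite !vprodDl (key _ _ h0) (key _ _ h1) scalerDr.
Qed.

Lemma vT_prod n a b : vT (vprod n a b) = vprod n (vT a) b + vprod n a (vT b).
Proof.
have := vtranslation n a b => /eqP; rewrite subr_eq => /eqP e.
by rewrite /vT e -/(vT a) vT_mode_l scaleNr.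
Qed.

Lemma vTD a b : vT (a + b) = vT a + vT b. Proof. exact: vprodDl. Qed.
Lemma vTZ x a : vT (x *: a) = x *: vT a. Proof. exact: vprodZl. Qed.
Lemma vTN a : vT (- a) = - vT a. Proof. exact: vprodNl. Qed.
Lemma vT0 : vT (0 : V) = 0. Proof. exact: vprod0l. Qed.
Lemma vT_vac0 : vT (vac : V) = 0. Proof. exact: vT_vac. Qed.
Lemma vpar_T p a : vpar p a -> vpar p (vT a).
Proof. by move=> h; rewrite -[p]addbF; apply: vprod_par => //; exact: vac_even. Qed.

Inductive lspan (S : V -> Prop) : V -> Prop :=
| lspan0 : lspan S 0
| lspan_add (x : F) u v : S u -> lspan S v -> lspan S (x *: u + v).

Lemma lspan_in S u : S u -> lspan S u.
Proof. by move=> h; rewrite -[u]scale1r -[1 *: u]addr0; apply: lspan_add h (lspan0 S). Qed.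
Lemma lspanD S u v : lspan S u -> lspan S v -> lspan S (u + v).
Proof.
elim=> [|x w w' hw _ IH] hv; first by rewrite add0r.
by rewrite -addrA; apply: lspan_add hw (IH hv).
Qed.
Lemma lspanZ S x u : lspan S u -> lspan S (x *: u).
Proof.
elim=> [|y w w' hw _ IH]; first by rewrite scaler0; exact: lspan0.
by rewrite scalerDr scalerA; apply: lspan_add.
Qed.
Lemma lspanN S u : lspan S u -> lspan S (- u).
Proof. by rewrite -scaleN1r; apply: lspanZ. Qed.
Lemma lspan_sum S I (r : seq I) (P : pred I) (f : I -> V) :
  (forall i, P i -> lspan S (f i)) -> lspan S (\sum_(i <- r | P i) f i).
Proof. by move=> h; elim/big_ind: _ => //; [exact: lspan0 | exact: lspanD]. Qed.

(** Products of two modes reduce to single modes of products. This makes the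
set of all b_(i) w closed under left multiplication, which is used for the
ideal generated by one vector. *)
Lemma vprod2_span p q u a m n w : vpar p u -> vpar q a ->
  lspan (fun x => exists b i, x = vprod i b w) (vprod m u (vprod n a w)).
Proof.
move=> hu ha; set S := lspan _.
suff: forall N n m, (vord a w)%:Z <= n + N%:Z -> S (vprod m u (vprod n a w)).
  by move=> h; apply: (h `|(vord a w)%:Z - n|%N); lia.
elim=> [|N IH] {m}n m le.
  by rewrite (vordP (n := n)) ?vprod0r; [exact: lspan0 | lia].
have [K0 h] := borcherds hu ha w (m - (vord u w)%:Z) (vord u w)%:Z n.
have := h K0.+1 (leqnSn _); rewrite [RHS]big_ord_recl binz0 mulr1 scale1r.
rewrite [vprod (_ + 0) u w]vordP; last lia.
rewrite vprod0r scaler0 subr0 => /esym /(canRL (addrK _)).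
have -> : (vord u w)%:Z + (m - (vord u w)%:Z) - 0%:Z = m by lia.
rewrite addr0 => ->; apply: lspanD.
  apply: lspan_sum => j _; apply/lspanZ/lspan_in; by do 2 eexists.
apply/lspanN/lspan_sum => j _; apply: lspanZ.
rewrite [vprod (_ + (bump 0 j)%:Z) u w]vordP; last by rewrite /bump; lia.
by rewrite vprod0r scaler0 subr0; apply: IH; rewrite lift0; lia.
Qed.
End Vertex.
End VertexCalculus.
Import VertexCalculus.
Arguments binz : simpl never.

(** * Graded matrix algebras *)
Module Gradings.
Section VertexTools.
Variables (F : numFieldType) (V : vertexSuperAlgType F).
Implicit Types a b c : V.

Lemma binz1 m : binz m 1 = m.
Proof. by case: m => n; rewrite /binz ?addn1 bin1 // NegzE expr1 mulN1r. Qed.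

Lemma vcomm2 pa pb a b (ha : vpar pa a) (hb : vpar pb b)
  (ab : forall j : nat, (2 <= j)%N -> vprod j%:Z a b = 0) m n c :
  vprod m a (vprod n b c) = vsgn F pa pb *: vprod n b (vprod m a c) +
    vprod (m + n) (vprod 0 a b) c + m%:~R *: vprod (m + n - 1) (vprod 1 a b) c.
Proof.
have [K0 h] := borcherds ha hb c 0 m n; have := h K0.+2 (leqW (leqnSn _)).
rewrite !big_ord_recl !big1 => [|j _|j _]; last first.
- by rewrite add0r ab ?vprod0l ?scaler0 // !lift0.
- by rewrite !lift0 binz0n mulr0 scale0r.
rewrite !lift0 /= !binz0 binz0n binz1 mulr0 scale0r mulr1 !scale1r.
rewrite !addr0 !add0r mulr1 => e.
by rewrite -addrA e; lmod.
Qed.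

Lemma vcomm1 pa pb a b (ha : vpar pa a) (hb : vpar pb b)
  (ab : forall j : nat, (1 <= j)%N -> vprod j%:Z a b = 0) m n c :
  vprod m a (vprod n b c) = vsgn F pa pb *: vprod n b (vprod m a c) +
    vprod (m + n) (vprod 0 a b) c.
Proof.
rewrite (vcomm2 ha hb); last by case=> [|[|j]] // _; apply: ab.
by rewrite (ab 1%N) // vprod0l scaler0 addr0.
Qed.

Lemma vcomm_free pa pb a b (ha : vpar pa a) (hb : vpar pb b)
  (ab : forall j : nat, vprod j%:Z a b = 0) m n c :
  vprod m a (vprod n b c) = vsgn F pa pb *: vprod n b (vprod m a c).
Proof. by rewrite (vcomm1 ha hb) // (ab 0%N) vprod0l addr0. Qed.

Lemma vskew_free pa pb a b (ha : vpar pa a) (hb : vpar pb b)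
  (ab : forall j : nat, vprod j%:Z a b = 0) (j : nat) : vprod j%:Z b a = 0.
Proof.
have [K0 h] := vskew ha hb j%:Z; rewrite (h K0) // big1 ?scaler0 // => i _.
by rewrite -PoszD ab vprod0l scaler0.
Qed.

Lemma vnop_fin pa pb a b (ha : vpar pa a) (hb : vpar pb b) n c M :
  (forall j : nat, (M <= j)%N -> vprod (n + j%:Z) b c = 0) ->
  (forall j : nat, (M <= j)%N -> vprod j%:Z a c = 0) ->
  vprod n (vprod (-1) a b) c =
  \sum_(j < M) (vprod (-1 - j%:Z) a (vprod (n + j%:Z) b c) +
     vsgn F pa pb *: vprod (n - 1 - j%:Z) b (vprod j%:Z a c)).
Proof.
move=> h1 h2; have [K0 h] := vnop_mode ha hb n c.
rewrite (h (K0 + M)%N) ?leq_addr //.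
rewrite [RHS](big_ord_widen (K0 + M)%N (fun j : nat => vprod (-1 - j%:Z) a (vprod (n + j%:Z) b c) +
     vsgn F pa pb *: vprod (n - 1 - j%:Z) b (vprod j%:Z a c))) ?leq_addl //.
rewrite [RHS]big_mkcond; apply: eq_bigr => j _; case: ltnP => // le.
by rewrite h1 // h2 // !vprod0r scaler0 addr0.
Qed.

Lemma vprod_vacl n c : vprod n vac c = (n == -1)%:R *: c :> V.
Proof. exact: vac_prod. Qed.
Lemma vsgnF (p : bool) : vsgn F p false = 1. Proof. by rewrite /vsgn andbF. Qed.
Lemma vsgnFl (p : bool) : vsgn F false p = 1. Proof. by []. Qed.
Lemma vsgnT : vsgn F true true = -1. Proof. by []. Qed.
End VertexTools.

Ltac mlmod F n := lmod_on F constr:('M[F]_n : lmodType F) constr:('M[F]_n) ltac:(ring).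
Section Grading.
Variables (F : numFieldType) (n : nat) (lev : 'I_n -> nat).
Local Notation M := 'M[F]_n.
Implicit Types a b x y : M.

Definition ip := ('I_n * 'I_n)%type.
Definition pos (al : ip) := (lev al.2 < lev al.1)%N.
Definition ud (al : ip) : M := delta_mx al.1 al.2.
Definition dd (al : ip) : M := delta_mx al.2 al.1.
Definition plus a : M := \matrix_(i, j) (if (lev j < lev i)%N then a i j else 0).
Definition minus a : M := \matrix_(i, j) (if (lev i < lev j)%N then a i j else 0).

Lemma plus_lin c a b : plus (c *: a + b) = c *: plus a + plus b.
Proof. by apply/matrixP => i j; rewrite !mxE; case: ifP; rewrite ?mulr0 ?addr0. Qed.
Lemma minus_lin c a b : minus (c *: a + b) = c *: minus a + minus b.
Proof. by apply/matrixP => i j; rewrite !mxE; case: ifP; rewrite ?mulr0 ?addr0. Qed.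

HB.instance Definition _ := GRing.isLinear.Build F M M *:%R plus
  (fun c a b => plus_lin c a b).
HB.instance Definition _ := GRing.isLinear.Build F M M *:%R minus
  (fun c a b => minus_lin c a b).

Lemma lie_lin_r x c a b : lie x (c *: a + b) = c *: lie x a + lie x b.
Proof.
rewrite /lie mulmxDr mulmxDl -scalemxAl -scalemxAr scalerBr opprD.
by rewrite !addrA; congr (_ + _); rewrite addrAC.
Qed.
Lemma lieC a b : lie a b = - lie b a. Proof. by rewrite /lie opprB. Qed.
HB.instance Definition _ x := GRing.isLinear.Build F M M *:%R (@lie F n x)
  (fun c a b => lie_lin_r x c a b).

Lemma lie_jac x y a : lie (lie x y) a = lie x (lie y a) - lie y (lie x a).
Proof.
rewrite /lie !mulmxBl !mulmxBr !mulmxA !opprB.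
by mlmod F n.
Qed.
Lemma lie_jac3 a x y : lie a (lie x y) = lie (lie a x) y - lie (lie a y) x.
Proof. by rewrite /lie !mulmxBl !mulmxBr !mulmxA !opprB; mlmod F n. Qed.

Lemma lie0l a : lie 0 a = 0 :> M. Proof. by rewrite /lie mul0mx mulmx0 subrr. Qed.
Lemma lieDl x y a : lie (x + y) a = lie x a + lie y a.
Proof. by rewrite /lie mulmxDl mulmxDr; mlmod F n. Qed.
Lemma lieZl c x a : lie (c *: x) a = c *: lie x a.
Proof. by rewrite /lie -scalemxAl -scalemxAr scalerBr. Qed.
Lemma lieNl x a : lie (- x) a = - lie x a.
Proof. by rewrite /lie mulNmx mulmxN; mlmod F n. Qed.
Lemma lie_suml I (r : seq I) (P : pred I) (g : I -> M) a :
  lie (\sum_(i <- r | P i) g i) a = \sum_(i <- r | P i) lie (g i) a.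
Proof. by elim/big_rec2: _ => [|i y z _ <-]; rewrite ?lie0l ?lieDl. Qed.

Lemma tr_lie x y z : \tr (lie x y *m z) = \tr (x *m lie y z).
Proof.
rewrite /lie mulmxBl mulmxBr !linearB /= !mulmxA; congr (_ - _).
by rewrite -(mulmxA y); exact: mxtrace_mulC.
Qed.

Lemma tr_ud a al : \tr (ud al *m a) = a al.2 al.1.
Proof.
rewrite /mxtrace (bigD1 al.1) //= big1 => [|i ne]; last first.
  by rewrite !mxE big1 // => j _; rewrite mxE (negbTE ne) mul0r.
rewrite addr0 mxE (bigD1 al.2) //= big1 => [|j ne]; last first.
  by rewrite mxE (negbTE ne) andbF mul0r.
by rewrite mxE !eqxx mul1r addr0.
Qed.
Lemma tr_dd a al : \tr (dd al *m a) = a al.1 al.2.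
Proof. exact: (tr_ud a (al.2, al.1)). Qed.

Lemma plus_sum a : plus a = \sum_(al | pos al) \tr (a *m dd al) *: ud al.
Proof.
transitivity (\sum_(al : ip) (if pos al then a al.1 al.2 else 0) *: ud al).
  rewrite {1}[plus a]matrix_sum_delta pair_big /=; apply: eq_bigr => -[i j] _ /=.
  by rewrite mxE.
rewrite [RHS]big_mkcond; apply: eq_bigr => al _; case: ifP => _; last by rewrite scale0r.
by rewrite mxtrace_mulC tr_dd.
Qed.
Lemma minus_sum a : minus a = \sum_(al | pos al) \tr (a *m ud al) *: dd al.
Proof.
transitivity (\sum_(al : ip) (if pos al then a al.2 al.1 else 0) *: dd al).
  rewrite {1}[minus a]matrix_sum_delta exchange_big pair_big /=.
  by apply: eq_bigr => -[i j] _ /=; rewrite mxE.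
rewrite [RHS]big_mkcond; apply: eq_bigr => al _; case: ifP => _; last by rewrite scale0r.
by rewrite mxtrace_mulC tr_ud.
Qed.

Lemma plus_ud al : pos al -> plus (ud al) = ud al.
Proof.
move=> h; apply/matrixP => i j; rewrite !mxE; case: ifP => // h'.
by case: eqP => [e|//]; case: eqP => [ej|//]; move: h h'; rewrite /pos ej e => ->.
Qed.
Lemma minus_dd al : pos al -> minus (dd al) = dd al.
Proof.
move=> h; apply/matrixP => i j; rewrite !mxE; case: ifP => // h'.
by case: eqP => [e|//]; case: eqP => [ej|//]; move: h h'; rewrite /pos ej e => ->.
Qed.
Lemma plus_plus a : plus (plus a) = plus a.
Proof. by apply/matrixP => i j; rewrite !mxE; case: ifP => //; case: ifP. Qed.
Lemma tr_plus a b : \tr (plus a *m b) = \tr (a *m minus b).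
Proof.
rewrite /mxtrace; apply: eq_bigr => i _; rewrite !mxE; apply: eq_bigr => j _.
by rewrite !mxE; case: ifP; rewrite ?mul0r ?mulr0.
Qed.
Lemma tr_minus a b : \tr (minus a *m b) = \tr (a *m plus b).
Proof. by rewrite mxtrace_mulC -tr_plus mxtrace_mulC. Qed.

Definition isplus a := plus a = a.
Lemma isplus_ud al : pos al -> isplus (ud al). Proof. exact: plus_ud. Qed.
Lemma isplusP a : isplus a -> forall i j, (lev i <= lev j)%N -> a i j = 0.
Proof. by move=> h i j le; rewrite -h mxE ltnNge le. Qed.
Lemma isplus_mul a b : isplus a -> isplus b -> isplus (a *m b).
Proof.
move=> ha hb; apply/matrixP => i j; rewrite mxE; case: ltnP => // le.
rewrite mxE big1 // => l _; have [le1|lt1] := leqP (lev i) (lev l).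
  by rewrite (isplusP ha) ?mul0r.
by rewrite (isplusP hb) ?mulr0 // ltnW // (leq_trans lt1).
Qed.
Lemma isplus_lie a b : isplus a -> isplus b -> isplus (lie a b).
Proof.
by move=> ha hb; rewrite /isplus /lie linearB /= (isplus_mul ha hb) (isplus_mul hb ha).
Qed.

Section Bilin.
Variable W : lmodType F.
Definition bilin (B : M -> M -> W) :=
  (forall c x y z, B (c *: x + y) z = c *: B x z + B y z) /\
  (forall c x y z, B z (c *: x + y) = c *: B z x + B z y).
Variables (B : M -> M -> W) (hB : bilin B).
Lemma bilin0l z : B 0 z = 0.
Proof. by have := hB.1 1 0 0 z; rewrite !scale1r addr0 => /eqP; rewrite -subr_eq subrr eq_sym => /eqP. Qed.
Lemma bilin0r z : B z 0 = 0.
Proof. by have := hB.2 1 0 0 z; rewrite !scale1r addr0 => /eqP; rewrite -subr_eq subrr eq_sym => /eqP. Qed.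
Lemma bilinZl c x z : B (c *: x) z = c *: B x z.
Proof. by rewrite -[c *: x]addr0 hB.1 bilin0l addr0. Qed.
Lemma bilinZr c x z : B z (c *: x) = c *: B z x.
Proof. by rewrite -[c *: x]addr0 hB.2 bilin0r addr0. Qed.
Lemma bilinDl x y z : B (x + y) z = B x z + B y z.
Proof. by rewrite -[x]scale1r hB.1 !scale1r. Qed.
Lemma bilinDr x y z : B z (x + y) = B z x + B z y.
Proof. by rewrite -[x]scale1r hB.2 !scale1r. Qed.
Lemma bilin_suml I (r : seq I) (P : pred I) (g : I -> M) z :
  B (\sum_(i <- r | P i) g i) z = \sum_(i <- r | P i) B (g i) z.
Proof. by elim/big_rec2: _ => [|i x y _ <-]; rewrite ?bilin0l ?bilinDl. Qed.
Lemma bilin_sumr I (r : seq I) (P : pred I) (g : I -> M) z :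
  B z (\sum_(i <- r | P i) g i) = \sum_(i <- r | P i) B z (g i).
Proof. by elim/big_rec2: _ => [|i x y _ <-]; rewrite ?bilin0r ?bilinDr. Qed.


(** The adjoint action can be moved from one side of the Casimir element of
g_+ to the other, as this element is defined by dual bases. *)
Lemma casimir_adj x : \sum_(al | pos al) B (ud al) (minus (lie x (dd al))) =
  \sum_(al | pos al) B (plus (lie (ud al) x)) (dd al).
Proof.
under eq_bigr => al _ do rewrite minus_sum bilin_sumr.
under [RHS]eq_bigr => al _ do rewrite plus_sum bilin_suml.
rewrite exchange_big; apply: eq_bigr => be _; apply: eq_bigr => al _.
rewrite bilinZl bilinZr; congr (_ *: _).
by rewrite mxtrace_mulC -tr_lie.
Qed.
End Bilin.
End Grading.
End Gradings.
Import Gradings.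

(** * The BRST differential and the hatted currents *)
Module BrstComplex.
Notation "a ## b" := (vprod (-1) a b) (at level 40, b at level 39, left associativity).

(** The BRST complex with fields indexed by all matrices and not by bases:
[bK] is the current of the traceless part of a matrix, [bp] depends only on
the part of positive degree and [bs] only on the part of negative degree.
Choosing the elementary matrices as dual bases becomes possible for any
homogeneous bases. *)
Record brst_ops (F : numFieldType) (V : vertexSuperAlgType F) (n : nat)
    (lev : 'I_n -> nat) (k : F) := BrstOps {
  bK : {linear 'M[F]_n -> V};
  bp : {linear 'M[F]_n -> V};
  bs : {linear 'M[F]_n -> V};
  bK_even : forall a, vpar false (bK a);
  bp_odd : forall a, vpar true (bp a);
  bs_odd : forall a, vpar true (bs a);
  bK1 : bK 1%:M = 0;
  bp_plus : forall a, bp (plus lev a) = bp a;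
  bs_minus : forall a, bs (minus lev a) = bs a;
  bKK0 : forall a b, vprod 0 (bK a) (bK b) = bK (lie a b);
  bKK1 : forall a b, vprod 1 (bK a) (bK b) =
    (k * (\tr (a *m b) - \tr a * \tr b / n%:R)) *: vac;
  bKK2 : forall a b (j : nat), (2 <= j)%N -> vprod j%:Z (bK a) (bK b) = 0;
  bKp : forall a b (j : nat), vprod j%:Z (bK a) (bp b) = 0;
  bKs : forall a b (j : nat), vprod j%:Z (bK a) (bs b) = 0;
  bpp : forall a b (j : nat), vprod j%:Z (bp a) (bp b) = 0;
  bss : forall a b (j : nat), vprod j%:Z (bs a) (bs b) = 0;
  bps0 : forall a b, vprod 0 (bp a) (bs b) = \tr (plus lev a *m b) *: vac;
  bps1 : forall a b (j : nat), (1 <= j)%N -> vprod j%:Z (bp a) (bs b) = 0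
}.

Section Brst.
Variables (F : numFieldType) (V : vertexSuperAlgType F) (n : nat).
Variables (lev : 'I_n -> nat) (k : F) (C : brst_ops V lev k).
Variable f : 'M[F]_n.
Local Notation M := 'M[F]_n.
Local Notation K := (bK C).
Local Notation p := (bp C).
Local Notation s := (bs C).
Local Notation plus := (plus lev).
Local Notation minus := (minus lev).
Local Notation pos := (pos lev).
Local Notation ud := (ud F).
Local Notation dd := (dd F).
Implicit Types (a b x y u w : M) (c v : V).
Let Ke := bK_even C.
Let po := bp_odd C.
Let so := bs_odd C.

Definition kap a b : F := k * (\tr (a *m b) - \tr a * \tr b / n%:R).

Lemma pK a b (j : nat) : vprod j%:Z (p a) (K b) = 0.
Proof. exact: (vskew_free (Ke b) (po a) (bKp C b a)). Qed.
Lemma sK a b (j : nat) : vprod j%:Z (s a) (K b) = 0.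
Proof. exact: (vskew_free (Ke b) (so a) (bKs C b a)). Qed.
Lemma sp j a b : vprod j%:Z (s b) (p a) = (j == 0%N)%:R * \tr (plus a *m b) *: vac.
Proof.
have [K0 h] := vskew (po a) (so b) j%:Z; rewrite (h K0.+1) // big_ord_recl big1 => [|i _].
  rewrite expr0 scale1r addr0 [_ + 0]addr0 vsgnT; case: j {h} => [|j].
    by rewrite bps0 vprodZl vprod_vacl eqxx scale1r expr0z mulr1 opprK scale1r mul1r.
  by rewrite bps1 // vprod0l scaler0 mul0r scale0r.
by rewrite -PoszD bps1 ?vprod0l ?scaler0 // lift0 addnS.
Qed.
Lemma sp0 a b : vprod 0 (s b) (p a) = \tr (plus a *m b) *: vac.
Proof. by rewrite (sp 0) mul1r. Qed.
Lemma sp1 j a b : (1 <= j)%N -> vprod j%:Z (s b) (p a) = 0.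
Proof. by case: j => // j _; rewrite sp mul0r scale0r. Qed.

Lemma cKK m l a b c : vprod m (K a) (vprod l (K b) c) = vprod l (K b) (vprod m (K a) c) +
  vprod (m + l) (K (lie a b)) c + (m%:~R * kap a b * (m + l == 0)%:R) *: c.
Proof.
rewrite (vcomm2 (Ke a) (Ke b)); last exact: bKK2.
rewrite vsgnF scale1r bKK0 bKK1 vprodZl vprod_vacl !scalerA; congr (_ + _ *: _).
by have -> : (m + l - 1 == -1) = (m + l == 0) by lia.
Qed.
Lemma cKp m l a b c : vprod m (K a) (vprod l (p b) c) = vprod l (p b) (vprod m (K a) c).
Proof. by rewrite (vcomm_free (Ke a) (po b)) ?scale1r //; exact: bKp. Qed.
Lemma cKs m l a b c : vprod m (K a) (vprod l (s b) c) = vprod l (s b) (vprod m (K a) c).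
Proof. by rewrite (vcomm_free (Ke a) (so b)) ?scale1r //; exact: bKs. Qed.
Lemma cpp m l a b c : vprod m (p a) (vprod l (p b) c) = - vprod l (p b) (vprod m (p a) c).
Proof. by rewrite (vcomm_free (po a) (po b)) ?vsgnT ?scaleN1r //; exact: bpp. Qed.
Lemma css m l a b c : vprod m (s a) (vprod l (s b) c) = - vprod l (s b) (vprod m (s a) c).
Proof. by rewrite (vcomm_free (so a) (so b)) ?vsgnT ?scaleN1r //; exact: bss. Qed.
Lemma cps m l a b c : vprod m (p a) (vprod l (s b) c) = - vprod l (s b) (vprod m (p a) c) +
  ((m + l == -1)%:R * \tr (plus a *m b)) *: c.
Proof.
rewrite (vcomm1 (po a) (so b)); last exact: bps1.
by rewrite vsgnT scaleN1r bps0 vprodZl vprod_vacl scalerA mulrC.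
Qed.
Lemma csp m l a b c : vprod m (s b) (vprod l (p a) c) = - vprod l (p a) (vprod m (s b) c) +
  ((m + l == -1)%:R * \tr (plus a *m b)) *: c.
Proof. by rewrite cps [l + m]addrC; lmod. Qed.

Definition ss a b := s a ## s b.
Lemma ssC a b : ss a b = - ss b a.
Proof.
rewrite /ss -[s b]vprod_vac -[s a]vprod_vac !vprod_vac.
by rewrite -{1}[s b]vprod_vac css !vprod_vac.
Qed.
Lemma ss_even a b : vpar false (ss a b).
Proof. exact: (vprod_par (-1) (so a) (so b)). Qed.

Lemma ssK (j : nat) a b x : vprod j%:Z (ss a b) (K x) = 0.
Proof.
rewrite (vnop_fin (so a) (so b) (M := 0)) ?big_ord0 // => i _; last exact: sK.
by rewrite -PoszD; apply: sK.
Qed.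
Lemma sss (j : nat) a b x : vprod j%:Z (ss a b) (s x) = 0.
Proof.
rewrite (vnop_fin (so a) (so b) (M := 0)) ?big_ord0 // => i _; last exact: bss.
by rewrite -PoszD; apply: bss.
Qed.
Lemma ssp (j : nat) a b y : vprod j%:Z (ss a b) (p y) =
  (j == 0%N)%:R *: (\tr (plus y *m b) *: s a - \tr (plus y *m a) *: s b).
Proof.
rewrite (vnop_fin (so a) (so b) (M := 1)) => [|i i1|i i1]; last exact: sp1.
  rewrite big_ord1 subr0 vsgnT scaleN1r addr0 sp sp0 !vprodZr vprod_vac.
  case: j => [|j]; last first.
    by rewrite (_ : j.+1%:Z - 1 - 0%:Z = j%:Z) ?vprod_nvac //; last lia; lmod.
  by rewrite sub0r subr0 vprod_vac; lmod.
by rewrite -PoszD sp1 // addn_gt0 i1 orbT.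
Qed.

Lemma t1_K u (v : M) a : vprod 0 (K u ## s v) (K a) = s v ## K (lie u a) + kap u a *: vT (s v).
Proof.
rewrite (vnop_fin (Ke u) (so v) (M := 2)) => [|i _|i i2]; last exact: bKK2.
  rewrite big_ord_recl big_ord1 !add0r lift0 /= sK sK !vprod0r !add0r vsgnFl !scale1r.
  by rewrite subr0 bKK0 bKK1 vprodZr.
by rewrite add0r; apply: sK.
Qed.
Lemma t1_p u (v : M) y : vprod 0 (K u ## s v) (p y) = \tr (plus y *m v) *: K u.
Proof.
rewrite (vnop_fin (Ke u) (so v) (M := 1)) => [|i i1|i _]; last exact: bKp.
  by rewrite big_ord1 add0r sp0 (bKp _ _ _ 0) vprod0r scaler0 addr0 vprodZr subr0 vprod_vac.
by rewrite add0r sp1.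
Qed.
Lemma t1_s u (v : M) b : vprod 0 (K u ## s v) (s b) = 0.
Proof.
rewrite (vnop_fin (Ke u) (so v) (M := 0)) ?big_ord0 // => i _; last exact: bKs.
by rewrite add0r; apply: bss.
Qed.
Lemma t2_K w a b x : vprod 0 (p w ## ss a b) (K x) = 0.
Proof.
rewrite (vnop_fin (po w) (ss_even a b) (M := 0)) ?big_ord0 // => i _; last exact: pK.
by rewrite add0r; apply: ssK.
Qed.
Lemma t2_p w a b y : vprod 0 (p w ## ss a b) (p y) =
  \tr (plus y *m b) *: (p w ## s a) - \tr (plus y *m a) *: (p w ## s b).
Proof.
rewrite (vnop_fin (po w) (ss_even a b) (M := 1)) => [|i i1|i _]; last exact: bpp.
  rewrite big_ord1 add0r (ssp 0) (bpp _ _ _ 0) vprod0r scaler0 addr0 subr0 scale1r.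
  by rewrite vprodBr !vprodZr.
by rewrite add0r ssp; case: i i1 => // i _; rewrite scale0r.
Qed.
Lemma t2_s w a b x : vprod 0 (p w ## ss a b) (s x) = \tr (plus w *m x) *: ss a b.
Proof.
rewrite (vnop_fin (po w) (ss_even a b) (M := 1)) => [|i _|i i1]; last exact: bps1.
  rewrite big_ord1 add0r (sss 0) vprod0r add0r vsgnF scale1r bps0 vprodZr.
  by rewrite (_ : 0 - 1 - 0%:Z = -1) // vprod_vac.
by rewrite add0r; apply: sss.
Qed.

(** The sum over c_{ij}^l of the usual formula is absorbed in the linear field
[bp]. *)
Definition Dv : V := \sum_(al | pos al) K (ud al) ## s (dd al)
  - 2^-1 *: (\sum_(al | pos al) \sum_(be | pos be)
      p (lie (ud al) (ud be)) ## ss (dd al) (dd be)) + s f.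
Definition dv v := vprod 0 Dv v.
(** The hatted current K a + (action of a on the ghosts). For a of positive
degree it is, up to a constant, the differential of the ghost p a ([dv_p]);
those of nonpositive degree survive in cohomology. *)
Definition hJ a : V := K a + \sum_(al | pos al) p (lie a (ud al)) ## s (dd al).

Lemma Dv_odd : vpar true Dv.
Proof.
apply: vparD (so _); apply: vparD.
  by apply: vpar_bigsum => al _; apply: (vprod_par (-1) (Ke _) (so _)).
apply/vparN/vparZ/vpar_bigsum => al _; apply: vpar_bigsum => be _.
exact: (vprod_par (-1) (po _) (ss_even _ _)).
Qed.

Lemma dvE v : dv v = \sum_(al | pos al) vprod 0 (K (ud al) ## s (dd al)) v
  - 2^-1 *: (\sum_(al | pos al) \sum_(be | pos be)
      vprod 0 (p (lie (ud al) (ud be)) ## ss (dd al) (dd be)) v) + vprod 0 (s f) v.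
Proof.
rewrite /dv /Dv !vprodDl vprodNl vprodZl !vprod_suml; congr (_ - _ *: _ + _).
by apply: eq_bigr => al _; rewrite vprod_suml.
Qed.

Lemma s_linE b : \sum_(al | pos al) \tr (ud al *m b) *: s (dd al) = s b.
Proof.
rewrite -[RHS](bs_minus C) minus_sum linear_sum; apply: eq_bigr => al _.
by rewrite linearZ mxtrace_mulC.
Qed.
Lemma s_linE' b : \sum_(al | pos al) \tr (b *m ud al) *: s (dd al) = s b.
Proof. by rewrite -[RHS]s_linE; apply: eq_bigr => al _; rewrite mxtrace_mulC. Qed.
Lemma p_linE b : \sum_(al | pos al) \tr (b *m dd al) *: p (ud al) = p b.
Proof.
by rewrite -[RHS](bp_plus C) plus_sum linear_sum; apply: eq_bigr => al _; rewrite linearZ.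
Qed.

Lemma tr_ud0 al : pos al -> \tr (ud al) = 0.
Proof.
move=> h; rewrite -[ud al]mulmx1 tr_ud mxE.
by case: eqP h => // e; rewrite /pos e ltnn.
Qed.

Lemma dv_K a : dv (K a) = \sum_(al | pos al) s (dd al) ## K (lie (ud al) a) + k *: vT (s a).
Proof.
rewrite dvE (sK _ _ 0) addr0 [X in _ - _ *: X]big1 => [|al _]; last first.
  by apply: big1 => be _; exact: t2_K.
rewrite scaler0 subr0; under eq_bigr => al _ do rewrite t1_K.
rewrite big_split /=; congr (_ + _).
rewrite -(s_linE a) /vT vprod_suml scaler_sumr; apply: eq_bigr => al h.
by rewrite vprodZl scalerA /kap (tr_ud0 h) mul0r mul0r subr0.
Qed.

Lemma dv_p y : dv (p y) = hJ (plus y) + \tr (plus y *m f) *: vac.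
Proof.
rewrite dvE sp0; congr (_ + _); rewrite /hJ; congr (_ + _).
  under eq_bigr => al _ do rewrite t1_p -linearZ.
  by rewrite -linear_sum -plus_sum plus_plus.
have hY : plus y = \sum_(al | pos al) \tr (plus y *m dd al) *: ud al.
  by rewrite -plus_sum plus_plus.
under eq_bigr => al _ do under eq_bigr => be _ do rewrite t2_p.
under eq_bigr => al _ do rewrite big_split /= sumrN.
move: (plus y) hY => Y hY.
have e1 : \sum_(al | pos al) \sum_(be | pos be) \tr (Y *m dd be) *:
    (p (lie (ud al) (ud be)) ## s (dd al)) =
  - \sum_(al | pos al) p (lie (Y) (ud al)) ## s (dd al).
  rewrite -sumrN; apply: eq_bigr => al _; rewrite -vprodNl -linearN /= -lieC.
  rewrite [in RHS]hY !linear_sum vprod_suml.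
  by apply: eq_bigr => be _; rewrite !linearZ /= vprodZl.
have e2 : \sum_(al | pos al) \sum_(be | pos be) \tr (Y *m dd al) *:
    (p (lie (ud al) (ud be)) ## s (dd be)) =
  \sum_(al | pos al) p (lie (Y) (ud al)) ## s (dd al).
  rewrite exchange_big; apply: eq_bigr => be _.
  rewrite [in RHS]hY lie_suml linear_sum vprod_suml.
  by apply: eq_bigr => al _; rewrite lieZl !linearZ /= vprodZl.
rewrite big_split /= sumrN e1 e2; set X := \sum_(al | _) _.
by lmod_by ltac:(try field).
Qed.

Lemma dv_s b : dv (s b) = 2^-1 *: \sum_(al | pos al) ss (dd al) (lie (ud al) b).
Proof.
rewrite dvE (bss _ _ _ 0) addr0 big1 => [|al _]; last exact: t1_s.
rewrite sub0r -scalerN; congr (_ *: _); rewrite -sumrN; apply: eq_bigr => al hal.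
rewrite /ss -[lie _ b](opprK) -lieC linearN vprodNr; congr (- _).
rewrite -(s_linE (lie b _)) vprod_sumr; apply: eq_bigr => be hbe.
rewrite t2_s vprodZr; congr (_ *: _).
rewrite (isplus_lie (isplus_ud F hal) (isplus_ud F hbe)) mxtrace_mulC.
by rewrite -(tr_lie b); exact: mxtrace_mulC.
Qed.

Lemma dv_prod q (a' : V) m (b' : V) : vpar q a' ->
  dv (vprod m a' b') = vprod m (dv a') b' + vsgn F true q *: vprod m a' (dv b').
Proof. by move=> h; rewrite /dv (vcomm0 Dv_odd h) addrC. Qed.
Lemma dv_vac : dv vac = 0. Proof. exact: (vprod_vac_ge0 0). Qed.
Lemma dvD (u v : V) : dv (u + v) = dv u + dv v. Proof. exact: vprodDr. Qed.
Lemma dvZ (c : F) v : dv (c *: v) = c *: dv v. Proof. exact: vprodZr. Qed.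
Lemma dvN v : dv (- v) = - dv v. Proof. exact: vprodNr. Qed.
Lemma dv0 : dv 0 = 0. Proof. exact: vprod0r. Qed.
Lemma dv_sum I (r : seq I) (P : pred I) (g : I -> V) :
  dv (\sum_(i <- r | P i) g i) = \sum_(i <- r | P i) dv (g i).
Proof. exact: vprod_sumr. Qed.
Lemma dv_even (a' : V) m (b' : V) : vpar false a' -> dv (vprod m a' b') = vprod m (dv a') b' + vprod m a' (dv b').
Proof. by move=> h; rewrite (dv_prod _ _ h) vsgnF scale1r. Qed.
Lemma dv_oddp (a' : V) m (b' : V) : vpar true a' -> dv (vprod m a' b') = vprod m (dv a') b' - vprod m a' (dv b').
Proof. by move=> h; rewrite (dv_prod _ _ h) vsgnT scaleN1r. Qed.
Lemma dv_T q (a' : V) : vpar q a' -> dv (vT a') = vT (dv a').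
Proof. by move=> h; rewrite /vT (dv_prod _ _ h) dv_vac vprod0r scaler0 addr0. Qed.

Lemma Ks_C a b : K a ## s b = s b ## K a.
Proof. by rewrite -{1}[s b]vprod_vac cKs vprod_vac. Qed.
Lemma sp_x a b v : s a ## (p b ## v) = - (p b ## (s a ## v)).
Proof. by rewrite csp /= mul0r scale0r addr0. Qed.
Lemma ps_s w x y : (p w ## s x) ## s y = p w ## ss x y - \tr (plus w *m y) *: vT (s x).
Proof.
rewrite (vnop_fin (po w) (so x) (M := 1)) => [|i i1|i i1]; last exact: bps1.
  by rewrite big_ord1 !addr0 bps0 vprodZr ?subr0 vsgnT /ss /vT; lmod.
by rewrite (_ : -1 + i%:Z = (i.-1)%:Z) ?bss //; lia.
Qed.
Lemma ss_s x y z : ss x y ## s z = s x ## ss y z.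
Proof.
rewrite (vnop_fin (so x) (so y) (M := 1)) => [|i i1|i i1]; last exact: bss.
  by rewrite big_ord1 addr0 (bss _ _ _ 0) vprod0r scaler0 addr0 ?subr0.
by rewrite (_ : -1 + i%:Z = (i.-1)%:Z) ?bss //; lia.
Qed.
Lemma ss_K x y z : ss x y ## K z = s x ## (s y ## K z).
Proof.
rewrite (vnop_fin (so x) (so y) (M := 1)) => [|i i1|i i1]; last exact: sK.
  by rewrite big_ord1 addr0 (sK _ _ 0) vprod0r scaler0 addr0 ?subr0.
by rewrite (_ : -1 + i%:Z = (i.-1)%:Z) ?sK //; lia.
Qed.
Lemma sTs_C x y : s x ## vT (s y) = - (vT (s y) ## s x).
Proof.
rewrite {1}/vT css vprod_vac vT_mode_l; congr (- _).
by rewrite -[RHS]/(- (-1)%:~R *: vprod (-2) (s y) (s x)) mulrN1z opprK scale1r.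
Qed.

Definition nonpos a := a - plus a.
Lemma nonpos_is_linear : linear nonpos.
Proof. by move=> c a b; rewrite /nonpos linearP /=; mlmod F n. Qed.
HB.instance Definition _ := GRing.isLinear.Build F M M *:%R nonpos nonpos_is_linear.
Lemma plus_nonpos a : plus (nonpos a) = 0.
Proof. by rewrite /nonpos linearB /= plus_plus subrr. Qed.

Lemma hJ_lin : linear hJ.
Proof.
move=> c a b; rewrite /hJ linearP /= scalerDr -!addrA; congr (_ + _).
rewrite addrCA; congr (_ + _); rewrite scaler_sumr -big_split; apply: eq_bigr => al _ /=.
by rewrite lieDl lieZl linearP /= vprod_linearl.
Qed.
HB.instance Definition _ := GRing.isLinear.Build F M V *:%R hJ hJ_lin.

Lemma hJ_s z y : hJ z ## s y = s y ## hJ z -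
  \sum_(be | pos be) \tr (plus (lie z (ud be)) *m y) *: vT (s (dd be)).
Proof.
rewrite /hJ vprodDl vprodDr Ks_C -addrA; congr (_ + _).
rewrite vprod_suml vprod_sumr -sumrB; apply: eq_bigr => be _.
by rewrite ps_s sp_x -/(ss _ _) ssC vprodNr; lmod.
Qed.

Hypothesis f_minus : minus f = f.

Definition tcoef a be := \sum_(al | pos al)
   \tr (lie (plus (lie a (ud al))) (ud be) *m dd al).

Lemma pss_bilin a be : bilin (fun x z => p (lie a x) ## ss (dd be) z).
Proof.
split=> c x y z; first by rewrite linearP /= linearP vprod_linearl.
by rewrite /ss linearP vprod_linearr vprod_linearr.
Qed.

(** For a of nonpositive degree the differential involves hatted currents of
nonpositive degree only, so the words in these currents and in s form a
subcomplex. *)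
Lemma dv_J a : dv (hJ a) = \sum_(al | pos al) s (dd al) ## hJ (nonpos (lie (ud al) a)) +
  s (lie f a) + vT (k *: s a - \sum_(be | pos be) tcoef a be *: s (dd be)).
Proof.
have dps al : pos al -> dv (p (lie a (ud al)) ## s (dd al)) =
    s (dd al) ## hJ (plus (lie a (ud al)))
    - (\sum_(be | pos be) \tr (lie (plus (lie a (ud al))) (ud be) *m dd al) *: vT (s (dd be)))
    + \tr (lie f a *m ud al) *: s (dd al)
    - 2^-1 *: \sum_(be | pos be) p (lie a (ud al)) ## ss (dd be) (minus (lie (ud be) (dd al))).
  move=> hal; rewrite (dv_oddp _ _ (po _)) dv_p vprodDl vprodZl vprod_vacl scale1r hJ_s.
  rewrite dv_s vprodZr vprod_sumr tr_plus f_minus.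
  have -> : \tr (lie a (ud al) *m f) = \tr (lie f a *m ud al).
    by rewrite mxtrace_mulC (tr_lie f).
  congr (_ - _ + _ - _ *: _).
    by apply: eq_bigr => be _; rewrite tr_plus minus_dd.
  by apply: eq_bigr => be _; rewrite /ss bs_minus.
have X0 : \sum_(al | pos al) \sum_(be | pos be)
    p (lie (lie a (ud al)) (ud be)) ## ss (dd be) (dd al) =
  2^-1 *: \sum_(al | pos al) \sum_(be | pos be)
    p (lie a (ud al)) ## ss (dd be) (minus (lie (ud be) (dd al))).
  set X := LHS; rewrite [in RHS]exchange_big /=.
  under [in RHS]eq_bigr => be _ do rewrite (casimir_adj lev (pss_bilin a be) (ud be)).
  have -> : \sum_(i | pos i) \sum_(al | pos al)
      p (lie a (plus (lie (ud al) (ud i)))) ## ss (dd i) (dd al) = X + X.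
    have X2 : X = \sum_(al | pos al) \sum_(be | pos be)
        p (lie (lie a (ud be)) (ud al)) ## ss (dd al) (dd be) by rewrite /X exchange_big.
    rewrite {2}X2 /X -big_split /= exchange_big /=; apply: eq_bigr => al hal.
    rewrite -big_split; apply: eq_bigr => be hbe /=.
    rewrite (isplus_lie (isplus_ud F hal) (isplus_ud F hbe)).
    by rewrite (ssC (dd al)) vprodNr -vprodBl -linearB -lie_jac3.
  by lmod_by ltac:(try field).
rewrite {1}/hJ dvD dv_sum dv_K (eq_bigr _ dps) !big_split /= !sumrN -scaler_sumr -X0.
rewrite s_linE' vTD vTZ -!addrA.
have -> : \sum_(al | pos al) s (dd al) ## hJ (nonpos (lie (ud al) a)) =
  \sum_(al | pos al) s (dd al) ## K (lie (ud al) a) +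
  \sum_(al | pos al) s (dd al) ## hJ (plus (lie a (ud al))) -
  \sum_(al | pos al) \sum_(be | pos be)
    p (lie (lie a (ud al)) (ud be)) ## ss (dd be) (dd al).
  rewrite -big_split -sumrB; apply: eq_bigr => al _ /=.
  rewrite -[in LHS](opprK (lie (ud al) a)) -lieC /nonpos linearN /= opprK.
  rewrite linearD linearN /= vprodDr vprodNr {1}/hJ vprodDr.
  rewrite -[in RHS](opprK (lie (ud al) a)) -lieC linearN vprodNr.
  have -> : \sum_(be | pos be) p (lie (lie a (ud al)) (ud be)) ## ss (dd be) (dd al) =
     s (dd al) ## \sum_(be | pos be) p (lie (lie a (ud al)) (ud be)) ## s (dd be).
    rewrite vprod_sumr; apply: eq_bigr => be _.
    by rewrite sp_x -/(ss _ _) ssC vprodNr.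
  by lmod.
have -> : vT (- \sum_(be | pos be) tcoef a be *: s (dd be)) =
  - \sum_(al | pos al) \sum_(be | pos be)
     \tr (lie (plus (lie a (ud al))) (ud be) *m dd al) *: vT (s (dd be)).
  rewrite vTN exchange_big /vT vprod_suml; congr (- _); apply: eq_bigr => be _.
  by rewrite vprodZl /tcoef scaler_suml.
by lmod.
Qed.


Hypothesis f_deg : forall i j, lev i != (lev j).+1 -> f j i = 0.

Definition dge (m : nat) x := forall i j, (lev i < lev j + m)%N -> x i j = 0.
Lemma dge_plus x : isplus lev x -> dge 1 x.
Proof. by move=> h i j lt; apply: (isplusP h); lia. Qed.
Lemma dge_ud al : pos al -> dge (lev al.1 - lev al.2) (ud al).
Proof.
move=> h i j lt; rewrite mxE; case: eqP => // e1; case: eqP => // e2.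
by move: h lt; rewrite /pos e1 e2 /=; lia.
Qed.
Lemma dge_mul m1 m2 x y : dge m1 x -> dge m2 y -> dge (m1 + m2) (x *m y).
Proof.
move=> h1 h2 i j lt; rewrite mxE big1 // => l _.
have [lt1|le1] := ltnP (lev i) (lev l + m1); first by rewrite h1 ?mul0r.
by rewrite h2 ?mulr0 //; lia.
Qed.
Lemma dge_lie m1 m2 x y : dge m1 x -> dge m2 y -> dge (m1 + m2) (lie x y).
Proof.
move=> h1 h2 i j lt; rewrite !mxE -[LHS]/(_ - _).
have := dge_mul h1 h2 lt; rewrite mxE => ->.
by have := dge_mul h2 h1; rewrite addnC => /(_ _ _ lt); rewrite mxE => ->; rewrite subr0.
Qed.
Lemma dge_plusr m x : dge m x -> dge m (plus x).
Proof. by move=> h i j lt; rewrite mxE h // if_same. Qed.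
Lemma dge_le m1 m2 x : (m1 <= m2)%N -> dge m2 x -> dge m1 x.
Proof. by move=> le h i j lt; apply: h; lia. Qed.

Lemma tcoef0 a be : dge 0 a -> pos be -> tcoef a be = 0.
Proof.
move=> ha hbe; rewrite /tcoef big1 // => al hal; rewrite mxtrace_mulC tr_dd.
have h := dge_lie (dge_plusr (dge_lie ha (dge_ud hal))) (dge_plus (isplus_ud F hbe)).
by apply: h; move: hal; rewrite /pos; lia.
Qed.
Lemma s_dge0 a : dge 0 a -> s a = 0.
Proof.
move=> h; rewrite -(bs_minus C) (_ : minus a = 0) ?linear0 //.
by apply/matrixP => i j; rewrite !mxE; case: ifP => // lt; rewrite h ?addn0.
Qed.
Lemma lief_dge m a : dge m.+1 a -> dge m (lie f a).
Proof.
move=> h i j lt; rewrite !mxE -[LHS]/(_ - _) !big1 ?subr0 // => l _.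
  have [e|ne] := eqVneq (lev j) (lev l).+1; last by rewrite f_deg ?mulr0.
  by rewrite h ?mul0r //; lia.
have [e|ne] := eqVneq (lev l) (lev i).+1; last by rewrite f_deg ?mul0r.
by rewrite h ?mulr0 //; lia.
Qed.
Lemma nonpos_dge a : dge 1 a -> nonpos a = 0.
Proof.
move=> h; apply/matrixP => i j; rewrite !mxE; case: ltnP => // le; rewrite ?subrr // h ?subr0 //.
by rewrite addn1 ltnS.
Qed.

Lemma dd_p y : dv (dv (p y)) = 0.
Proof.
rewrite dv_p dvD dvZ dv_vac scaler0 addr0 dv_J.
have hy : dge 1 (plus y) by apply: dge_plus; exact: plus_plus.
have hy0 : dge 0 (plus y) by exact: dge_le hy.
rewrite (s_dge0 (lief_dge hy)) (s_dge0 hy0) scaler0 big1 => [|al hal]; last first.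
  by rewrite nonpos_dge ?linear0 ?vprod0r //; apply: dge_le (dge_lie (dge_ud hal) hy); lia.
by rewrite big1 => [|al hal]; rewrite ?tcoef0 ?scale0r // subrr vT0 !addr0.
Qed.

Lemma S_swap x y z : s x ## ss y z = - (s y ## ss x z).
Proof. by rewrite /ss css. Qed.
Lemma S_cyc x y z : s x ## ss y z = s y ## ss z x.
Proof. by rewrite S_swap ssC vprodNr opprK. Qed.

(** After cyclic symmetrization the cubic terms in s combine by the Jacobi
identity. *)
Lemma dd_s b : dv (dv (s b)) = 0.
Proof.
pose A := \sum_(be | pos be) \sum_(al | pos al)
  s (dd be) ## ss (dd al) (lie (ud al) (lie (ud be) b)).
pose G := \sum_(be | pos be) \sum_(al | pos al)
  s (dd be) ## ss (dd al) (lie (lie (ud al) (ud be)) b).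
have e : dv (dv (s b)) = 2^-1 *: (2^-1 *: G - 2^-1 *: A).
  rewrite {1}dv_s dvZ dv_sum; congr (_ *: _).
  under eq_bigr => al _ do rewrite /ss (dv_oddp _ _ (so _)) !dv_s vprodZl vprodZr -scalerBr.
  rewrite -scaler_sumr -scalerBr sumrB; congr (_ *: (_ - _)); last first.
    by apply: eq_bigr => al _; rewrite vprod_sumr.
  under eq_bigr => al _ do rewrite vprod_suml.
  rewrite exchange_big; apply: eq_bigr => be hbe /=.
  have Bb : bilin (fun x z => s (dd be) ## ss z (lie x b)).
    split=> c x y z; first by rewrite /ss lieDl lieZl linearP vprod_linearr vprod_linearr.
    by rewrite /ss linearP vprod_linearl vprod_linearr.
  transitivity (\sum_(al | pos al) s (dd be) ## ss (minus (lie (ud be) (dd al))) (lie (ud al) b)).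
    by apply: eq_bigr => al _; rewrite ss_s /ss bs_minus.
  rewrite (casimir_adj lev Bb); apply: eq_bigr => al hal.
  by rewrite (isplus_lie (isplus_ud F hal) (isplus_ud F hbe)).
have eG : G = A + A.
  have A2 : A = \sum_(be | pos be) \sum_(al | pos al)
     s (dd al) ## ss (dd be) (lie (ud be) (lie (ud al) b)) by rewrite /A exchange_big.
  rewrite {2}A2 /A /G -big_split /=; apply: eq_bigr => be _; rewrite -big_split.
  apply: eq_bigr => al _ /=; rewrite (S_swap (dd al)) -vprodBr /ss -vprodBr -linearB /=.
  by rewrite lie_jac.
have G0 : 3%:R *: G = 0.
  pose T be al ga := \tr (ud ga *m lie (lie (ud al) (ud be)) b) *: (s (dd be) ## ss (dd al) (dd ga)).
  have eT : G = \sum_(be | pos be) \sum_(al | pos al) \sum_(ga | pos ga) T be al ga.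
    apply: eq_bigr => be _; apply: eq_bigr => al _; rewrite {1}/ss -(s_linE (lie _ b)).
    rewrite !vprod_sumr; apply: eq_bigr => ga _; by rewrite !vprodZr.
  have eT2 : G = \sum_(be | pos be) \sum_(al | pos al) \sum_(ga | pos ga) T al ga be.
    rewrite eT exchange_big; under eq_bigr => al _ do rewrite exchange_big.
    by rewrite exchange_big; under eq_bigr => ga _ do rewrite exchange_big.
  have eT3 : G = \sum_(be | pos be) \sum_(al | pos al) \sum_(ga | pos ga) T ga be al.
    rewrite eT2 exchange_big; under eq_bigr => al _ do rewrite exchange_big.
    by rewrite exchange_big; under eq_bigr => ga _ do rewrite exchange_big.
  have -> : 3%:R *: G = G + (G + G) by lmod.
  rewrite {1}eT {1}eT2 eT3 -!big_split /= big1 // => be _; rewrite -!big_split big1 // => al _.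
  rewrite -!big_split big1 // => ga _ /=; rewrite /T.
  rewrite -(S_cyc (dd be)) (S_cyc (dd ga)) -!scalerDl.
  rewrite -!tr_lie -!linearD -!mulmxDl /= (_ : _ + _ = 0) ?mul0mx ?linear0 ?scale0r //.
  by rewrite /lie !mulmxBl !mulmxBr !mulmxA; mlmod F n.
have {G0} G0 : G = 0 by apply/eqP; move/eqP: G0; rewrite scaler_eq0 pnatr_eq0.
have A0 : A = 0.
  have : 2%:R *: A = 0 by rewrite -[RHS]G0 eG; lmod.
  by move/eqP; rewrite scaler_eq0 pnatr_eq0 => /eqP.
by rewrite e G0 A0; lmod.
Qed.

Lemma dd_K a : dv (dv (K a)) = 0.
Proof.
pose U x y z := s x ## (s y ## K z).
have Usw x y z : U x y z = - U y x z by rewrite /U css.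
pose Y := \sum_(be | pos be) \sum_(al | pos al) U (dd be) (dd al) (lie (ud al) (lie (ud be) a)).
have e1 : \sum_(al | pos al) dv (s (dd al)) ## K (lie (ud al) a) = Y.
  under eq_bigr => al _ do rewrite dv_s vprodZl vprod_suml.
  rewrite -scaler_sumr exchange_big /=.
  have -> : \sum_(be | pos be) \sum_(al | pos al) ss (dd be) (lie (ud be) (dd al)) ## K (lie (ud al) a)
     = Y + Y; last by lmod_by ltac:(try field).
  have Y2 : Y = \sum_(be | pos be) \sum_(al | pos al) U (dd al) (dd be) (lie (ud be) (lie (ud al) a))
    by rewrite /Y exchange_big.
  rewrite {2}Y2 /Y -big_split; apply: eq_bigr => be hbe.
  rewrite -big_split /=.
  have Bb : bilin (fun x z => U (dd be) z (lie x a)).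
    split=> c x y z; first by rewrite /U lieDl lieZl linearP vprod_linearr vprod_linearr.
    by rewrite /U linearP vprod_linearl vprod_linearr.
  transitivity (\sum_(al | pos al) U (dd be) (minus (lie (ud be) (dd al))) (lie (ud al) a)).
    by apply: eq_bigr => al _; rewrite ss_K /U bs_minus.
  rewrite (casimir_adj lev Bb); apply: eq_bigr => al hal.
  rewrite (isplus_lie (isplus_ud F hal) (isplus_ud F hbe)) (Usw (dd al)) /U.
  by rewrite -!vprodBr -linearB lie_jac.
have e2 : \sum_(al | pos al) s (dd al) ## dv (K (lie (ud al) a)) =
  Y + k *: \sum_(al | pos al) s (dd al) ## vT (s (lie (ud al) a)).
  rewrite /Y scaler_sumr -big_split /=; apply: eq_bigr => al _.
  by rewrite dv_K vprodDr vprodZr vprod_sumr.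
pose W := \sum_(al | pos al) \sum_(ga | pos ga) \tr (ud ga *m lie (ud al) a) *: (vT (s (dd al)) ## s (dd ga)).
have e3 : \sum_(al | pos al) vT (s (dd al)) ## s (lie (ud al) a) = W.
  by apply: eq_bigr => al _; rewrite -(s_linE (lie _ a)) vprod_sumr; apply: eq_bigr => ga _; rewrite vprodZr.
have e4 : \sum_(al | pos al) s (dd al) ## vT (s (lie (ud al) a)) = W.
  transitivity (\sum_(al | pos al) \sum_(ga | pos ga)
      \tr (ud ga *m lie (ud al) a) *: - (vT (s (dd ga)) ## s (dd al))).
    apply: eq_bigr => al _; rewrite -(s_linE (lie _ a)) /vT vprod_suml vprod_sumr.
    by apply: eq_bigr => ga _; rewrite vprodZl vprodZr -/(vT _) sTs_C.
  rewrite /W exchange_big; apply: eq_bigr => al _; apply: eq_bigr => ga _ /=.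
  rewrite scalerN -scaleNr; congr (_ *: _).
  by rewrite -!tr_lie lieC mulNmx linearN opprK.
rewrite {1}dv_K dvD dvZ (dv_T (so _)) dv_s dv_sum.
under eq_bigr => al _ do rewrite (dv_oddp _ _ (so _)).
have vTs : vT (\sum_(al | pos al) ss (dd al) (lie (ud al) a)) =
    \sum_(al | pos al) (vT (s (dd al)) ## s (lie (ud al) a) + s (dd al) ## vT (s (lie (ud al) a))).
  by rewrite {1}/vT vprod_suml; apply: eq_bigr => al _; rewrite -/(vT _) vT_prod.
rewrite sumrB e1 e2 vTZ vTs.
by rewrite big_split /= e3 e4; lmod_by ltac:(try field).
Qed.
End Brst.
End BrstComplex.
Import BrstComplex.

(** * The conformal vector and the charge of the complex *)
Module ConformalVector.
Section Conformal.
Variables (F : numFieldType) (V : vertexSuperAlgType F) (n : nat).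
Variables (lev : 'I_n -> nat) (k : F) (C : brst_ops V lev k).
Variable f : 'M[F]_n.
Local Notation M := 'M[F]_n.
Local Notation K := (bK C).
Local Notation p := (bp C).
Local Notation s := (bs C).
Local Notation plus := (plus lev).
Local Notation minus := (minus lev).
Local Notation nonpos := (nonpos lev).
Local Notation pos := (pos lev).
Local Notation ud := (ud F).
Local Notation dd := (dd F).
Local Notation ss := (ss C).

Local Notation Dv := (Dv C f).
Local Notation dv := (dv C f).
Local Notation hJ := (hJ C).
Implicit Types (a b x y u w : M) (c v : V).
Let Ke := bK_even C.
Let po := bp_odd C.
Let so := bs_odd C.

Definition levm : M := diag_mx (\row_i (lev i)%:R).
Definition mdeg (al : ip n) : F := (lev al.1)%:R - (lev al.2)%:R.

Lemma lie_levmE a i j : lie levm a i j = ((lev i)%:R - (lev j)%:R) * a i j.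
Proof. by rewrite /lie /levm mul_diag_mx mul_mx_diag !mxE mulrBl [a i j * _]mulrC. Qed.
Lemma lie_levm_ud al : lie levm (ud al) = mdeg al *: ud al.
Proof.
apply/matrixP => i j; rewrite lie_levmE !mxE /mdeg.
by case: eqP => [->|]; case: eqP => [->|]; rewrite ?mulr0.
Qed.
Lemma lie_levm_dd al : lie levm (dd al) = - mdeg al *: dd al.
Proof.
apply/matrixP => i j; rewrite lie_levmE !mxE /mdeg opprB.
by case: eqP => [->|]; case: eqP => [->|]; rewrite ?mulr0.
Qed.
Lemma lie_levm_lie a b : lie levm (lie a b) = lie (lie levm a) b + lie a (lie levm b).
Proof. by rewrite /lie !mulmxBl !mulmxBr !mulmxA; mlmod F n. Qed.
Lemma lie_levm_plus a : lie levm (plus a) = plus (lie levm a).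
Proof.
apply/matrixP => i j; rewrite lie_levmE [RHS]mxE lie_levmE mxE.
by case: ifP; rewrite ?mulr0.
Qed.

Definition wS : V := (2 * (k + n%:R))^-1 *: \sum_(al : ip n) K (ud al) ## K (dd al).
Definition wT : V := vT (K levm).
Definition wC : V := \sum_(al | pos al) (- (mdeg al *: (s (dd al) ## vT (p (ud al))))
   + (1 - mdeg al) *: (vT (s (dd al)) ## p (ud al))).
Definition om : V := wS + wT + wC.

Lemma om_even : vpar false om.
Proof.
apply: vparD; first apply: vparD.
- by apply/vparZ/vpar_bigsum => al _; apply: (vprod_par (-1) (Ke _) (Ke _)).
- exact: vpar_T.
- apply: vpar_bigsum => al _; apply: vparD.
    by apply/vparN/vparZ; exact: (vprod_par (-1) (so _) (vpar_T (po _))).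
  by apply/vparZ; exact: (vprod_par (-1) (vpar_T (so _)) (po _)).
Qed.

Lemma KK_C a b : K a ## K b = K b ## K a + vT (K (lie a b)).
Proof.
by rewrite -{1}[K b]vprod_vac cKK vprod_vac /= mulr0 scale0r addr0.
Qed.

Lemma sum_ud a : \sum_(al : ip n) \tr (dd al *m a) *: ud al = a.
Proof.
rewrite {2}[a]matrix_sum_delta pair_big; apply: eq_bigr => -[i j] _.
by rewrite tr_dd.
Qed.
Lemma sum_dd a : \sum_(al : ip n) \tr (ud al *m a) *: dd al = a.
Proof.
rewrite {2}[a]matrix_sum_delta exchange_big pair_big; apply: eq_bigr => -[i j] _.
by rewrite tr_ud.
Qed.
Definition swp (al : ip n) : ip n := (al.2, al.1).
Lemma swpK : involutive swp. Proof. by case. Qed.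
Lemma sum_swp (W : lmodType F) (g : ip n -> W) : \sum_al g (swp al) = \sum_al g al.
Proof.
by rewrite [RHS](reindex_onto swp swp) => [|i _]; [apply: eq_bigl => i; rewrite swpK eqxx | rewrite swpK].
Qed.
(** The Casimir element of gl_n acts on gl_n by 2n (id - trace part); the
level shift k + n of the Sugawara vector comes from here. *)
Lemma casimir_full a : \sum_(al : ip n) lie (lie a (ud al)) (dd al) =
  (2 * n%:R) *: a - (2 * \tr a) *: 1%:M.
Proof.
have h1 : \sum_(al : ip n) ud al *m dd al = n%:R *: 1%:M :> M.
  rewrite -(pair_big xpredT xpredT (fun i j => ud (i, j) *m dd (i, j))) /=.
  transitivity (\sum_(i < n) \sum_(j < n) (delta_mx i i : M)).
    by apply: eq_bigr => i _; apply: eq_bigr => j _; rewrite mul_delta_mx.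
  under eq_bigr => i _ do rewrite sumr_const card_ord -scaler_nat.
  by rewrite -scaler_sumr -mx1_sum_delta.
have h2 : \sum_(al : ip n) dd al *m ud al = n%:R *: 1%:M :> M.
  by rewrite -h1 -(sum_swp (fun al => ud al *m dd al)).
have h3 b : \sum_(al : ip n) ud al *m b *m dd al = \tr b *: 1%:M :> M.
  apply/matrixP => i j; rewrite summxE.
  rewrite -(pair_big xpredT xpredT (fun q r => (ud (q, r) *m b *m dd (q, r)) i j)) /=.
  transitivity (\sum_(q < n) \sum_(r < n) ((i == q) && (j == q))%:R * b r r).
    apply: eq_bigr => q _; apply: eq_bigr => r _.
    rewrite !mxE (bigD1 r) //= big1 => [|l /negbTE ne]; last by rewrite [dd _ _ _]mxE ne mulr0.
    rewrite addr0 [dd _ _ _]mxE eqxx !mxE (bigD1 r) //= big1 => [|l /negbTE ne].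
      by rewrite mxE eqxx addr0 andbT; do 2 case: eqP => _; rewrite ?mul1r ?mulr1 ?mul0r ?mulr0.
    by rewrite mxE ne andbF mul0r.
  rewrite exchange_big /= !mxE /mxtrace mulr_suml; apply: eq_bigr => r _.
  rewrite -mulr_suml mulrC; congr (_ * _).
  rewrite (bigD1 i) //= eqxx big1 ?addr0; last by move=> q /negbTE; rewrite eq_sym => ->.
  by rewrite eq_sym.
have h4 b : \sum_(al : ip n) dd al *m b *m ud al = \tr b *: 1%:M :> M.
  by rewrite -h3 -(sum_swp (fun al => ud al *m b *m dd al)).
transitivity (\sum_(al : ip n) (a *m (ud al *m dd al) - ud al *m a *m dd al
    - dd al *m a *m ud al + (dd al *m ud al) *m a)).
  by apply: eq_bigr => al _; rewrite /lie !mulmxBl !mulmxBr !mulmxA; mlmod F n.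
rewrite !big_split /= !sumrN -mulmx_sumr -mulmx_suml h1 h2 h3 h4.
by rewrite -scalemxAr -scalemxAl mulmx1 mul1mx; mlmod F n.
Qed.

Lemma tr_lie0 x y : \tr (lie x y) = 0.
Proof. by rewrite /lie linearB /= mxtrace_mulC subrr. Qed.
Lemma K_mod1 (c d : F) a : K (c *: a - d *: 1%:M) = c *: K a.
Proof.
have hz : K (d *: 1%:M) = 0 by rewrite linearZ /= bK1; exact: scaler0.
by rewrite linearB /= hz linearZ /=; exact: subr0.
Qed.

Lemma K_kap a : \sum_(al : ip n) kap k (dd al) a *: K (ud al) = k *: K a.
Proof.
rewrite -{2}(sum_ud a) linear_sum scaler_sumr.
transitivity (\sum_(al : ip n) (k *: K (\tr (dd al *m a) *: ud al) -
    (k * \tr a / n%:R) *: K (\tr (dd al *m 1%:M) *: ud al))).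
  by apply: eq_bigr => al _; rewrite /kap !linearZ /= mulmx1; lmod.
by rewrite sumrB -!scaler_sumr -!linear_sum !sum_ud bK1; lmod.
Qed.
Lemma K_kap' a : \sum_(al : ip n) kap k (ud al) a *: K (dd al) = k *: K a.
Proof. by rewrite -K_kap -(sum_swp (fun al => kap k (dd al) a *: K (ud al))). Qed.

Lemma tKK j u y a : vprod j%:Z (K u ## K y) (K a) =
  match j with
  | 0 => K u ## K (lie y a) + K y ## K (lie u a) + vT (kap k y a *: K u + kap k u a *: K y)
  | 1 => kap k y a *: K u + kap k u a *: K y + K (lie y (lie u a))
  | 2 => kap k y (lie u a) *: vac
  | _ => 0
  end.
Proof.
rewrite (vnop_fin (Ke u) (Ke y) (M := 2)) => [|i i2|i i2]; try by rewrite -?PoszD bKK2 ?ltn_addl.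
rewrite big_ord_recl big_ord1 vsgnFl !scale1r lift0 /= !bKK0 !bKK1 !addr0 ?subr0.
case: j => [|[|[|j]]].
- by rewrite add0r bKK0 bKK1 !vprodZr /vT vprodDl !vprodZl /kap; lmod.
- by rewrite bKK1 -PoszD bKK2 // subrr !bKK0 !vprodZr !vprod_vac vprod0r /kap; lmod.
- rewrite (@bKK2 _ _ _ _ _ C y a 2) // [vprod (2%:Z + 1%:Z) _ _](@bKK2 _ _ _ _ _ C y a 3) //.
  rewrite !vprod0r !add0r (_ : 2%:Z - 1 - 1%:Z = 0) // (_ : 2%:Z - 1 = 1) // bKK1 vprodZr.
  by rewrite (vprod_vac_ge0 0) scaler0 addr0.
- rewrite (@bKK2 _ _ _ _ _ C y a j.+3) // -PoszD (@bKK2 _ _ _ _ _ C y a (j.+3 + 1)) ?addn1 //.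
  rewrite !vprod0r !add0r (_ : j.+3%:Z - 1 = j.+2%:Z); last lia.
  by rewrite bKK2 // vprodZr vprod_nvac ?scaler0 ?addr0 //; lia.
Qed.

Hypothesis kn : k + n%:R != 0.

Lemma wS_K j a : vprod j%:Z wS (K a) =
  match j with 0 => vT (K a) | 1 => K a | _ => 0 end.
Proof.
rewrite /wS vprodZl vprod_suml; under eq_bigr => al _ do rewrite tKK.
have hX : \sum_(al : ip n) K (ud al) ## K (lie (dd al) a) = n%:R *: vT (K a).
  set X := LHS.
  have XE : X = \sum_(al : ip n) K (dd al) ## K (lie (ud al) a).
    by rewrite /X -(sum_swp (fun al => K (ud al) ## K (lie (dd al) a))).
  have e : X = - X + vT (K (\sum_(al : ip n) lie (lie a (ud al)) (dd al))).
    rewrite {2}XE -sumrN linear_sum /vT vprod_suml -big_split /=.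
    transitivity (\sum_(al : ip n) K (lie a (ud al)) ## K (dd al)).
      rewrite /X; transitivity (- \sum_(al : ip n) K (ud al) ## K (lie a (dd al))).
        by rewrite -sumrN; apply: eq_bigr => al _; rewrite lieC linearN vprodNr.
      have Bb : bilin (fun x y => K x ## K y).
        by split=> c x y z; rewrite linearP ?vprod_linearl ?vprod_linearr.
      under eq_bigr => al _ do rewrite -(sum_dd (lie a (dd al))) (bilin_sumr Bb).
      under [RHS]eq_bigr => al _ do rewrite -(sum_ud (lie a (ud al))) (bilin_suml Bb).
      rewrite [in RHS]exchange_big -sumrN; apply: eq_bigr => al _; rewrite -sumrN.
      apply: eq_bigr => be _; rewrite (bilinZl Bb) (bilinZr Bb) -scaleNr; congr (_ *: _).
      rewrite -(tr_lie (ud be)) lieC mulNmx linearN opprK; exact: mxtrace_mulC.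
    apply: eq_bigr => al _; rewrite KK_C; congr (_ + _); by rewrite lieC linearN vprodNr.
  rewrite casimir_full in e.
  have {}e : X = - X + (2 * n%:R) *: vT (K a).
    by rewrite {1}e K_mod1 vTZ.
  have : 2%:R *: (X - n%:R *: vT (K a)) = 0.
    clear XE; move: X e => X e.
    have -> : 2%:R *: (X - n%:R *: vT (K a)) = X + X - (2 * n%:R) *: vT (K a) by lmod.
    by rewrite {1}e; lmod.
  by move/eqP; rewrite scaler_eq0 pnatr_eq0 subr_eq0 => /eqP.
have hX' : \sum_(al : ip n) K (dd al) ## K (lie (ud al) a) = n%:R *: vT (K a).
  by rewrite -hX -(sum_swp (fun al => K (ud al) ## K (lie (dd al) a))).
have hT : \sum_(al : ip n) (kap k (dd al) a *: K (ud al) + kap k (ud al) a *: K (dd al)) = (2 * k) *: K a.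
  by rewrite big_split /= K_kap K_kap'; lmod.
have kn2 : 2 * (k + n%:R) != 0 by rewrite mulf_neq0 // pnatr_eq0.
case: j => [|[|[|j]]] /=.
- rewrite !big_split /= hX hX' (_ : \sum_(i : ip n) vT _ = vT ((2 * k) *: K a)).
    by rewrite vTZ -!scalerDl scalerA (_ : _ * _ = 1) ?scale1r //; field.
  by rewrite -hT {2}/vT vprod_suml.
- rewrite big_split /= hT -linear_sum (_ : \sum_al _ = (2 * n%:R) *: a - (2 * \tr a) *: 1%:M).
    rewrite K_mod1 -scalerDl scalerA.
    by rewrite (_ : _ * _ = 1) ?scale1r //; field.
  by rewrite -casimir_full; apply: eq_bigr => al _; rewrite lieC -lieNl -lieC.
- rewrite -scaler_suml (_ : \sum_al _ = 0) ?scale0r ?scaler0 //.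
  rewrite (eq_bigr (fun al => k * (\tr (dd al *m ud al *m a) - \tr (ud al *m dd al *m a)))).
    rewrite -mulr_sumr sumrB -!linear_sum -!mulmx_suml.
    by rewrite -(sum_swp (fun al => ud al *m dd al)) subrr mulr0.
  move=> al _; rewrite /kap tr_lie0 mulr0 mul0r subr0 /lie mulmxBr linearB /= !mulmxA.
  by rewrite [\tr (dd al *m a *m _)]mxtrace_mulC mulmxA.
- by rewrite big1 ?scaler0.
Qed.


Lemma tsTp_p (j : nat) u w y : vprod j%:Z (s w ## vT (p u)) (p y) =
  - ((j == 0%N)%:R * \tr (plus y *m w)) *: vT (p u).
Proof.
rewrite (vnop_fin (so w) (vpar_T (po u)) (M := 1)) => [|i i1|i i1]; last exact: sp1.
  rewrite big_ord1 /= addr0 vT_mode_l sp0 vprodZr vsgnT.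
  case: j => [|j]; first by rewrite mulr0z oppr0 scale0r vprod0r vprod_vac; lmod.
  rewrite (_ : j.+1%:Z - 1 = j%:Z) ?bpp; last lia.
  by rewrite scaler0 vprod0r [vprod _ (vT _) vac]vprod_nvac /=; [lmod | lia].
rewrite vT_mode_l (_ : j%:Z + i%:Z - 1 = (j + i.-1)%N%:Z) ?bpp ?scaler0 //; lia.
Qed.
Lemma tTsp_p (j : nat) u w y : vprod j%:Z (vT (s w) ## p u) (p y) =
  match j with 0 => \tr (plus y *m w) *: vT (p u) | 1 => \tr (plus y *m w) *: p u | _ => 0 end.
Proof.
have h i : vprod i%:Z (vT (s w)) (p y) = - (i == 1%N)%:R * \tr (plus y *m w) *: vac.
  rewrite vT_mode_l; case: i => [|i]; first by rewrite /= mulr0z; lmod.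
  rewrite (_ : i.+1%:Z - 1 = i%:Z) ?sp; last lia.
  by case: i => [|i] /=; [rewrite mulr1z; lmod | lmod].
rewrite (vnop_fin (vpar_T (so w)) (po u) (M := 2)) => [|i i2|i i2]; last first.
- by rewrite h; case: i i2 => [|[|i]] // _; rewrite oppr0 mul0r scale0r.
- by rewrite -PoszD bpp.
rewrite big_ord_recl big_ord1 lift0 /= !h vsgnT /= -PoszD !bpp.
rewrite !vprod0r !vprodZr.
case: j => [|[|j]].
- by rewrite (_ : 0%:Z - 1 - 1%:Z = -2) // /vT; lmod.
- by rewrite (_ : 1%:Z - 1 - 1%:Z = -1) // vprod_vac; lmod.
- by rewrite [vprod (_ - 1%:Z) _ _]vprod_nvac; [lmod | lia].
Qed.
Lemma tsTp_s (j : nat) u w b : vprod j%:Z (s w ## vT (p u)) (s b) =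
  match j with 0 => - \tr (plus u *m b) *: vT (s w) | 1 => - \tr (plus u *m b) *: s w | _ => 0 end.
Proof.
have h i : vprod i%:Z (vT (p u)) (s b) = if i is 1 then - \tr (plus u *m b) *: vac else 0.
  rewrite vT_mode_l; case: i => [|i]; first by rewrite /= mulr0z oppr0 scale0r.
  rewrite (_ : i.+1%:Z - 1 = i%:Z); last lia.
  by case: i => [|i] /=; [rewrite bps0 scalerA mulN1r | rewrite bps1 // scaler0].
rewrite (vnop_fin (so w) (vpar_T (po u)) (M := 2)) => [|i i2|i i2]; last exact: bss.
  rewrite big_ord_recl big_ord1 lift0 /= -!PoszD !h (bss _ _ _ 0) (bss _ _ _ 1) !vprod0r.
  rewrite !scaler0 !addr0 (_ : -1 - 1%:Z = -2) //.
  case: j => [|[|j]]; rewrite ?addn0 ?addn1 /= ?vprod0r ?add0r ?addr0 ?vprodZr ?vprod_vac //.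
by rewrite -PoszD h; case: (j + i)%N (leq_trans i2 (leq_addl j i)) => [|[|l]].
Qed.
Lemma vT0m (x c : V) : vprod 0 (vT x) c = 0.
Proof. by rewrite vT_mode_l mulr0z oppr0 scale0r. Qed.
Lemma tTsp_s (j : nat) u w b : vprod j%:Z (vT (s w) ## p u) (s b) =
  ((j == 0%N)%:R * \tr (plus u *m b)) *: vT (s w).
Proof.
rewrite (vnop_fin (vpar_T (so w)) (po u) (M := 1)) => [|i i1|i i1].
- rewrite big_ord1 /= addr0 vT0m vprod0r scaler0 addr0.
  by case: j => [|j] /=; [rewrite bps0 vprodZr vprod_vac; lmod | rewrite bps1 // vprod0r; lmod].
- by rewrite -PoszD bps1 // ltn_addl.
- by rewrite vT_mode_l (_ : i%:Z - 1 = i.-1%:Z) ?bss ?scaler0 //; lia.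
Qed.
Lemma tsTp_K (j : nat) u w a : vprod j%:Z (s w ## vT (p u)) (K a) = 0.
Proof.
rewrite (vnop_fin (so w) (vpar_T (po u)) (M := 0)) ?big_ord0 // => i _; last exact: sK.
rewrite vT_mode_l; case: (j + i)%N (PoszD j i) => [|l] <-; first by rewrite mulr0z oppr0 scale0r.
by rewrite (_ : l.+1%:Z - 1 = l%:Z) ?pK ?scaler0 //; lia.
Qed.
Lemma tTsp_K (j : nat) u w a : vprod j%:Z (vT (s w) ## p u) (K a) = 0.
Proof.
rewrite (vnop_fin (vpar_T (so w)) (po u) (M := 0)) ?big_ord0 // => i _; first by rewrite -PoszD; apply: pK.
rewrite vT_mode_l; case: i => [|l]; first by rewrite mulr0z oppr0 scale0r.
by rewrite (_ : l.+1%:Z - 1 = l%:Z) ?sK ?scaler0 //; lia.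
Qed.
Lemma wS_p (j : nat) y : vprod j%:Z wS (p y) = 0.
Proof.
rewrite /wS vprodZl vprod_suml big1 ?scaler0 // => al _.
rewrite (vnop_fin (Ke _) (Ke _) (M := 0)) ?big_ord0 // => i _; last exact: bKp.
by rewrite -PoszD; apply: bKp.
Qed.
Lemma wS_s (j : nat) y : vprod j%:Z wS (s y) = 0.
Proof.
rewrite /wS vprodZl vprod_suml big1 ?scaler0 // => al _.
rewrite (vnop_fin (Ke _) (Ke _) (M := 0)) ?big_ord0 // => i _; last exact: bKs.
by rewrite -PoszD; apply: bKs.
Qed.

Lemma omE (j : nat) v : vprod j%:Z om v = vprod j%:Z wS v - j%:R *: vprod (j%:Z - 1) (K levm) v +
  \sum_(al | pos al) (- (mdeg al *: vprod j%:Z (s (dd al) ## vT (p (ud al))) v)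
   + (1 - mdeg al) *: vprod j%:Z (vT (s (dd al)) ## p (ud al)) v).
Proof.
rewrite /om !vprodDl /wT vT_mode_l scaleNr /wC vprod_suml; congr (_ - _ *: _ + _).
by apply: eq_bigr => al _; rewrite vprodDl vprodNl !vprodZl.
Qed.

(** The pole of order three is the anomaly caused by the term T K(levm); it
vanishes unless a has degree 0. *)
Lemma om_K j a : vprod j%:Z om (K a) = match j with
  | 0 => vT (K a) | 1 => K a - K (lie levm a) | 2 => - (2 * kap k levm a) *: vac | _ => 0 end.
Proof.
rewrite omE wS_K big1 => [|al _]; last by rewrite tsTp_K tTsp_K; lmod.
case: j => [|[|[|j]]].
- by rewrite scale0r subr0 addr0.
- by rewrite subrr bKK0 scale1r addr0.
- by rewrite (_ : 2%:Z - 1 = 1) // bKK1 /kap; lmod.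
- by rewrite (_ : j.+3%:Z - 1 = j.+2%:Z) // bKK2 //; lmod.
Qed.

Lemma om_p j y : vprod j%:Z om (p y) = match j with
  | 0 => vT (p y) | 1 => p y - p (lie levm y) | _ => 0 end.
Proof.
rewrite omE wS_p.
have -> : j%:R *: vprod (j%:Z - 1) (K levm) (p y) = 0.
  case: j => [|j]; first by rewrite scale0r.
  by rewrite (_ : j.+1%:Z - 1 = j%:Z) ?bKp ?scaler0 //; lia.
rewrite subr0 add0r; under eq_bigr => al _ do rewrite tsTp_p tTsp_p.
case: j => [|[|j]]; last by rewrite big1 // => al _; lmod.
- rewrite -[p y]p_linE /vT vprod_suml; apply: eq_bigr => al h.
  by rewrite tr_plus (minus_dd F h) vprodZl -/(vT _); lmod.
- rewrite -{1}[p y]p_linE -(p_linE C (lie levm y)) -sumrB; apply: eq_bigr => al h.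
  rewrite tr_plus (minus_dd F h) [\tr (lie _ _ *m _)]mxtrace_mulC tr_dd lie_levmE.
  by rewrite mxtrace_mulC tr_dd /mdeg /=; lmod.
Qed.

Lemma om_s j b : vprod j%:Z om (s b) = match j with
  | 0 => vT (s b) | 1 => - s (lie levm b) | _ => 0 end.
Proof.
rewrite omE wS_s.
have -> : j%:R *: vprod (j%:Z - 1) (K levm) (s b) = 0.
  case: j => [|j]; first by rewrite scale0r.
  by rewrite (_ : j.+1%:Z - 1 = j%:Z) ?bKs ?scaler0 //; lia.
rewrite subr0 add0r; under eq_bigr => al _ do rewrite tsTp_s tTsp_s.
case: j => [|[|j]]; last by rewrite big1 // => al _; lmod.
- rewrite -[s b]s_linE /vT vprod_suml; apply: eq_bigr => al h.
  by rewrite (plus_ud F h) vprodZl -/(vT _); lmod.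
- rewrite -(s_linE C (lie levm b)) -sumrN; apply: eq_bigr => al h.
  by rewrite (plus_ud F h) !tr_ud lie_levmE /mdeg; lmod.
Qed.

Definition prim (D : F) v := [/\ vprod 0 om v = vT v, vprod 1 om v = D *: v &
  forall j : nat, (2 <= j)%N -> vprod j%:Z om v = 0].

(** The factors do not contract with each other, so the conformal vector acts
on the two factors separately and no anomalous term arises. *)
Lemma prim_nop D D' q q' (a b : V) : vpar q a -> vpar q' b -> prim D a -> prim D' b ->
  (forall j : nat, vprod j%:Z a b = 0) -> prim (D + D') (a ## b).
Proof.
move=> ha hb [a0 a1 a2] [b0 b1 b2] ab.
have h (j : nat) : vprod j%:Z om (a ## b) = a ## vprod j%:Z om b +
    (vprod (j%:Z - 1) (vT a) b + (j%:R * D) *: vprod (j%:Z - 2) a b).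
  rewrite (vcomm om_even ha) vsgnFl scale1r; congr (_ + _).
  rewrite big_ord_recl bin0 scale1r a0 subr0; congr (_ + _).
  case: j => [|j]; first by rewrite big_ord0 mul0r scale0r.
  rewrite big_ord_recl big1 => [|i _]; last first.
    by rewrite a2 ?vprod0l ?scaler0 // !lift0.
  rewrite lift0 /= bin1 a1 vprodZl addr0 scalerA; congr (_ *: vprod _ _ _); lia.
split.
- by rewrite (h 0) b0 sub0r mul0r scale0r addr0 vT_prod addrC.
- rewrite (h 1%N) b1 subrr vT_mode_l mulr0z oppr0 scale0r add0r mul1r.
  by rewrite (_ : 1 - 2 = -1 :> int) // vprodZr; lmod.
- move=> [|[|j]] // _; rewrite h b2 // vprod0r add0r vT_mode_l.
  rewrite (_ : j.+2%:Z - 1 - 1 = j%:Z); last lia.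
  by rewrite (_ : j.+2%:Z - 2 = j%:Z) ?ab ?scaler0 ?addr0 //; lia.
Qed.
Lemma primD D (v w : V) : prim D v -> prim D w -> prim D (v + w).
Proof.
move=> [a0 a1 a2] [b0 b1 b2]; split; rewrite ?vprodDr ?a0 ?b0 ?vTD ?a1 ?b1 ?scalerDr //.
by move=> j hj; rewrite vprodDr a2 ?b2 ?addr0.
Qed.
Lemma primZ D (x : F) v : prim D v -> prim D (x *: v).
Proof.
move=> [a0 a1 a2]; split; rewrite ?vprodZr ?a0 ?vTZ ?a1 //; first by lmod.
by move=> j hj; rewrite vprodZr a2 ?scaler0.
Qed.
Lemma prim0 D : prim D 0.
Proof. by split=> *; rewrite ?vprod0r ?vT0 ?scaler0. Qed.
Lemma prim_sum D I (r : seq I) (P : pred I) (g : I -> V) :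
  (forall i, P i -> prim D (g i)) -> prim D (\sum_(i <- r | P i) g i).
Proof. by move=> h; elim/big_ind: _ => //; [exact: prim0 | exact: primD]. Qed.

Lemma prim_p D y : lie levm y = D *: y -> prim (1 - D) (p y).
Proof.
move=> h; split=> [||[|[|j]] // _]; rewrite ?(om_p 0) ?(om_p 1) ?(om_p j.+2) //.
by rewrite h linearZ /=; lmod.
Qed.
Lemma prim_s D y : lie levm y = - D *: y -> prim D (s y).
Proof.
move=> h; split=> [||[|[|j]] // _]; rewrite ?(om_s 0) ?(om_s 1) ?(om_s j.+2) //.
by rewrite h linearZ /=; lmod.
Qed.
Lemma prim_K al : pos al -> prim (1 - mdeg al) (K (ud al)).
Proof.
move=> h; split=> [||[|[|[|j]]] // _]; rewrite ?(om_K 0) ?(om_K 1) ?(om_K 2) ?(om_K j.+3) //.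
  by rewrite lie_levm_ud linearZ /=; lmod.
have ne : (al.1 == al.2) = false by apply/eqP => e; move: h; rewrite /pos e ltnn.
rewrite /kap (tr_ud0 F h) mulr0 mul0r subr0 mxtrace_mulC tr_ud /levm mxE.
by rewrite eq_sym ne mulr0n !mulr0 oppr0 scale0r.
Qed.

Hypothesis f_levm : lie levm f = - f.

Lemma tr_lie_dd al be : pos al -> pos be -> \tr (lie (ud al) (ud be) *m dd al) = 0.
Proof.
move=> ha h; rewrite mxtrace_mulC tr_dd.
have ha' := dge_lie (dge_ud F ha) (dge_plus (isplus_ud F h)).
by apply: ha'; move: ha; rewrite /pos; lia.
Qed.
Lemma tr_lie_dd' al be : pos al -> pos be -> \tr (lie (ud al) (ud be) *m dd be) = 0.
Proof. by move=> ha hb; rewrite lieC mulNmx linearN /= tr_lie_dd ?oppr0. Qed.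

(** Homogeneity of f of degree -1 makes all terms of the BRST vector primary
of weight one. *)
Lemma prim_Dv : prim 1 Dv.
Proof.
have cK al : pos al -> prim 1 (K (ud al) ## s (dd al)).
  move=> h; rewrite -[1](subrK (mdeg al)).
  apply: (prim_nop (Ke _) (so _) (prim_K h) (prim_s (lie_levm_dd al))) => j; exact: bKs.
apply: primD; last by apply: prim_s; rewrite f_levm scaleN1r.
apply: primD; first exact: prim_sum.
rewrite -scaleNr; apply: primZ; apply: prim_sum => al ha; apply: prim_sum => be hb.
have e : 1 = 1 - (mdeg al + mdeg be) + (mdeg al + mdeg be) by rewrite subrK.
rewrite [X in prim X]e; apply: (prim_nop (po _) (ss_even C _ _)).
- by apply: prim_p; rewrite lie_levm_lie !lie_levm_ud lieZl linearZ /= -scalerDl.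
- apply: (prim_nop (so _) (so _)); [exact/prim_s/lie_levm_dd | exact/prim_s/lie_levm_dd | ].
  by move=> j; apply: bss.
move=> j; rewrite /ss (vcomm (po _) (so _)) vsgnT big1 => [|i _].
  rewrite addr0; case: j => [|j]; last by rewrite bps1 // vprod0r scaler0.
  rewrite bps0 (isplus_lie (isplus_ud F ha) (isplus_ud F hb)) tr_lie_dd' // scale0r.
  by rewrite vprod0r scaler0.
case: (val i) => [|l]; last by rewrite bps1 // vprod0l scaler0.
rewrite bps0 (isplus_lie (isplus_ud F ha) (isplus_ud F hb)) tr_lie_dd // scale0r.
by rewrite vprod0l scaler0.
Qed.

(** A primary vector of weight one has a residue that commutes with the
conformal vector, by skew-symmetry. *)
Lemma dv_om : dv om = 0.
Proof.
have [K0 h] := vskew om_even (Dv_odd C f) 0.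
rewrite -[dv om]/(vprod 0 Dv om) (h K0.+2) ?leqW // !big_ord_recl big1 => [|i _]; last first.
  by case: prim_Dv => _ _ h2; rewrite add0r h2 ?vprod0l ?scaler0 // !lift0.
case: prim_Dv => d0 d1 _; rewrite lift0 /= !add0r d0 d1 vprod_vac addr0.
by rewrite scale1r (_ : -1 - 1%:Z = -2) // -/(vT Dv) expr0 expr1 scaleN1r scale1r subrr scaler0.
Qed.

Definition Qv : V := \sum_(al | pos al) s (dd al) ## p (ud al).
Definition qv v := vprod 0 Qv v.
Lemma Qv_even : vpar false Qv.
Proof. by apply: vpar_bigsum => al _; exact: (vprod_par (-1) (so _) (po _)). Qed.
Lemma qv_K a : qv (K a) = 0.
Proof.
rewrite /qv /Qv vprod_suml big1 // => al _.
rewrite (vnop_fin (so _) (po _) (M := 0)) ?big_ord0 // => i _; last exact: sK.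
by rewrite add0r; apply: pK.
Qed.
Lemma qv_p y : qv (p y) = - p y.
Proof.
rewrite /qv /Qv vprod_suml -{2}[p y]p_linE -sumrN; apply: eq_bigr => al h.
rewrite (vnop_fin (so _) (po _) (M := 1)) => [|i _|i i1]; last exact: sp1.
  rewrite big_ord1 /= !addr0 (bpp _ _ _ 0) vprod0r sp0 vprodZr vsgnT tr_plus minus_dd //.
  by rewrite vprod_vac; lmod.
by rewrite add0r; apply: bpp.
Qed.
Lemma qv_s b : qv (s b) = s b.
Proof.
rewrite /qv /Qv vprod_suml -{2}[s b]s_linE; apply: eq_bigr => al h.
rewrite (vnop_fin (so _) (po _) (M := 1)) => [|i i1|i _]; last exact: bss.
  rewrite big_ord1 /= !addr0 bps0 (bss _ _ _ 0) vprod0r scaler0 addr0 vprodZr plus_ud //.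
  by rewrite ?subr0 vprod_vac.
by rewrite add0r bps1.
Qed.
Lemma qv_prod m (a b : V) : qv (vprod m a b) = vprod m (qv a) b + vprod m a (qv b).
Proof.
rewrite /qv; have [a0 [a1 [h0 h1 ->]]] := vpar_sum a.
by rewrite ?(vprodDl, vprodDr) (vcomm0 Qv_even h0) (vcomm0 Qv_even h1) !vsgnFl; lmod.
Qed.
Lemma qvD (u v : V) : qv (u + v) = qv u + qv v. Proof. exact: vprodDr. Qed.
Lemma qvZ (c : F) v : qv (c *: v) = c *: qv v. Proof. exact: vprodZr. Qed.
Lemma qv_vac : qv vac = 0. Proof. exact: (vprod_vac_ge0 0). Qed.
Lemma qv_T v : qv (vT v) = vT (qv v).
Proof. by rewrite /vT qv_prod qv_vac vprod0r addr0. Qed.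
Lemma qv_sum I (r : seq I) (P : pred I) (g : I -> V) :
  qv (\sum_(i <- r | P i) g i) = \sum_(i <- r | P i) qv (g i).
Proof. exact: vprod_sumr. Qed.
Lemma qv_om : qv om = 0.
Proof.
rewrite /om !qvD /wS /wT /wC qvZ qv_T qv_K vT0 !qv_sum !big1 ?scaler0 ?addr0 //.
  move=> al _; rewrite qvD -scaleNr !qvZ !qv_prod !qv_vac !qv_p !qv_s !vprod0r !addr0 /vT.
  by rewrite !vprodNl !vprodNr ?vprodNl; lmod.
by move=> al _; rewrite qv_prod !qv_K vprod0l vprod0r addr0.
Qed.
Lemma qv_Dv : qv Dv = Dv.
Proof.
rewrite /Dv !qvD -scaleNr qvZ qv_s !qv_sum; congr (_ + _ *: _ + _).
  by apply: eq_bigr => al _; rewrite qv_prod qv_K vprod0l add0r qv_s.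
apply: eq_bigr => al _; rewrite qv_sum; apply: eq_bigr => be _.
by rewrite qv_prod qv_p /ss qv_prod !qv_s vprodNl vprodDr; lmod.
Qed.
(** The BRST vector has charge one, so the differential raises the charge by
one. *)
Lemma qv_dv v : qv (dv v) = dv (qv v) + dv v.
Proof. by rewrite -[dv v]/(vprod 0 Dv v) qv_prod qv_Dv addrC. Qed.
Lemma qv_hJ a : qv (hJ a) = 0.
Proof.
rewrite /hJ qvD qv_K add0r qv_sum big1 // => al _.
by rewrite qv_prod qv_p qv_s vprodNl addNr.
Qed.
End Conformal.
End ConformalVector.
Import ConformalVector.

(** * A contracting homotopy of the leading part of the differential *)
Module Homotopy.
Section LinExt.
Variables (F : numFieldType) (V : vertexSuperAlgType F) (r : nat).
Variables (pg : 'I_r -> bool) (g : 'I_r -> V) (hfree : freely_generated pg g).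
Local Notation word := (seq ('I_r * nat)).
Local Notation mono := (gen_monomial g).
Local Notation srt := (sorted (gen_le pg)).

Definition lsum (Phi : word -> V) (l : seq (word * F)) : V := \sum_(x <- l) x.2 *: Phi x.1.

Lemma lsum_undup Phi l : lsum Phi l =
  \sum_(w <- undup (map fst l)) (\sum_(x <- l | x.1 == w) x.2) *: Phi w.
Proof.
under [RHS]eq_bigr => w _ do rewrite scaler_suml.
rewrite (exchange_big_dep xpredT) //= /lsum big_seq [RHS]big_seq; apply: eq_bigr => x xl.
have xU : x.1 \in undup (map fst l) by rewrite mem_undup map_f.
rewrite big_mkcond (bigD1_seq x.1) ?undup_uniq //= eqxx big1 ?addr0 //.
by move=> w; rewrite eq_sym => /negbTE ->.
Qed.

(** A relation between sorted monomials has zero coefficients after collecting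
equal words, so it remains true for any values in place of the monomials. *)
Lemma lsum_eq0 Phi l : all (fun x => srt x.1) l -> lsum mono l = 0 -> lsum Phi l = 0.
Proof.
move=> hs; rewrite !lsum_undup => h0; rewrite big_seq big1 // => w wU.
have [_ _ /(_ _ _ (undup_uniq _) _ h0 _ wU) ->] := hfree; first by rewrite scale0r.
by apply/allP => u; rewrite mem_undup => /mapP[x xl ->]; apply: (allP hs).
Qed.

Lemma lsum_rep v : exists l, all (fun x => srt x.1) l /\ v = lsum mono l.
Proof.
have [_ /(_ v) [s [c [hs ->]]] _] := hfree.
exists [seq (w, c w) | w <- s]; split; last by rewrite /lsum big_map.
by rewrite all_map; apply: sub_all hs.
Qed.

(** Freeness gives the basis only as a spanning family with unique
coefficients; the linear map with prescribed values on it is built by choosing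
a representation of every vector. *)
Lemma lin_ext (Phi : word -> V) : exists L : V -> V,
  (forall c u v, L (c *: u + v) = c *: L u + L v) /\
  (forall w, srt w -> L (mono w) = Phi w).
Proof.
pose l v := sval (cid (lsum_rep v)).
have lP v : all (fun x => srt x.1) (l v) /\ v = lsum mono (l v) by rewrite /l; case: cid.
exists (fun v => lsum Phi (l v)); split.
  move=> c u v.
  pose t := [seq (x.1, - x.2) | x <- l (c *: u + v)] ++ [seq (x.1, c * x.2) | x <- l u] ++ l v.
  have tE Ps : lsum Ps t = - lsum Ps (l (c *: u + v)) + (c *: lsum Ps (l u) + lsum Ps (l v)).
    rewrite /lsum !big_cat !big_map /= -sumrN scaler_sumr; congr (_ + (_ + _)).
      by apply: eq_bigr => x _; rewrite scaleNr.
    by apply: eq_bigr => x _; rewrite scalerA.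
  have : lsum Phi t = 0.
    apply: lsum_eq0; last by rewrite tE -!(lP _).2 addNr.
    rewrite !all_cat !all_map (lP _).1 andbT.
    by apply/andP; split; [apply: sub_all (lP (c *: u + v)).1 | apply: sub_all (lP u).1].
  by rewrite tE addrC => /eqP; rewrite subr_eq0 => /eqP <-.
move=> w hw; apply/eqP; rewrite -subr_eq0; apply/eqP.
have := lsum_eq0 Phi (l := (w, -1) :: l (mono w)).
rewrite /= hw (lP _).1 => /(_ isT).
rewrite /lsum !big_cons /= -!/(lsum _ _) -(lP _).2 scaleN1r addNr => /(_ erefl).
by rewrite scaleN1r addrC.
Qed.
End LinExt.

Section Filtration.
Variables (F : numFieldType) (V : vertexSuperAlgType F) (n : nat).
Variables (lev : 'I_n -> nat) (k : F) (C : brst_ops V lev k).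
Local Notation M := 'M[F]_n.
Local Notation K := (bK C).
Local Notation p := (bp C).
Local Notation s := (bs C).

(** The filtration by the number of letters K and p: a word with q such
letters lies in [fil q.+1]. The letters s are free of cost, which makes the
differential preserve the filtration. *)
Inductive fil : nat -> V -> Prop :=
| fil_0 q : fil q 0
| fil_lin q (c : F) u v of fil q u & fil q v : fil q (c *: u + v)
| fil_vac q : fil q.+1 vac
| fil_K q a (m : nat) v of fil q v : fil q.+1 (vprod (-1 - m%:Z) (K a) v)
| fil_p q a (m : nat) v of fil q v : fil q.+1 (vprod (-1 - m%:Z) (p a) v)
| fil_s q a (m : nat) v of fil q v : fil q (vprod (-1 - m%:Z) (s a) v).

Lemma filZ q c v : fil q v -> fil q (c *: v).
Proof. by move=> h; rewrite -[_ *: _]addr0; apply: fil_lin h (fil_0 q). Qed.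
Lemma filD q u v : fil q u -> fil q v -> fil q (u + v).
Proof. by move=> hu hv; rewrite -[u]scale1r; apply: fil_lin. Qed.
Lemma filN q v : fil q v -> fil q (- v).
Proof. by rewrite -scaleN1r; apply: filZ. Qed.
Lemma filB q u v : fil q u -> fil q v -> fil q (u - v).
Proof. by move=> hu hv; apply/filD/filN. Qed.
Lemma fil_sum q I (r : seq I) (P : pred I) (h : I -> V) :
  (forall i, P i -> fil q (h i)) -> fil q (\sum_(i <- r | P i) h i).
Proof. by move=> hh; elim/big_ind: _ => //; [exact: fil_0 | exact: filD]. Qed.
Lemma filS q v : fil q v -> fil q.+1 v.
Proof. elim=> *; by [exact: fil_0|exact: fil_lin|exact: fil_vac|exact: fil_K|exact: fil_p|exact: fil_s]. Qed.
Lemma fil_le q q' v : (q <= q')%N -> fil q v -> fil q' v.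
Proof. by move=> le h; rewrite -(subnK le); elim: (q' - q)%N => // m; apply: filS. Qed.
Lemma fil0_eq0 v : fil 0 v -> v = 0.
Proof.
suff: forall q v, fil q v -> q = 0%N -> v = 0 by move=> h /h; apply.
move=> q {}v; elim=> {q v} // [q c u v _ IHu _ IHv e|q a m v _ IH e].
  by rewrite IHu // IHv // scaler0 addr0.
by rewrite IH // vprod0r.
Qed.

Lemma negz_case (i : int) : (exists m : nat, i = -1 - m%:Z) \/ (exists m : nat, i = m%:Z).
Proof. by case: i => m; [right; exists m | left; exists m; lia]. Qed.

Lemma fil_Kn q v : fil q v -> forall a (m : nat), fil q (vprod m%:Z (K a) v).
Proof.
elim=> {q v} [q|q c u v _ IHu _ IHv|q|q b l v hv IH|q b l v hv IH|q b l v hv IH] a m.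
- by rewrite vprod0r; exact: fil_0.
- by rewrite vprod_linearr; apply: fil_lin.
- by rewrite vprod_vac_ge0; exact: fil_0.
- rewrite cKK; apply: filD; last exact/filZ/filS.
  apply: filD; first exact: fil_K.
  have [[j ->]|[j ->]] := negz_case (m%:Z + (-1 - l%:Z)); first exact: fil_K.
  exact/filS/IH.
- by rewrite cKp; apply: fil_p.
- by rewrite cKs; apply: fil_s.
Qed.
Lemma fil_pn q v : fil q v -> forall a (m : nat), fil q (vprod m%:Z (p a) v).
Proof.
elim=> {q v} [q|q c u v _ IHu _ IHv|q|q b l v hv IH|q b l v hv IH|q b l v hv IH] a m.
- by rewrite vprod0r; exact: fil_0.
- by rewrite vprod_linearr; apply: fil_lin.
- by rewrite vprod_vac_ge0; exact: fil_0.
- by rewrite -cKp; apply: fil_K.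
- by rewrite cpp; apply/filN/fil_p.
- rewrite cps; apply: filD; first exact/filN/fil_s.
  exact: filZ.
Qed.
(** A nonnegative mode of s contracts with one letter p, so it lowers the
filtration. *)
Lemma fil_sn q v : fil q v -> forall a (m : nat), fil q.-1 (vprod m%:Z (s a) v).
Proof.
elim=> {q v} [q|q c u v _ IHu _ IHv|q|q b l v hv IH|q b l v hv IH|q b l v hv IH] a m.
- by rewrite vprod0r; exact: fil_0.
- by rewrite vprod_linearr; apply: fil_lin.
- by rewrite vprod_vac_ge0; exact: fil_0.
- rewrite -cKs /=; case: q hv IH => [|q] hv IH; last exact: fil_K.
  by rewrite (fil0_eq0 hv) !vprod0r; exact: fil_0.
- rewrite csp /=; case: q hv IH => [|q] hv IH.
    by rewrite (fil0_eq0 hv) !vprod0r scaler0 addr0 oppr0; exact: fil_0.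
  by apply: filD; [exact/filN/fil_p | exact: filZ].
- by rewrite css; apply/filN/fil_s.
Qed.
Lemma fil_Ki q v a i : fil q v -> fil q.+1 (vprod i (K a) v).
Proof.
move=> h; have [[m ->]|[m ->]] := negz_case i; first exact: fil_K.
exact/filS/fil_Kn.
Qed.
Lemma fil_pi q v a i : fil q v -> fil q.+1 (vprod i (p a) v).
Proof.
move=> h; have [[m ->]|[m ->]] := negz_case i; first exact: fil_p.
exact/filS/fil_pn.
Qed.
Lemma fil_si q v a i : fil q v -> fil q (vprod i (s a) v).
Proof.
move=> h; have [[m ->]|[m ->]] := negz_case i; first exact: fil_s.
by apply: (fil_le (leq_pred q)); apply: fil_sn.
Qed.

Inductive letter := LK of M | LP of M | LS of M.
Definition lev_ x := match x with LK a => K a | LP a => p a | LS a => s a end.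
Definition ldeg x := match x with LK _ | LP _ => 1%N | LS _ => 0%N end.
Definition lodd x := if x is LK _ then false else true.
(** The odd derivation that the homotopy realizes up to lower order: a current
becomes the ghost of the same matrix. *)
Definition lder x := if x is LK a then p a else 0.
Definition lsg x : F := if lodd x then -1 else 1.
Definition lop x (m : nat) (v : V) := vprod (-1 - m%:Z) (lev_ x) v.
Definition dop_ x (m : nat) (v : V) := vprod (-1 - m%:Z) (lder x) v.
Definition lss x y : F := if lodd x && lodd y then -1 else 1.

Lemma fil_lop x m q v : fil q v -> fil (ldeg x + q) (lop x m v).
Proof. by case: x => a h; rewrite /lop /=; [exact: fil_K|exact: fil_p|exact: fil_s]. Qed.
Lemma fil_dop x m q v : fil q v -> fil (ldeg x + q) (dop_ x m v).
Proof.
by case: x => a h; rewrite /dop_ /=; [exact: fil_p|rewrite vprod0l; exact: fil_0|rewrite vprod0l; exact: fil_0].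
Qed.
(** Reordering two letters only costs words with fewer letters K and p. *)
Lemma lop_swap x m y l q v : fil q v ->
  fil ((ldeg x + (ldeg y + q)).-1) (lop x m (lop y l v) - lss x y *: lop y l (lop x m v)).
Proof.
rewrite /lop /lss; case: x => a; case: y => b h /=; rewrite ?scale1r ?scaleN1r ?opprK.
- rewrite cKK (_ : (_ + _ == 0) = false) ?mulr0 ?scale0r ?addr0; last lia.
  rewrite addrC addKr; exact: fil_Ki.
- by rewrite cKp subrr; exact: fil_0.
- by rewrite cKs subrr; exact: fil_0.
- by rewrite cKp subrr; exact: fil_0.
- by rewrite cpp addNr; exact: fil_0.
- rewrite cps (_ : (_ + _ == -1) = false) ?mul0r ?scale0r ?addr0 ?addNr; [exact: fil_0|lia].
- by rewrite cKs subrr; exact: fil_0.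
- rewrite csp (_ : (_ + _ == -1) = false) ?mul0r ?scale0r ?addr0 ?addNr; [exact: fil_0|lia].
- by rewrite css addNr; exact: fil_0.
Qed.
Lemma lop_sqr x m v : lodd x -> lop x m (lop x m v) = 0.
Proof.
move=> hx; have : lop x m (lop x m v) = - lop x m (lop x m v).
  by case: x hx => // a _; rewrite /lop /=; [exact: cpp | exact: css].
move/eqP; rewrite -addr_eq0 -mulr2n -scaler_nat scaler_eq0 pnatr_eq0 => /eqP //.
Qed.
Lemma dop_swap x m y l v : dop_ x m (lop y l v) = lsg y * lss x y *: lop y l (dop_ x m v).
Proof.
rewrite /dop_ /lop /lsg /lss; case: x => a; rewrite /= ?vprod0l ?vprod0r ?scaler0 //.
case: y => b /=; rewrite ?mulr1 ?scale1r ?scaleN1r.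
- by rewrite cKp.
- exact: cpp.
- by rewrite cps (_ : (_ + _ == -1) = false) ?mul0r ?scale0r ?addr0 //; lia.
Qed.
Lemma lssC x y : lss x y = lss y x. Proof. by rewrite /lss andbC. Qed.
Lemma lss2 x y : lss x y * lss x y = 1. Proof. by rewrite /lss; case: ifP; rewrite ?mulrNN mulr1. Qed.

Section Homotopy.
Variables (r : nat) (pg : 'I_r -> bool) (g : 'I_r -> V) (mt : 'I_r -> letter).
Hypothesis hfree : freely_generated pg g.
Hypothesis gE : forall i, g i = lev_ (mt i).
Hypothesis pgE : forall i, pg i = lodd (mt i).
Hypothesis spK : forall a, exists c : 'I_r -> F, K a = \sum_(i | ~~ lodd (mt i)) c i *: g i /\
   p a = \sum_(i | ~~ lodd (mt i)) c i *: lder (mt i).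
Hypothesis spP : forall a, exists c : 'I_r -> F, p a = \sum_(i | lodd (mt i) && (ldeg (mt i) == 1%N)) c i *: g i.
Hypothesis spS : forall a, exists c : 'I_r -> F, s a = \sum_(i | ldeg (mt i) == 0%N) c i *: g i.
Local Notation ltr := ('I_r * nat)%type.
Local Notation mono := (gen_monomial g).
Local Notation le := (gen_le pg).
Definition wdeg (w : seq ltr) := sumn [seq ldeg (mt x.1) | x <- w].
Definition op (x : ltr) v := lop (mt x.1) x.2 v.

Lemma mono_cons x w : mono (x :: w) = op x (mono w).
Proof. by rewrite /op /lop /= gE; congr vprod; lia. Qed.
(** The value of the homotopy on a word: the signed sum over all replacements
of one letter. *)
Fixpoint Hw (w : seq ltr) : V := match w with
  | [::] => 0
  | x :: w => dop_ (mt x.1) x.2 (mono w) + lsg (mt x.1) *: op x (Hw w) end.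

Lemma fil_mono w : fil (wdeg w).+1 (mono w).
Proof. by elim: w => [|x w IH]; [exact: fil_vac | rewrite mono_cons -addnS; exact: fil_lop]. Qed.
Lemma fil_Hw w : fil (wdeg w).+1 (Hw w).
Proof.
elim: w => [|x w IH]; first exact: fil_0.
rewrite /= -addnS; apply: filD; [exact/fil_dop/fil_mono | exact/filZ/fil_lop].
Qed.

Lemma le_total x y : ~~ le x y -> x != y -> le y x.
Proof.
case: x y => i m [j l]; rewrite /gen_le /= xpair_eqE -!val_eqE /=.
case: (ltngtP (i : nat) j) => //= e; have -> : j = i by apply: val_inj.
case: (pg i); lia.
Qed.
Lemma le_refl_odd x : ~~ le x x -> lodd (mt x.1).
Proof. by rewrite /gen_le ltnn eqxx /= -pgE; case: (pg _) => //; rewrite leqnn. Qed.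

Fixpoint ins (x : ltr) w := match w with
  | [::] => [:: x] | y :: w' => if le x y then x :: w else y :: ins x w' end.
(** The sign that goes with [ins]; it is 0 if an odd letter would be repeated.
*)
Fixpoint cins (x : ltr) w : F := match w with
  | [::] => 1 | y :: w' => if le x y then 1 else
     if x == y then 0 else lss (mt x.1) (mt y.1) * cins x w' end.

Lemma ins_path z x w : cins x w != 0 -> le z x -> path le z w -> path le z (ins x w).
Proof.
elim: w z => [|y w IH] z /=; first by move=> _ ->.
case: ifP => [hxy _ zx /andP[_ pw]|hxy]; first by rewrite /= zx hxy.
case: (eqVneq x y) => [_|ne]; first by rewrite eqxx.
rewrite mulf_eq0 negb_or => /andP[_ hc] zx /andP[zy pw] /=; rewrite zy IH //.
by apply: le_total => //; rewrite hxy.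
Qed.
Lemma ins_sorted x w : cins x w != 0 -> sorted le w -> sorted le (ins x w).
Proof.
case: w => [|y w] //=; case: ifP => [hxy _ pw|hxy]; first by rewrite /= hxy.
case: (eqVneq x y) => [_|ne]; first by rewrite eqxx.
rewrite mulf_eq0 negb_or => /andP[_ hc] pw /=; apply: ins_path => //.
by apply: le_total => //; rewrite hxy.
Qed.
Lemma wdeg_ins x w : wdeg (ins x w) = wdeg (x :: w).
Proof. by elim: w => //= y w IH; case: ifP => //= _; rewrite /wdeg /= -!/(wdeg _) IH /wdeg /=; lia. Qed.

(** Sorting a letter into a word changes neither the monomial nor the value of
the homotopy modulo lower filtration. *)
Lemma insP x w : fil (wdeg (x :: w)) (op x (mono w) - cins x w *: mono (ins x w)) /\
  fil (wdeg (x :: w)) (Hw (x :: w) - cins x w *: Hw (ins x w)).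
Proof.
elim: w => [|y w [IH1 IH2]].
  rewrite [ins _ _]/= [cins _ _]/= !scale1r mono_cons !subrr; split; exact: fil_0.
rewrite [ins _ _]/=; rewrite [cins _ _]/=; case: ifP => hxy.
  by rewrite !scale1r (mono_cons x (y :: w)) !subrr; split; exact: fil_0.
case: (eqVneq x y) => [e|ne].
  have hx : lodd (mt x.1) by apply: le_refl_odd; rewrite {2}e hxy.
  have d0 v : dop_ (mt x.1) x.2 v = 0.
    by move: hx; rewrite /dop_; case: (mt x.1) => // a _; rewrite vprod0l.
  rewrite !scale0r !subr0 -e mono_cons /= !d0 !add0r /op lop_sqr //; split; first exact: fil_0.
  have -> : lop (mt x.1) x.2 (lsg (mt x.1) *: lop (mt x.1) x.2 (Hw w)) = 0.
    by rewrite /lop vprodZr -/(lop _ _ _) -/(lop _ _ _) lop_sqr ?scaler0.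
  by rewrite scaler0; exact: fil_0.
set c := cins x w; set w' := ins x w.
have dE : wdeg (x :: y :: w) = (ldeg (mt y.1) + wdeg (x :: w))%N by rewrite /wdeg /=; lia.
have sw v q : fil q.+1 v -> fil (ldeg (mt x.1) + ldeg (mt y.1) + q)
    (op x (op y v) - lss (mt x.1) (mt y.1) *: op y (op x v)).
  by move=> hv; have := lop_swap (mt x.1) x.2 (mt y.1) y.2 hv; rewrite !addnS addnA.
have dE' : wdeg (x :: y :: w) = (ldeg (mt x.1) + ldeg (mt y.1) + wdeg w)%N by rewrite /wdeg /=; lia.
set e := lss _ _.
split.
  rewrite mono_cons.
  have -> : op x (op y (mono w)) - (e * c) *: mono (y :: w') =
     (op x (op y (mono w)) - e *: op y (op x (mono w))) +
     e *: op y (op x (mono w) - c *: mono w').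
    by rewrite mono_cons /op /lop vprodBr vprodZr; lmod.
  apply: filD; first by rewrite dE'; apply/sw/fil_mono.
  by rewrite dE; apply/filZ/fil_lop.
have -> : Hw (x :: y :: w) - (e * c) *: Hw (y :: w') =
   (lsg (mt x.1) * lsg (mt y.1)) *: (op x (op y (Hw w)) - e *: op y (op x (Hw w))) +
   e *: (dop_ (mt y.1) y.2 (op x (mono w) - c *: mono w')
     + lsg (mt y.1) *: op y (Hw (x :: w) - c *: Hw w')).
  have HwE z u : Hw (z :: u) = dop_ (mt z.1) z.2 (mono u) + lsg (mt z.1) *: op z (Hw u) by [].
  rewrite !HwE mono_cons /op dop_swap -/e.
  have -> : dop_ (mt y.1) y.2 (lop (mt x.1) x.2 (mono w) - c *: mono w') =
      (lsg (mt x.1) * e) *: lop (mt x.1) x.2 (dop_ (mt y.1) y.2 (mono w))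
      - c *: dop_ (mt y.1) y.2 (mono w').
    by rewrite /e lssC -dop_swap /dop_ vprodBr vprodZr.
  have lD z i u v : lop z i (u + v) = lop z i u + lop z i v by exact: vprodDr.
  have lB z i u v : lop z i (u - v) = lop z i u - lop z i v by exact: vprodBr.
  have lZ z i (d : F) v : lop z i (d *: v) = d *: lop z i v by exact: vprodZr.
  rewrite !(lB, lD, lZ) -/c.
  have e2 : e * e = 1 by exact: lss2.
  have lN z i v : lop z i (- v) = - lop z i v by exact: vprodNr.
  rewrite !(lN, lZ); clear sw; move: e e2 => {}e e2.
  by lmod_by ltac:(first [ring | ring: e2]).
apply: filD; first by rewrite dE'; apply/filZ/sw/fil_Hw.
by rewrite dE; apply/filZ/filD; [exact/fil_dop | exact/filZ/fil_lop].
Qed.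

(** The description of [fil q] by sorted words ([fil_sw]), on which the
homotopy is known explicitly. *)
Definition sw q (v : V) := lspan (fun u => exists w, [/\ sorted le w, (wdeg w < q)%N & u = mono w]) v.
Lemma sw_le q q' v : (q <= q')%N -> sw q v -> sw q' v.
Proof.
move=> lq; elim=> [|c u u' [w [h1 h2 ->]] _ IH]; first exact: lspan0.
by apply: lspan_add IH; exists w; split => //; apply: leq_trans lq.
Qed.

Lemma sw_ops q v x :
  (forall q' u, (q' < ldeg (mt x.1) + q)%N -> fil q' u -> sw q' u) -> sw q v ->
  sw (ldeg (mt x.1) + q) (op x v).
Proof.
move=> hq; elim=> [|c u u' [w [h1 h2 ->]] _ IH].
  by rewrite /op /lop vprod0r; exact: lspan0.
rewrite /op /lop vprod_linearr -!/(lop _ _ _) -!/(op _ _); apply: lspanD => //; apply: lspanZ.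
rewrite -[op x _](subrK (cins x w *: mono (ins x w))); apply: lspanD.
  have dlt : (wdeg (x :: w) < ldeg (mt x.1) + q)%N by rewrite /wdeg /= ltn_add2l.
  by apply: (sw_le (ltnW dlt)); apply: hq => //; have [h _] := insP x w.
have [-> |c0] := eqVneq (cins x w) 0; first by rewrite scale0r; exact: lspan0.
apply/lspanZ/lspan_in; exists (ins x w); split => //; first exact: ins_sorted.
by rewrite wdeg_ins /wdeg /= -/(wdeg w) ltn_add2l.
Qed.

Lemma op_sumE (P : pred 'I_r) (c : 'I_r -> F) m v :
  vprod (-1 - m%:Z) (\sum_(i | P i) c i *: g i) v = \sum_(i | P i) c i *: op (i, m) v.
Proof.
by rewrite vprod_suml; apply: eq_bigr => i _; rewrite vprodZl /op /lop /= gE.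
Qed.

Lemma fil_sw q v : fil q v -> sw q v.
Proof.
elim/ltn_ind: q v => q IH v h; elim: h IH => {q v}.
- by move=> q _; exact: lspan0.
- by move=> q c u v _ IHu _ IHv IH; apply: lspanD; [apply/lspanZ/IHu | apply: IHv].
- by move=> q _; apply: lspan_in; exists [::].
- move=> q a m v hv _ IH; have [c [-> _]] := spK a; rewrite op_sumE.
  apply: lspan_sum => i hi; apply: lspanZ.
  have e1 : ldeg (mt i) = 1%N by case: (mt i) hi.
  rewrite -add1n -e1; apply: (@sw_ops q v (i, m)); last exact: IH.
  by move=> q' u; rewrite /= e1 add1n => lt; apply: IH.
- move=> q a m v hv _ IH; have [c ->] := spP a; rewrite op_sumE.
  apply: lspan_sum => i /andP[_ /eqP e1]; apply: lspanZ.
  rewrite -add1n -e1; apply: (@sw_ops q v (i, m)); last exact: IH.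
  by move=> q' u; rewrite /= e1 add1n => lt; apply: IH.
- move=> q a m v hv IHv IH; have [c ->] := spS a; rewrite op_sumE.
  apply: lspan_sum => i /eqP e0; apply: lspanZ.
  rewrite -[q]add0n -e0; apply: (@sw_ops q v (i, m)); last exact: IHv.
  by move=> q' u; rewrite /= e0 add0n => lt; apply: IH.
Qed.

Lemma fil_all v : exists q, fil q v.
Proof.
have [_ /(_ v) [t [c [_ ->]]] _] := hfree.
elim: t => [|w t [q IH]]; first by exists 0%N; rewrite big_nil; exact: fil_0.
exists ((wdeg w).+1 + q)%N; rewrite big_cons; apply: fil_lin.
  exact: fil_le (leq_addr _ _) (fil_mono w).
exact: fil_le (leq_addl _ _) IH.
Qed.

(** On sorted monomials the map is given by [Hw]. The derivation rule then
holds because reordering commutes with [Hw] up to lower filtration, and it is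
only valid up to that order. *)
Theorem homotopy : exists H : V -> V,
  [/\ forall c u v, H (c *: u + v) = c *: H u + H v, H vac = 0,
     forall q v, fil q v -> fil q (H v) &
     [/\ forall q v a (m : nat), fil q v -> fil q (H (vprod (-1 - m%:Z) (K a) v)
         - vprod (-1 - m%:Z) (K a) (H v) - vprod (-1 - m%:Z) (p a) v),
       forall q v a (m : nat), fil q v -> fil q (H (vprod (-1 - m%:Z) (p a) v)
         + vprod (-1 - m%:Z) (p a) (H v)) &
       forall q v a (m : nat), fil q v -> fil q.-1 (H (vprod (-1 - m%:Z) (s a) v)
         + vprod (-1 - m%:Z) (s a) (H v))]].
Proof.
have [H [Hl Hm]] := lin_ext hfree Hw.
have H0 : H 0 = 0.
  by have := Hl 1 0 0; rewrite !scale1r addr0 => /eqP; rewrite -subr_eq subrr eq_sym => /eqP.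
have HZ c v : H (c *: v) = c *: H v by rewrite -[c *: v]addr0 Hl H0 addr0.
have HD u v : H (u + v) = H u + H v by rewrite -[u]scale1r Hl !scale1r.
have Hsum (P : pred 'I_r) h : H (\sum_(i | P i) h i) = \sum_(i | P i) H (h i).
  exact: (big_morph H HD H0).
have HF q v : fil q v -> fil q (H v).
  move/fil_sw; elim=> [|c u u' [w [h1 h2 ->]] _ IH]; first by rewrite H0; exact: fil_0.
  by rewrite Hl; apply: fil_lin => //; rewrite Hm //; apply: fil_le (fil_Hw w).
have step (x : ltr) q v : fil q v -> fil (ldeg (mt x.1) + q).-1
    (H (op x v) - dop_ (mt x.1) x.2 v - lsg (mt x.1) *: op x (H v)).
  move/fil_sw; elim=> [|c u u' [w [h1 h2 ->]] _ IH].
    rewrite /op /lop /dop_ !(vprod0r, H0) scaler0 !subr0; exact: fil_0.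
  have -> : H (op x (c *: mono w + u')) - dop_ (mt x.1) x.2 (c *: mono w + u')
      - lsg (mt x.1) *: op x (H (c *: mono w + u')) =
    c *: (H (op x (mono w)) - Hw (x :: w)) +
    (H (op x u') - dop_ (mt x.1) x.2 u' - lsg (mt x.1) *: op x (H u')).
    rewrite /= Hl (Hm _ h1) /op /lop /dop_ !vprod_linearr Hl.
    by lmod.
  apply: filD => //; apply: filZ; have [i1 i2] := insP x w.
  have dle : (wdeg (x :: w) <= (ldeg (mt x.1) + q).-1)%N.
    have -> : wdeg (x :: w) = (ldeg (mt x.1) + wdeg w)%N by [].
    by move: h2; lia.
  apply: (fil_le dle).
  have -> : H (op x (mono w)) - Hw (x :: w) =
     H (op x (mono w) - cins x w *: mono (ins x w)) -
     (Hw (x :: w) - cins x w *: Hw (ins x w)).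
    rewrite HD -scaleNr HZ; have [-> |c0] := eqVneq (cins x w) 0; first by lmod.
    by rewrite (Hm _ (ins_sorted c0 h1)); lmod.
  by apply: filB => //; apply: HF.
exists H; split => //; first by rewrite -[vac]/(mono [::]) Hm.
split=> q v a m hv.
- have [c [eK ep]] := spK a; rewrite eK ep !op_sumE Hsum vprod_suml -!sumrB.
  apply: fil_sum => i hi; rewrite HZ vprodZl -!scalerBr; apply: filZ.
  have e1 : ldeg (mt i) = 1%N by case: (mt i) hi.
  have := step (i, m) q v hv; rewrite /= e1 add1n /= /lsg (negbTE hi) scale1r /dop_.
  by rewrite addrAC.
- have [c ->] := spP a; rewrite !op_sumE Hsum -big_split /=.
  apply: fil_sum => i /andP[hi /eqP e1]; rewrite HZ -scalerDr; apply: filZ.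
  have := step (i, m) q v hv; rewrite /= e1 add1n /= /lsg hi scaleN1r opprK /dop_.
  by case: (mt i) hi => // b _; rewrite vprod0l subr0.
- have [c ->] := spS a; rewrite !op_sumE Hsum -big_split /=.
  apply: fil_sum => i /eqP e0; rewrite HZ -scalerDr; apply: filZ.
  have hi : lodd (mt i) by case: (mt i) e0.
  have := step (i, m) q v hv; rewrite /= e0 add0n /= /lsg hi scaleN1r opprK /dop_.
  by case: (mt i) hi => // b _; rewrite vprod0l subr0.
Qed.
End Homotopy.
End Filtration.
End Homotopy.
Import Homotopy.

(** * Cocycles modulo coboundaries are words in the hatted currents *)
Module Acyclicity.
Section Acyclic.
Variables (F : numFieldType) (V : vertexSuperAlgType F) (n : nat).
Variables (lev : 'I_n -> nat) (k : F) (C : brst_ops V lev k).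
Variable f : 'M[F]_n.
Hypothesis f_minus : minus lev f = f.
Hypothesis f_deg : forall i j, lev i != (lev j).+1 -> f j i = 0.
Local Notation M := 'M[F]_n.
Local Notation K := (bK C).
Local Notation p := (bp C).
Local Notation s := (bs C).
Local Notation plus := (plus lev).
Local Notation nonpos := (nonpos lev).
Local Notation pos := (pos lev).
Local Notation ud := (ud F).
Local Notation dd := (dd F).
Local Notation ss := (ss C).
Local Notation dv := (dv C f).
Local Notation hJ := (hJ C).
Local Notation fil := (fil C).
Variable H : V -> V.
Hypothesis Hl : forall c u v, H (c *: u + v) = c *: H u + H v.
Hypothesis Hvac : H vac = 0.
Hypothesis HF : forall q v, fil q v -> fil q (H v).
Hypothesis HK : forall q v a (m : nat), fil q v -> fil q (H (vprod (-1 - m%:Z) (K a) v)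
         - vprod (-1 - m%:Z) (K a) (H v) - vprod (-1 - m%:Z) (p a) v).
Hypothesis Hp : forall q v a (m : nat), fil q v -> fil q (H (vprod (-1 - m%:Z) (p a) v)
         + vprod (-1 - m%:Z) (p a) (H v)).
Hypothesis Hs : forall q v a (m : nat), fil q v -> fil q.-1 (H (vprod (-1 - m%:Z) (s a) v)
         + vprod (-1 - m%:Z) (s a) (H v)).
Hypothesis fil_all : forall v, exists q, fil q v.

Lemma H0 : H 0 = 0.
Proof. by have := Hl 1 0 0; rewrite !scale1r addr0 => /eqP; rewrite -subr_eq subrr eq_sym => /eqP. Qed.
Lemma HZ c v : H (c *: v) = c *: H v. Proof. by rewrite -[c *: v]addr0 Hl H0 addr0. Qed.
Lemma HD u v : H (u + v) = H u + H v. Proof. by rewrite -[u]scale1r Hl !scale1r. Qed.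
Lemma Hsum I (r : seq I) (P : pred I) h : H (\sum_(i <- r | P i) h i) = \sum_(i <- r | P i) H (h i).
Proof. exact: (big_morph H HD H0). Qed.

(** The commutation rule of the homotopy with all modes of x, up to lower
filtration; x' is the derivative of x in the sense of the Leibniz rule
[hpair_nop]. *)
Definition hpair (dl : nat) (sg : F) (x x' : V) := forall i q v, fil q v ->
  [/\ fil (q + dl) (vprod i x v), fil (q + dl) (vprod i x' v) &
      fil (q + dl).-1 (H (vprod i x v) - sg *: vprod i x (H v) - vprod i x' v)].

Lemma hpair_K a : hpair 1 1 (K a) (p a).
Proof.
move=> i q v hv; rewrite addn1; split; [exact: fil_Ki | exact: fil_pi | ].
rewrite scale1r; have [[m ->]|[m ->]] := negz_case i; first exact: HK.
by apply: filB; [apply: filB; [exact/HF/fil_Kn | exact/fil_Kn/HF] | exact: fil_pn].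
Qed.
Lemma hpair_p a : hpair 1 (-1) (p a) 0.
Proof.
move=> i q v hv; rewrite addn1 vprod0l; split; [exact: fil_pi | exact: fil_0 | ].
rewrite scaleN1r opprK subr0; have [[m ->]|[m ->]] := negz_case i; first exact: Hp.
by apply: filD; [exact/HF/fil_pn | exact/fil_pn/HF].
Qed.
Lemma hpair_s a : hpair 0 (-1) (s a) 0.
Proof.
move=> i q v hv; rewrite addn0 vprod0l; split; [exact: fil_si | exact: fil_0 | ].
rewrite scaleN1r opprK subr0; have [[m ->]|[m ->]] := negz_case i; first exact: Hs.
by apply: filD; [exact/HF/fil_sn | exact/fil_sn/HF].
Qed.
Lemma hpair_lin dl sg c x y x' y' : hpair dl sg x x' -> hpair dl sg y y' ->
  hpair dl sg (c *: x + y) (c *: x' + y').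
Proof.
move=> hx hy i q v hv; have [h1 h2 h3] := hx i q v hv; have [g1 g2 g3] := hy i q v hv.
rewrite !vprod_linearl; split; [exact: fil_lin | exact: fil_lin | ].
have -> : H (c *: vprod i x v + vprod i y v) - sg *: (c *: vprod i x (H v) + vprod i y (H v)) -
   (c *: vprod i x' v + vprod i y' v) =
   c *: (H (vprod i x v) - sg *: vprod i x (H v) - vprod i x' v) +
   (H (vprod i y v) - sg *: vprod i y (H v) - vprod i y' v).
  by rewrite Hl; lmod.
exact: fil_lin.
Qed.
Lemma hpair_0 dl sg : hpair dl sg 0 0.
Proof. by move=> i q v _; rewrite !vprod0l H0 scaler0 !subr0; split; exact: fil_0. Qed.
Lemma hpair_Z dl sg c x x' : hpair dl sg x x' -> hpair dl sg (c *: x) (c *: x').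
Proof. by move=> h; rewrite -[c *: x]addr0 -[c *: x']addr0; apply: hpair_lin h (hpair_0 _ _). Qed.
Lemma hpair_D dl sg x y x' y' : hpair dl sg x x' -> hpair dl sg y y' ->
  hpair dl sg (x + y) (x' + y').
Proof. by move=> h h'; rewrite -[x]scale1r -[x']scale1r; apply: hpair_lin. Qed.
Lemma hpair_sum dl sg I (r : seq I) (P : pred I) (x x' : I -> V) :
  (forall i, P i -> hpair dl sg (x i) (x' i)) ->
  hpair dl sg (\sum_(i <- r | P i) x i) (\sum_(i <- r | P i) x' i).
Proof.
by move=> h; elim/big_rec2: _ => [|i y y' Pi]; [exact: hpair_0 | apply: hpair_D; exact: h].
Qed.
Lemma hpair_sum0 dl sg I (r : seq I) (P : pred I) (x : I -> V) :
  (forall i, P i -> hpair dl sg (x i) 0) -> hpair dl sg (\sum_(i <- r | P i) x i) 0.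
Proof. by move=> h; elim/big_rec: _ => [|i y Pi]; [exact: hpair_0 | rewrite -{2}[0]addr0; apply: hpair_D; exact: h]. Qed.
Lemma hpair_weak dl dl' sg x x' : (dl < dl')%N -> hpair dl sg x x' -> hpair dl' sg x 0.
Proof.
move=> lt h i q v hv; have [h1 h2 h3] := h i q v hv; rewrite vprod0l subr0.
have h4 : fil (q + dl) (H (vprod i x v) - sg *: vprod i x (H v)).
  by apply: filB; [exact: HF | apply: filZ; have [] := h i q _ (HF hv)].
split; [by apply: fil_le h1; lia | exact: fil_0 | by apply: fil_le h4; lia].
Qed.
Lemma hpair_vac : hpair 0 1 vac 0.
Proof.
move=> i q v hv; rewrite !vprod_vacl vprod0l addn0 HZ scale1r subrr subr0.
by split; [exact: filZ | exact: fil_0 | exact: fil_0].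
Qed.
Lemma hpair_T dl sg x x' : hpair dl sg x x' -> hpair dl sg (vT x) (vT x').
Proof.
move=> h i q v hv; have [h1 h2 h3] := h (i - 1) q v hv; rewrite !vT_mode_l.
split; [exact: filZ | exact: filZ | ].
have -> : forall t : F, H (t *: vprod (i - 1) x v) - sg *: (t *: vprod (i - 1) x (H v)) -
  t *: vprod (i - 1) x' v = t *: (H (vprod (i - 1) x v) - sg *: vprod (i - 1) x (H v) - vprod (i - 1) x' v).
  by move=> t; rewrite HZ; lmod.
exact: filZ.
Qed.

Definition psg (b : bool) : F := if b then -1 else 1.
Lemma psg2 b : psg b * psg b = 1. Proof. by case: b; rewrite /psg ?mulrNN mulr1. Qed.

(** The derivative of a normally ordered product is given by the Leibniz rule,
as the contractions are of lower order. *)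
Lemma hpair_nop bx by_ dx dy x x' y y' : vpar bx x -> vpar (~~ bx) x' -> vpar by_ y -> vpar (~~ by_) y' ->
  hpair dx (psg bx) x x' -> hpair dy (psg by_) y y' ->
  hpair (dx + dy) (psg bx * psg by_) (x ## y) (x' ## y + psg bx *: (x ## y')).
Proof.
move=> px px' py py' hx hy i q v.
case: q => [/fil0_eq0 ->|q hv].
  by rewrite !vprod0r H0 vprod0r scaler0 !subr0; split; exact: fil_0.
have [K1 h1] := vnop_mode px py i v; have [K2 h2] := vnop_mode px' py i v.
have [K3 h3] := vnop_mode px py' i v; have [K4 h4] := vnop_mode px py i (H v).
pose N := (K1 + K2 + K3 + K4)%N.
have fx j t u : fil t u -> fil (t + dx) (vprod j x u) by move=> hu; have [] := hx j t u hu.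
have fx' j t u : fil t u -> fil (t + dx) (vprod j x' u) by move=> hu; have [] := hx j t u hu.
have fy j t u : fil t u -> fil (t + dy) (vprod j y u) by move=> hu; have [] := hy j t u hu.
have fy' j t u : fil t u -> fil (t + dy) (vprod j y' u) by move=> hu; have [] := hy j t u hu.
have e1 : (q.+1 + (dx + dy) = q.+1 + dy + dx)%N by lia.
have e2 : (q.+1 + (dx + dy) = q.+1 + dx + dy)%N by lia.
have sE (b c : bool) : vsgn F (~~ b) c = vsgn F b c * psg c.
  by case: b c => [] []; rewrite /vsgn /psg /= ?expr0 ?expr1 ?mulr1 ?mulrNN ?mul1r ?mulr1.
have sE' (b c : bool) : vsgn F b (~~ c) = vsgn F b c * psg b.
  by case: b c => [] []; rewrite /vsgn /psg /= ?expr0 ?expr1 ?mulr1 ?mulrNN ?mul1r ?mulr1.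
split.
- rewrite (h1 N); last by rewrite /N; lia.
  apply: fil_sum => j _; apply: filD; first by rewrite e1; apply/fx/fy.
  by rewrite e2; apply/filZ/fy/fx.
- rewrite vprodDl vprodZl; apply: filD; last apply: filZ.
    rewrite (h2 N); last by rewrite /N; lia.
    apply: fil_sum => j _; apply: filD; first by rewrite e1; apply/fx'/fy.
    by rewrite e2; apply/filZ/fy/fx'.
  rewrite (h3 N); last by rewrite /N; lia.
  apply: fil_sum => j _; apply: filD; first by rewrite e1; apply/fx/fy'.
  by rewrite e2; apply/filZ/fy'/fx.
- rewrite vprodDl vprodZl (h1 N) ?(h2 N) ?(h3 N) ?(h4 N); try by rewrite /N; lia.
  rewrite Hsum !scaler_sumr -!sumrB -big_split -sumrB; apply: fil_sum => j _ /=.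
  set a := -1 - j%:Z; set b := i + j%:Z; set c := i - 1 - j%:Z; set d := j%:Z.
  rewrite sE sE' HD HZ.
  have [_ _ r1] := hx a _ _ (fy b _ _ hv); have [_ _ r2] := hy b _ _ hv.
  have [_ _ r3] := hy c _ _ (fx d _ _ hv); have [_ _ r4] := hx d _ _ hv.
  set R1 := (X in fil _ X) in r1; set R2 := (X in fil _ X) in r2.
  set R3 := (X in fil _ X) in r3; set R4 := (X in fil _ X) in r4.
  have -> : H (vprod a x (vprod b y v)) + vsgn F bx by_ *: H (vprod c y (vprod d x v)) -
    (psg bx * psg by_) *: (vprod a x (vprod b y (H v)) + vsgn F bx by_ *: vprod c y (vprod d x (H v))) -
    (vprod a x' (vprod b y v) + (vsgn F bx by_ * psg by_) *: vprod c y (vprod d x' v) +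
     psg bx *: (vprod a x (vprod b y' v) + (vsgn F bx by_ * psg bx) *: vprod c y' (vprod d x v))) =
    R1 + psg bx *: vprod a x R2 + vsgn F bx by_ *: (R3 + psg by_ *: vprod c y R4).
    rewrite /R1 /R2 /R3 /R4 !vprodBr !vprodZr; have s2 := psg2 bx.
    by lmod_by ltac:(first [ring | ring: s2]).
  apply: filD; [apply: filD | apply/filZ/filD].
  + by apply: fil_le r1; lia.
  + by apply/filZ/(fil_le _ (fx a _ _ r2)); lia.
  + by apply: fil_le r3; lia.
  + by apply/filZ/(fil_le _ (fy c _ _ r4)); lia.
Qed.

Lemma vpar0' b : vpar b (0 : V). Proof. exact: vpar0. Qed.
Lemma hpair_ps w y : hpair 1 1 (p w ## s y) 0.
Proof.
have := hpair_nop (bp_odd C w) (vpar0' _) (bs_odd C y) (vpar0' _) (hpair_p w) (hpair_s y).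
by rewrite vprod0l vprod0r scaler0 addr0 /psg mulrNN mulr1.
Qed.
Lemma hpair_ss w y : hpair 0 1 (ss w y) 0.
Proof.
have := hpair_nop (bs_odd C w) (vpar0' _) (bs_odd C y) (vpar0' _) (hpair_s w) (hpair_s y).
by rewrite vprod0l vprod0r scaler0 addr0 /psg mulrNN mulr1.
Qed.
(** The ghost bilinears in the hatted current have no derivative at leading
order. *)
Lemma hpair_J a : hpair 1 1 (hJ a) (p a).
Proof.
rewrite /hJ -[p a]addr0; apply: hpair_D; first exact: hpair_K.
by apply: hpair_sum0 => al _; apply: hpair_ps.
Qed.
Lemma hJ_even a : vpar false (hJ a).
Proof.
apply: vparD; first exact: bK_even.
by apply: vpar_bigsum => al _; apply: (vprod_par (-1) (bp_odd C _) (bs_odd C _)).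
Qed.
Lemma p_nonpos a : p (nonpos a) = 0.
Proof. by rewrite -bp_plus plus_nonpos linear0. Qed.
Lemma hpair_sJ y a : hpair 1 (-1) (s y ## hJ (nonpos a)) 0.
Proof.
have hp0 : vpar true (p (nonpos a)) by exact: bp_odd.
have := hpair_nop (bs_odd C y) (vpar0' _) (hJ_even (nonpos a)) hp0 (hpair_s y) (hpair_J _).
by rewrite vprod0l add0r p_nonpos vprod0r scaler0 /psg mulr1.
Qed.
Lemma hpair_sK y a : hpair 1 (-1) (s y ## K a) (- (s y ## p a)).
Proof.
have := hpair_nop (bs_odd C y) (vpar0' _) (bK_even C a) (bp_odd C a) (hpair_s y) (hpair_K a).
by rewrite vprod0l add0r /psg mulr1 scaleN1r.
Qed.

Lemma hpair_Z0 dl sg c x : hpair dl sg x 0 -> hpair dl sg (c *: x) 0.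
Proof. by move=> h; have := hpair_Z c h; rewrite scaler0. Qed.
Lemma hpair_D0 dl sg x y : hpair dl sg x 0 -> hpair dl sg y 0 -> hpair dl sg (x + y) 0.
Proof. by move=> h h'; have := hpair_D h h'; rewrite addr0. Qed.
Lemma hpair_T0 dl sg x : hpair dl sg x 0 -> hpair dl sg (vT x) 0.
Proof. by move=> h; have := hpair_T h; rewrite vT0. Qed.
Lemma hpair_ds b : hpair 0 1 (dv (s b)) 0.
Proof. by rewrite dv_s; apply: hpair_Z0; apply: hpair_sum0 => al _; apply: hpair_ss. Qed.
Lemma hpair_dp y : hpair 1 1 (dv (p y)) (p y).
Proof.
have h0 := hpair_Z0 (\tr (plus y *m f)) (hpair_weak (dl := 0) (dl' := 1) isT hpair_vac).
by have := hpair_D (hpair_J (plus y)) h0; rewrite addr0 bp_plus dv_p.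
Qed.
Lemma hpair_dK a : exists z, hpair 1 (-1) (dv (K a)) z.
Proof.
rewrite dv_K; eexists; apply: hpair_D; first by apply: hpair_sum => al _; apply: hpair_sK.
by apply: hpair_Z0; apply: hpair_T0; apply: (hpair_weak (dl := 0) (dl' := 1) isT (hpair_s _)).
Qed.
Lemma hpair_dJ a : hpair 1 (-1) (dv (hJ a)) 0.
Proof.
have s1 b : hpair 1 (-1) (s b) 0 by apply: (hpair_weak (dl := 0) (dl' := 1) isT (hpair_s _)).
rewrite (dv_J C f_minus); apply: hpair_D0; first apply: hpair_D0 => //.
  by apply: hpair_sum0 => al _; apply: hpair_sJ.
apply: hpair_T0; rewrite -scaleN1r; apply: hpair_D0; first exact: hpair_Z0.
by apply: hpair_Z0; apply: hpair_sum0 => be _; apply: hpair_Z0.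
Qed.

(** The differentials of K, p and s contain no more letters K and p than these
letters themselves. *)
Lemma fil_d q v : fil q v -> fil q (dv v).
Proof.
elim=> {q v} [q|q c u v _ IHu _ IHv|q|q b l v hv IH|q b l v hv IH|q b l v hv IH].
- by rewrite dv0; exact: fil_0.
- by rewrite dvD dvZ; apply: fil_lin.
- by rewrite dv_vac; exact: fil_0.
- rewrite (dv_even C f _ _ (bK_even C b)); apply: filD; last exact: fil_K.
  by have [z /(_ (-1 - l%:Z) q v hv)[]] := hpair_dK b; rewrite addn1.
- rewrite (dv_oddp C f _ _ (bp_odd C b)); apply: filB; last exact: fil_p.
  by have [] := hpair_dp b (-1 - l%:Z) hv; rewrite addn1.
- rewrite (dv_oddp C f _ _ (bs_odd C b)); apply: filB; last exact: fil_s.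
  by have [] := hpair_ds b (-1 - l%:Z) hv; rewrite addn0.
Qed.

(** The square of the differential is an even derivation that vanishes on
generators, so it vanishes on all words. *)
Lemma dd0 v : dv (dv v) = 0.
Proof.
have [q] := fil_all v; elim=> {q v} [q|q c u v _ IHu _ IHv|q|q b l v hv IH|q b l v hv IH|q b l v hv IH].
- by rewrite !dv0.
- by rewrite !(dvD, dvZ) IHu IHv scaler0 addr0.
- by rewrite dv_vac dv0.
- have o : vpar true (dv (K b)) by exact: (vprod_par 0 (Dv_odd C f) (bK_even C b)).
  rewrite (dv_even C f _ _ (bK_even C b)) dvD (dv_oddp C f _ _ o) (dv_even C f _ _ (bK_even C b)).
  by rewrite (dd_K C f) IH vprod0l vprod0r sub0r addr0 addNr.
- have o : vpar false (dv (p b)) by exact: (vprod_par 0 (Dv_odd C f) (bp_odd C b)).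
  rewrite (dv_oddp C f _ _ (bp_odd C b)) dvD dvN (dv_even C f _ _ o) (dv_oddp C f _ _ (bp_odd C b)).
  by rewrite (dd_p C f_minus f_deg) IH vprod0l vprod0r subr0 add0r subrr.
- have o : vpar false (dv (s b)) by exact: (vprod_par 0 (Dv_odd C f) (bs_odd C b)).
  rewrite (dv_oddp C f _ _ (bs_odd C b)) dvD dvN (dv_even C f _ _ o) (dv_oddp C f _ _ (bs_odd C b)).
  by rewrite (dd_s C f) IH vprod0l vprod0r subr0 add0r subrr.
Qed.

Definition EE v := dv (H v) + H (dv v).
Lemma EE_lin c u v : EE (c *: u + v) = c *: EE u + EE v.
Proof. by rewrite /EE Hl !(dvD, dvZ) Hl; lmod. Qed.
Lemma fil_EE q v : fil q v -> fil q (EE v).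
Proof. by move=> h; apply: filD; [exact/fil_d/HF | exact/HF/fil_d]. Qed.

Lemma EE_comm b dl x x' z i q v : vpar b x -> vpar (~~ b) x' ->
  hpair dl (psg b) x x' -> hpair dl (- psg b) (dv x) z -> fil q v ->
  fil (q + dl).-1 (EE (vprod i x v) - vprod i x (EE v) - vprod i (dv x' + z) v).
Proof.
move=> px px' hx hd hv.
have [_ _ r1] := hx i q v hv; have [_ _ r2] := hd i q v hv; have [_ _ r3] := hx i q _ (fil_d hv).
have eb : vsgn F true b = psg b by case: (b).
have eb' : vsgn F true (~~ b) = - psg b by case: (b); rewrite /psg /= ?opprK.
set R1 := (X in fil _ X) in r1; set R2 := (X in fil _ X) in r2; set R3 := (X in fil _ X) in r3.
have -> : EE (vprod i x v) - vprod i x (EE v) - vprod i (dv x' + z) v =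
   dv R1 + R2 + psg b *: R3.
  rewrite /R1 /R2 /R3 /EE (dv_prod C f _ _ px) eb HD HZ vprodDr vprodDl.
  rewrite !(dvD, dvN, dvZ) (dv_prod C f _ _ px) (dv_prod C f _ _ px') eb eb'; have s2 := psg2 b.
  by lmod_by ltac:(first [ring | ring: s2]).
by apply: filD; [apply: filD => //; exact: fil_d | exact: filZ].
Qed.

(** The letters p y and d (p y) form pairs that cancel in cohomology; the
second index counts them, the first is the filtration. *)
Inductive nx : nat -> nat -> V -> Prop :=
| nx_0 q e : nx q e 0
| nx_lin q e c u v : nx q e u -> nx q e v -> nx q e (c *: u + v)
| nx_vac q : nx q.+1 0 vac
| nx_J q e a (m : nat) v : nx q e v -> nx q.+1 e (vprod (-1 - m%:Z) (hJ (nonpos a)) v)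
| nx_s q e a (m : nat) v : nx q e v -> nx q e (vprod (-1 - m%:Z) (s a) v)
| nx_p q e y (m : nat) v : nx q e v -> nx q.+1 e.+1 (vprod (-1 - m%:Z) (p y) v)
| nx_d q e y (m : nat) v : nx q e v -> nx q.+1 e.+1 (vprod (-1 - m%:Z) (dv (p y)) v).

Lemma hJ_fil q v a i : fil q v -> fil q.+1 (vprod i (hJ a) v).
Proof. by move=> h; have [] := hpair_J a i h; rewrite addn1. Qed.
Lemma ds_fil q v a i : fil q v -> fil q.+1 (vprod i (dv (p a)) v).
Proof. by move=> h; have [] := hpair_dp a i h; rewrite addn1. Qed.
Lemma nx_fil q e v : nx q e v -> fil q v.
Proof.
elim=> {q e v}; [move=> q e|move=> q e c u v _ h1 _ h2|move=> q|move=> q e a m v _ h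
  |move=> q e a m v _ h|move=> q e a m v _ h|move=> q e a m v _ h].
- exact: fil_0.
- exact: fil_lin.
- exact: fil_vac.
- exact: hJ_fil.
- exact: fil_s.
- exact: fil_p.
- exact: ds_fil.
Qed.

Lemma EE0 : EE 0 = 0. Proof. by rewrite /EE dv0 H0 dv0 addr0. Qed.
(** The homotopy exchanges d (p y), whose leading term is K y, with p y, and
kills the other letters; so d H + H d is a derivation that multiplies each of
the two by one. *)
Lemma EE_nx q e v : nx q e v -> fil q.-1 (EE v - e%:R *: v).
Proof.
have hpn a : p (nonpos a) = 0 by exact: p_nonpos.
elim=> {q e v}; [move=> q e|move=> q e c u v _ h1 _ h2|move=> q|move=> q e a m v hv h
  |move=> q e a m v hv h|move=> q e a m v hv h|move=> q e a m v hv h].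
- by rewrite EE0 scaler0 subr0; exact: fil_0.
- have -> : EE (c *: u + v) - e%:R *: (c *: u + v) = c *: (EE u - e%:R *: u) + (EE v - e%:R *: v).
    by rewrite EE_lin; lmod.
  exact: fil_lin.
- by rewrite /EE Hvac dv0 dv_vac H0 scale0r subr0 addr0; exact: fil_0.
- have hx : hpair 1 (psg false) (hJ (nonpos a)) (p (nonpos a)) by exact: hpair_J.
  have r := EE_comm (-1 - m%:Z) (hJ_even _) (bp_odd C _) hx (hpair_dJ _) (nx_fil hv).
  rewrite hpn dv0 addr0 vprod0l subr0 addn1 in r.
  set x := hJ _ in r *; set i := -1 - _ in r *.
  rewrite (_ : _ - _ = (EE (vprod i x v) - vprod i x (EE v)) + vprod i x (EE v - e%:R *: v)); last first.
    by rewrite vprodBr vprodZr; lmod.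
  apply: filD => //; case: (q) h => [|q'] h; last exact: hJ_fil.
  by rewrite (fil0_eq0 h) vprod0r; exact: fil_0.
- have ds0 : hpair 0 (- psg true) (dv (s a)) 0 by rewrite opprK; exact: hpair_ds.
  have r := EE_comm (-1 - m%:Z) (bs_odd C a) (vpar0' _) (hpair_s a) ds0 (nx_fil hv).
  rewrite dv0 addr0 vprod0l subr0 addn0 in r.
  set i := -1 - _ in r *.
  rewrite (_ : _ - _ = (EE (vprod i (s a) v) - vprod i (s a) (EE v)) + vprod i (s a) (EE v - e%:R *: v)); last first.
    by rewrite vprodBr vprodZr; lmod.
  by apply: filD => //; exact: fil_s.
- have dp0 : hpair 1 (- psg true) (dv (p a)) (p a) by rewrite opprK; exact: hpair_dp.
  have r := EE_comm (-1 - m%:Z) (bp_odd C a) (vpar0' _) (hpair_p a) dp0 (nx_fil hv).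
  rewrite dv0 add0r addn1 in r.
  set i := -1 - _ in r *.
  rewrite (_ : _ - _ = (EE (vprod i (p a) v) - vprod i (p a) (EE v) - vprod i (p a) v) + vprod i (p a) (EE v - e%:R *: v)); last first.
    by rewrite -natr1 scalerDl scale1r vprodBr vprodZr; lmod.
  apply: filD => //; case: (q) h => [|q'] h; last exact: fil_p.
  by rewrite (fil0_eq0 h) vprod0r; exact: fil_0.
- have dd2 : hpair 1 (- psg false) (dv (dv (p a))) 0 by rewrite dd0; exact: hpair_0.
  have pd : vpar false (dv (p a)) by exact: (vprod_par 0 (Dv_odd C f) (bp_odd C a)).
  have r := EE_comm (-1 - m%:Z) pd (bp_odd C a) (hpair_dp a) dd2 (nx_fil hv).
  rewrite addr0 addn1 in r.
  set i := -1 - _ in r *; set x := dv (p a) in r *.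
  rewrite (_ : _ - _ = (EE (vprod i x v) - vprod i x (EE v) - vprod i x v) + vprod i x (EE v - e%:R *: v)); last first.
    by rewrite -natr1 scalerDl scale1r vprodBr vprodZr; lmod.
  apply: filD => //; case: (q) h => [|q'] h; last exact: ds_fil.
  by rewrite (fil0_eq0 h) vprod0r; exact: fil_0.
Qed.

Definition nxs q m v := exists u : nat -> V, (forall e, nx q e (u e)) /\
  fil q.-1 (v - \sum_(e < m.+1) u e).
Lemma nxs_0 q m : nxs q m 0.
Proof. by exists (fun=> 0); split=> [e|]; [exact: nx_0 | rewrite big1 ?subrr //; exact: fil_0]. Qed.
Lemma nxs_lin q m c v w : nxs q m v -> nxs q m w -> nxs q m (c *: v + w).
Proof.
move=> [u [h1 h2]] [u' [g1 g2]]; exists (fun e => c *: u e + u' e); split.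
  by move=> e; apply: nx_lin.
rewrite big_split /= -scaler_sumr (_ : _ - _ = c *: (v - \sum_(i < m.+1) u i) + (w - \sum_(i < m.+1) u' i)).
  exact: fil_lin.
by lmod.
Qed.
Lemma nxs_fil q m v : fil q.-1 v -> nxs q m v.
Proof. by move=> h; exists (fun=> 0); split=> [e|]; [exact: nx_0 | rewrite big1 ?subr0]. Qed.
Lemma nxs_nx q e m v : (e <= m)%N -> nx q e v -> nxs q m v.
Proof.
move=> em h; exists (fun e' => if e' == e then v else 0); split.
  by move=> e'; case: eqP => [->|_] //; exact: nx_0.
rewrite (bigD1 (Ordinal (em : (e < m.+1)%N))) //= eqxx big1 ?addr0 ?subrr; first exact: fil_0.
by move=> i; rewrite -val_eqE /= => /negbTE ->.
Qed.
Lemma nxs_D q m v w : nxs q m v -> nxs q m w -> nxs q m (v + w).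
Proof. by move=> h h'; rewrite -[v]scale1r; apply: nxs_lin. Qed.
Lemma nxs_Z q m c v : nxs q m v -> nxs q m (c *: v).
Proof. by move=> h; rewrite -[c *: v]addr0; apply/nxs_lin/nxs_0. Qed.
Lemma nxs_N q m v : nxs q m v -> nxs q m (- v).
Proof. by rewrite -scaleN1r; exact: nxs_Z. Qed.
Lemma nxs_sum q m I (r : seq I) (P : pred I) (h : I -> V) :
  (forall i, P i -> nxs q m (h i)) -> nxs q m (\sum_(i <- r | P i) h i).
Proof. by move=> hh; elim/big_rec: _ => [|i y Pi]; [exact: nxs_0 | apply/nxs_D/hh]. Qed.
Lemma nxs_up q m m' v : (m <= m')%N -> nxs q m v -> nxs q m' v.
Proof.
move=> le [u [h1 h2]]; rewrite -(subrK (\sum_(e < m.+1) u e) v); apply: nxs_D; first exact: nxs_fil.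
by apply: nxs_sum => e _; apply: nxs_nx (h1 e); have := ltn_ord e; lia.
Qed.

Lemma nxs_op (dl dm : nat) x q m v i : (forall q v, fil q v -> fil (q + dl) (vprod i x v)) ->
  (forall q e v, nx q e v -> nxs (q + dl) (e + dm) (vprod i x v)) -> nxs q m v ->
  nxs (q + dl) (m + dm) (vprod i x v).
Proof.
move=> hf hx [u [h1 h2]]; rewrite -(subrK (\sum_(e < m.+1) u e) v) vprodDr; apply: nxs_D.
  case: q h1 h2 hx => [|q] h1 h2 hx; last by apply/nxs_fil/(fil_le _ (hf _ _ h2)); rewrite addSn.
  by rewrite (fil0_eq0 h2) vprod0r; exact: nxs_0.
rewrite vprod_sumr; apply: nxs_sum => e _; apply: nxs_up (hx _ _ _ (h1 e)).
by have := ltn_ord e; lia.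
Qed.

Lemma nonpos_plus (a : M) : a = nonpos a + plus a.
Proof. by rewrite addrC /BrstComplex.nonpos subrKC || rewrite /BrstComplex.nonpos subrK. Qed.

(** The current of a positive matrix is d (p y) up to ghost bilinears and a
constant, and that of a nonpositive one is a hatted current up to ghost
bilinears. *)
Lemma nxs_K q e a (m : nat) v : nx q e v -> nxs q.+1 e.+1 (vprod (-1 - m%:Z) (K a) v).
Proof.
move=> hv; have hf := nx_fil hv.
rewrite (_ : K a = hJ (nonpos a) + (dv (p a) - \tr (plus a *m f) *: vac)
   - \sum_(al | pos al) p (lie a (ud al)) ## s (dd al)); last first.
  by rewrite dv_p addrK -linearD -nonpos_plus /hJ /BrstComplex.hJ addrK.
set X := hJ (nonpos a); have hX : nx q.+1 e (vprod (-1 - m%:Z) X v) by exact: nx_J.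
move: X hX => X hX; rewrite vprodBl !vprodDl vprodNl vprodZl vprod_suml; apply: nxs_D; first apply: nxs_D; last apply: nxs_N.
- exact: (nxs_nx (leqnSn e) hX).
- apply: nxs_D; first exact: (nxs_nx (leqnn _) (nx_d _ _ hv)).
  by apply/nxs_N/nxs_Z/nxs_fil; rewrite vprod_vacl; apply: filZ.
apply: nxs_sum => al _.
have [N hN] := vnop_mode (bp_odd C (lie a (ud al))) (bs_odd C (dd al)) (-1 - m%:Z) v.
rewrite (hN N) //; apply: nxs_sum => j _; apply: nxs_D; last first.
  by apply/nxs_Z/nxs_fil => /=; apply: fil_si; apply: fil_pn.
have [[l hl]|[l hl]] := negz_case (-1 - m%:Z + j%:Z).
  by rewrite hl; apply: (nxs_nx (leqnn _)); apply/nx_p/nx_s.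
rewrite hl; apply: nxs_fil => /=; have : fil q.-1 (vprod l%:Z (s (dd al)) v) by exact: fil_sn.
move: hf => _.
case: (q) => [|q'] h; last exact: fil_p.
by rewrite (fil0_eq0 h) vprod0r; exact: fil_0.
Qed.

Lemma fil_nxs q v : fil q v -> exists m, nxs q m v.
Proof.
elim=> {q v} [q|q c u v _ [m1 h1] _ [m2 h2]|q|q b l v hv [m h]|q b l v hv [m h]|q b l v hv [m h]].
- by exists 0%N; exact: nxs_0.
- exists (m1 + m2)%N; apply: nxs_lin; [exact: nxs_up (leq_addr _ _) h1 | exact: nxs_up (leq_addl _ _) h2].
- by exists 0%N; apply: (nxs_nx (leqnn _)); exact: nx_vac.
- exists (m + 1)%N; rewrite -addn1; apply: nxs_op h => [q' v' h'|q' e v' h']; rewrite !addn1.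
    exact: fil_K.
  exact: nxs_K.
- exists (m + 1)%N; rewrite -addn1; apply: nxs_op h => [q' v' h'|q' e v' h']; rewrite !addn1.
    exact: fil_p.
  exact: (nxs_nx (leqnn _) (nx_p _ _ h')).
- exists (m + 0)%N; rewrite -[q]addn0; apply: nxs_op h => [q' v' h'|q' e v' h']; rewrite !addn0.
    exact: fil_s.
  exact: (nxs_nx (leqnn _) (nx_s _ _ h')).
Qed.

(** Induction on the number of letters p y and d (p y): subtracting d of H v /
(m+1) kills the part with m+1 such letters, because d H + H d multiplies it by
m+1. *)
Lemma fil_acyclic q v : fil q v -> fil q.-1 (H (dv v)) ->
  exists x w, [/\ nx q 0 x, fil q w & fil q.-1 (v - x - dv w)].
Proof.
move=> hv hd; have [m [u [h1 h2]]] := fil_nxs hv; elim: m v u hv hd h1 h2 => [|m IH] v u hv hd h1 h2.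
  by exists (u 0%N), 0; rewrite dv0 subr0; split=> //; [exact: fil_0 | rewrite big_ord1 in h2].
pose c : F := m.+1%:R^-1; pose w := c *: H v.
have hw : fil q w by apply/filZ/HF.
pose u' e := (1 - e%:R / m.+1%:R) *: u e.
have nz : m.+1%:R != 0 :> F by rewrite pnatr_eq0.
have [||||x [w' [g1 g2 g3]]] := IH (v - dv w) u'.
- by apply: filB => //; exact: fil_d.
- by rewrite dvD dvN dd0 subr0.
- by move=> e; rewrite /u' -[_ *: _]addr0; apply: nx_lin => //; exact: nx_0.
- have -> : v - dv w - \sum_(e < m.+1) u' e = (v - \sum_(e < m.+2) u e) + c *: H (dv v)
     - c *: (EE (v - \sum_(e < m.+2) u e) + \sum_(e < m.+2) (EE (u e) - e%:R *: u e)).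
    have ES : EE (\sum_(e < m.+2) u e) = \sum_(e < m.+2) EE (u e).
      have ED a b : EE (a + b) = EE a + EE b by rewrite -[a]scale1r EE_lin !scale1r.
      exact: (big_morph _ ED EE0).
    have -> : EE (v - \sum_(e < m.+2) u e) = EE v - \sum_(e < m.+2) EE (u e).
      by rewrite -ES -scaleN1r addrC EE_lin scaleN1r addrC.
    have -> : \sum_(e < m.+1) u' e = \sum_(e < m.+2) (1 - e%:R / m.+1%:R) *: u e.
      by rewrite [RHS]big_ord_recr /= divff // subrr scale0r addr0.
    under eq_bigr => e _ do rewrite scalerBl scale1r mulrC -scalerA.
    rewrite !sumrB -scaler_sumr /EE /w dvZ -/c.
    by lmod.
  apply: filB; first by apply: filD => //; apply: filZ.
  apply/filZ/filD; first exact: fil_EE.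
  by apply: fil_sum => e _; exact: EE_nx.
- exists x, (w + w'); split=> //; first exact: filD.
  by rewrite (_ : v - x - dv (w + w') = v - dv w - x - dv w') // dvD; lmod.
Qed.

(** The vectors that occur in the differentials of words of weight at most two
in hatted currents. On them the homotopy takes values in the lowest nonzero
step of the filtration, so that [fil_acyclic] can be iterated. *)
Definition dlow (u : V) := (exists w y, plus y = 0 /\ u = s w ## hJ y) \/
  exists w, u = s w \/ u = vT (s w).
Lemma H_dlow u : lspan dlow u -> fil 1 (H u).
Proof.
have sv b i : fil 1 (H (vprod (-1 - i%:Z) (s b) vac)).
  have := Hs b i (fil_vac C 0); rewrite Hvac vprod0r addr0; exact: filS.
elim=> [|c a b [[w [y [hy ->]]]|[w [->|->]]] _ IH]; first by rewrite H0; exact: fil_0.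
- rewrite Hl; apply: fil_lin => //.
  have f2 : fil 2 (hJ y) by rewrite -[hJ y]vprod_vac; apply/hJ_fil/fil_vac.
  have fH : fil 1 (H (hJ y)).
    have [_ _] := hpair_J y (-1) (fil_vac C 0).
    by rewrite vprod_vac Hvac vprod0r scaler0 subr0 -(bp_plus C) hy linear0 vprod0l subr0.
  have := Hs w 0 f2 => /= h.
  by rewrite -[H _](addrK (vprod (-1 - 0%:Z) (s w) (H (hJ y)))); apply: filB h _; exact: fil_s.
- by rewrite Hl; apply: fil_lin => //; have := sv w 0%N; rewrite vprod_vac.
- by rewrite Hl; apply: fil_lin => //; exact: (sv w 1%N).
Qed.
End Acyclic.
End Acyclicity.
Import Acyclicity.

(** * Cocycles of conformal weight at most two *)
Module HatWords.
Section Eigen.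
Variables (F : numFieldType) (V : vertexSuperAlgType F) (T : V -> V).
Hypothesis Tl : forall c u v, T (c *: u + v) = c *: T u + T v.
Hypothesis Tdiag : forall v, lspan (fun u => exists z : int, T u = z%:~R *: u) v.
Let eig (z : int) u := T u = z%:~R *: u.
Let ne z u := exists2 z', z' != z & eig z' u.

Lemma eig_T0 : T 0 = 0.
Proof. by have := Tl 1 0 0; rewrite !scale1r addr0 => /eqP; rewrite -subr_eq subrr eq_sym => /eqP. Qed.
Lemma eig_lin z c u v : eig z u -> eig z v -> eig z (c *: u + v).
Proof. by rewrite /eig => h h'; rewrite Tl h h'; lmod. Qed.

Lemma eig_indep z u : eig z u -> lspan (ne z) u -> u = 0.
Proof.
move=> hu hs.
have [Q [Ql QT Qu [r r0 Qr]]] : exists Q : V -> V, [/\ forall c a b, Q (c *: a + b) = c *: Q a + Q b,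
   forall a, Q (T a) = T (Q a), Q u = 0 & exists2 r : F, r != 0 & forall a, eig z a -> Q a = r *: a].
  elim: hs => [|c a b [z' nz ha] _ [Q [Ql QT Qu [r r0 Qr]]]].
    exists id; split=> //; exists 1 => [|a _]; rewrite ?oner_neq0 // scale1r //.
  have Q0 : Q 0 = 0.
    by have := Ql 1 0 0; rewrite !scale1r addr0 => /eqP; rewrite -subr_eq subrr eq_sym => /eqP.
  exists (fun x => Q (T x - z'%:~R *: x)); split.
  - move=> d x y; rewrite -Ql; congr Q; rewrite Tl; lmod.
  - move=> x; rewrite -QT; congr Q; rewrite -!scaleNr addrC [in RHS]addrC Tl.
    by lmod.
  - rewrite Tl ha (_ : _ - _ = T b + (- z'%:~R) *: b); last by lmod.
    by rewrite addrC Ql QT Qu eig_T0 scaler0 addr0.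
  exists (r * (z%:~R - z'%:~R)) => [|x hx].
    by rewrite mulf_neq0 // subr_eq0 eqr_int eq_sym.
  have -> : T x - z'%:~R *: x = (z%:~R - z'%:~R) *: x + 0 by rewrite hx; lmod.
  by rewrite Ql Q0 Qr //; lmod.
by move/eqP: Qu; rewrite Qr // scaler_eq0 (negbTE r0) => /eqP.
Qed.

(** Diagonalizability is only given as spanning by eigenvectors; their
independence makes the eigencomponents of a vector well defined. *)
Theorem eigproj : exists pi : int -> V -> V,
  [/\ forall z c u v, pi z (c *: u + v) = c *: pi z u + pi z v,
     forall z u, T u = z%:~R *: u -> pi z u = u &
     forall z z' u, T u = z'%:~R *: u -> z' != z -> pi z u = 0].
Proof.
pose R z v u := eig z u /\ lspan (ne z) (v - u).
have Rlin z c v u v' u' : R z v u -> R z v' u' -> R z (c *: v + v') (c *: u + u').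
  move=> [h1 h2] [h3 h4]; split; first exact: eig_lin.
  by rewrite (_ : _ - _ = c *: (v - u) + (v' - u')); [apply: lspanD => //; exact: lspanZ | lmod].
have Runiq z v u u' : R z v u -> R z v u' -> u = u'.
  move=> [h1 h2] [h3 h4]; apply/eqP; rewrite -subr_eq0; apply/eqP; apply: (@eig_indep z).
    by rewrite -scaleN1r addrC; apply: eig_lin.
  rewrite (_ : u - u' = (-1) *: (v - u) + (v - u')); last by lmod.
  by apply: lspanD => //; exact: lspanZ.
have Rself z u : eig z u -> R z u u.
  by move=> h; split=> //; rewrite subrr; exact: lspan0.
have Rother z z' u : eig z' u -> z' != z -> R z u 0.
  move=> h nz; split; first by rewrite /eig eig_T0 scaler0.
  by rewrite subr0; apply: lspan_in; exists z'.
have Rex (x : int * V) : exists u, R x.1 x.2 u.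
  case: x => z v /=; elim: (Tdiag v) => [|c a b [z' ha] _ [u hu]].
    by exists 0; split; [rewrite /eig eig_T0 scaler0 | rewrite subrr; exact: lspan0].
  have [e|nz] := eqVneq z' z; first by exists (c *: a + u); apply: Rlin => //; apply: Rself; rewrite -e.
  by exists (c *: 0 + u); apply: Rlin => //; apply: Rother nz.
have [g hg] := choice Rex; exists (fun z v => g (z, v)); split.
- move=> z c u v; apply: (Runiq _ _ _ _ (hg (z, _))); apply: Rlin; [exact: (hg (z, u)) | exact: (hg (z, v))].
- by move=> z u h; apply: (Runiq _ _ _ _ (hg (z, u))); apply: Rself.
- by move=> z z' u h nz; apply: (Runiq _ _ _ _ (hg (z, u))); apply: Rother nz.
Qed.
End Eigen.

Lemma lspan_map (F : numFieldType) (V : vertexSuperAlgType F) (S S' : V -> Prop) (g : V -> V) v :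
  (forall c u v, g (c *: u + v) = c *: g u + g v) -> (forall u, S u -> lspan S' (g u)) ->
  lspan S v -> lspan S' (g v).
Proof.
move=> gl gS; elim=> [|c a b ha _ IH].
  have -> : g 0 = 0; last exact: lspan0.
  by have := gl 1 0 0; rewrite !scale1r addr0 => /eqP; rewrite -subr_eq subrr eq_sym => /eqP.
by rewrite gl; apply: lspanD => //; apply/lspanZ/gS.
Qed.
Section Graded.
Variables (F : numFieldType) (V : vertexSuperAlgType F) (n : nat).
Variables (lev : 'I_n -> nat) (k : F) (C : brst_ops V lev k).
Variable f : 'M[F]_n.
Hypothesis f_minus : minus lev f = f.
Hypothesis f_deg : forall i j, lev i != (lev j).+1 -> f j i = 0.
Hypothesis f_levm : lie (levm F lev) f = - f.
Hypothesis kn : k + n%:R != 0.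
Local Notation M := 'M[F]_n.
Local Notation K := (bK C).
Local Notation p := (bp C).
Local Notation s := (bs C).
Local Notation plus := (plus lev).
Local Notation nonpos := (nonpos lev).
Local Notation pos := (pos lev).
Local Notation ud := (ud F).
Local Notation dd := (dd F).
Local Notation dv := (dv C f).
Local Notation hJ := (hJ C).
Local Notation fil := (fil C).
Local Notation om := (om C).
Local Notation qv := (qv C).
Local Notation levm := (levm F lev).
Hypothesis fil_all : forall v, exists q, fil q v.

Lemma om0T v : vprod 0 om v = vT v.
Proof.
have st b x i v' : vpar b x -> vprod 0 om x = vT x -> vprod 0 om v' = vT v' ->
    vprod 0 om (vprod i x v') = vT (vprod i x v').
  by move=> px h1 h2; rewrite (vcomm0 (om_even C) px) h1 h2 vsgnFl scale1r vT_prod addrC.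
have [q] := fil_all v; elim=> {q v} [q|q c u v _ IHu _ IHv|q|q b l v hv IH|q b l v hv IH|q b l v hv IH].
- by rewrite vprod0r vT0.
- by rewrite vprod_linearr IHu IHv vTD vTZ.
- by rewrite vT_vac0 vprod_vac_ge0.
- by apply: (st _ _ _ _ (bK_even C b)) => //; exact: (om_K C kn 0).
- by apply: (st _ _ _ _ (bp_odd C b)) => //; exact: (om_p C kn 0).
- by apply: (st _ _ _ _ (bs_odd C b)) => //; exact: (om_s C kn 0).
Qed.

Definition L0 v := vprod 1 om v.
Definition hm (c z : int) v := qv v = c%:~R *: v /\ L0 v = z%:~R *: v.

Lemma L0_prod i x v : L0 (vprod i x v) = vprod i x (L0 v) + vprod (1 + i) (vT x) v + vprod i (L0 x) v.
Proof.
have key b y : vpar b y -> L0 (vprod i y v) = vprod i y (L0 v) + vprod (1 + i) (vT y) v + vprod i (L0 y) v.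
  move=> py; rewrite /L0 (vcomm (om_even C) py 1) !big_ord_recl big_ord0 vsgnFl.
  rewrite bin0 lift0 bin1 !scale1r !addr0 om0T addrA /= (_ : 1%N%:Z + i - 1 = i) //; lia.
have [x0 [x1 [h0 h1 ->]]] := vpar_sum x.
rewrite vTD !vprodDl /L0 !vprodDr -!/(L0 _) vprodDl (key _ _ h0) (key _ _ h1); lmod.
Qed.
Lemma hm_lin c z t u v : hm c z u -> hm c z v -> hm c z (t *: u + v).
Proof.
move=> [h1 h2] [g1 g2]; split; rewrite ?qvD ?qvZ /L0 ?vprod_linearr -?/(L0 _) ?h1 ?h2 ?g1 ?g2; lmod.
Qed.
Lemma hm0 c z : hm c z 0.
Proof. by split; rewrite /L0 /ConformalVector.qv vprod0r scaler0. Qed.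
Lemma hmZ c z t u : hm c z u -> hm c z (t *: u).
Proof. by move=> h; rewrite -[t *: u]addr0; apply/hm_lin/hm0. Qed.
Lemma hmD c z u v : hm c z u -> hm c z v -> hm c z (u + v).
Proof. by move=> h; rewrite -[u]scale1r; apply: hm_lin. Qed.
Lemma hm_sum c z I (r : seq I) (P : pred I) (g : I -> V) :
  (forall i, P i -> hm c z (g i)) -> hm c z (\sum_(i <- r | P i) g i).
Proof. by move=> h; elim/big_rec: _ => [|i y Pi]; [exact: hm0 | apply: hmD; exact: h]. Qed.
Lemma hm_prod c z c' z' (i : int) x v : hm c z x -> hm c' z' v -> hm (c + c') (z + z' - i - 1) (vprod i x v).
Proof.
move=> [h1 h2] [g1 g2]; split.
  by rewrite qv_prod h1 g1 vprodZl vprodZr -scalerDl -intrD.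
rewrite L0_prod h2 g2 vprodZl vprodZr vT_mode_l (_ : 1 + i - 1 = i); last lia.
by rewrite -!scalerDl; congr (_ *: _); rewrite !(intrD, intrN); ring.
Qed.
Lemma hm_vac : hm 0 0 vac.
Proof. by split; rewrite ?qv_vac /L0 ?(vprod_vac_ge0 1) scale0r. Qed.
Lemma hm_T c z u : hm c z u -> hm c (z + 1) (vT u).
Proof. by move=> h; have := hm_prod (-2) h hm_vac; rewrite /vT !addr0 => g; congr hm: g; lia. Qed.
Lemma hm_dv c z u : hm c z u -> hm (c + 1) z (dv u).
Proof.
move=> [h1 h2]; split; first by rewrite qv_dv h1 dvZ intrD; lmod.
have := dv_even C f 1 u (om_even C); rewrite (dv_om C kn f_levm) vprod0l add0r -!/(L0 _) h2 dvZ => <- //.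
Qed.
Lemma hm_K a z : lie levm a = z%:~R *: a -> hm 0 (1 - z) (K a).
Proof.
move=> h; split; first by rewrite qv_K scale0r.
by rewrite /L0 (om_K C kn 1) h linearZ /= intrD intrN; lmod.
Qed.
Lemma hm_p a z : lie levm a = z%:~R *: a -> hm (-1) (1 - z) (p a).
Proof.
move=> h; split; first by rewrite qv_p; lmod.
by rewrite /L0 (om_p C kn 1) h linearZ /= intrD intrN; lmod.
Qed.
Lemma hm_s a z : lie levm a = z%:~R *: a -> hm 1 (- z) (s a).
Proof.
move=> h; split; first by rewrite qv_s; lmod.
by rewrite /L0 (om_s C kn 1) h linearZ /= intrN; lmod.
Qed.
Definition idg (al : ip n) : int := (lev al.1)%:Z - (lev al.2)%:Z.
Lemma mdegE al : mdeg F lev al = (idg al)%:~R.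
Proof. by rewrite /mdeg /idg intrD intrN !pmulrn. Qed.
Lemma lev_ud al : lie levm (ud al) = (idg al)%:~R *: ud al.
Proof. by rewrite lie_levm_ud mdegE. Qed.
Lemma lev_dd al : lie levm (dd al) = (- idg al)%:~R *: dd al.
Proof. by rewrite lie_levm_dd mdegE intrN. Qed.
Lemma lev_lie a b z z' : lie levm a = z%:~R *: a -> lie levm b = z'%:~R *: b ->
  lie levm (lie a b) = (z + z')%:~R *: lie a b.
Proof. by move=> h h'; rewrite lie_levm_lie h h' lieZl linearZ /= intrD scalerDl. Qed.
Lemma hm_J a z : lie levm a = z%:~R *: a -> hm 0 (1 - z) (hJ a).
Proof.
move=> h; apply: hmD; first exact: hm_K.
apply: hm_sum => al _.
have := hm_prod (-1) (hm_p (lev_lie h (lev_ud al))) (hm_s (lev_dd al)).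
by move=> g; congr hm: g; lia.
Qed.

Lemma mx_sum (a : M) : a = \sum_(al : ip n) \tr (dd al *m a) *: ud al.
Proof. by rewrite sum_ud. Qed.
Lemma letter_lspan (S S' : V -> Prop) (g : {linear M -> V}) i a v :
  (forall al u, S u -> lspan S' (vprod i (g (ud al)) u)) -> lspan S v -> lspan S' (vprod i (g a) v).
Proof.
move=> h; apply: lspan_map => [c u w|u hu]; first exact: vprod_linearr.
rewrite (mx_sum a) linear_sum vprod_suml; apply: lspan_sum => al _.
by rewrite linearZ vprodZl; apply/lspanZ/h.
Qed.

Lemma fil_hm q v : fil q v -> lspan (fun u => fil q u /\ exists c z, hm c z u) v.
Proof.
elim=> {q v} [q|q c u v _ IHu _ IHv|q|q b l v hv IH|q b l v hv IH|q b l v hv IH].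
- exact: lspan0.
- by apply: lspanD => //; exact: lspanZ.
- by apply: lspan_in; split; [exact: fil_vac | exists 0, 0; exact: hm_vac].
- apply: letter_lspan IH => al u [h [c [z hz]]]; apply: lspan_in; split; first exact: fil_K.
  by have := hm_prod (-1 - l%:Z) (hm_K (lev_ud al)) hz; eexists; eexists; eassumption.
- apply: letter_lspan IH => al u [h [c [z hz]]]; apply: lspan_in; split; first exact: fil_p.
  by have := hm_prod (-1 - l%:Z) (hm_p (lev_ud al)) hz; eexists; eexists; eassumption.
- apply: letter_lspan IH => al u [h [c [z hz]]]; apply: lspan_in; split; first exact: fil_s.
  by have := hm_prod (-1 - l%:Z) (hm_s (lev_ud al)) hz; eexists; eexists; eassumption.
Qed.

Lemma lspanW (S S' : V -> Prop) v : (forall u, S u -> S' u) -> lspan S v -> lspan S' v.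
Proof. by move=> h; elim=> [|c a b ha _ IH]; [exact: lspan0 | apply: lspan_add => //; exact: h]. Qed.

Lemma hm_all v : lspan (fun u => exists c z, hm c z u) v.
Proof. by have [q h] := fil_all v; apply: lspanW (fil_hm h) => u []. Qed.

Lemma grproj : exists P : int -> int -> V -> V,
  [/\ forall c z t u v, P c z (t *: u + v) = t *: P c z u + P c z v,
     forall c z u, hm c z u -> P c z u = u &
     forall c z c' z' u, hm c' z' u -> (c' != c) || (z' != z) -> P c z u = 0].
Proof.
have ql c u v : qv (c *: u + v) = c *: qv u + qv v by rewrite qvD qvZ.
have ll c u v : L0 (c *: u + v) = c *: L0 u + L0 v by exact: vprod_linearr.
have [||P [P1 P2 P3]] := @eigproj F V qv; [exact: ql | | ].
  by move=> v; apply: lspanW (hm_all v) => u [c [z [h _]]]; exists c.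
have [||Q [Q1 Q2 Q3]] := @eigproj F V L0; [exact: ll | | ].
  by move=> v; apply: lspanW (hm_all v) => u [c [z [_ h]]]; exists z.
exists (fun c z v => Q z (P c v)); split.
- by move=> c z t u v; rewrite P1 Q1.
- by move=> c z u [h1 h2]; rewrite P2 // Q2.
move=> c z c' z' u [h1 h2]; have Q0 : Q z 0 = 0.
  by have := Q1 z 1 0 0; rewrite !scale1r addr0 => /eqP; rewrite -subr_eq subrr eq_sym => /eqP.
have [e|ne] := eqVneq c' c; last by rewrite (P3 _ _ _ h1).
by rewrite /= P2 -?e // => ne; rewrite (Q3 _ _ _ h2).
Qed.
(** The sign is chosen so that hJ a has conformal weight 1 + j. *)
Definition hdeg (j : nat) (a : M) := plus a = 0 /\ lie levm a = (- j%:Z)%:~R *: a.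
(** All letters have positive conformal weight, so there are few words of
weight at most two. *)
Inductive jw : nat -> V -> Prop :=
| jw_vac : jw 0 vac
| jw_J j (m : nat) D a v of hdeg j a & jw D v : jw (j + m + D).+1 (vprod (-1 - m%:Z) (hJ a) v).

Lemma jw_hm D v : jw D v -> hm 0 D%:Z v.
Proof.
elim=> [|j m D' a v' [_ h] _ IH]; first exact: hm_vac.
by have g := hm_prod (-1 - m%:Z) (hm_J h) IH; congr hm: g; lia.
Qed.

Lemma nonpos_ud al : nonpos (ud al) = 0 \/ exists j, hdeg j (nonpos (ud al)).
Proof.
have [h|h] := boolP (pos al); first by left; rewrite /BrstComplex.nonpos plus_ud ?subrr.
right; exists `|idg al|%N; split; first exact: plus_nonpos.
have -> : - `|idg al|%N%:Z = idg al by move: h; rewrite /Gradings.pos -leqNgt /idg; lia.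
rewrite /BrstComplex.nonpos linearB /= scalerBr lie_levm_plus lev_ud.
by congr (_ - _); rewrite linearZ.
Qed.

Definition jsp (u : V) := (exists D, jw D u) \/ exists c z, (0 < c)%R /\ hm c z u.
Lemma nx0_span q v : nx C f q 0 v -> lspan jsp v.
Proof.
suff : forall e, nx C f q e v -> e = 0%N -> lspan jsp v by move=> h /h; apply.
move=> e; elim=> {q e v}; [move=> q e|move=> q e c u v _ h1 _ h2|move=> q|move=> q e a m v hv h
  |move=> q e a m v hv h|by []|by []].
- by move=> _; exact: lspan0.
- by move=> e0; apply: lspanD; [apply/lspanZ/h1 | exact: h2].
- by move=> _; apply: lspan_in; left; exists 0%N; exact: jw_vac.
- move=> e0; have := h e0; apply: (letter_lspan (g := hJ \o nonpos)) => al u hu /=.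
  have [->|[j hj]] := nonpos_ud al; first by rewrite linear0 vprod0l; exact: lspan0.
  apply: lspan_in; case: hu => [[D hD]|[c [z [c0 hz]]]].
    by left; exists (j + m + D).+1; exact: jw_J.
  by right; exists (0 + c), (1 - - j%:Z + z - (-1 - m%:Z) - 1); rewrite add0r; split=> //;
    have := hm_prod (-1 - m%:Z) (hm_J (proj2 hj)) hz; rewrite add0r.
- move=> e0; have := h e0; apply: letter_lspan => al u hu.
  apply: lspan_in; right; case: hu => [[D hD]|[c [z [c0 hz]]]].
    by have g := hm_prod (-1 - m%:Z) (hm_s (lev_ud al)) (jw_hm hD); eexists; eexists; split; last exact: g.
  have g := hm_prod (-1 - m%:Z) (hm_s (lev_ud al)) hz; eexists; eexists; split; last exact: g.
  by lia.
Qed.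

(** Words in the letters s only: these have positive charge unless they are
empty. *)
Lemma fil1_span v : fil 1 v -> lspan (fun u => u = vac \/ exists c z, (0 < c)%R /\ hm c z u) v.
Proof.
set S := lspan _; suff : forall q, fil q v -> (q <= 1)%N -> S v by move=> h /h; apply.
move=> q; elim=> {q v} [q|q c u v _ IHu _ IHv|q|q b l v hv IH|q b l v hv IH|q b l v hv IH] q1.
- exact: lspan0.
- by apply: lspanD; [apply/lspanZ/IHu | exact: IHv].
- by apply: lspan_in; left.
- have e : q = 0%N by lia. 
  by move: hv; rewrite e => /fil0_eq0 ->; rewrite vprod0r; exact: lspan0.
- have e : q = 0%N by lia. 
  by move: hv; rewrite e => /fil0_eq0 ->; rewrite vprod0r; exact: lspan0.
- apply: letter_lspan (IH q1) => al u hu; apply: lspan_in; right; case: hu => [->|[c [z [c0 hz]]]].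
    by have g := hm_prod (-1 - l%:Z) (hm_s (lev_ud al)) hm_vac; eexists; eexists; split; last exact: g.
  have g := hm_prod (-1 - l%:Z) (hm_s (lev_ud al)) hz; eexists; eexists; split; last exact: g.
  by lia.
Qed.

Lemma dge_hdeg a : hdeg 0 a -> dge lev 0 a.
Proof.
move=> [_ h] i j; rewrite addn0 => lt; move/matrixP/(_ i j): h.
rewrite lie_levmE oppr0 scale0r mxE => /eqP; rewrite mulf_eq0 => /orP[|/eqP //].
by rewrite subr_eq0 eqr_nat ltn_eqF.
Qed.
Lemma dv_J0 a : hdeg 0 a -> dv (hJ a) = s (lie f a).
Proof.
move=> /dge_hdeg ha; rewrite (dv_J C f_minus) (s_dge0 C ha) scaler0 !big1 => [|be hbe|al hal].
- by rewrite subrr vT0 addr0 add0r.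
- by rewrite tcoef0 ?scale0r.
rewrite nonpos_dge ?linear0 ?vprod0r //; apply: dge_le (dge_lie (dge_ud F hal) ha).
by move: hal; rewrite /Gradings.pos; lia.
Qed.

Definition jw2 (u : V) := [\/ exists a b, [/\ hdeg 0 a, hdeg 0 b & u = hJ a ## hJ b],
   exists2 b, hdeg 0 b & u = vT (hJ b) | exists2 c, hdeg 1 c & u = hJ c].
Lemma jw0_inv D u : jw D u -> D = 0%N -> u = vac. Proof. by case. Qed.
Lemma jw1_inv D u : jw D u -> D = 1%N -> exists2 a, hdeg 0 a & u = hJ a.
Proof.
case=> {D u} // j m D a v ha hv e.
have [ej em eD] : [/\ j = 0%N, m = 0%N & D = 0%N] by split; lia.
by exists a; [rewrite -ej | rewrite em subr0 (jw0_inv hv eD) vprod_vac].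
Qed.
Lemma jw2_inv D u : jw D u -> D = 2 -> jw2 u.
Proof.
case=> {D u} // j m D a v ha hv e.
have : [\/ [/\ j = 0%N, m = 0%N & D = 1%N], [/\ j = 0%N, m = 1%N & D = 0%N] |
        [/\ j = 1%N, m = 0%N & D = 0%N]].
  case: j m D e {ha hv} => [|[|j]] [|[|m]] [|[|D]] //= _;
  by [constructor 1 | constructor 2 | constructor 3].
case=> -[ej em eD].
- have [b hb ->] := jw1_inv hv eD; constructor 1; exists a, b; split=> //; first by rewrite -ej.
  by rewrite em subr0.
- by constructor 2; exists a; [rewrite -ej | rewrite em (jw0_inv hv eD)].
- by constructor 3; exists a; [rewrite -ej | rewrite em (jw0_inv hv eD) subr0 vprod_vac].
Qed.

Local Notation dlow := (dlow C).
Lemma dlow_s w : lspan dlow (s w).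
Proof. by apply: lspan_in; right; exists w; left. Qed.
Lemma dlow_Ts w : lspan dlow (vT (s w)).
Proof. by apply: lspan_in; right; exists w; right. Qed.
Lemma dlow_sJ w y : plus y = 0 -> lspan dlow (s w ## hJ y).
Proof. by move=> hy; apply: lspan_in; left; exists w, y. Qed.
Lemma hJ_s_mode z y : hJ z ## s y = s y ## hJ z -
  \sum_(be | pos be) \tr (plus (lie z (ud be)) *m y) *: vT (s (dd be)).
Proof. exact: hJ_s. Qed.
Lemma hJ_hdeg1 c : hdeg 1 c -> dv (hJ c) = \sum_(al | pos al) s (dd al) ## hJ (nonpos (lie (ud al) c)) +
  s (lie f c) + (k *: vT (s c) - \sum_(be | pos be) tcoef lev c be *: vT (s (dd be))).
Proof.
move=> _; rewrite (dv_J C f_minus) vTD vTN vTZ; congr (_ + (_ - _)).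
by rewrite /vT vprod_suml; apply: eq_bigr => be _; rewrite vprodZl.
Qed.
Lemma dv_JJ a b : hdeg 0 a -> hdeg 0 b ->
  dv (hJ a ## hJ b) = s (lie f a) ## hJ b + (s (lie f b) ## hJ a -
  \sum_(be | pos be) \tr (plus (lie a (ud be)) *m lie f b) *: vT (s (dd be))).
Proof.
by move=> ha hb; rewrite (dv_even C f _ _ (hJ_even C a)) (dv_J0 ha) (dv_J0 hb) hJ_s_mode.
Qed.
Lemma dv_TJ b : hdeg 0 b -> dv (vT (hJ b)) = vT (s (lie f b)).
Proof. by move=> hb; rewrite (dv_T C f (hJ_even C b)) (dv_J0 hb). Qed.

Lemma jw_dlow D u : (D <= 2)%N -> jw D u -> lspan dlow (dv u).
Proof.
case: D => [|[|[|D]]] // _ h.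
- by rewrite (jw0_inv h erefl) dv_vac; exact: lspan0.
- by have [a ha ->] := jw1_inv h erefl; rewrite dv_J0 //; exact: dlow_s.
have [[a [b [ha hb ->]]]|[b hb ->]|[c hc ->]] := jw2_inv h erefl.
- rewrite dv_JJ //; apply: lspanD; first by apply: dlow_sJ; case: hb.
  apply: lspanD; first by apply: dlow_sJ; case: ha.
  by apply/lspanN/lspan_sum => be _; apply/lspanZ/dlow_Ts.
- by rewrite dv_TJ //; exact: dlow_Ts.
rewrite hJ_hdeg1 //; apply: lspanD; first apply: lspanD.
- by apply: lspan_sum => al _; apply: dlow_sJ; exact: plus_nonpos.
- exact: dlow_s.
apply: lspanD; first exact/lspanZ/dlow_Ts.
by apply/lspanN/lspan_sum => be _; apply/lspanZ/dlow_Ts.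
Qed.

Section LowWeight.
Variable H : V -> V.
Hypothesis Hl : forall c u v, H (c *: u + v) = c *: H u + H v.
Hypothesis Hvac : H vac = 0.
Hypothesis HF : forall q v, fil q v -> fil q (H v).
Hypothesis HK : forall q v a (m : nat), fil q v -> fil q (H (vprod (-1 - m%:Z) (K a) v)
         - vprod (-1 - m%:Z) (K a) (H v) - vprod (-1 - m%:Z) (p a) v).
Hypothesis Hp : forall q v a (m : nat), fil q v -> fil q (H (vprod (-1 - m%:Z) (p a) v)
         + vprod (-1 - m%:Z) (p a) (H v)).
Hypothesis Hs : forall q v a (m : nat), fil q v -> fil q.-1 (H (vprod (-1 - m%:Z) (s a) v)
         + vprod (-1 - m%:Z) (s a) (H v)).

(** Iterates [fil_acyclic] and projects on the bidegree of v. The words split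
off have weight at most two, so [H_dlow] bounds the homotopy on their
differentials, and this is the hypothesis of the next iteration. *)
Lemma low_weight z v : z <= 2 -> hm 0 z v -> dv v = 0 -> exists x w,
  [/\ lspan (fun u => exists D : nat, z = D%:Z /\ jw D u) x, hm (-1) z w & v = x + dv w].
Proof.
have [P [P1 P2 P3]] := grproj.
have P0 c z' : P c z' 0 = 0.
  by have := P1 c z' 1 0 0; rewrite !scale1r addr0 => /eqP; rewrite -subr_eq subrr eq_sym => /eqP.
have PD c z' a b : P c z' (a + b) = P c z' a + P c z' b by rewrite -[a]scale1r P1 !scale1r.
have PN c z' a : P c z' (- a) = - P c z' a by rewrite -scaleN1r -[_ *: a]addr0 P1 P0 addr0 scaleN1r.
have PE c z' c' z'' u : hm c' z'' u -> P c z' u = if (c' == c) && (z'' == z') then u else 0.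
  move=> h; case: ifP => [/andP[/eqP e1 /eqP e2]|/negbT]; first by rewrite P2 // -e1 -e2.
  by rewrite negb_and; exact: P3 h.
have Phm c z' u : hm c z' (P c z' u).
  elim: (hm_all u) => [|t a b [c' [z'' h]] _ IH]; first by rewrite P0; exact: hm0.
  rewrite P1; apply: hm_lin => //; rewrite (PE _ _ _ _ _ h).
  by case: ifP => [/andP[/eqP <- /eqP <-] //|_]; exact: hm0.
have Pdv c z' u : P (c + 1) z' (dv u) = dv (P c z' u).
  elim: (hm_all u) => [|t a b [c' [z'' h]] _ IH]; first by rewrite P0 dv0 P0.
  rewrite P1 !(dvD, dvZ) P1 IH (PE _ _ _ _ _ h) (PE _ _ _ _ _ (hm_dv h)); congr (_ *: _ + _).
  rewrite (_ : (c' + 1 == c + 1) = (c' == c)); last lia.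
  by case: ifP; rewrite ?dv0.
have Pfil c z' q u : fil q u -> fil q (P c z' u).
  move=> h; elim: (fil_hm h) => [|t a b [ha [c' [z'' h']]] _ IH]; first by rewrite P0; exact: fil_0.
  by rewrite P1; apply: fil_lin => //; rewrite (PE _ _ _ _ _ h'); case: ifP => // _; exact: fil_0.
set X := fun u => exists D : nat, z = D%:Z /\ jw D u.
move=> z2 hv dv0v; have [q hq] := fil_all v.
have hH : fil 1 (H (dv v)).
  have -> : H (dv v) = 0; last exact: fil_0.
  by rewrite dv0v; have := Hl 1 0 0; rewrite !scale1r addr0 => /eqP; rewrite -subr_eq subrr eq_sym => /eqP.
clear dv0v; elim: q v hv hq hH => [|q IH] v hv hq hH.
  by exists 0, 0; rewrite (fil0_eq0 hq) dv0 addr0; split=> //; [exact: lspan0 | exact: hm0].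
case: q IH hq => [|q] IH hq.
  exists v, 0; rewrite dv0 addr0; split=> //; last exact: hm0.
  rewrite -(P2 _ _ _ hv); apply: (lspan_map (g := P 0 z) _ _ (fil1_span hq)) => [t a b|u]; first exact: P1.
  move=> [->|[c [z' [c0 h]]]].
    rewrite (PE _ _ _ _ _ hm_vac) eqxx /=; case: eqP => [e|_]; last exact: lspan0.
    by apply: lspan_in; exists 0%N; split; [rewrite -e | exact: jw_vac].
  by rewrite (PE _ _ _ _ _ h) gt_eqF //; exact: lspan0.
have [|x [w [hx hw hr]]] := fil_acyclic f_minus f_deg Hl Hvac HF HK Hp Hs fil_all hq.
  by apply: fil_le hH.
set r := v - x - dv w in hr; pose x' := P 0 z x; pose r' := P 0 z r; pose w' := P (-1) z w.
have vE : v = x' + dv w' + r'.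
  rewrite -[LHS](P2 _ _ _ hv) (_ : v = x + dv w + r); last by rewrite /r; lmod.
  by rewrite 2!PD -[P 0 z (dv w)]/(P (-1 + 1) z (dv w)) Pdv.
have hx' : lspan X x'.
  apply: (lspan_map (g := P 0 z) _ _ (nx0_span hx)) => [t a b|u]; first exact: P1.
  move=> [[D hD]|[c [z' [c0 h]]]].
    rewrite (PE _ _ _ _ _ (jw_hm hD)) eqxx /=; case: eqP => [e|_]; last exact: lspan0.
    by apply: lspan_in; exists D.
  by rewrite (PE _ _ _ _ _ h) gt_eqF //; exact: lspan0.
have hdx : fil 1 (H (dv x')).
  apply: (H_dlow Hl Hvac HF HK Hp Hs); apply: (lspan_map (g := dv) _ _ hx') => [t a b|u [D [e hu]]].
    by rewrite dvD dvZ.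
  by apply: jw_dlow hu; rewrite -lez_nat -e.
have [||| x2 [w2 [g1 g2 g3]]] := IH r'.
- exact: Phm.
- exact: Pfil.
- have -> : dv r' = (-1) *: dv x' + dv v.
    by rewrite vE !dvD (dd0 f_minus f_deg fil_all); lmod.
  by rewrite Hl; apply: fil_lin.
exists (x' + x2), (w' + w2); split; first exact: lspanD.
  by apply: hmD => //; exact: Phm.
by rewrite vE g3 dvD; lmod.
Qed.
End LowWeight.
End Graded.
End HatWords.
Import HatWords.

(** * Operator products of the hatted currents *)
Module HatCurrents.
Section Currents.
Variables (F : numFieldType) (V : vertexSuperAlgType F) (n : nat).
Variables (lev : 'I_n -> nat) (k : F) (C : brst_ops V lev k).
Local Notation M := 'M[F]_n.
Local Notation K := (bK C).
Local Notation p := (bp C).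
Local Notation s := (bs C).
Local Notation plus := (plus lev).
Local Notation pos := (pos lev).
Local Notation ud := (ud F).
Local Notation dd := (dd F).
Local Notation hJ := (hJ C).
Local Notation om := (om C).
Local Notation levm := (levm F lev).
Implicit Types (a b x y z w : M).

Lemma ps_p0 (j : nat) x w y : vprod j%:Z (p x ## s w) (p y) = ((j == 0%N)%:R * \tr (plus y *m w)) *: p x.
Proof.
rewrite (vnop_fin (bp_odd C x) (bs_odd C w) (M := 1)) => [|i i1|i _]; last exact: bpp.
  by rewrite big_ord1 !addr0 bpp vprod0r scaler0 addr0 (sp C j) vprodZr vprod_vac.
by rewrite -PoszD (sp C) (_ : (j + i == 0)%N = false) ?mul0r ?scale0r //; lia.
Qed.
Lemma ps_s0 (j : nat) x w z : vprod j%:Z (p x ## s w) (s z) = - ((j == 0%N)%:R * \tr (plus x *m z)) *: s w.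
Proof.
rewrite (vnop_fin (bp_odd C x) (bs_odd C w) (M := 1)) => [|i _|i i1]; last exact: bps1.
  rewrite big_ord1 addr0 bss vprod0r add0r subr0 bps0 vprodZr vsgnT; case: j => [|j].
    by rewrite sub0r vprod_vac; lmod.
  by rewrite (_ : j.+1%:Z - 1 = j%:Z) ?vprod_vac_ge0; [lmod | lia].
by rewrite -PoszD bss.
Qed.
Lemma ps_K0 (j : nat) x w a : vprod j%:Z (p x ## s w) (K a) = 0.
Proof.
rewrite (vnop_fin (bp_odd C x) (bs_odd C w) (M := 0)) ?big_ord0 // => i _; last exact: pK.
by rewrite -PoszD; exact: sK.
Qed.

Lemma hJ_p0 (j : nat) a y : vprod j%:Z (hJ a) (p y) = (j == 0%N)%:R *: p (lie a (plus y)).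
Proof.
rewrite /hJ vprodDl bKp add0r vprod_suml.
under eq_bigr => al _ do rewrite ps_p0.
have -> : p (lie a (plus y)) = \sum_(al | pos al) \tr (plus y *m dd al) *: p (lie a (ud al)).
  rewrite -{1}[plus y]plus_plus {1}plus_sum (linear_sum (lie a)) (linear_sum p).
  by apply: eq_bigr => al _; rewrite !linearZ.
by rewrite scaler_sumr; apply: eq_bigr => al _; rewrite scalerA.
Qed.
Definition sact a z : V := - \sum_(al | pos al) \tr (plus (lie a (ud al)) *m z) *: s (dd al).
Lemma hJ_s0 (j : nat) a z : vprod j%:Z (hJ a) (s z) = (j == 0%N)%:R *: sact a z.
Proof.
rewrite /hJ vprodDl bKs add0r vprod_suml /sact -sumrN scaler_sumr.
by apply: eq_bigr => al _; rewrite ps_s0; lmod.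
Qed.
Lemma hJ_K0 (j : nat) a b : vprod j%:Z (hJ a) (K b) = match j with
  | 0 => K (lie a b) | 1 => kap k a b *: vac | _ => 0 end.
Proof.
rewrite /hJ vprodDl vprod_suml big1 ?addr0 => [|al _]; last exact: ps_K0.
by case: j => [|[|j]]; [exact: bKK0 | exact: bKK1 | exact: bKK2].
Qed.
Lemma hJ_ps (j : nat) a y z : vprod j%:Z (hJ a) (p y ## s z) =
  match j with 0 => p (lie a (plus y)) ## s z + p y ## sact a z
  | 1 => \tr (plus (lie a (plus y)) *m z) *: vac | _ => 0 end.
Proof.
rewrite (vcomm (hJ_even C a) (bp_odd C y)) vsgnFl scale1r hJ_s0 vprodZr.
rewrite big_ord_recl big1 ?addr0 => [|i _]; last by rewrite hJ_p0 scale0r vprod0l scaler0.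
rewrite bin0 scale1r hJ_p0 scale1r.
case: j => [|[|j]]; rewrite ?scale1r ?scale0r ?add0r ?subr0.
- by rewrite addrC.
- exact: bps0.
- by rewrite (_ : j.+2%:Z + -1 = j.+1%:Z) ?bps1 //; lia.
Qed.

(** The coefficient of the double pole of two hatted currents: the affine term
and the trace over g_+ of the two adjoint actions. *)
Definition Psi a b : F := kap k a b + \sum_(al | pos al) \tr (plus (lie a (plus (lie b (ud al)))) *m dd al).
Lemma hJJ1 (j : nat) a b : vprod j.+1%:Z (hJ a) (hJ b) = ((j == 0%N)%:R * Psi a b) *: vac.
Proof.
rewrite {2}/hJ -/(hJ) vprodDr hJ_K0 vprod_sumr; case: j => [|j].
  under eq_bigr => al _ do rewrite (hJ_ps 1).
  by rewrite -scaler_suml -scalerDl mul1r.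
by rewrite big1 ?mul0r ?scale0r ?addr0 // => al _; rewrite (hJ_ps j.+2).
Qed.

Section Diag.
Variable t : 'I_n -> F.
Definition dg : M := diag_mx (\row_i t i).
Lemma lie_dgE a i j : lie dg a i j = (t i - t j) * a i j.
Proof.
by rewrite /lie /dg mul_diag_mx mul_mx_diag !mxE; ring.
Qed.
Lemma lie_dg_ud al : lie dg (ud al) = (t al.1 - t al.2) *: ud al.
Proof.
apply/matrixP => i j; rewrite lie_dgE !mxE.
by case: eqP => [->|]; case: eqP => [->|]; rewrite ?mulr0.
Qed.
Lemma lie_dg_plus a : lie dg (plus a) = plus (lie dg a).
Proof.
by apply/matrixP => i j; rewrite lie_dgE [RHS]mxE lie_dgE mxE; case: ifP; rewrite ?mulr0.
Qed.
Lemma sact_dg al : pos al -> sact dg (dd al) = - (t al.1 - t al.2) *: s (dd al).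
Proof.
move=> ha; rewrite /sact scaleNr -linearZ -(s_linE C (_ *: _)); congr (- _); apply: eq_bigr => be hb /=.
congr (_ *: _); rewrite lie_dg_ud linearZ /= (plus_ud F hb) -scalemxAl -scalemxAr !linearZ /=.
by rewrite !tr_ud !mxE; case: eqP => [->|]; case: eqP => [->|]; rewrite ?mulr0.
Qed.
(** For a diagonal matrix the adjoint action preserves the grading and no
ghost terms are left in the simple pole. *)
Lemma hJJ0 b : vprod 0 (hJ dg) (hJ b) = hJ (lie dg b).
Proof.
rewrite {2}/hJ -/(hJ) vprodDr (hJ_K0 0) vprod_sumr /hJ; congr (_ + _); apply: eq_bigr => al ha.
rewrite (hJ_ps 0) sact_dg // lie_dg_plus (bp_plus C) vprodZr lie_jac lie_dg_ud linearZ /=.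
have -> x c y : p (x - c *: y) = p x - c *: p y by rewrite (linearB p) linearZ.
by rewrite vprodBl vprodZl scaleNr.
Qed.
End Diag.

Hypothesis kn : k + n%:R != 0.
(** The coefficient of the third-order pole of the conformal vector with a
hatted current, that is its failure to be primary. *)
Definition sig b : F := - (2 * kap k levm b) +
  \sum_(al | pos al) (\tr (plus (lie b (ud al)) *m dd al) - 2 * \tr (plus (lie levm (lie b (ud al))) *m dd al)).
Lemma om_ps2 (j : nat) y z : vprod j.+2%:Z om (p y ## s z) =
  ((j == 0%N)%:R * (\tr (plus y *m z) - 2 * \tr (plus (lie levm y) *m z))) *: vac.
Proof.
rewrite (vcomm (om_even C) (bp_odd C y)) vsgnFl scale1r (om_s C kn j.+2) vprod0r add0r.
rewrite !big_ord_recl big1 ?addr0 => [|i _]; last by rewrite !lift0 (om_p C kn i.+3) vprod0l scaler0.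
rewrite !lift0 bin0 bin1 scale1r (om_p C kn 0) (om_p C kn 1) (om_p C kn 2) vprod0l scaler0 addr0 vT_mode_l vprodBl.
case: j => [|j].
  rewrite [nat_of_ord _]/= (_ : 2%:Z - 1 - 1%:Z = 0) // !bps0.
  by rewrite (_ : (2%:Z - 1)%:~R = 1 :> F) // eqxx mul1r; lmod.
rewrite [nat_of_ord _]/= (_ : j.+3%:Z - 1 - 1 = j.+1%:Z); last lia.
by rewrite !bps1 // subrr !scaler0 mul0r scale0r addr0.
Qed.
Lemma om_J2 (j : nat) b : vprod j.+2%:Z om (hJ b) = ((j == 0%N)%:R * sig b) *: vac.
Proof.
rewrite /hJ vprodDr vprod_sumr (om_K C kn j.+2).
under eq_bigr => al _ do rewrite om_ps2.
rewrite -scaler_suml -mulr_sumr; case: j => [|j].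
  by rewrite !mul1r -scalerDl /sig mulrN1 || rewrite !mul1r -scalerDl.
by rewrite !mul0r scale0r addr0.
Qed.
Lemma om_J3 b : vprod 3 om (hJ b) = 0.
Proof. by rewrite (om_J2 1) mul0r scale0r. Qed.
End Currents.
End HatCurrents.
Import HatCurrents.

(** * Contractions in conformal weight two *)
Module ContractionForms.
Section Expanded.
Variables (F : numFieldType) (V : vertexSuperAlgType F).
Lemma sum_ord2 (W : zmodType) (G : nat -> W) : \sum_(j < 2) G j = G 0%N + G 1%N.
Proof. by rewrite !big_ord_recl big_ord0 addr0. Qed.
Lemma sum_ord3 (W : zmodType) (G : nat -> W) : \sum_(j < 3) G j = G 0%N + G 1%N + G 2.
Proof. by rewrite !big_ord_recl big_ord0 addr0 !addrA. Qed.
Lemma sum_ord4 (W : zmodType) (G : nat -> W) : \sum_(j < 4) G j = G 0%N + G 1%N + G 2 + G 3.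
Proof. by rewrite !big_ord_recl big_ord0 addr0 !addrA. Qed.
Variables (q q' : bool) (a b : V).
Hypotheses (ha : vpar q a) (hb : vpar q' b).
Lemma vcomm_1 m c : vprod 1 a (vprod m b c) = vsgn F q q' *: vprod m b (vprod 1 a c) +
  (vprod (m + 1) (vprod 0 a b) c + vprod m (vprod 1 a b) c).
Proof.
rewrite (vcomm ha hb 1) (sum_ord2 (fun j => 'C(1, j)%:R *: vprod (1%N%:Z + m - j%:Z) (vprod j%:Z a b) c)).
rewrite !scale1r; congr (_ + (vprod _ _ _ + vprod _ _ _)); lia.
Qed.
Lemma vcomm_2 m c : vprod 2 a (vprod m b c) = vsgn F q q' *: vprod m b (vprod 2 a c) +
  (vprod (m + 2) (vprod 0 a b) c + 2 *: vprod (m + 1) (vprod 1 a b) c + vprod m (vprod 2 a b) c).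
Proof.
rewrite (vcomm ha hb 2) (sum_ord3 (fun j => 'C(2, j)%:R *: vprod (2%N%:Z + m - j%:Z) (vprod j%:Z a b) c)).
rewrite !scale1r; congr (_ + (vprod _ _ _ + _ *: vprod _ _ _ + vprod _ _ _)); lia.
Qed.
Lemma vcomm_3 m c : vprod 3 a (vprod m b c) = vsgn F q q' *: vprod m b (vprod 3 a c) +
  (vprod (m + 3) (vprod 0 a b) c + 3 *: vprod (m + 2) (vprod 1 a b) c + 3 *: vprod (m + 1) (vprod 2 a b) c
   + vprod m (vprod 3 a b) c).
Proof.
rewrite (vcomm ha hb 3) (sum_ord4 (fun j => 'C(3, j)%:R *: vprod (3%N%:Z + m - j%:Z) (vprod j%:Z a b) c)).
rewrite !scale1r; congr (_ + (vprod _ _ _ + _ *: vprod _ _ _ + _ *: vprod _ _ _ + vprod _ _ _)); lia.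
Qed.
End Expanded.

Section Twice.
Variables (F : numFieldType) (V : vertexSuperAlgType F) (J a b a' a2 : V) (ra rb r' r2 : F).
Hypotheses (Je : vpar false J) (ae : vpar false a) (ae' : vpar false a').
Hypotheses (J0a : vprod 0 J a = a') (J1a : vprod 1 J a = ra *: vac) (J1b : vprod 1 J b = rb *: vac).
Hypotheses (J0a' : vprod 0 J a' = a2) (J1a' : vprod 1 J a' = r' *: vac) (a2b : vprod 1 a2 b = r2 *: vac).
Lemma twice_prod : vprod 1 J (vprod 1 J (a ## b)) = (2 * (ra * rb) + r2) *: vac.
Proof.
rewrite (vcomm_1 Je ae) vsgnFl scale1r J1b vprodZr vprod_vac J0a J1a vprodZl vprod_vacl eqxx scale1r.
rewrite !vprodDr !vprodZr J1a J1b -[vprod (-1 + 1) _ _]/(vprod 0 a' b).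
rewrite (vcomm_1 Je ae') vsgnFl scale1r J1b vprodZr (vprod_vac_ge0 0) scaler0 add0r J0a' J1a'.
rewrite vprodZl vprod_vacl (_ : (0 == -1 :> int) = false) // scale0r scaler0 addr0.
by rewrite -[vprod (0 + 1) _ _]/(vprod 1 a2 b) a2b; lmod.
Qed.
Lemma twice_T : r' = 0 -> vprod 1 J (vprod 1 J (vT a)) = 0.
Proof.
move=> h; rewrite /vT (vcomm_1 Je ae) (vprod_vac_ge0 1) vprod0r scaler0 add0r.
rewrite J0a J1a vprodZl vprod_vacl (_ : (-2 == -1 :> int) = false) // scale0r scaler0 addr0.
by rewrite -[vprod (-2 + 1) _ _]/(vprod (-1) a' vac) vprod_vac J1a' h scale0r.
Qed.
Lemma twice_nop v r l : vprod 0 J J = 0 -> vprod 1 J J = l *: vac -> vprod 2 J J = 0 ->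
  (forall i : nat, (3 <= i)%N -> vprod i%:Z J v = 0) -> vprod 2 J v = r *: vac ->
  vprod 3 (J ## J) v = vprod 1 J (vprod 1 J v).
Proof.
move=> e0 e1 e2 h3 h2.
have h20 : vprod 2 J (vprod 0 J v) = 0.
  rewrite (vcomm_2 Je Je) vsgnFl scale1r h2 vprodZr (vprod_vac_ge0 0) scaler0 add0r.
  rewrite e0 e1 e2 !vprod0l addr0 add0r.
  by rewrite vprodZl vprod_vacl (_ : (0 + 1 == -1 :> int) = false) // scale0r !scaler0.
rewrite (vnop_fin Je Je (M := 3)) => [|i _|i i3]; last exact: h3.
  rewrite (sum_ord3 (fun i => vprod (-1 - i%:Z) J (vprod (3 + i%:Z) J v) + vsgn F false false *: vprod (3 - 1 - i%:Z) J (vprod i%:Z J v))).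
  have [h30 h31 h32] : [/\ vprod (3 + 0%:Z) J v = 0, vprod (3 + 1%:Z) J v = 0 & vprod (3 + 2%:Z) J v = 0].
    by split; [exact: (h3 3) | exact: (h3 4) | exact: (h3 5)].
  rewrite h30 h31 h32 !vprod0r !add0r vsgnFl !scale1r -[vprod (3 - 1 - 0%:Z) _ _]/(vprod 2 J (vprod 0 J v)) h20 add0r.
  by rewrite -[vprod (3 - 1 - 2%:Z) _ _]/(vprod 0 J (vprod 2 J v)) h2 vprodZr (vprod_vac_ge0 0) scaler0 addr0.
by rewrite -PoszD h3 //; lia.
Qed.
End Twice.

Section WeightTwo.
Variables (F : numFieldType) (V : vertexSuperAlgType F) (n : nat).
Variables (lev : 'I_n -> nat) (k : F) (C : brst_ops V lev k).
Variable f : 'M[F]_n.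
Hypothesis f_minus : minus lev f = f.
Hypothesis f_deg : forall i j, lev i != (lev j).+1 -> f j i = 0.
Hypothesis f_levm : lie (levm F lev) f = - f.
Hypothesis kn : k + n%:R != 0.
Local Notation M := 'M[F]_n.
Local Notation K := (bK C).
Local Notation p := (bp C).
Local Notation s := (bs C).
Local Notation plus := (plus lev).
Local Notation nonpos := (nonpos lev).
Local Notation pos := (pos lev).
Local Notation ud := (ud F).
Local Notation dd := (dd F).
Local Notation hJ := (hJ C).
Local Notation dv := (dv C f).
Local Notation om := (om C).
Local Notation levm := (levm F lev).
Local Notation hdeg := (hdeg lev).
Local Notation Psi := (Psi lev k).
Local Notation sig := (sig lev k).
Hypothesis fil_all : forall v, exists q, fil C q v.
Implicit Types (a b c x y z w : M).

Lemma om0_J a : vprod 0 om (hJ a) = vT (hJ a).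
Proof. exact: (om0T kn fil_all). Qed.
Lemma om1_J a : hdeg 0 a -> vprod 1 om (hJ a) = hJ a.
Proof. by move=> [_ h]; have [_] := hm_J kn fil_all h; rewrite /L0 => ->; rewrite scale1r. Qed.

Lemma om3_JJ a b : hdeg 0 a -> vprod 3 om (hJ a ## hJ b) = Psi a b *: vac.
Proof.
move=> ha; rewrite (vcomm_3 (om_even C) (hJ_even C a)) (om_J3 C kn) vprod0r scaler0 add0r.
rewrite om0_J (om1_J ha) (om_J2 C kn 0) (om_J3 C kn) vT_mode_l !vprodZl vprod_vacl vprod0l addr0.
by rewrite -[vprod (-1 + 3 - 1) _ _]/(vprod 1 (hJ a) (hJ b)) -[vprod (-1 + 2) _ _]/(vprod 1 (hJ a) (hJ b))
  (hJJ1 C 0 a b) mul1r (_ : (-1 + 3)%:~R = 2 :> F) // (_ : (-1 + 1 == -1) = false) // scale0r; lmod.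
Qed.
Lemma om3_TJ b : hdeg 0 b -> vprod 3 om (vT (hJ b)) = (3 * sig b) *: vac.
Proof.
move=> hb; rewrite /vT (vcomm_3 (om_even C) (hJ_even C b)) (vprod_vac_ge0 3) vprod0r scaler0 add0r.
rewrite om0_J (om1_J hb) (om_J2 C kn 0) (om_J3 C kn) vprodZl vprod0l addr0.
rewrite -[vprod (-2 + 3) _ _]/(vprod 1%N (vT (hJ b)) vac) -[vprod (-2 + 2) _ _]/(vprod 0%N (hJ b) vac).
rewrite !vprod_vac_ge0 scaler0 !add0r -[vprod (-2 + 1) _ _]/(vprod (-1) vac vac).
by rewrite vprod_vac scalerA mul1r.
Qed.

Section Diag.
Variable t : 'I_n -> F.
Local Notation j := (dg t).
Let J := hJ j.
Lemma hJ1 x y : vprod 1 (hJ x) (hJ y) = Psi x y *: vac.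
Proof. by rewrite (hJJ1 C 0 x y) mul1r. Qed.
Lemma JJ_JJ a b : vprod 1 J (vprod 1 J (hJ a ## hJ b)) = (2 * (Psi j a * Psi j b) + Psi (lie j (lie j a)) b) *: vac.
Proof.
exact: (twice_prod (hJ_even C j) (hJ_even C a) (hJ_even C (lie j a)) (hJJ0 C t a) (hJ1 j a) (hJ1 j b)
  (hJJ0 C t (lie j a)) (hJ1 j (lie j a)) (hJ1 (lie j (lie j a)) b)).
Qed.
Lemma JJ_TJ b : Psi j (lie j b) = 0 -> vprod 1 J (vprod 1 J (vT (hJ b))) = 0.
Proof. exact: (twice_T (hJ_even C j) (hJ_even C b) (hJJ0 C t b) (hJ1 j b) (hJ1 j (lie j b))). Qed.
Lemma JJ_J c : Psi j c = 0 -> vprod 1 J (vprod 1 J (hJ c)) = 0.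
Proof. by move=> h; rewrite hJ1 h scale0r vprod0r. Qed.
Lemma JJ3 v r : (forall i : nat, (3 <= i)%N -> vprod i%:Z J v = 0) -> vprod 2 J v = r *: vac ->
  vprod 3 (J ## J) v = vprod 1 J (vprod 1 J v).
Proof.
apply: (twice_nop (hJ_even C j) (l := Psi j j)); last 2 first.
- exact: hJ1.
- by rewrite (hJJ1 C 1 j j) mul0r scale0r.
by rewrite /J (hJJ0 C t j) /lie subrr linear0.
Qed.
End Diag.

Lemma p_J a u : vprod 0 (p u) (hJ a) = - p (lie a (plus u)).
Proof.
have [K0 h] := vskew (hJ_even C a) (bp_odd C u) 0; rewrite (h K0.+1) // big_ord_recl big1 => [|i _].
  rewrite expr0 scale1r !addr0 hJ_p0 scale1r vprod_vac expr0z mulr1 vsgnFl scaleN1r //.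
by rewrite add0r (hJ_p0 C i.+1) scale0r vprod0l scaler0.
Qed.
Lemma s_J a z : vprod 0 (s z) (hJ a) = - sact C a z.
Proof.
have [K0 h] := vskew (hJ_even C a) (bs_odd C z) 0; rewrite (h K0.+1) // big_ord_recl big1 => [|i _].
  rewrite expr0 scale1r !addr0 hJ_s0 scale1r vprod_vac expr0z mulr1 vsgnFl scaleN1r //.
by rewrite add0r (hJ_s0 C i.+1) scale0r vprod0l scaler0.
Qed.
(** Iterated residues that extract one coefficient of s y ## hJ b; they kill s
w and its derivative. *)
Definition tau u z u2 (v : V) := vprod 0 (p u2) (vprod 0 (s z) (vprod 0 (p u) v)).
Lemma tau_s u z u2 w : tau u z u2 (s w) = 0.
Proof. by rewrite /tau bps0 !vprodZr (vprod_vac_ge0 0) vprod0r scaler0. Qed.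
Lemma tau_Ts u z u2 w : tau u z u2 (vT (s w)) = 0.
Proof.
rewrite /tau {1}/vT (vcomm0 (bp_odd C u) (bs_odd C w)) (vprod_vac_ge0 0) vprod0r scaler0 add0r bps0.
by rewrite vprodZl vprod_vacl (_ : (-2 == -1 :> int) = false) // scale0r scaler0 !vprod0r.
Qed.
Lemma sact_lin al b w : pos al -> \sum_(be | pos be) \tr (plus (lie b (ud be)) *m w) * \tr (ud al *m dd be)
  = \tr (plus (lie b (ud al)) *m w).
Proof.
move=> h; rewrite (bigD1 al) //= big1 => [|be /andP[_ ne]].
  by rewrite tr_ud mxE !eqxx mulr1 addr0.
rewrite tr_ud mxE; case: eqP => [e1|]; case: eqP => [e2|]; rewrite ?mulr0 //.
by move: ne; rewrite (_ : be = al) ?eqxx //; case: (be) e1 e2 => [? ?]; case: (al) => ? ? /= -> ->.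
Qed.
Lemma tau_sJ al al2 z y b : pos al -> pos al2 -> \tr (plus (lie b (ud al)) *m z) = 0 ->
  tau (ud al) z (ud al2) (s y ## hJ b) = (y al.2 al.1 * \tr (plus (lie b (ud al2)) *m z)) *: vac.
Proof.
move=> ha ha2 h0; rewrite /tau (vcomm0 (bp_odd C _) (bs_odd C y)) bps0 vsgnT p_J (plus_ud F ha) vprodZl.
rewrite vprod_vacl eqxx scale1r tr_ud vprodNr scaleN1r opprK !vprodDr !vprodZr s_J.
rewrite (vcomm0 (bs_odd C z) (bs_odd C y)) (bss C _ _ 0) vprod0l addr0 sp0 h0 scale0r vprod0r scaler0 vprod0r add0r.
rewrite /sact opprK vprod_sumr; under eq_bigr => be _ do rewrite vprodZr bps0 (plus_ud F ha2) scalerA.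
by rewrite -scaler_suml scalerA sact_lin.
Qed.
(** The contraction that sees the derivative of s w, and not the products s y
## hJ b. *)
Definition ptwo u (v : V) := vprod 1 (p u) v.
Lemma ptwo_s u w : ptwo u (s w) = 0. Proof. exact: bps1. Qed.
Lemma ptwo_Ts u w : ptwo u (vT (s w)) = \tr (plus u *m w) *: vac.
Proof.
rewrite /ptwo /vT (vcomm_1 (bp_odd C u) (bs_odd C w)) (vprod_vac_ge0 1) vprod0r scaler0 add0r.
rewrite bps0 (bps1 C _ _ (j := 1)) // vprod0l addr0.
by rewrite -[vprod (-2 + 1) _ _]/(vprod (-1) _ vac) vprod_vac.
Qed.
Lemma p_J1 a u (i : nat) : vprod i.+1%:Z (p u) (hJ a) = 0.
Proof.
have [K0 h] := vskew (hJ_even C a) (bp_odd C u) i.+1%:Z; rewrite (h K0) // big1 ?scaler0 // => j _.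
by rewrite -PoszD (hJ_p0 C (i.+1 + j)) scale0r vprod0l scaler0.
Qed.
Lemma ptwo_sJ u y b : ptwo u (s y ## hJ b) = 0.
Proof.
rewrite /ptwo (vcomm_1 (bp_odd C u) (bs_odd C y)) (p_J1 b u 0) vprod0r scaler0 add0r.
rewrite bps0 (bps1 C _ _ (j := 1)) // vprod0l addr0.
by rewrite vprodZl vprod_vacl scale0r scaler0.
Qed.

Lemma lie_udE b al i j : lie b (ud al) i j = b i al.1 * (j == al.2)%:R - (i == al.1)%:R * b al.2 j.
Proof.
rewrite /lie !mxE; congr (_ - _).
  rewrite (bigD1 al.1) //= big1 ?addr0 => [|l ne]; last by rewrite mxE (negbTE ne) mulr0.
  by rewrite mxE eqxx.
rewrite (bigD1 al.2) //= big1 ?addr0 => [|l ne]; last by rewrite mxE (negbTE ne) andbF mul0r.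
by rewrite mxE eqxx andbT.
Qed.
Lemma tr_plus_dd x al : pos al -> \tr (plus x *m dd al) = x al.1 al.2.
Proof. by move=> h; rewrite mxtrace_mulC tr_dd mxE (h : (lev al.2 < lev al.1)%N). Qed.
Lemma PsiE a b : Psi a b = kap k a b + \sum_(al | pos al)
  (\sum_j a al.1 j * (if (lev al.2 < lev j)%N then b j al.1 - (j == al.1)%:R * b al.2 al.2 else 0)
  - \sum_j (if (lev j < lev al.1)%N then b al.1 al.1 * (j == al.2)%:R - b al.2 j else 0) * a j al.2).
Proof.
congr (_ + _); apply: eq_bigr => al h; rewrite (tr_plus_dd _ h).
rewrite /(lie a) mxE [X in _ + X]mxE !mxE; congr (_ - _).
  by apply: eq_bigr => j _; rewrite mxE lie_udE eqxx mulr1.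
by apply: eq_bigr => j _; rewrite mxE lie_udE eqxx mul1r.
Qed.
Lemma sigE b : sig b = - (2 * kap k levm b) + \sum_(al | pos al)
   (1 - 2 * ((lev al.1)%:R - (lev al.2)%:R)) * (b al.1 al.1 - b al.2 al.2).
Proof.
rewrite /HatCurrents.sig; congr (_ + _); apply: eq_bigr => al h.
by rewrite !(tr_plus_dd _ h) lie_levmE lie_udE !eqxx /=; ring.
Qed.
Lemma tr_plus_E b al al' : \tr (plus (lie b (ud al)) *m ud al') =
  if (lev al'.1 < lev al'.2)%N then b al'.2 al.1 * (al'.1 == al.2)%:R - (al'.2 == al.1)%:R * b al.2 al'.1 else 0.
Proof. by rewrite mxtrace_mulC tr_ud mxE lie_udE. Qed.
Lemma tr_plus_gen b al y : \tr (plus (lie b (ud al)) *m y) =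
  \sum_i (if (lev al.2 < lev i)%N then b i al.1 * y al.2 i else 0) -
  \sum_j (if (lev j < lev al.1)%N then b al.2 j * y j al.1 else 0).
Proof.
rewrite /mxtrace; under eq_bigr => i _ do rewrite mxE.
under eq_bigr => i _ do under eq_bigr => j _ do rewrite mxE lie_udE.
have -> : \sum_i \sum_j (if (lev j < lev i)%N then b i al.1 * (j == al.2)%:R - (i == al.1)%:R * b al.2 j else 0) * y j i
  = \sum_i \sum_j (if (lev j < lev i)%N then b i al.1 * (j == al.2)%:R * y j i else 0) -
    \sum_i \sum_j (if (lev j < lev i)%N then (i == al.1)%:R * b al.2 j * y j i else 0).
  rewrite -sumrB; apply: eq_bigr => i _; rewrite -sumrB; apply: eq_bigr => j _.
  by case: ifP => _; rewrite ?mul0r ?subrr // mulrBl.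
congr (_ - _).
  apply: eq_bigr => i _; rewrite (bigD1 al.2) //= big1 ?addr0 ?eqxx ?mulr1 // => j /negbTE ->.
  by rewrite mulr0 mul0r; case: ifP.
rewrite (bigD1 al.1) //= [X in _ + X]big1 ?addr0 => [|i /negbTE ne]; last first.
  by apply: big1 => j _; rewrite ne !mul0r; case: ifP.
by apply: eq_bigr => j _; rewrite eqxx mul1r.
Qed.
End WeightTwo.
End ContractionForms.
Import ContractionForms.

(** * The weight-one cocycle and the coset vector in type (4,2) *)
Module HeisenbergField.
Section Concrete.
Variable F : numFieldType.
Local Notation M := 'M[F]_6.
Definition o0 : 'I_6 := @Ordinal 6 0 isT.
Definition o1 : 'I_6 := @Ordinal 6 1 isT.
Definition o2 : 'I_6 := @Ordinal 6 2 isT.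
Definition o3 : 'I_6 := @Ordinal 6 3 isT.
Definition o4 : 'I_6 := @Ordinal 6 4 isT.
Definition o5 : 'I_6 := @Ordinal 6 5 isT.
(** The degrees of the basis vectors, shifted so that both Jordan blocks have
consecutive levels and the difference of two levels is the degree for h/2. *)
Definition lev6 (i : 'I_6) : nat := nth 0%N [:: 3; 2; 1; 0; 2; 1]%N i.
(** The sum of the matrix units that lower the level by one inside each block:
3 -> 2 -> 1 -> 0 on the first four basis vectors and 2 -> 1 on the last two.
The default value 9 marks the end of a block. *)
Definition f0 : M := \matrix_(i, j) (nat_of_ord i == nth 9 [:: 1; 2; 3; 9; 5; 9]%N j)%:R.
(** The eigenvalues of the generator of the centralizer of f0: constant on
each block and of trace zero. *)
Definition t6 (i : 'I_6) : F := nth 0 [:: 1; 1; 1; 1; -2; -2] i.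

Lemma ord6P (P : 'I_6 -> Prop) : P o0 -> P o1 -> P o2 -> P o3 -> P o4 -> P o5 -> forall i, P i.
Proof.
move=> h0 h1 h2 h3 h4 h5 [m hm].
case: m hm => [|[|[|[|[|[|m]]]]]] hm //.
- by rewrite (_ : Ordinal hm = o0) //; apply: val_inj.
- by rewrite (_ : Ordinal hm = o1) //; apply: val_inj.
- by rewrite (_ : Ordinal hm = o2) //; apply: val_inj.
- by rewrite (_ : Ordinal hm = o3) //; apply: val_inj.
- by rewrite (_ : Ordinal hm = o4) //; apply: val_inj.
- by rewrite (_ : Ordinal hm = o5) //; apply: val_inj.
Qed.
Lemma sum6 (W : zmodType) (G : 'I_6 -> W) : \sum_i G i = G o0 + G o1 + G o2 + G o3 + G o4 + G o5.
Proof.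
rewrite !big_ord_recl big_ord0 addr0 !addrA.
by congr (G _ + G _ + G _ + G _ + G _ + G _); apply: val_inj.
Qed.
Lemma sumpos6 (W : zmodType) (G : ip 6 -> W) : \sum_(al | pos lev6 al) G al =
  G (o0, o1) + G (o0, o2) + G (o0, o3) + G (o0, o4) + G (o0, o5) + G (o1, o2) + G (o1, o3) + G (o1, o5)
  + G (o2, o3) + G (o4, o2) + G (o4, o3) + G (o4, o5) + G (o5, o3).
Proof.
transitivity (\sum_i \sum_j (if pos lev6 (i, j) then G (i, j) else 0)).
  by rewrite pair_bigA big_mkcond; apply: eq_bigr => -[i j] _.
by rewrite sum6 !sum6 /pos /lev6 /= !(addr0, add0r) !addrA.
Qed.

Lemma f0_deg i j : lev6 i != (lev6 j).+1 -> f0 j i = 0.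
Proof. by move: i j; apply: ord6P; apply: ord6P; rewrite !mxE /lev6 /=. Qed.
Lemma f0_minus : minus lev6 f0 = f0.
Proof. by apply/matrixP; apply: ord6P; apply: ord6P; rewrite !mxE /lev6 /=. Qed.
Lemma f0_levm : lie (levm F lev6) f0 = - f0.
Proof.
apply/matrixP => i j; rewrite lie_levmE [RHS]mxE.
have [e|ne] := eqVneq (lev6 j) (lev6 i).+1; last by rewrite f0_deg // mulr0 oppr0.
by rewrite e -natr1; ring.
Qed.

Definition blk (a : M) := forall i j, lev6 i != lev6 j -> a i j = 0.
Lemma blk_hdeg a : hdeg lev6 0 a -> blk a.
Proof.
move=> [_ h] i j ne; move/matrixP/(_ i j): h.
rewrite lie_levmE oppr0 scale0r mxE => /eqP; rewrite mulf_eq0 => /orP[|/eqP //].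
by rewrite subr_eq0 eqr_nat (negbTE ne).
Qed.
Lemma hdeg1_entry (c : M) i j : hdeg lev6 1 c -> (lev6 i).+1 != lev6 j -> c i j = 0.
Proof.
move=> [_ h] ne; move/matrixP/(_ i j): h; rewrite lie_levmE mxE => /eqP.
rewrite -subr_eq0 -mulrBl mulf_eq0 => /orP[|/eqP //].
by rewrite mulrN1z opprK addrAC natr1 subr_eq0 eqr_nat (negbTE ne).
Qed.
Definition lief0 (a : M) (i j : 'I_6) : F :=
  (if nat_of_ord i is 1 then a o0 j else if nat_of_ord i is 2 then a o1 j else
   if nat_of_ord i is 3 then a o2 j else if nat_of_ord i is 5 then a o4 j else 0) -
  (if nat_of_ord j is 0 then a i o1 else if nat_of_ord j is 1 then a i o2 else
   if nat_of_ord j is 2 then a i o3 else if nat_of_ord j is 4 then a i o5 else 0).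
Lemma lie_f0E a i j : lie f0 a i j = lief0 a i j.
Proof.
have -> : lie f0 a i j = (f0 *m a) i j - (a *m f0) i j by rewrite /lie mxE [X in _ + X]mxE.
rewrite 2!mxE !sum6 /lief0; congr (_ - _).
  by move: i; apply: ord6P; rewrite !mxE /= ?mul0r ?mul1r ?(addr0, add0r).
by move: j; apply: ord6P; rewrite !mxE /= ?mulr0 ?mulr1 ?(addr0, add0r).
Qed.

Variables (V : vertexSuperAlgType F) (k : F) (C : brst_ops V lev6 k).
Hypothesis kn : k + 6%:R != 0.
Local Notation p := (bp C).
Local Notation s := (bs C).
Local Notation ud := (ud F).
Local Notation dd := (dd F).
Local Notation hJ := (hJ C).
Local Notation dv := (dv C f0).
Local Notation om := (om C).
Local Notation Psi := (Psi lev6 k).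
Local Notation sig := (sig lev6 k).
Hypothesis fil_all : forall v, exists q, fil C q v.
Local Notation jm := (dg t6).
Definition J0 := hJ jm.

Lemma dgE i j : jm i j = t6 i *+ (i == j).
Proof. by rewrite !mxE. Qed.
Lemma jm_hdeg : hdeg lev6 0 jm.
Proof.
split; apply/matrixP => i j.
  by rewrite mxE [RHS]mxE dgE; case: ifP => // lt; case: eqP => // e; move: lt; rewrite e ltnn.
rewrite lie_levmE [RHS]mxE dgE oppr0 mul0r; have [->|_] := eqVneq i j; last by rewrite mulr0.
by rewrite subrr mul0r.
Qed.

Definition PsiS (a b : M) : F := \sum_(al | pos lev6 al) (\sum_j a al.1 j * b j al.1 + \sum_j b al.2 j * a j al.2
   - a al.1 al.1 * b al.2 al.2 - b al.1 al.1 * a al.2 al.2).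
Lemma Psi_blk a b : blk a -> Psi a b = kap k a b + PsiS a b.
Proof.
move=> ha; rewrite PsiE; congr (_ + _); apply: eq_bigr => al hal.
have lt : (lev6 al.2 < lev6 al.1)%N by exact: hal.
have -> : \sum_j a al.1 j * (if (lev6 al.2 < lev6 j)%N then b j al.1 - (j == al.1)%:R * b al.2 al.2 else 0) =
   \sum_j a al.1 j * b j al.1 - a al.1 al.1 * b al.2 al.2.
  have -> : a al.1 al.1 * b al.2 al.2 = \sum_j a al.1 j * ((j == al.1)%:R * b al.2 al.2).
    by rewrite (bigD1 al.1) //= big1 ?addr0 ?eqxx ?mul1r // => j /negbTE ->; rewrite mul0r mulr0.
  rewrite -sumrB; apply: eq_bigr => j _; rewrite -mulrBr.
  by have [e|ne] := eqVneq (lev6 al.1) (lev6 j); [rewrite -e lt | rewrite ha ?mul0r].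
have -> : \sum_j (if (lev6 j < lev6 al.1)%N then b al.1 al.1 * (j == al.2)%:R - b al.2 j else 0) * a j al.2 =
   b al.1 al.1 * a al.2 al.2 - \sum_j b al.2 j * a j al.2.
  have -> : b al.1 al.1 * a al.2 al.2 = \sum_j (b al.1 al.1 * (j == al.2)%:R) * a j al.2.
    by rewrite (bigD1 al.2) //= big1 ?addr0 ?eqxx ?mulr1 // => j /negbTE ->; rewrite mulr0 mul0r.
  rewrite -sumrB; apply: eq_bigr => j _; rewrite -mulrBl.
  by have [e|ne] := eqVneq (lev6 j) (lev6 al.2); [rewrite e lt | rewrite (ha _ _ ne) !mulr0].
by ring.
Qed.

Definition T6 (u z u2 : ip 6) (v : V) := tau C (ud u) (ud z) (ud u2) v.
Definition good (u z u2 : ip 6) := [&& lev6 u.1 == (lev6 u.2).+1, pos lev6 u2 & ((lev6 z.1).+2 <= lev6 z.2)%N].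
Definition x6 (x : M) (z u2 : ip 6) : F := x z.2 u2.1 * (z.1 == u2.2)%:R - (z.2 == u2.1)%:R * x u2.2 z.1.
Lemma T6_sJ u z u2 (y x : M) : good u z u2 -> blk x -> T6 u z u2 (s y ## hJ x) = (y u.2 u.1 * x6 x z u2) *: vac.
Proof.
case/and3P=> /eqP h1 h2 h3 hx.
have hz : (lev6 z.1 < lev6 z.2)%N by lia.
rewrite /T6 tau_sJ //; last 2 first.
- by rewrite /pos h1.
- rewrite tr_plus_E hz.
  have [e|_] := eqVneq z.1 u.2; have [e'|_] := eqVneq z.2 u.1; rewrite ?mulr0 ?mul0r ?subr0 //.
  + by move: h3; rewrite e e' h1 ltnn.
  + by rewrite hx ?mul0r //; move: h3; rewrite e; lia.
  + by rewrite hx ?mulr0 ?subr0 //; move: h3; rewrite e'; lia.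
by rewrite tr_plus_E hz.
Qed.

(** The coefficients and residues of the functional [Fop] on the products s y
## hJ x. They solve the linear system which says that the pairing with the
coset vector at level -13/3 factors through the differential; at any other
level the cocycle of [omt_W2] rules out a solution. *)
Definition Lf : seq (F * ip 6 * ip 6 * ip 6) := [::
  (5 / 3, (o0, o1), (o3, o0), (o0, o3)); (- (5 / 3), (o0, o1), (o2, o0), (o0, o2));
  (1 / 2, (o1, o2), (o5, o0), (o0, o5)); (1 / 4, (o1, o2), (o3, o1), (o1, o3));
  (1 / 12, (o1, o2), (o3, o0), (o0, o3)); (1 / 4, (o1, o2), (o2, o0), (o0, o2));
  (1 / 2, (o1, o2), (o3, o4), (o4, o3)); (5 / 12, (o4, o2), (o3, o4), (o1, o3));
  (5 / 6, (o5, o3), (o3, o4), (o1, o3)); (1, (o1, o5), (o3, o1), (o4, o3));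
  (17 / 12, (o1, o5), (o5, o0), (o0, o2)); (2 / 3, (o4, o5), (o5, o0), (o0, o5));
  (- (2 / 3), (o4, o5), (o3, o0), (o0, o3)); (2 / 3, (o4, o5), (o3, o4), (o4, o3))].
(** A linear functional on the values of the differential: iterated residues
for the products s y ## hJ x, together with two contractions for the
derivatives of s w. *)
Definition Fop (v : V) : V := \sum_(q <- Lf) q.1.1.1 *: T6 q.1.1.2 q.1.2 q.2 v +
   ptwo C (ud (o1, o2)) v + ptwo C (ud (o4, o5)) v.
Definition phiF (y x : M) : F := \sum_(q <- Lf) q.1.1.1 * (y q.1.1.2.2 q.1.1.2.1 * x6 x q.1.2 q.2).
Lemma Lf_good : all (fun q => good q.1.1.2 q.1.2 q.2) Lf.
Proof. by []. Qed.
Lemma Fop_lin c (u v : V) : Fop (c *: u + v) = c *: Fop u + Fop v.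
Proof.
rewrite /Fop /ptwo !vprod_linearr.
have -> : \sum_(q <- Lf) q.1.1.1 *: T6 q.1.1.2 q.1.2 q.2 (c *: u + v) =
   c *: (\sum_(q <- Lf) q.1.1.1 *: T6 q.1.1.2 q.1.2 q.2 u) + \sum_(q <- Lf) q.1.1.1 *: T6 q.1.1.2 q.1.2 q.2 v.
  by rewrite scaler_sumr -big_split; apply: eq_bigr => q _ /=; rewrite /T6 /tau !vprod_linearr; lmod.
by lmod.
Qed.
Lemma Fop0 : Fop 0 = 0.
Proof. by have := Fop_lin 1 0 0; rewrite !scale1r addr0 => /eqP; rewrite -subr_eq subrr eq_sym => /eqP. Qed.
Lemma FopD u v : Fop (u + v) = Fop u + Fop v. Proof. by rewrite -[u]scale1r Fop_lin !scale1r. Qed.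
Lemma FopZ c v : Fop (c *: v) = c *: Fop v. Proof. by rewrite -[c *: v]addr0 Fop_lin Fop0 addr0. Qed.
Lemma FopN v : Fop (- v) = - Fop v. Proof. by rewrite -scaleN1r FopZ scaleN1r. Qed.
Lemma Fop_sum I (r : seq I) (P : pred I) g : Fop (\sum_(i <- r | P i) g i) = \sum_(i <- r | P i) Fop (g i).
Proof. exact: (big_morph Fop FopD Fop0). Qed.
Lemma Fop_s w : Fop (s w) = 0.
Proof. by rewrite /Fop big1 => [|q _]; rewrite ?ptwo_s ?addr0 // /T6 tau_s scaler0. Qed.
Lemma Fop_Ts w : Fop (vT (s w)) = (w o2 o1 + w o5 o4) *: vac.
Proof.
rewrite /Fop big1 => [|q _]; last by rewrite /T6 tau_Ts scaler0.
by rewrite add0r !ptwo_Ts !plus_ud // !tr_ud scalerDl.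
Qed.
Lemma Fop_sJ y x : blk x -> Fop (s y ## hJ x) = phiF y x *: vac.
Proof.
move=> hx; rewrite /Fop !ptwo_sJ !addr0 /phiF scaler_suml big_seq [RHS]big_seq; apply: eq_bigr => q hq.
by rewrite T6_sJ ?scalerA //; have /allP := Lf_good; apply.
Qed.

(** The pairs of indices of distinct levels: a block matrix vanishes there. *)
Ltac z6 h := rewrite ?(h o0 o1 isT) ?(h o0 o2 isT) ?(h o0 o3 isT) ?(h o0 o4 isT) ?(h o0 o5 isT)
  ?(h o1 o0 isT) ?(h o1 o2 isT) ?(h o1 o3 isT) ?(h o1 o5 isT) ?(h o2 o0 isT) ?(h o2 o1 isT) ?(h o2 o3 isT) ?(h o2 o4 isT)
  ?(h o3 o0 isT) ?(h o3 o1 isT) ?(h o3 o2 isT) ?(h o3 o4 isT) ?(h o3 o5 isT) ?(h o4 o0 isT) ?(h o4 o2 isT) ?(h o4 o3 isT) ?(h o4 o5 isT)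
  ?(h o5 o0 isT) ?(h o5 o1 isT) ?(h o5 o3 isT) ?(h o5 o4 isT).
(** The pairs (i, j) for which the level of j is not one more than that of i:
a matrix of degree -1 vanishes there. *)
Ltac n6 h := rewrite ?(h o0 o0 isT) ?(h o0 o1 isT) ?(h o0 o2 isT) ?(h o0 o3 isT) ?(h o0 o4 isT) ?(h o0 o5 isT)
  ?(h o1 o1 isT) ?(h o1 o2 isT) ?(h o1 o3 isT) ?(h o1 o4 isT) ?(h o1 o5 isT)
  ?(h o2 o0 isT) ?(h o2 o2 isT) ?(h o2 o3 isT) ?(h o2 o5 isT)
  ?(h o3 o0 isT) ?(h o3 o1 isT) ?(h o3 o3 isT) ?(h o3 o4 isT)
  ?(h o4 o1 isT) ?(h o4 o2 isT) ?(h o4 o3 isT) ?(h o4 o4 isT) ?(h o4 o5 isT)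
  ?(h o5 o0 isT) ?(h o5 o2 isT) ?(h o5 o3 isT) ?(h o5 o5 isT).

Lemma tr6 (a b : M) : \tr (a *m b) = \sum_i \sum_j a i j * b j i.
Proof. by rewrite /mxtrace; apply: eq_bigr => i _; rewrite mxE. Qed.
Lemma trc6 (a : M) : \tr a = a o0 o0 + a o1 o1 + a o2 o2 + a o3 o3 + a o4 o4 + a o5 o5.
Proof. by rewrite /mxtrace sum6. Qed.

(** On block matrices the trace form of the hatted currents is a polynomial in
the entries, obtained by expanding the sum over the positive pairs. *)
Lemma Psi_poly (a b : M) : blk a -> blk b -> Psi a b =
  k * (a o0 o0 * b o0 o0 + a o1 o1 * b o1 o1 + a o1 o4 * b o4 o1 + a o4 o1 * b o1 o4 + a o4 o4 * b o4 o4
     + a o2 o2 * b o2 o2 + a o2 o5 * b o5 o2 + a o5 o2 * b o2 o5 + a o5 o5 * b o5 o5 + a o3 o3 * b o3 o3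
     - (a o0 o0 + a o1 o1 + a o2 o2 + a o3 o3 + a o4 o4 + a o5 o5) * (b o0 o0 + b o1 o1 + b o2 o2 + b o3 o3 + b o4 o4 + b o5 o5) / 6%:R)
  + (5 * a o0 o0 * b o0 o0 + 5 * a o3 o3 * b o3 o3
     + 4 * (a o1 o1 * b o1 o1 + a o1 o4 * b o4 o1 + a o4 o1 * b o1 o4 + a o4 o4 * b o4 o4)
     + 4 * (a o2 o2 * b o2 o2 + a o2 o5 * b o5 o2 + a o5 o2 * b o2 o5 + a o5 o5 * b o5 o5)
     - a o0 o0 * (b o1 o1 + b o4 o4 + b o2 o2 + b o5 o5 + b o3 o3) - b o0 o0 * (a o1 o1 + a o4 o4 + a o2 o2 + a o5 o5 + a o3 o3)
     - (a o1 o1 + a o4 o4) * (b o2 o2 + b o5 o5 + b o3 o3) - (b o1 o1 + b o4 o4) * (a o2 o2 + a o5 o5 + a o3 o3)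
     - (a o2 o2 + a o5 o5) * b o3 o3 - (b o2 o2 + b o5 o5) * a o3 o3).
Proof.
move=> ha hb; rewrite Psi_blk // /kap /PsiS sumpos6 !sum6 /= tr6 sum6 !sum6 !trc6.
by z6 ha; z6 hb; ring.
Qed.

Lemma blk_jm : blk jm. Proof. exact: blk_hdeg jm_hdeg. Qed.
Lemma blk_lie_jm a : blk a -> blk (lie jm a).
Proof. by move=> ha i j ne; rewrite lie_dgE ha ?mulr0. Qed.
Lemma Psi_jm a : blk a -> Psi jm a = (k + 6) * (a o0 o0 + a o3 o3) + (k + 3) * (a o1 o1 + a o2 o2) - (2 * k + 9) * (a o4 o4 + a o5 o5).
Proof.
move=> ha; rewrite Psi_poly //; last exact: blk_jm.
by rewrite !dgE /t6 /= -?val_eqE /=; field.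
Qed.

Variable r : F.
Hypothesis hr : (24 * k + 108) * r = 1.
(** The coset vector: for r the inverse of twice the level of J0, the second
term is the conformal vector of the Heisenberg field J0. *)
Definition omt : V := om - r *: (J0 ## J0).

Lemma J0_modes (b : M) (i : nat) : vprod i.+2%:Z J0 (hJ b) = 0.
Proof. by rewrite (hJJ1 C i.+1 jm b) mul0r scale0r. Qed.
Lemma J0_hJ2 (b : M) (j : nat) : (2 <= j)%N -> vprod j%:Z J0 (hJ b) = 0.
Proof. by case: j => [|[|j]] // _; exact: J0_modes. Qed.
Let Je := hJ_even C jm.
Lemma J0_JJ (a b : M) (i : nat) : vprod i.+2%:Z J0 (hJ a ## hJ b) = ((i == 0%N)%:R * Psi (lie jm a) b) *: vac.
Proof.
rewrite (vcomm2 Je (hJ_even C a) (J0_hJ2 a)) J0_modes vprod0r scaler0 add0r (hJJ0 C t6 a) (hJ1 C jm a).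
rewrite vprodZl vprod_vacl (_ : (i.+2%:Z + -1 - 1 == -1) = false) ?scale0r ?scaler0 ?addr0; last lia.
by rewrite (_ : i.+2%:Z + -1 = i.+1%:Z); [exact: (hJJ1 C i (lie jm a) b) | lia].
Qed.
Lemma J0_TJ (b : M) (i : nat) : exists t, vprod i.+2%:Z J0 (vT (hJ b)) = ((i == 0%N)%:R * t) *: vac.
Proof.
exists (2 * Psi jm b).
rewrite /vT (vcomm2 Je (hJ_even C b) (J0_hJ2 b)) vprod_vac_ge0 vprod0r scaler0 add0r (hJJ0 C t6 b) (hJ1 C jm b).
rewrite (_ : i.+2%:Z - 2 = i%:Z); last lia.
rewrite vprod_vac_ge0 add0r vprodZl vprod_vacl (_ : (i%:Z - 1 == -1) = (i == 0%N)); last lia.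
by case: i => [|i]; rewrite ?mul1r ?scale1r ?mul0r ?scale0r ?scaler0 // scalerA.
Qed.

(** The vector omt pairs with two currents as the conformal vector does,
corrected by the double contraction with J0. *)
Lemma omt_JJ (a b : M) : hdeg lev6 0 a -> hdeg lev6 0 b -> vprod 3 omt (hJ a ## hJ b) =
  (Psi a b - r * (2 * (Psi jm a * Psi jm b) + Psi (lie jm (lie jm a)) b)) *: vac.
Proof.
move=> ha hb; rewrite /omt vprodBl vprodZl (om3_JJ kn fil_all) // /J0.
rewrite (JJ3 (r := Psi (lie jm a) b)).
- by rewrite (JJ_JJ C t6 a b) scalerA -scalerBl.
- by case=> [|[|[|i]]] // _; rewrite (J0_JJ a b i.+1) mul0r scale0r.
- by rewrite (J0_JJ a b 0) mul1r.
Qed.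
Lemma omt_TJ (b : M) : hdeg lev6 0 b -> vprod 3 omt (vT (hJ b)) = (3 * sig b) *: vac.
Proof.
move=> hb; rewrite /omt vprodBl vprodZl (om3_TJ kn fil_all) // /J0.
have [t h] := J0_TJ b 0.
rewrite (JJ3 (r := t)) ?JJ_TJ ?scaler0 ?subr0 //.
- have hb' := blk_lie_jm (blk_hdeg hb); rewrite Psi_jm // !lie_dgE; ring.
- by case=> [|[|[|i]]] // _; have [t' ->] := J0_TJ b i.+1; rewrite mul0r scale0r.
- by rewrite h mul1r.
Qed.
Lemma omt_J (c : M) : hdeg lev6 1 c -> vprod 3 omt (hJ c) = 0.
Proof.
move=> hc; rewrite /omt vprodBl vprodZl (om_J3 C kn) // /J0.
rewrite (JJ3 (r := 0)) ?JJ_J ?scaler0 ?subr0 //.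
- rewrite Psi_blk; last exact: blk_jm.
  rewrite /kap /PsiS sumpos6 !sum6 /= tr6 sum6 !sum6 !trc6 !dgE /t6 /= -?val_eqE /=.
  have hc' i j : (lev6 i).+1 != lev6 j -> c i j = 0 by exact: hdeg1_entry.
  by n6 hc'; ring.
- by case=> [|[|[|i]]] // _; exact: (J0_modes c i.+1).
- by rewrite (J0_modes c 0) scale0r.
Qed.
End Concrete.
End HeisenbergField.
Import HeisenbergField.

(** * The coset vector at level -13/3 *)
Module SpecialLevel.
Ltac z6 h := rewrite ?(h o0 o1 isT) ?(h o0 o2 isT) ?(h o0 o3 isT) ?(h o0 o4 isT) ?(h o0 o5 isT)
  ?(h o1 o0 isT) ?(h o1 o2 isT) ?(h o1 o3 isT) ?(h o1 o5 isT) ?(h o2 o0 isT) ?(h o2 o1 isT) ?(h o2 o3 isT) ?(h o2 o4 isT)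
  ?(h o3 o0 isT) ?(h o3 o1 isT) ?(h o3 o2 isT) ?(h o3 o4 isT) ?(h o3 o5 isT) ?(h o4 o0 isT) ?(h o4 o2 isT) ?(h o4 o3 isT) ?(h o4 o5 isT)
  ?(h o5 o0 isT) ?(h o5 o1 isT) ?(h o5 o3 isT) ?(h o5 o4 isT).
Ltac n6 h := rewrite ?(h o0 o0 isT) ?(h o0 o1 isT) ?(h o0 o2 isT) ?(h o0 o3 isT) ?(h o0 o4 isT) ?(h o0 o5 isT)
  ?(h o1 o1 isT) ?(h o1 o2 isT) ?(h o1 o3 isT) ?(h o1 o4 isT) ?(h o1 o5 isT)
  ?(h o2 o0 isT) ?(h o2 o2 isT) ?(h o2 o3 isT) ?(h o2 o5 isT)
  ?(h o3 o0 isT) ?(h o3 o1 isT) ?(h o3 o3 isT) ?(h o3 o4 isT)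
  ?(h o4 o1 isT) ?(h o4 o2 isT) ?(h o4 o3 isT) ?(h o4 o4 isT) ?(h o4 o5 isT)
  ?(h o5 o0 isT) ?(h o5 o2 isT) ?(h o5 o3 isT) ?(h o5 o5 isT).
Section Certificate.
Variables (F : numFieldType) (V : vertexSuperAlgType F) (k : F) (C : brst_ops V lev6 k).
Local Notation M := 'M[F]_6.
Hypothesis kn : k + 6%:R != 0.
Local Notation p := (bp C).
Local Notation s := (bs C).
Local Notation ud := (ud F).
Local Notation dd := (dd F).
Local Notation hJ := (hJ C).
Local Notation dv := (dv C (f0 F)).
Local Notation Psi := (Psi lev6 k).
Local Notation sig := (sig lev6 k).
Local Notation f0 := (f0 F).
Local Notation nonpos := (nonpos lev6).
Hypothesis fil_all : forall v, exists q, fil C q v.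
Local Notation jm := (dg (t6 F)).
Variable r : F.
Hypothesis hr : (24 * k + 108) * r = 1.
Local Notation omt := (omt C r).
Local Notation Fop := (Fop C).

Lemma sig_poly (b : M) : sig b = - (2 * k * (3 * b o0 o0 + 2 * b o1 o1 + b o2 o2 + 2 * b o4 o4 + b o5 o5
    - 3 / 2 * (b o0 o0 + b o1 o1 + b o2 o2 + b o3 o3 + b o4 o4 + b o5 o5)))
  - 13 * b o0 o0 - 4 * (b o1 o1 + b o4 o4) + 4 * (b o2 o2 + b o5 o5) + 13 * b o3 o3.
Proof.
rewrite sigE sumpos6 /kap tr6 sum6 !sum6 !trc6 /levm !mxE /lev6 /=.
by field.
Qed.

Lemma nonposE (x : M) i j : nonpos x i j = if (lev6 j < lev6 i)%N then 0 else x i j.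
Proof. by rewrite /BrstComplex.nonpos !mxE; case: ifP; rewrite ?subrr ?subr0. Qed.
Lemma lie_udE' (b : M) al i j : lie (ud al) b i j = (i == al.1)%:R * b al.2 j - b i al.1 * (j == al.2)%:R.
Proof. by rewrite lieC mxE lie_udE opprB. Qed.
Lemma tcoefE (a : M) be : tcoef lev6 a be = \sum_(al | pos lev6 al)
  ((if (lev6 be.1 < lev6 al.1)%N then a al.1 al.1 * (be.1 == al.2)%:R - a al.2 be.1 else 0) * (al.2 == be.2)%:R
  - (al.1 == be.1)%:R * (if (lev6 al.2 < lev6 be.2)%N then a be.2 al.1 - (be.2 == al.1)%:R * a al.2 al.2 else 0)).
Proof.
by apply: eq_bigr => al _; rewrite mxtrace_mulC tr_dd lie_udE [X in X * _]mxE [X in _ - _ * X]mxE !lie_udE !eqxx mulr1 mul1r.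
Qed.
Lemma tcoef_deg1 (c : M) : hdeg lev6 1 c -> \sum_(be | pos lev6 be) tcoef lev6 c be *: vT (s (dd be)) =
  - (3 * c o1 o0 *: vT (s (dd (o0, o1))) + 3 * c o4 o0 *: vT (s (dd (o0, o4)))
   + 2 * c o2 o1 *: vT (s (dd (o1, o2))) + 2 * c o5 o1 *: vT (s (dd (o1, o5)))
   + 2 * c o2 o4 *: vT (s (dd (o4, o2))) + 2 * c o5 o4 *: vT (s (dd (o4, o5)))
   + 3 * c o3 o2 *: vT (s (dd (o2, o3))) + 3 * c o3 o5 *: vT (s (dd (o5, o3)))).
Proof.
move=> hc; have hc' i j : (lev6 i).+1 != lev6 j -> c i j = 0 by exact: hdeg1_entry.
have tc i j x : tcoef lev6 c (i, j) = x -> tcoef lev6 c (i, j) = x by [].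
rewrite sumpos6.
rewrite (tc o0 o1 (- (3 * c o1 o0))); last by rewrite tcoefE sumpos6 /lev6 /= -?val_eqE /=; n6 hc'; ring.
rewrite (tc o0 o2 0); last by rewrite tcoefE sumpos6 /lev6 /= -?val_eqE /=; n6 hc'; ring.
rewrite (tc o0 o3 0); last by rewrite tcoefE sumpos6 /lev6 /= -?val_eqE /=; n6 hc'; ring.
rewrite (tc o0 o4 (- (3 * c o4 o0))); last by rewrite tcoefE sumpos6 /lev6 /= -?val_eqE /=; n6 hc'; ring.
rewrite (tc o0 o5 0); last by rewrite tcoefE sumpos6 /lev6 /= -?val_eqE /=; n6 hc'; ring.
rewrite (tc o1 o2 (- (2 * c o2 o1))); last by rewrite tcoefE sumpos6 /lev6 /= -?val_eqE /=; n6 hc'; ring.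
rewrite (tc o1 o3 0); last by rewrite tcoefE sumpos6 /lev6 /= -?val_eqE /=; n6 hc'; ring.
rewrite (tc o1 o5 (- (2 * c o5 o1))); last by rewrite tcoefE sumpos6 /lev6 /= -?val_eqE /=; n6 hc'; ring.
rewrite (tc o2 o3 (- (3 * c o3 o2))); last by rewrite tcoefE sumpos6 /lev6 /= -?val_eqE /=; n6 hc'; ring.
rewrite (tc o4 o2 (- (2 * c o2 o4))); last by rewrite tcoefE sumpos6 /lev6 /= -?val_eqE /=; n6 hc'; ring.
rewrite (tc o4 o3 0); last by rewrite tcoefE sumpos6 /lev6 /= -?val_eqE /=; n6 hc'; ring.
rewrite (tc o4 o5 (- (2 * c o5 o4))); last by rewrite tcoefE sumpos6 /lev6 /= -?val_eqE /=; n6 hc'; ring.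
rewrite (tc o5 o3 (- (3 * c o3 o5))); last by rewrite tcoefE sumpos6 /lev6 /= -?val_eqE /=; n6 hc'; ring.
by rewrite !scaleNr !opprD !scale0r !addr0; lmod.
Qed.

Lemma blk_nonpos (c : M) al : hdeg lev6 1 c -> pos lev6 al -> blk (nonpos (lie (ud al) c)).
Proof.
move=> hc lt i j ne; rewrite nonposE; case: ltnP => // le; rewrite lie_udE'.
have lt' : (lev6 al.2 < lev6 al.1)%N by exact: lt.
rewrite (_ : (i == al.1)%:R * c al.2 j = 0); last first.
  case: eqP => [e|_]; rewrite ?mul0r // mul1r (hdeg1_entry hc) //.
  by move: ne le lt'; rewrite e; lia.
rewrite (_ : c i al.1 * (j == al.2)%:R = 0) ?subrr //.
case: eqP => [e|_]; rewrite ?mulr0 // mulr1 (hdeg1_entry hc) //.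
by move: ne le lt'; rewrite e; lia.
Qed.

Section Special.
Hypothesis hk : k = - (13 / 3).
Lemma r_val : r = 1 / 4.
Proof. by move: hr; rewrite hk => h; have : r = ((24 * - (13 / 3) + 108) * r) / 4; [field | rewrite h]. Qed.
(** With r = 1/4 both sides are explicit bilinear forms in the entries of the
blocks. *)
Lemma cert_JJ (a b : M) : blk a -> blk b ->
  Psi a b - r * (2 * (Psi jm a * Psi jm b) + Psi (lie jm (lie jm a)) b) =
  phiF (lie f0 a) b + phiF (lie f0 b) a -
  (\tr (plus lev6 (lie a (ud (o1, o2))) *m lie f0 b) + \tr (plus lev6 (lie a (ud (o4, o5))) *m lie f0 b)).
Proof.
move=> ha hb; have hja := blk_lie_jm (blk_lie_jm ha).
rewrite !Psi_jm // (Psi_poly k ha hb) (Psi_poly k hja hb) !lie_dgE.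
rewrite /phiF /Lf !big_cons !big_nil /x6 /= -?val_eqE /= !tr_plus_gen !sum6 /= !lie_f0E /lief0 /= /t6 /lev6 /=.
by z6 ha; z6 hb; rewrite r_val hk; field.
Qed.
Lemma cert_TJ (b : M) : blk b -> 3 * sig b = lie f0 b o2 o1 + lie f0 b o5 o4.
Proof. by move=> hb; rewrite sig_poly !lie_f0E /lief0 /= hk; field. Qed.
Lemma cert_J (c : M) : hdeg lev6 1 c ->
  \sum_(al | pos lev6 al) phiF (dd al) (nonpos (lie (ud al) c)) + (k + 2) * (c o2 o1 + c o5 o4) = 0.
Proof.
move=> hc; have hc' i j : (lev6 i).+1 != lev6 j -> c i j = 0 by exact: hdeg1_entry.
have -> : \sum_(al | pos lev6 al) phiF (dd al) (nonpos (lie (ud al) c)) =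
    \sum_(q <- Lf F) q.1.1.1 * x6 (nonpos (lie (ud q.1.1.2) c)) q.1.2 q.2.
  rewrite exchange_big /= big_seq [RHS]big_seq; apply: eq_bigr => q hq.
  have /allP/(_ _ hq)/and3P[/eqP h1 _ _] := Lf_good F.
  have hp : pos lev6 q.1.1.2 by rewrite /pos h1.
  rewrite -mulr_sumr (bigD1 q.1.1.2) //= big1 ?addr0; first by rewrite mxE !eqxx mul1r.
  move=> al /andP[_ ne]; rewrite mxE; case: eqP => [e1|]; case: eqP => [e2|]; rewrite ?mul0r //.
  by case/eqP: ne; case: (al) (q.1.1.2) e1 e2 => [? ?] [? ?] /= -> ->.
pose L u i j := (i == u.1)%:R * c u.2 j - c i u.1 * (j == u.2)%:R.
have E u z u2 : x6 (nonpos (lie (ud u) c)) z u2 =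
    (if (lev6 u2.1 < lev6 z.2)%N then 0 else L u z.2 u2.1) * (z.1 == u2.2)%:R -
    (z.2 == u2.1)%:R * (if (lev6 z.1 < lev6 u2.2)%N then 0 else L u u2.2 z.1).
  by rewrite /x6 !nonposE !lie_udE'.
under eq_bigr => q _ do rewrite E.
rewrite /Lf !big_cons !big_nil /L /lev6 /= -?val_eqE /=.
by n6 hc'; rewrite hk; field.
Qed.
(** The three kinds of words of weight two are treated separately; the
functional [Fop] was chosen so that the certificates [cert_JJ], [cert_TJ] and
[cert_J] hold. *)
Theorem special_pairing u : jw2 C u -> vprod 3 omt u = Fop (dv u).
Proof.
case=> [[a [b [ha hb ->]]]|[b hb ->]|[c hc ->]].
- have ba := blk_hdeg ha; have bb := blk_hdeg hb.
  rewrite (omt_JJ kn fil_all _ ha hb) (dv_JJ C (f0_minus F)) // !(FopD, FopN) !Fop_sJ // Fop_sum cert_JJ //.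
  rewrite !scalerBl scalerDl -addrA; congr (_ + (_ - _)).
  under eq_bigr => be _ do rewrite FopZ Fop_Ts scalerA.
  rewrite -scaler_suml; congr (_ *: _); under eq_bigr => be _ do rewrite mulrDr.
  rewrite big_split /= -(sact_lin (al := (o1, o2)) a (lie f0 b)) // -(sact_lin (al := (o4, o5)) a (lie f0 b)) //.
  by congr (_ + _); apply: eq_bigr => be _; rewrite tr_ud.
- by rewrite (omt_TJ kn fil_all) // (dv_TJ C (f0_minus F)) // Fop_Ts cert_TJ //; exact: blk_hdeg.
rewrite (omt_J C kn _ hc) (hJ_hdeg1 C (f0_minus F)) // !(FopD, FopN) Fop_s Fop_sum FopZ Fop_Ts tcoef_deg1 //.
have -> : \sum_(al | pos lev6 al) Fop (s (dd al) ## hJ (nonpos (lie (ud al) c))) =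
    \sum_(al | pos lev6 al) phiF (dd al) (nonpos (lie (ud al) c)) *: vac.
  by apply: eq_bigr => al hal; rewrite Fop_sJ //; exact: blk_nonpos.
rewrite !(FopD, FopN, FopZ) !Fop_Ts -scaler_suml !mxE -?val_eqE /=.
have := cert_J hc; set S := \sum_(_ | _) _ => e.
rewrite (_ : S = - ((k + 2) * (c o2 o1 + c o5 o4))); first by lmod.
by apply/eqP; rewrite -addr_eq0 e.
Qed.
End Special.
End Certificate.
End SpecialLevel.
Import SpecialLevel.

(** * An explicit cocycle of weight two *)
Module WeightTwo.
Section Cocycle.
Variables (F : numFieldType) (V : vertexSuperAlgType F) (k : F) (C : brst_ops V lev6 k).
Local Notation M := 'M[F]_6.
Hypothesis kn : k + 6%:R != 0.
Local Notation p := (bp C).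
Local Notation s := (bs C).
Local Notation ud := (ud F).
Local Notation dd := (dd F).
Local Notation hJ := (hJ C).
Local Notation dv := (dv C (f0 F)).
Local Notation Psi := (Psi lev6 k).
Local Notation sig := (sig lev6 k).
Local Notation f0 := (f0 F).
Local Notation nonpos := (nonpos lev6).
Hypothesis fil_all : forall v, exists q, fil C q v.
Local Notation jm := (dg (t6 F)).

(** Matrix units with natural-number indices. An index out of range gives 0,
so that the action of f0 is described by total functions and zero terms
disappear by computation. *)
Definition D (i j : nat) : M := \matrix_(a, b) ((nat_of_ord a == i) && (nat_of_ord b == j))%:R.
(** The action of f0 on basis vectors, with 9 for zero. *)
Definition nx i := nth 9 [:: 1; 2; 3; 9; 5; 9]%N i.
(** The transposed action of f0. *)
Definition pv i := nth 9 [:: 9; 0; 1; 2; 9; 4]%N i.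
Definition lv i := nth 0%N [:: 3; 2; 1; 0; 2; 1]%N i.
Lemma D_out i j : (6 <= i)%N || (6 <= j)%N -> D i j = 0.
Proof.
move=> h; apply/matrixP => a b; rewrite !mxE; case: eqP => [e|//]; case: eqP => [e'|//].
by move: h (ltn_ord a) (ltn_ord b); rewrite e e'; lia.
Qed.
Lemma mulD i j i' j' : (j < 6)%N -> D i j *m D i' j' = if j == i' then D i j' else 0.
Proof.
move=> hj; apply/matrixP => a b; rewrite mxE (bigD1 (Ordinal hj)) //= big1 => [|c ne].
  rewrite !mxE /= eqxx andbT addr0; case: ifP => _; rewrite ?mxE ?mulr0 //=.
  by case: (nat_of_ord a == i); rewrite ?mul1r ?mul0r.
rewrite !mxE; rewrite -val_eqE /= in ne; rewrite (negbTE ne) andbF mul0r //.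
Qed.
Lemma f0D i j : (i < 6)%N -> f0 *m D i j = D (nx i) j.
Proof.
move=> hi; apply/matrixP => a b; rewrite mxE (bigD1 (Ordinal hi)) //= big1 => [|c ne].
  rewrite !mxE /= eqxx addr0 /nx; case: (nat_of_ord a == _); by rewrite ?mul1r ?mul0r.
rewrite !mxE; rewrite -val_eqE /= in ne; rewrite (negbTE ne) mulr0 //.
Qed.
Lemma Df0 i j : (j < 6)%N -> D i j *m f0 = D i (pv j).
Proof.
move=> hj; apply/matrixP => a b; rewrite mxE (bigD1 (Ordinal hj)) //= big1 => [|c ne].
  rewrite !mxE /= eqxx andbT addr0; case: (nat_of_ord a == i); rewrite /= ?mul0r // mul1r; congr (_%:R).
  move: j hj => [|[|[|[|[|[|j]]]]]] // hj; by move: b; apply: ord6P.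
rewrite !mxE; rewrite -val_eqE /= in ne; rewrite (negbTE ne) andbF mul0r //.
Qed.
Lemma lie_f0D i j : (i < 6)%N -> (j < 6)%N -> lie f0 (D i j) = D (nx i) j - D i (pv j).
Proof. by move=> hi hj; rewrite /lie f0D // Df0. Qed.
Lemma ddD i j (hi : (i < 6)%N) (hj : (j < 6)%N) : dd (Ordinal hi, Ordinal hj) = D j i.
Proof. by apply/matrixP => a b; rewrite !mxE -!val_eqE. Qed.
Lemma udD i j (hi : (i < 6)%N) (hj : (j < 6)%N) : ud (Ordinal hi, Ordinal hj) = D i j.
Proof. by apply/matrixP => a b; rewrite !mxE -!val_eqE. Qed.
Lemma nonposD i j : nonpos (D i j) = if (lv j < lv i)%N then 0 else D i j.
Proof.
apply/matrixP => a b; rewrite nonposE !mxE.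
have [/andP[/eqP ea /eqP eb]|h] := boolP ((nat_of_ord a == i) && (nat_of_ord b == j)).
  by rewrite /lev6 ea eb -!/(lv _); case: ifP; rewrite mxE // ea eb !eqxx.
by case: ifP; case: ifP => _; rewrite ?mxE // (negbTE h).
Qed.
Lemma hdegD d i j : (lv i + d = lv j)%N -> hdeg lev6 d (D i j).
Proof.
move=> e; split; apply/matrixP => a b.
  rewrite !mxE; case: ifP => // lt; case: eqP => // ea; case: eqP => // eb.
  by move: lt; rewrite /lev6 ea eb -!/(lv _) -e; lia.
rewrite lie_levmE !mxE; case: eqP => ea; case: eqP => eb; rewrite ?mulr0 //= !mulr1 /lev6 ea eb -!/(lv _) -e.
by rewrite natrD intrN; ring.
Qed.

Lemma minus_deg1 (w : M) : lie (levm F lev6) w = - w -> minus lev6 w = w.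
Proof.
move=> h; apply/matrixP => i j; rewrite mxE; case: ltnP => // le.
move/matrixP/(_ i j): h; rewrite lie_levmE mxE => /eqP.
rewrite -subr_eq0 opprK -{2}[w i j]mul1r -mulrDl mulf_eq0 => /orP[|/eqP -> //].
rewrite -natrB // natr1 pnatr_eq0 //.
Qed.
Lemma lie_f0_deg0 (b : M) : hdeg lev6 0 b -> lie (levm F lev6) (lie f0 b) = - lie f0 b.
Proof. by move=> [_ h]; rewrite lie_levm_lie f0_levm h oppr0 scale0r linear0 addr0 lieNl. Qed.
Lemma dv_JJ' (a b : M) : hdeg lev6 0 a -> hdeg lev6 0 b ->
  dv (hJ a ## hJ b) = s (lie f0 a) ## hJ b + s (lie f0 b) ## hJ a - vT (s (lie (lie f0 b) a)).
Proof.
move=> ha hb; rewrite (dv_JJ C (f0_minus F)) // addrA; congr (_ - _).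
rewrite -(s_linE C (lie _ a)) {2}/vT vprod_suml; apply: eq_bigr => be hbe.
rewrite vprodZl -/(vT _); congr (_ *: _).
by rewrite tr_plus (minus_deg1 (lie_f0_deg0 hb)) (lieC a) mulNmx linearN /= tr_lie -linearN -mulmxN /= -lieC.
Qed.

Lemma mulD' i j i' j' : (i' < 6)%N -> D i j *m D i' j' = if j == i' then D i j' else 0.
Proof.
move=> h; have [lt|ge] := ltnP j 6; first exact: mulD.
by rewrite (D_out (i := i)) ?ge ?orbT // mul0mx; case: eqP => // e; move: ge; rewrite e leqNgt h.
Qed.
Definition dif (b : bool) (x : M) : M := if b then x else 0.
Lemma dv_JJD i j i' j' : (i < 6)%N -> (j < 6)%N -> (i' < 6)%N -> (j' < 6)%N ->
  lv i = lv j -> lv i' = lv j' ->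
  dv (hJ (D i j) ## hJ (D i' j')) = s (D (nx i) j) ## hJ (D i' j') - s (D i (pv j)) ## hJ (D i' j') +
  (s (D (nx i') j') ## hJ (D i j) - s (D i' (pv j')) ## hJ (D i j)) -
  (vT (s (dif (j' == i) (D (nx i') j))) - vT (s (dif (pv j' == i) (D i' j)))
   - vT (s (dif (j == nx i') (D i j'))) + vT (s (dif (j == i') (D i (pv j'))))).
Proof.
move=> hi hj hi' hj' e e'.
rewrite dv_JJ' ?lie_f0D //; last 2 first.
- by apply: hdegD; rewrite addn0.
- by apply: hdegD; rewrite addn0.
have -> : lie (D (nx i') j' - D i' (pv j')) (D i j) =
  dif (j' == i) (D (nx i') j) - dif (pv j' == i) (D i' j) - dif (j == nx i') (D i j') + dif (j == i') (D i (pv j')).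
  by rewrite /lie mulmxBl mulmxBr !(mulD' _ _ _ hi) !(mulD _ _ _ hj) opprB addrA addrAC.
by rewrite !(linearB s) (linearD s) !(linearB s) !vprodBl !vTD !vTN.
Qed.
Lemma dv_TJD i j : (i < 6)%N -> (j < 6)%N -> lv i = lv j ->
  dv (vT (hJ (D i j))) = vT (s (D (nx i) j)) - vT (s (D i (pv j))).
Proof.
move=> hi hj e; rewrite (dv_TJ C (f0_minus F)) ?lie_f0D ?(linearB s) ?vTD ?vTN //.
by apply: hdegD; rewrite addn0.
Qed.
Definition npD i j := dif (lv i <= lv j)%N (D i j).
Lemma nonpos_lieD i j i' j' : (i < 6)%N -> (j < 6)%N -> (i' < 6)%N -> (j' < 6)%N ->
  nonpos (lie (D i j) (D i' j')) = dif (j == i') (npD i j') - dif (j' == i) (npD i' j).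
Proof.
move=> hi hj hi' hj'; rewrite /lie !mulD // linearB /=; congr (_ - _).
  by case: eqP => _ /=; rewrite ?linear0 // nonposD /npD; case: ltnP.
by case: eqP => _ /=; rewrite ?linear0 // nonposD /npD; case: ltnP.
Qed.
Definition tm i j i' j' := s (D j i) ## hJ (dif (j == i') (npD i j')) - s (D j i) ## hJ (dif (j' == i) (npD i' j)).
Lemma dv_JD i j : (i < 6)%N -> (j < 6)%N -> (lv i).+1 = lv j -> dv (hJ (D i j)) =
  tm 0 1 i j + tm 0 2 i j + tm 0 3 i j + tm 0 4 i j + tm 0 5 i j + tm 1 2 i j + tm 1 3 i j + tm 1 5 i j
  + tm 2 3 i j + tm 4 2 i j + tm 4 3 i j + tm 4 5 i j + tm 5 3 i j + (s (D (nx i) j) - s (D i (pv j)))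
  + (k + (if lv i == 1%N then 2 else 3)) *: vT (s (D i j)).
Proof.
move=> hi hj e; have hc : hdeg lev6 1 (D i j) by apply: hdegD; rewrite addn1.
have E a b (ha : (a < 6)%N) (hb : (b < 6)%N) :
    s (dd (Ordinal ha, Ordinal hb)) ## hJ (nonpos (lie (ud (Ordinal ha, Ordinal hb)) (D i j))) = tm a b i j.
  by rewrite ddD udD nonpos_lieD // linearB vprodBr.
rewrite (hJ_hdeg1 C (f0_minus F) hc) (tcoef_deg1 C hc) sumpos6 !E lie_f0D // (linearB s) opprK.
congr (_ + _); clear E hc; rewrite !ddD !mxE /= scalerDl; congr (_ + _).
move: i hi e => [|[|[|[|[|[|i]]]]]] hi //; move: j hj => [|[|[|[|[|[|j]]]]]] hj // _;
  by rewrite /= ?(mulr0, scale0r, addr0, add0r, mulr1).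
Qed.

Local Notation JJ i j i' j' := (hJ (D i j) ## hJ (D i' j')).
Local Notation TJ i := (vT (hJ (D i i))).
(** The shape of the cocycle of weight two: products of two currents,
derivatives, and currents of degree -1. The same combination is taken of the
words, of their differentials and of their pairings. *)
Definition comb (W : lmodType F) (a b c d e g h i j t0 t1 t2 c1 c2 c3 v t4 c4 : W) : W :=
  a + b + c + d + e + g - h - i - j - (3 * k + 13) *: t0 - (2 * k + 8) *: t1 - (k + 4) *: t2 + c1 + c2 + c3
  - 10 *: (v + i - (k + 4) *: t4 + c4).
Lemma comb_map (g : V -> V) : (forall c u v, g (c *: u + v) = c *: g u + g v) ->
  forall a1 a2 a3 a4 a5 a6 a7 a8 a9 a10 a11 a12 a13 a14 a15 a16 a17 a18,
  g (comb a1 a2 a3 a4 a5 a6 a7 a8 a9 a10 a11 a12 a13 a14 a15 a16 a17 a18) =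
  comb (g a1) (g a2) (g a3) (g a4) (g a5) (g a6) (g a7) (g a8) (g a9) (g a10) (g a11) (g a12) (g a13) (g a14)
    (g a15) (g a16) (g a17) (g a18).
Proof.
move=> gl *; have g0 : g 0 = 0.
  by have := gl 1 0 0; rewrite !scale1r addr0 => /eqP; rewrite -subr_eq subrr eq_sym => /eqP.
have gZ c u : g (c *: u) = c *: g u by rewrite -[c *: u]addr0 gl g0 addr0.
have gD u v : g (u + v) = g u + g v by rewrite -[u]scale1r gl !scale1r.
have gN u : g (- u) = - g u by rewrite -scaleN1r gZ scaleN1r.
by rewrite /comb !(gD, gN, gZ).
Qed.
Lemma comb_hm a1 a2 a3 a4 a5 a6 a7 a8 a9 a10 a11 a12 a13 a14 a15 a16 a17 a18 :
  hm C 0 2 a1 -> hm C 0 2 a2 -> hm C 0 2 a3 -> hm C 0 2 a4 -> hm C 0 2 a5 -> hm C 0 2 a6 -> hm C 0 2 a7 ->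
  hm C 0 2 a8 -> hm C 0 2 a9 -> hm C 0 2 a10 -> hm C 0 2 a11 -> hm C 0 2 a12 -> hm C 0 2 a13 -> hm C 0 2 a14 ->
  hm C 0 2 a15 -> hm C 0 2 a16 -> hm C 0 2 a17 -> hm C 0 2 a18 ->
  hm C 0 2 (comb a1 a2 a3 a4 a5 a6 a7 a8 a9 a10 a11 a12 a13 a14 a15 a16 a17 a18).
Proof.
move=> *; have hN v : hm C 0 2 v -> hm C 0 2 (- v) by rewrite -scaleN1r; exact: hmZ.
rewrite /comb; by repeat first [assumption | refine (hN _ _) | apply: hmZ | apply: hmD].
Qed.
Definition W2 : V := comb (JJ 0 0 1 1) (JJ 0 0 2 2) (JJ 0 0 3 3) (JJ 1 1 2 2) (JJ 1 1 3 3) (JJ 2 2 3 3)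
  (JJ 1 4 4 1) (JJ 1 4 5 2) (JJ 2 5 5 2) (TJ 0) (TJ 1) (TJ 2) (hJ (D 1 0)) (hJ (D 2 1)) (hJ (D 3 2))
  (JJ 5 5 4 4) (TJ 4) (hJ (D 5 4)).
Lemma D9l j : D 9 j = 0. Proof. exact: D_out. Qed.
Lemma D9r i : D i 9 = 0. Proof. by apply: D_out; rewrite orbT. Qed.
(** After expanding the differentials of all words into s y ## hJ x and
derivatives of s w, the terms cancel in pairs. *)
Lemma dv_W2 : dv W2 = 0.
Proof.
have dl c u v : dv (c *: u + v) = c *: dv u + dv v by rewrite dvD dvZ.
rewrite /W2 (comb_map dl) !dv_JJD // !dv_TJD // !dv_JD // /tm /dif /npD /= !(D9l, D9r) !(linear0 s) !(linear0 hJ).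
by rewrite !(vT0, vprod0l, vprod0r) /comb; lmod.
Qed.
Lemma W2_hm : hm C 0 2 W2.
Proof.
have h1 i j : lv i = lv j -> hm C 0 1 (hJ (D i j)).
  by move=> e; have [|_ h] := @hdegD 0 i j; [rewrite addn0 | exact: (hm_J kn fil_all h)].
have h2 i j : (lv i).+1 = lv j -> hm C 0 2 (hJ (D i j)).
  by move=> e; have [|_ h] := @hdegD 1 i j; [rewrite addn1 | exact: (hm_J kn fil_all h)].
have h3 i j i' j' : lv i = lv j -> lv i' = lv j' -> hm C 0 2 (hJ (D i j) ## hJ (D i' j')).
  by move=> e e'; exact: (hm_prod kn fil_all (-1) (h1 _ _ e) (h1 _ _ e')).
have h4 i : hm C 0 2 (vT (hJ (D i i))) by exact: (hm_T kn fil_all (h1 i i erefl)).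
by apply: comb_hm; [exact: h3 | exact: h3 | exact: h3 | exact: h3 | exact: h3 | exact: h3 | exact: h3 | exact: h3 | exact: h3 | exact: h4 | exact: h4 | exact: h4 | exact: h2 | exact: h2 | exact: h2 | exact: h3 | exact: h4 | exact: h2].
Qed.
Lemma blkD i j : lv i = lv j -> blk (D i j).
Proof. by move=> e; apply: blk_hdeg; apply: hdegD; rewrite addn0. Qed.
Variable r : F.
Local Notation omt := (omt C r).
Definition PhiS (a b : M) := Psi a b - r * (2 * (Psi jm a * Psi jm b) + Psi (lie jm (lie jm a)) b).
Lemma omt_JJD i j i' j' : lv i = lv j -> lv i' = lv j' -> vprod 3 omt (JJ i j i' j') = PhiS (D i j) (D i' j') *: vac.
Proof.
by move=> e e'; apply: (omt_JJ kn fil_all); apply: hdegD; rewrite addn0.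
Qed.
Lemma omt_TJD i : vprod 3 omt (TJ i) = (3 * sig (D i i)) *: vac.
Proof. by apply: (omt_TJ kn fil_all); apply: hdegD; rewrite addn0. Qed.
Lemma omt_JD i j : (lv i).+1 = lv j -> vprod 3 omt (hJ (D i j)) = 0.
Proof. by move=> e; apply: (omt_J C kn); apply: hdegD; rewrite addn1. Qed.
(** The cocycle is not orthogonal to the coset vector except at one level.
Only the products of two currents and the derivatives contribute. *)
Lemma omt_W2 : (24 * k + 108) * r = 1 -> vprod 3 omt W2 = (39 / 2 * (k + 13 / 3)) *: vac.
Proof.
move=> hr; have nz : 24 * k + 108 != 0 by apply/eqP => e; move: hr; rewrite e mul0r => /eqP; rewrite eq_sym oner_eq0.
have rE : r = (24 * k + 108)^-1 by apply: (mulfI nz); rewrite hr divff.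
have P0011 : PhiS (D 0 0) (D 1 1) = ((-1 / 6) * k + (-1)) -r * (2 * (((1) * k + (6)) * ((1) * k + (3))) + ((0) * k + (0))).
  by rewrite /PhiS !Psi_jm ?(Psi_poly k) ?lie_dgE; try (exact: blkD || exact: blk_lie_jm (blk_lie_jm (blkD _))); rewrite ?lie_dgE !mxE /t6 /=; field.
have P0022 : PhiS (D 0 0) (D 2 2) = ((-1 / 6) * k + (-1)) -r * (2 * (((1) * k + (6)) * ((1) * k + (3))) + ((0) * k + (0))).
  by rewrite /PhiS !Psi_jm ?(Psi_poly k) ?lie_dgE; try (exact: blkD || exact: blk_lie_jm (blk_lie_jm (blkD _))); rewrite ?lie_dgE !mxE /t6 /=; field.
have P0033 : PhiS (D 0 0) (D 3 3) = ((-1 / 6) * k + (-1)) -r * (2 * (((1) * k + (6)) * ((1) * k + (6))) + ((0) * k + (0))).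
  by rewrite /PhiS !Psi_jm ?(Psi_poly k) ?lie_dgE; try (exact: blkD || exact: blk_lie_jm (blk_lie_jm (blkD _))); rewrite ?lie_dgE !mxE /t6 /=; field.
have P1122 : PhiS (D 1 1) (D 2 2) = ((-1 / 6) * k + (-1)) -r * (2 * (((1) * k + (3)) * ((1) * k + (3))) + ((0) * k + (0))).
  by rewrite /PhiS !Psi_jm ?(Psi_poly k) ?lie_dgE; try (exact: blkD || exact: blk_lie_jm (blk_lie_jm (blkD _))); rewrite ?lie_dgE !mxE /t6 /=; field.
have P1133 : PhiS (D 1 1) (D 3 3) = ((-1 / 6) * k + (-1)) -r * (2 * (((1) * k + (3)) * ((1) * k + (6))) + ((0) * k + (0))).
  by rewrite /PhiS !Psi_jm ?(Psi_poly k) ?lie_dgE; try (exact: blkD || exact: blk_lie_jm (blk_lie_jm (blkD _))); rewrite ?lie_dgE !mxE /t6 /=; field.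
have P2233 : PhiS (D 2 2) (D 3 3) = ((-1 / 6) * k + (-1)) -r * (2 * (((1) * k + (3)) * ((1) * k + (6))) + ((0) * k + (0))).
  by rewrite /PhiS !Psi_jm ?(Psi_poly k) ?lie_dgE; try (exact: blkD || exact: blk_lie_jm (blk_lie_jm (blkD _))); rewrite ?lie_dgE !mxE /t6 /=; field.
have P1441 : PhiS (D 1 4) (D 4 1) = ((1) * k + (4)) -r * (2 * (((0) * k + (0)) * ((0) * k + (0))) + ((9) * k + (36))).
  by rewrite /PhiS !Psi_jm ?(Psi_poly k) ?lie_dgE; try (exact: blkD || exact: blk_lie_jm (blk_lie_jm (blkD _))); rewrite ?lie_dgE !mxE /t6 /=; field.
have P1452 : PhiS (D 1 4) (D 5 2) = ((0) * k + (0)) -r * (2 * (((0) * k + (0)) * ((0) * k + (0))) + ((0) * k + (0))).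
  by rewrite /PhiS !Psi_jm ?(Psi_poly k) ?lie_dgE; try (exact: blkD || exact: blk_lie_jm (blk_lie_jm (blkD _))); rewrite ?lie_dgE !mxE /t6 /=; field.
have P2552 : PhiS (D 2 5) (D 5 2) = ((1) * k + (4)) -r * (2 * (((0) * k + (0)) * ((0) * k + (0))) + ((9) * k + (36))).
  by rewrite /PhiS !Psi_jm ?(Psi_poly k) ?lie_dgE; try (exact: blkD || exact: blk_lie_jm (blk_lie_jm (blkD _))); rewrite ?lie_dgE !mxE /t6 /=; field.
have P5544 : PhiS (D 5 5) (D 4 4) = ((-1 / 6) * k + (-1)) -r * (2 * (((-2) * k + (-9)) * ((-2) * k + (-9))) + ((0) * k + (0))).
  by rewrite /PhiS !Psi_jm ?(Psi_poly k) ?lie_dgE; try (exact: blkD || exact: blk_lie_jm (blk_lie_jm (blkD _))); rewrite ?lie_dgE !mxE /t6 /=; field.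
have S0 : sig (D 0 0) = ((-3) * k + (-13)).
  by rewrite sig_poly !mxE /=; field.
have S1 : sig (D 1 1) = ((-1) * k + (-4)).
  by rewrite sig_poly !mxE /=; field.
have S2 : sig (D 2 2) = ((1) * k + (4)).
  by rewrite sig_poly !mxE /=; field.
have S4 : sig (D 4 4) = ((-1) * k + (-4)).
  by rewrite sig_poly !mxE /=; field.
rewrite /W2 (comb_map (vprod_linearr 3 omt)) !omt_JJD // !omt_TJD // !omt_JD //.
rewrite P0011 P0022 P0033 P1122 P1133 P2233 P1441 P1452 P2552 P5544 S0 S1 S2 S4.
rewrite /comb rE.
by lmod_by ltac:(first [ring | field; exact: nz]).
Qed.
End Cocycle.
End WeightTwo.
Import WeightTwo.

(** * Weight components of cocycles and the centralizer *)
Module Centralizer.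
Section Decomposition.
Variables (F : numFieldType) (V : vertexSuperAlgType F) (n : nat).
Variables (lev : 'I_n -> nat) (k : F) (C : brst_ops V lev k).
Variable f : 'M[F]_n.
Hypothesis f_levm : lie (levm F lev) f = - f.
Hypothesis kn : k + n%:R != 0.
Local Notation dv := (dv C f).
Local Notation om := (om C).
Local Notation qv := (qv C).
Hypothesis fil_all : forall v, exists q, fil C q v.

Lemma hm_om : hm C 0 2 om.
Proof.
apply: hmD; first apply: hmD.
- apply: hmZ; apply: hm_sum => al _.
  have h1 := hm_K C kn (lev_ud F lev al); have h2 := hm_K C kn (lev_dd F lev al).
  by have := hm_prod kn fil_all (-1) h1 h2; congr hm; lia.
- have h : lie (levm F lev) (levm F lev) = 0%:~R *: levm F lev by rewrite scale0r /lie subrr.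
  exact: (hm_T kn fil_all (hm_K C kn h)).
apply: hm_sum => al _.
have hs := hm_s C kn (lev_dd F lev al); have hp := hm_p C kn (lev_ud F lev al).
apply: hmD; last apply: hmZ.
  rewrite -scaleNr; apply: hmZ; have := hm_prod kn fil_all (-1) hs (hm_T kn fil_all hp).
  by congr hm; lia.
by have := hm_prod kn fil_all (-1) (hm_T kn fil_all hs) hp; congr hm; lia.
Qed.

Lemma dv_prod0 (i : int) (a b : V) : dv a = 0 -> dv b = 0 -> dv (vprod i a b) = 0.
Proof.
have [a0 [a1 [h0 h1 ->]]] := vpar_sum a; rewrite dvD => e hb.
have d0 : vpar true (dv a0) by exact: (vprod_par 0 (Dv_odd C f) h0).
have d1 : vpar false (dv a1) by exact: (vprod_par 0 (Dv_odd C f) h1).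
have e1 : dv a1 = - dv a0 by apply/eqP; rewrite -addr_eq0 addrC e.
have z1 : dv a1 = 0 by apply: vpar_direct => //; rewrite e1; exact: vparN.
have z0 : dv a0 = 0 by move: e; rewrite z1 addr0.
rewrite vprodDl dvD (dv_even C f _ _ h0) (dv_oddp C f _ _ h1) z0 z1 hb.
by rewrite !vprod0l !vprod0r subrr !addr0.
Qed.

(** The differential and the charge commute with the projections on weight
spaces, so each weight component of a cocycle is a cocycle. *)
Lemma cocycle_decomp v : qv v = 0 -> dv v = 0 ->
  lspan (fun u => dv u = 0 /\ exists z, hm C 0 z u) v.
Proof.
move=> hq hd.
have ll c u w : L0 C (c *: u + w) = c *: L0 C u + L0 C w by exact: vprod_linearr.
have [||Q [Q1 Q2 Q3]] := @eigproj F V (L0 C); [exact: ll | | ].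
  by move=> u; apply: lspanW (hm_all kn fil_all u) => x [c [z [_ h]]]; exists z.
have Q0 z : Q z 0 = 0.
  by have := Q1 z 1 0 0; rewrite !scale1r addr0 => /eqP; rewrite -subr_eq subrr eq_sym => /eqP.
have QZ z c u : Q z (c *: u) = c *: Q z u by rewrite -[c *: u]addr0 Q1 Q0 addr0.
have QE z z' u : L0 C u = z'%:~R *: u -> Q z u = if z' == z then u else 0.
  by move=> h; case: eqP => [e|/eqP ne]; [rewrite Q2 // -e | exact: Q3 h ne].
have Qeig z u : L0 C (Q z u) = z%:~R *: Q z u.
  elim: (hm_all kn fil_all u) => [|t a b [c [z' [_ h]]] _ IH].
    by rewrite Q0 /L0 vprod0r scaler0.
  rewrite Q1 ll IH (QE _ _ _ h); case: eqP => [<-|_]; first by rewrite h; lmod.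
  by rewrite /L0 vprod0r; lmod.
have Qq z u : qv (Q z u) = Q z (qv u).
  elim: (hm_all kn fil_all u) => [|t a b [c [z' [h h']]] _ IH].
    by rewrite Q0 /ConformalVector.qv vprod0r Q0.
  rewrite Q1 !qvD !qvZ Q1 IH (QE _ _ _ h') h QZ (QE _ _ _ h'); case: eqP => _; rewrite ?h //.
  by rewrite /ConformalVector.qv vprod0r !scaler0.
have Qd z u : dv (Q z u) = Q z (dv u).
  elim: (hm_all kn fil_all u) => [|t a b [c [z' h]] _ IH]; first by rewrite Q0 dv0 Q0.
  have [_ h1] := h; have [_ h2] := hm_dv f_levm kn h.
  rewrite Q1 !dvD !dvZ Q1 IH (QE _ _ _ h1) (QE _ _ _ h2); case: eqP => _ //.
  by rewrite dv0.
have [s hs] : exists s : seq int, forall t : seq int, uniq t -> {subset s <= t} -> v = \sum_(z <- t) Q z v.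
  elim: (hm_all kn fil_all v) => [|c a b [c' [z' [_ h]]] _ [s hs]].
    by exists [::] => t _ _; rewrite big1 // => z _; exact: Q0.
  exists (z' :: s) => t ut st.
  have e1 : b = \sum_(z <- t) Q z b by apply: hs => // z hz; apply: st; rewrite inE hz orbT.
  have e2 : a = \sum_(z <- t) Q z a.
    rewrite (bigD1_seq z') //=; last by apply: st; rewrite inE eqxx.
    rewrite (QE _ _ _ h) eqxx big1 ?addr0 // => z ne; rewrite (QE _ _ _ h) eq_sym (negbTE ne) //.
  rewrite {1}e1 {1}e2 scaler_sumr -big_split; apply: eq_bigr => z _ /=; by rewrite Q1.
rewrite (hs (undup s)) ?undup_uniq => [||z]; last by rewrite mem_undup.
  apply: lspan_sum => z _; apply: lspan_in; split; first by rewrite Qd hd Q0.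
  by exists z; split; [rewrite Qq hq Q0 scale0r | exact: Qeig].
by [].
Qed.
End Decomposition.

Section WeightOne.
Variables (F : numFieldType) (V : vertexSuperAlgType F) (k : F) (C : brst_ops V lev6 k).
Hypothesis kn : k + 6%:R != 0.
Local Notation M := 'M[F]_6.
Local Notation p := (bp C).
Local Notation s := (bs C).
Local Notation hJ := (hJ C).
Local Notation f0 := (f0 F).
Local Notation dv := (dv C f0).
Local Notation om := (om C).
Local Notation jm := (dg (t6 F)).
Hypothesis fil_all : forall v, exists q, fil C q v.
Local Notation J0 := (J0 C).

Lemma lie_f0_jm : lie f0 jm = 0.
Proof.
apply/matrixP; apply: ord6P; apply: ord6P; by rewrite lie_f0E /lief0 /= !mxE /t6 /= ?subrr ?subr0 ?oppr0.
Qed.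
Lemma dv_J0_0 : dv J0 = 0.
Proof. by rewrite /HeisenbergField.J0 (dv_J0 C (f0_minus F) kn (jm_hdeg F)) lie_f0_jm linear0. Qed.
Lemma J0_J0 : vprod 0 J0 J0 = 0.
Proof. by rewrite /HeisenbergField.J0 (hJJ0 C (t6 F) jm) /lie subrr linear0. Qed.
(** This is three times the level 4 (k + 9/2), so that J and J0 differ by a
factor whose square is 1/3. *)
Lemma J0_1J0 : vprod 1 J0 J0 = (12 * k + 54) *: vac.
Proof.
rewrite /HeisenbergField.J0 (hJ1 C jm jm) Psi_jm; last exact: blk_jm.
by congr (_ *: _); rewrite !mxE /t6 /=; ring.
Qed.
Lemma om2_J0 : vprod 2 om J0 = 0.
Proof.
rewrite /HeisenbergField.J0 (om_J2 C kn 0) sig_poly !mxE /t6 /= (_ : _ * _ = 0) ?scale0r //.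
by field.
Qed.
Lemma J0_hm : hm C 0 1 J0.
Proof. by have [_ h] := jm_hdeg F; exact: (hm_J kn fil_all h). Qed.
Lemma om2_J0J0 : vprod 2 om (J0 ## J0) = 0.
Proof.
rewrite (vcomm_2 (om_even C) (hJ_even C jm)) -/J0 om2_J0 vprod0r scaler0 add0r.
have [_ h1] := J0_hm; rewrite (om0T kn fil_all) -[vprod 1 om J0]/(L0 C J0) h1 scale1r vprod0l addr0 vT_mode_l.
rewrite -[vprod (-1 + 2 - 1) J0 J0]/(vprod 0 J0 J0) -[vprod (-1 + 1) J0 J0]/(vprod 0 J0 J0).
by rewrite J0_J0 !scaler0 addr0.
Qed.
(** A matrix of degree 0 that commutes with f0 modulo scalars is a combination
of the identity and of the generator jm, and the identity has zero current. *)
Lemma centralizer (a : M) : (vac : V) != 0 -> hdeg lev6 0 a -> s (lie f0 a) = 0 -> exists c, hJ a = c *: J0.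
Proof.
move=> v0 ha e; have ba := blk_hdeg ha.
have E al : pos lev6 al -> lief0 a al.2 al.1 = 0.
  move=> hal; have := bps0 C (ud F al) (lie f0 a); rewrite e vprod0r (plus_ud F hal) tr_ud lie_f0E => /esym/eqP.
  by rewrite scaler_eq0 (negbTE v0) orbF => /eqP.
have h10 := E (o0, o1) isT; have h21 := E (o1, o2) isT; have h32 := E (o2, o3) isT.
have h54 := E (o4, o5) isT; have h40 := E (o0, o4) isT; have h51 := E (o1, o5) isT.
have h24 := E (o4, o2) isT; have h35 := E (o5, o3) isT.
rewrite /lief0 /= in h10 h21 h32 h54 h40 h51 h24 h35.
have z41 : a o4 o1 = 0 by move/eqP: h40; rewrite sub0r oppr_eq0 => /eqP.
have z52 : a o5 o2 = 0 by move/eqP: h51; rewrite z41 sub0r oppr_eq0 => /eqP.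
have z25 : a o2 o5 = 0 by move: h35; rewrite subr0.
have z14 : a o1 o4 = 0 by move: h24; rewrite z25 subr0.
move/eqP: h10; rewrite subr_eq0 => /eqP e01; move/eqP: h21; rewrite subr_eq0 => /eqP e12.
move/eqP: h32; rewrite subr_eq0 => /eqP e23; move/eqP: h54; rewrite subr_eq0 => /eqP e45.
pose c := (a o0 o0 - a o4 o4) / 3.
exists c.
have hJ1 : hJ 1%:M = 0.
  rewrite /BrstComplex.hJ bK1 add0r big1 // => al _.
  by rewrite (_ : lie 1%:M _ = 0) ?linear0 ?vprod0l // /lie mul1mx mulmx1 subrr.
have -> : a = c *: jm + (a o0 o0 - c) *: 1%:M.
  apply/matrixP; apply: ord6P; apply: ord6P; rewrite !mxE /t6 /= ?(mulr0n, mulr1n, mulr0, addr0, mulr1) ?z41 ?z52 ?z25 ?z14 //;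
    first [by rewrite ba | rewrite /c -?e45 -?e23 -?e12 -?e01; by field].
by rewrite linearD !linearZ /= hJ1; rewrite scaler0 addr0.
Qed.
End WeightOne.
End Centralizer.
Import Centralizer.

(** * The simple quotient *)
Module SimpleQuotient.
(** Skew-symmetry when the derivatives of the higher products vanish: only the
sign remains. *)
Lemma skew_low (F : numFieldType) (V : vertexSuperAlgType F) (q q' : bool) (a b : V) (r : int) :
  vpar q a -> vpar q' b -> (forall j : nat, vprod (-1 - j.+1%:Z) (vprod (r + j.+1%:Z) a b) vac = 0) ->
  vprod r b a = - (vsgn F q q' * (-1) ^ r) *: vprod r a b.
Proof.
move=> ha hb h; have [K0 hK] := vskew ha hb r.
rewrite (hK K0.+1) // big_ord_recl big1 => [|i _]; last by rewrite lift0 h scaler0.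
by rewrite expr0 scale1r addr0 !addr0 vprod_vac.
Qed.
Section Final.
Variables (F : numFieldType) (V W : vertexSuperAlgType F) (k : F) (C : brst_ops V lev6 k).
Hypothesis kn : k + 6%:R != 0.
Hypothesis k92 : k + 9 / 2 != 0.
Local Notation hJ := (hJ C).
Local Notation f0 := (f0 F).
Local Notation dv := (dv C f0).
Local Notation qv := (qv C).
Local Notation om := (om C).
Local Notation J0 := (J0 C).
Local Notation fil := (fil C).
Local Notation hm := (hm C).
Hypothesis fil_all : forall v, exists q, fil q v.
Hypothesis homot : exists H : V -> V,
  [/\ forall c u v, H (c *: u + v) = c *: H u + H v, H vac = 0,
     forall q v, fil q v -> fil q (H v) &
     [/\ forall q v a (m : nat), fil q v -> fil q (H (vprod (-1 - m%:Z) (bK C a) v)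
         - vprod (-1 - m%:Z) (bK C a) (H v) - vprod (-1 - m%:Z) (bp C a) v),
       forall q v a (m : nat), fil q v -> fil q (H (vprod (-1 - m%:Z) (bp C a) v)
         + vprod (-1 - m%:Z) (bp C a) (H v)) &
       forall q v a (m : nat), fil q v -> fil q.-1 (H (vprod (-1 - m%:Z) (bs C a) v)
         + vprod (-1 - m%:Z) (bs C a) (H v))]].
Definition coc v := qv v = 0 /\ dv v = 0.
Variable rho : V -> W.
Hypothesis rho_lin : forall c u v, coc u -> coc v -> rho (c *: u + v) = c *: rho u + rho v.
Hypothesis rho_vac : rho vac = vac.
Hypothesis rho_prod : forall i u v, coc u -> coc v -> rho (vprod i u v) = vprod i (rho u) (rho v).
Hypothesis rho_par : forall q v, coc v -> vpar q v -> vpar q (rho v).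
Hypothesis rho_surj : forall w, exists2 v, coc v & rho v = w.
Hypothesis rho_cob : forall w, qv w = - w -> rho (dv w) = 0.
Hypothesis simpW : vertex_simple W.

Lemma coc_lin c u v : coc u -> coc v -> coc (c *: u + v).
Proof. by move=> [h1 h2] [g1 g2]; split; rewrite ?qvD ?qvZ ?dvD ?dvZ ?h1 ?h2 ?g1 ?g2 scaler0 addr0. Qed.
Lemma coc0 : coc 0.
Proof. by split; rewrite ?dv0 // /ConformalVector.qv vprod0r. Qed.
Lemma coc_prod i u v : coc u -> coc v -> coc (vprod i u v).
Proof.
by move=> [h1 h2] [g1 g2]; split; [rewrite qv_prod h1 g1 vprod0l vprod0r addr0 | exact: dv_prod0].
Qed.
Lemma coc_vac : coc vac. Proof. by split; [exact: qv_vac | exact: dv_vac]. Qed.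
Lemma coc_om : coc om. Proof. by split; [exact: qv_om | exact: (dv_om C kn (f0_levm F))]. Qed.
Lemma coc_J0 : coc J0.
Proof. by split; [exact: qv_hJ | exact: dv_J0_0]. Qed.
Lemma rho0 : rho 0 = 0.
Proof.
by have := rho_lin 1 coc0 coc0; rewrite !scale1r addr0 => /eqP; rewrite -subr_eq subrr eq_sym => /eqP.
Qed.
Lemma rhoZ c v : coc v -> rho (c *: v) = c *: rho v.
Proof. by move=> h; rewrite -[c *: v]addr0 rho_lin ?rho0 ?addr0 //; exact: coc0. Qed.
Lemma vacW : (vac : W) <> 0.
Proof. by case: simpW => -[v hv] _ e; apply: hv; rewrite -[v]vprod_vac e vprod0r. Qed.
Lemma vacV : (vac : V) != 0.
Proof. by apply/eqP => e; apply: vacW; rewrite -rho_vac e rho0. Qed.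

(** Classes of homogeneous cocycles. The simple quotient is spanned by them,
and [Wz_L0] makes z the conformal weight. *)
Definition Wz (z : int) w := exists v, [/\ hm 0 z v, dv v = 0 & w = rho v].
Lemma hm0_qv z v : hm 0 z v -> qv v = 0. Proof. by case=> -> _; rewrite scale0r. Qed.
Lemma Wz_lin z c u v : Wz z u -> Wz z v -> Wz z (c *: u + v).
Proof.
move=> [u' [h1 h2 ->]] [v' [g1 g2 ->]]; exists (c *: u' + v'); split; first exact: hm_lin.
  by rewrite dvD dvZ h2 g2 scaler0 addr0.
by rewrite rho_lin //; split=> //; apply: hm0_qv; eassumption.
Qed.
Lemma Wz_prod z z' i u v : Wz z u -> Wz z' v -> Wz (z + z' - i - 1) (vprod i u v).
Proof.
move=> [u' [h1 h2 ->]] [v' [g1 g2 ->]]; exists (vprod i u' v'); split.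
- by have := hm_prod kn fil_all i h1 g1.
- exact: dv_prod0.
by rewrite rho_prod //; split=> //; apply: hm0_qv; eassumption.
Qed.
Definition omW := rho om.
Lemma omW_even : vpar false omW. Proof. exact: (rho_par coc_om (om_even C)). Qed.
Lemma Wz_omW : Wz 2 omW.
Proof. by exists om; split=> //; [exact: (hm_om kn fil_all) | exact: coc_om.2]. Qed.
Lemma Wz_L0 z w : Wz z w -> vprod 1 omW w = z%:~R *: w.
Proof.
move=> [v [h1 h2 ->]]; have hc : coc v by split=> //; exact: hm0_qv h1.
rewrite -rho_prod //; last exact: coc_om.
have [_] := h1; rewrite -/(L0 C v) => ->; exact: rhoZ.
Qed.
Lemma Wz_all w : lspan (fun u => exists z, Wz z u) w.
Proof.
have [v [hq hd] <-] := rho_surj w.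
have : coc v /\ lspan (fun u => dv u = 0 /\ exists z, hm 0 z u) v.
  by split=> //; exact: (cocycle_decomp (f0_levm F) kn fil_all hq hd).
move=> [_]; elim=> [|c a b [ha [z hz]] hb IH]; first by rewrite rho0; exact: lspan0.
have cb : coc b.
  elim: hb {IH} => [|c' a' b' [ha' [z' hz']] _ IH]; first exact: coc0.
  by apply: coc_lin => //; split=> //; exact: hm0_qv hz'.
rewrite rho_lin //; last by split=> //; exact: hm0_qv hz.
by apply: lspan_add => //; exists z, a.
Qed.
Lemma omW_T w : vprod 0 omW w = vT w.
Proof.
have [v hv <-] := rho_surj w; rewrite -rho_prod //; last exact: coc_om.
by rewrite (om0T kn fil_all) /vT rho_prod // ?rho_vac //; exact: coc_vac.
Qed.

Lemma Wz_low z w : z <= 2 -> Wz z w -> exists x, [/\ lspan (fun u => exists D : nat, z = D%:Z /\ jw C D u) x,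
  coc x & w = rho x].
Proof.
move=> z2 [v [h1 h2 ->]]; have [H [Hl Hvac HF [HK Hp Hs]]] := homot.
have [x [u [hx hu e]]] := low_weight (f0_minus F) (@f0_deg F) (f0_levm F) kn fil_all Hl Hvac HF HK Hp Hs z2 h1 h2.
have cu : coc (dv u).
  split; last exact: (dd0 (f0_minus F) (@f0_deg F) fil_all).
  by have [q1 _] := hu; rewrite qv_dv q1 dvZ; lmod.
have cx : coc x.
  have -> : x = (-1) *: dv u + v by rewrite e; lmod.
  by apply: coc_lin => //; split=> //; exact: hm0_qv h1.
exists x; split=> //; have [q1 _] := hu.
have q1' : qv u = - u by rewrite q1; lmod.
by rewrite e addrC -[dv u]scale1r rho_lin // rho_cob // scaler0 add0r.
Qed.
(** There are no words of negative weight in the hatted currents. *)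
Lemma Wz_neg z w : z < 0 -> Wz z w -> w = 0.
Proof.
move=> z0 /Wz_low [|x [hx _ ->]]; first lia.
suff -> : x = 0 by exact: rho0.
by elim: hx => // c a b [D [e _]] _ _; move: z0; rewrite e.
Qed.
Lemma Wz_0 w : Wz 0 w -> exists c, w = c *: vac.
Proof.
move=> /Wz_low [//|x [hx _ ->]].
suff [c ->] : exists c, x = c *: vac by exists c; rewrite rhoZ ?rho_vac //; exact: coc_vac.
elim: hx => [|c a b [[|D] [// e ha]] _ [c' ->]]; first by exists 0; rewrite scale0r.
by exists (c + c'); rewrite (jw0_inv ha erefl); lmod.
Qed.
Lemma Wz_1 w : Wz 1 w -> exists c, w = c *: rho J0.
Proof.
move=> /Wz_low [//|x [hx cx ->]].
have [a ha e] : exists2 a, hdeg lev6 0 a & x = hJ a.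
  elim: hx {cx} => [|c u v [[|[|D]] [// _ hu]] _ [b [b1 b2] ->]].
    exists 0; rewrite ?linear0 //; split; rewrite ?linear0 ?scaler0 //.
  have [a [a1 a2] ->] := jw1_inv kn hu erefl; exists (c *: a + b); last by rewrite linearP.
  split; first by rewrite linearP /= a1 b1 scaler0 addr0.
  by rewrite linearP /= a2 b2 oppr0 !scale0r scaler0 addr0.
have [_ d0] := cx; rewrite e (dv_J0 C (f0_minus F) kn ha) in d0.
have [c h] := centralizer vacV ha d0.
by exists c; rewrite e h rhoZ //; exact: coc_J0.
Qed.
Lemma Wz_2 w : Wz 2 w -> exists x, [/\ lspan (jw2 C) x, vpar false x, coc x & w = rho x].
Proof.
move=> /Wz_low [//|x [hx cx ->]]; exists x; split=> //.
  by apply: lspanW hx => u [[|[|[|D]]] [// _ hu]]; exact: (jw2_inv kn hu).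
elim: hx {cx} => [|c u v [D [_ hu]] _ IH]; first exact: vpar0.
apply: vparD => //; apply: vparZ.
elim: hu => [|j m D' a v' _ _ h]; first exact: vac_even.
exact: (vprod_par _ (hJ_even C a) h).
Qed.

Variable J : W.
Hypothesis J_wt : vprod 1 omW J = J.
Hypothesis J_ope : heisenberg_field J (4 * (k + 9 / 2)).
(** J has weight one, hence is a multiple of the class of J0; comparing double
poles fixes the square of the factor. *)
Lemma J_J0 : exists c, J = c *: rho J0 /\ c * c * 3 = 1.
Proof.
have Tl c (u v : W) : vprod 1 omW (c *: u + v) = c *: vprod 1 omW u + vprod 1 omW v by exact: vprod_linearr.
have [j [hj hr]] : exists j, Wz 1 j /\ lspan (fun u => exists2 z, z != 1 & vprod 1 omW u = z%:~R *: u) (J - j).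
  elim: (Wz_all J) => [|c a b [z ha] _ [j [hj hr]]].
    exists 0; split; last by rewrite subr0; exact: lspan0.
    by exists 0; split; [exact: hm0 | exact: dv0 | rewrite rho0].
  have [e|ne] := eqVneq z 1.
    exists (c *: a + j); split; first by apply: Wz_lin => //; rewrite -e.
    by rewrite opprD addrACA subrr add0r.
  exists j; split=> //; rewrite -addrA; apply: lspanD => //; apply/lspanZ/lspan_in.
  by exists z => //; exact: Wz_L0.
have eJ : J = j.
  apply/eqP; rewrite -subr_eq0; apply/eqP; apply: (@eig_indep F W (vprod 1 omW) Tl 1) => //.
  by rewrite -scaleN1r addrC Tl (Wz_L0 hj) J_wt !scale1r.
have [c hc] := Wz_1 hj; exists c; split; first by rewrite eJ.
have := J_ope 1%N; rewrite /= eJ hc vprodZl vprodZr -rho_prod; try exact: coc_J0.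
rewrite J0_1J0 // rhoZ; last exact: coc_vac.
rewrite rho_vac !scalerA => /eqP; rewrite -subr_eq0 -scalerBl scaler_eq0 => /orP[/eqP h|/eqP /vacW //].
have e : (k + 9 / 2) * (c * c * 3 - 1) = 0.
  have -> : (k + 9 / 2) * (c * c * 3 - 1) = (c * c * (12 * k + 54) - 4 * (k + 9 / 2)) / 4 by field.
  by rewrite h mul0r.
by move/eqP: e; rewrite mulf_eq0 (negbTE k92) /= subr_eq0 => /eqP.
Qed.

Definition rr : F := (24 * k + 108)^-1.
Lemma nz24 : 24 * k + 108 != 0.
Proof.
have -> : 24 * k + 108 = 24 * (k + 9 / 2) by field.
by rewrite mulf_neq0 // pnatr_eq0.
Qed.
Lemma hrr : (24 * k + 108) * rr = 1. Proof. by rewrite /rr divff // nz24. Qed.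
Local Notation omt := (omt C rr).
Lemma coc_omt : coc omt.
Proof.
have -> : omt = (- rr) *: (J0 ## J0) + om by rewrite /HeisenbergField.omt; lmod.
by apply: coc_lin; [apply: coc_prod; exact: coc_J0 | exact: coc_om].
Qed.
Lemma rho_omt : rho omt = omW - heisenberg_conformal J (4 * (k + 9 / 2)).
Proof.
have [c [hJ hc]] := J_J0.
have -> : omt = (- rr) *: (J0 ## J0) + om by rewrite /HeisenbergField.omt; lmod.
rewrite rho_lin; [|apply: coc_prod; exact: coc_J0 | exact: coc_om].
rewrite rho_prod; [|exact: coc_J0 | exact: coc_J0].
rewrite /heisenberg_conformal /vnop hJ vprodZl vprodZr addrC !scalerA scaleNr; congr (_ - _ *: _).
rewrite /rr; apply: (mulfI nz24); rewrite divff ?nz24 //.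
have n8 : 2 * (4 * (k + 9 / 2)) != 0 by rewrite !mulf_neq0 ?pnatr_eq0.
have -> : (24 * k + 108) = 3 * (2 * (4 * (k + 9 / 2))) by field.
by rewrite -mulrA mulVKf // mulrC hc.
Qed.
Lemma Wz_omt : Wz 2 (rho omt).
Proof.
exists omt; split=> //; last exact: coc_omt.2.
rewrite /HeisenbergField.omt -scaleNr; apply: hmD; first exact: (hm_om kn fil_all).
apply: hmZ; have h := J0_hm kn fil_all; exact: (hm_prod kn fil_all (-1) h h).
Qed.
Lemma omt_even : vpar false omt.
Proof.
rewrite /HeisenbergField.omt -scaleNr; apply: vparD; first exact: om_even.
by apply: vparZ; exact: (vprod_par (-1) (hJ_even C _) (hJ_even C _)).
Qed.
Local Notation wt := (rho omt).
Lemma wt_even : vpar false wt. Proof. exact: (rho_par coc_omt omt_even). Qed.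

(** If the class of omt is zero then so is its third product with the class of
the cocycle W2. *)
Theorem conformal_only : wt = 0 -> k = - (13 / 3).
Proof.
move=> h; have cW : coc (W2 C) by split; [exact: hm0_qv (W2_hm kn fil_all) | exact: (dv_W2 C kn)].
have := rho_prod 3 coc_omt cW; rewrite h vprod0l (omt_W2 kn fil_all hrr) rhoZ; last exact: coc_vac.
rewrite rho_vac => /eqP; rewrite scaler_eq0 => /orP[/eqP e|/eqP /vacW //].
have e' : k + 13 / 3 = 0.
  have -> : k + 13 / 3 = (39 / 2 * (k + 13 / 3)) * (2 / 39) by field.
  by rewrite e mul0r.
by apply/eqP; rewrite -addr_eq0 e'.
Qed.

Section Special.
Hypothesis hk : k = - (13 / 3).

(** The coset vector is quasi-primary, because both conformal vectors in it
are. *)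
Lemma omW2_wt : vprod 2 omW wt = 0.
Proof.
have hom2 : vprod 2 omW omW = 0.
  have [c hc] := Wz_0 (Wz_prod 3 Wz_omW Wz_omW).
  have := skew_low omW_even omW_even (r := 2) => h; have {}h : vprod 2 omW omW = - vprod 2 omW omW.
    rewrite {1}h; first by rewrite vsgnFl mul1r (_ : (-1) ^ 2 = 1 :> F) ?scaleN1r // -exprnP sqrrN expr1n.
    case=> [|j].
      by rewrite (_ : 2 + 1%:Z = 3) // hc vprodZl vprod_vacl (_ : (-1 - 1%:Z == -1) = false) // scale0r scaler0.
    have wn := Wz_prod (2 + j.+2%:Z) Wz_omW Wz_omW.
    by rewrite (Wz_neg _ wn) ?vprod0l //; lia.
  by move/eqP: h; rewrite -addr_eq0 -mulr2n -scaler_nat scaler_eq0 pnatr_eq0 => /eqP.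
have -> : wt = (- rr) *: rho (J0 ## J0) + omW.
  rewrite -rho_lin; [|apply: coc_prod; exact: coc_J0 | exact: coc_om].
  by congr rho; rewrite /HeisenbergField.omt; lmod.
rewrite vprod_linearr hom2 addr0 -rho_prod; [|exact: coc_om | apply: coc_prod; exact: coc_J0].
by rewrite om2_J0J0 // rho0 scaler0.
Qed.

Lemma com2 z a : vprod 2 omW (vprod z a wt) = vprod z a (vprod 2 omW wt) +
  (vprod (z + 2) (vT a) wt + 2 *: vprod (z + 1) (vprod 1 omW a) wt + vprod z (vprod 2 omW a) wt).
Proof.
have key b x : vpar b x -> vprod 2 omW (vprod z x wt) = vprod z x (vprod 2 omW wt) +
  (vprod (z + 2) (vT x) wt + 2 *: vprod (z + 1) (vprod 1 omW x) wt + vprod z (vprod 2 omW x) wt).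
  by move=> hx; rewrite (vcomm_2 omW_even hx) vsgnFl scale1r omW_T.
have [a0 [a1 [h0 h1 ->]]] := vpar_sum a.
rewrite vTD !(vprodDl, vprodDr) (key _ _ h0) (key _ _ h1).
by lmod.
Qed.
(** The vectors of weight two are classes of cocycles x that are words in
hatted currents, and omt_(3) x = Fop (dv x) = 0. *)
Lemma pairing2 a : Wz 2 a -> vprod 3 a wt = 0.
Proof.
move=> wa; have [x [hx px cx e]] := Wz_2 wa.
have pa : vpar false a by rewrite e; exact: rho_par.
rewrite (skew_low wt_even pa (r := 3)) => [|j].
  rewrite e -rho_prod //; last exact: coc_omt.
  suff -> : vprod 3 omt x = 0 by rewrite rho0 scaler0.
  have <- : Fop C (dv x) = 0 by rewrite cx.2 Fop0.
  elim: hx => [|c u v hu _ IH]; first by rewrite vprod0r dv0 Fop0.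
  by rewrite vprod_linearr dvD dvZ Fop_lin IH (special_pairing kn fil_all hrr hk hu).
have wn := Wz_prod (3 + j.+1%:Z) Wz_omt wa.
by rewrite (Wz_neg _ wn) ?vprod0l //; lia.
Qed.
(** By [com2] applied to the vector a_(z) wt of weight one, a multiple of the
class of J0 and therefore killed by omega_(2), the vector (z - 2) a_(z+1) wt
is determined by the pairing of omega_(2) a, whose weight is z - 1. Induction
on z starts with negative weights, and z = 2 is [pairing2]. *)
Lemma pairing z a : Wz z a -> vprod (z + 1) a wt = 0.
Proof.
have st z' a' : z' != 2 -> Wz z' a' -> vprod z' (vprod 2 omW a') wt = 0 -> vprod (z' + 1) a' wt = 0.
  move=> n2 wa h; have wb : Wz 1 (vprod z' a' wt) by have := Wz_prod z' wa Wz_omt; congr Wz; lia.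
  have [c hc] := Wz_1 wb; have := com2 z' a'.
  rewrite hc vprodZr -rho_prod; [|exact: coc_om | exact: coc_J0].
  rewrite om2_J0 // rho0 scaler0 omW2_wt vprod0r add0r h addr0 (Wz_L0 wa) vprodZl vT_mode_l.
  rewrite (_ : z' + 2 - 1 = z' + 1); last lia.
  rewrite scalerA -scalerDl => /esym/eqP; rewrite scaler_eq0 => /orP[|/eqP //].
  have -> : - (z' + 2)%:~R + 2 * z'%:~R = (z' - 2)%:~R :> F by rewrite !(intrD, intrN); ring.
  by rewrite intr_eq0 subr_eq0 (negbTE n2).
have w1 z' a' : Wz z' a' -> Wz (z' - 1) (vprod 2 omW a').
  by move=> h; have := Wz_prod 2 Wz_omW h; congr Wz; lia.
have [z0|z0] := ltP z 0; first by move=> h; rewrite (Wz_neg z0 h) vprod0l.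
have -> : z = `|z|%N%:Z by lia.
move: `|z|%N => m {z0}; elim: m a => [|m IH] a wa.
  by apply: (st 0 a) => //; rewrite (Wz_neg _ (w1 _ _ wa)) ?vprod0l.
have [e|ne] := eqVneq m.+1%:Z 2; first by rewrite e in wa *; exact: pairing2.
apply: (st m.+1%:Z a) => //; have := IH _ (_ : Wz m%:Z (vprod 2 omW a)).
rewrite (_ : m%:Z + 1 = m.+1%:Z); last lia.
by apply; have := w1 _ _ wa; congr Wz; lia.
Qed.

Let I := lspan (fun x => exists b i, x = vprod i b wt).
Lemma I_in b i : I (vprod i b wt). Proof. by apply: lspan_in; exists b, i. Qed.
Lemma I_left i u x : I x -> I (vprod i u x).
Proof.
apply: lspan_map => [c v v'|v [b [j ->]]]; first exact: vprod_linearr.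
have [u0 [u1 [h0 h1 ->]]] := vpar_sum u; have [b0 [b1 [g0 g1 ->]]] := vpar_sum b.
rewrite !(vprodDl, vprodDr).
by apply: lspanD; apply: lspanD; apply: vprod2_span; eassumption.
Qed.
Lemma I_par x : I x -> exists x0 x1, [/\ vpar false x0, vpar true x1, x = x0 + x1, I x0 & I x1].
Proof.
elim=> [|c u v [b [i ->]] _ [x0 [x1 [h0 h1 -> i0 i1]]]].
  by exists 0, 0; split; rewrite ?addr0 //; [exact: vpar0 | exact: vpar0 | exact: lspan0 | exact: lspan0].
have [b0 [b1 [g0 g1 ->]]] := vpar_sum b.
exists (c *: vprod i b0 wt + x0), (c *: vprod i b1 wt + x1); split.
- by apply: vparD => //; apply: vparZ; exact: (vprod_par _ g0 wt_even).
- by apply: vparD => //; apply: vparZ; exact: (vprod_par _ g1 wt_even).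
- by rewrite vprodDl; lmod.
- by apply: lspanD => //; apply/lspanZ/I_in.
- by apply: lspanD => //; apply/lspanZ/I_in.
Qed.
Lemma I_vac j x : I x -> I (vprod (-1 - j%:Z) x vac).
Proof.
move=> hx; elim: j => [|j IH]; first by rewrite subr0 vprod_vac.
have := vT_mode (-1 - j%:Z) x => e.
have -> : vprod (-1 - j.+1%:Z) x vac = j.+1%:R^-1 *: vT (vprod (-1 - j%:Z) x vac).
  rewrite /vT e (_ : -1 - j%:Z - 1 = -1 - j.+1%:Z); last lia.
  rewrite -intrN (_ : - (-1 - j%:Z) = j.+1%:Z); last lia.
  by rewrite -pmulrn scalerA mulVf ?scale1r // pnatr_eq0.
by apply: lspanZ; rewrite -omW_T; exact: I_left.
Qed.
(** The span of the vectors b_(i) wt is closed under left products by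
[vprod2_span] and under right products by skew-symmetry. *)
Lemma I_ideal : vertex_ideal I.
Proof.
have right0 q q' i u v : vpar q u -> vpar q' v -> I u -> I (vprod i u v).
  move=> pu pv hu; have [K0 h] := vskew pv pu i; rewrite (h K0) //.
  by apply/lspanZ/lspan_sum => j _; apply/lspanZ/I_vac/I_left.
split.
- exact: lspan0.
- by move=> c u v hu hv; apply: lspanD => //; exact: lspanZ.
- move=> u v pu pv /I_par [x0 [x1 [h0 h1 e i0 i1]]].
  have e' : u - x0 = x1 - v.
    apply/eqP; rewrite subr_eq (_ : x1 - v + x0 = x0 + x1 - v); last by lmod.
    by rewrite -e addrK.
  have d0 : u - x0 = 0.
    apply: vpar_direct; first by apply: vparD => //; exact: vparN.
    by rewrite e'; apply: vparD => //; exact: vparN.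
  have eu : u = x0 by apply/eqP; rewrite -subr_eq0 d0.
  have ev : v = x1 by apply/eqP; rewrite eq_sym -subr_eq0 -e' d0.
  by rewrite eu ev.
- by move=> i u v; exact: I_left.
- move=> i u v /I_par [x0 [x1 [h0 h1 -> i0 i1]]].
  have [v0 [v1 [g0 g1 ->]]] := vpar_sum v; rewrite !(vprodDl, vprodDr).
  by apply: lspanD; apply: lspanD; apply: right0; eassumption.
Qed.
(** By [pairing] the vacuum is not in the ideal spanned by the b_(i) wt, since
its weight-zero part is spanned by the a_(z+1) wt with a of weight z. *)
Theorem conformal_special : wt = 0.
Proof.
have [_ /(_ _ I_ideal) [h|h]] := simpW.
  by apply: h; have := I_in vac (-1); rewrite vprod_vacl eqxx scale1r.
case: vacW; have Tl c (u v : W) : vprod 1 omW (c *: u + v) = c *: vprod 1 omW u + vprod 1 omW v by exact: vprod_linearr.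
apply: (@eig_indep F W (vprod 1 omW) Tl 0); first by rewrite scale0r; exact: (vprod_vac_ge0 1).
apply: (lspan_map (g := id)) (h vac) => // _ [b [i ->]].
apply: (lspan_map (g := fun b => vprod i b wt)) (Wz_all b) => [c u v|u [z hz]]; first exact: vprod_linearl.
have w := Wz_prod i hz Wz_omt.
have [e|ne] := eqVneq (z + 2 - i - 1) 0.
  rewrite (_ : i = z + 1); first by rewrite pairing //; exact: lspan0.
  by lia.
by apply: lspan_in; exists (z + 2 - i - 1) => //; exact: Wz_L0.
Qed.
End Special.

Theorem conformal_iff : conformal_embedding (heisenberg_algebra J)
    (heisenberg_conformal J (4 * (k + 9 / 2))) omW <-> k = - (13 / 3).
Proof.
have e := rho_omt; split.
  by move=> [_ h]; apply: conformal_only; rewrite e h subrr.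
move=> hk; split; last by apply/eqP; rewrite eq_sym -subr_eq0 -e conformal_special.
rewrite /heisenberg_conformal /vnop -[_ *: _]addr0.
have g0 : heisenberg_algebra J 0.
  have := vgen_linear (-1) (vgen_vac (fun v : W => v = J)) (vgen_vac (fun v : W => v = J)).
  by rewrite scaleN1r addNr.
by apply: vgen_linear => //; apply: vgen_prod; apply: vgen_in.
Qed.
End Final.
End SimpleQuotient.
Import SimpleQuotient.

(** * Normal form of a nilpotent matrix of Jordan type (4,2) *)
Module NormalForm.
Ltac cvlmod F := first [lmod_on F constr:('cV[F]_6 : lmodType F) constr:('cV[F]_6) ltac:(ring) |
  lmod_on F constr:('cV[F]_6 : lmodType F) constr:('cV[F]_6) ltac:(field)].
Section NormalForm.
Variable F : numFieldType.
Local Notation M := 'M[F]_6.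
Local Notation cV := 'cV[F]_6.
Variables (e h f : M).
Hypothesis hefh : sl2_triple e h f.
Hypothesis hf : jordan_type_4_2 f.
Local Notation f0 := (f0 F).

Lemma heE : h *m e = e *m h + 2 *: e.
Proof. by have [/eqP h1 _ _] := hefh; move: h1; rewrite /lie subr_eq addrC => /eqP. Qed.
Lemma hfE : h *m f = f *m h - 2 *: f.
Proof. by have [_ /eqP h1 _] := hefh; move: h1; rewrite /lie subr_eq addrC => /eqP. Qed.
Lemma efE : e *m f = f *m e + h.
Proof. by have [_ _ /eqP h1] := hefh; move: h1; rewrite /lie subr_eq addrC => /eqP. Qed.

Lemma jordan_block_E : block_mx (jordan_block F 4) 0 0 (jordan_block F 2) =
  \matrix_(a < 4 + 2, i < 4 + 2) (((nat_of_ord a).+1 == nat_of_ord i) && (nat_of_ord i != 4))%:R.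
Proof.
apply/matrixP => a i; rewrite !mxE; case: splitP => a' ea; rewrite mxE; case: splitP => i' ei; rewrite !mxE ea ei;
  have := ltn_ord a'; have := ltn_ord i'.
- by move=> h1 h2; congr (nat_of_bool _)%:R; lia.
- by move=> h1 h2; rewrite (_ : _ && _ = false) //; lia.
- by move=> h1 h2; rewrite (_ : _ && _ = false) //; lia.
- by move=> h1 h2; congr (nat_of_bool _)%:R; lia.
Qed.
(** The columns of the inverse of the conjugating matrix. *)
Lemma jordan_basis : exists2 b : 'I_6 -> cV, (forall x : cV, exists c : 'I_6 -> F, x = \sum_i c i *: b i) &
  (forall c : 'I_6 -> F, \sum_i c i *: b i = 0 -> forall i, c i = 0) /\
  [/\ f *m b o0 = 0, f *m b o1 = b o0, f *m b o2 = b o1, f *m b o3 = b o2 & f *m b o4 = 0 /\ f *m b o5 = b o4].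
Proof.
have [P Pu fE] := hf; rewrite jordan_block_E in fE; set N := \matrix_(a, i) _ in fE.
pose b (i : 'I_6) : cV := invmx P *m (delta_mx i 0 : cV).
have bE (x : cV) : invmx P *m x = \sum_i x i 0 *: b i.
  rewrite {1}[x]matrix_sum_delta mulmx_sumr; apply: eq_bigr => i _.
  by rewrite big_ord1 -scalemxAr.
exists b.
  by move=> x; exists (fun i => (P *m x) i 0); rewrite -bE mulKmx.
split.
  move=> c e0 i; have := bE (\col_i c i); under eq_bigr => j _ do rewrite mxE.
  rewrite e0 => h1; have : P *m (invmx P *m (\col_i c i : cV)) = 0 by rewrite h1 mulmx0.
  by rewrite mulKVmx // => /colP/(_ i); rewrite !mxE.
have fb i : f *m b i = \sum_a N a i *: b a.
  rewrite {1}/b fE -!mulmxA (mulmxA P) mulmxV // mul1mx bE; apply: eq_bigr => a _.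
  by rewrite -colE mxE.
rewrite !fb !sum6 !mxE /= !scale0r !scale1r !(addr0, add0r).
by do ![split].
Qed.

(** The vector b o0 = f^3 b o3 lies in the image of f^3 and the kernel of f,
so it has the weight -3. In the kernel of f the weight of b o4 is -1 modulo b
o0, and a correction by a multiple of b o0 makes it an eigenvector. Applying e
to these two lowest weight vectors gives strings; the factors 1, 3, 12, 36
normalize f to send each basis vector exactly to the next. *)
Theorem normal_form : exists2 Q : M, Q \in unitmx &
  f *m Q = Q *m f0 /\ h *m Q = Q *m (2 *: levm F lev6 - 3%:R *: 1%:M).
Proof.
have [b bspan [bfree [fb0 fb1 fb2 fb3 [fb4 fb5]]]] := jordan_basis.
have eF (u : cV) : e *m (f *m u) = f *m (e *m u) + h *m u by rewrite !mulmxA efE mulmxDl.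
have hF (u : cV) : h *m (f *m u) = f *m (h *m u) - 2 *: (f *m u) by rewrite !mulmxA hfE mulmxBl scalemxAl.
have hE (u : cV) : h *m (e *m u) = e *m (h *m u) + 2 *: (e *m u) by rewrite !mulmxA heE mulmxDl scalemxAl.
have fE (u : cV) : f *m (e *m u) = e *m (f *m u) - h *m u by rewrite eF addrK.
have f4 (u : cV) : f *m (f *m (f *m (f *m u))) = 0.
  have [c ->] := bspan u; rewrite sum6 !mulmxDr -!scalemxAr fb0 fb1 fb2 fb3 fb4 fb5.
  by rewrite !(scaler0, mulmx0, addr0, add0r) ?mulmxDr -?scalemxAr ?fb0 ?fb1 ?fb2 ?fb4
     ?(scaler0, mulmx0, addr0, add0r) ?mulmxDr -?scalemxAr ?fb0 ?fb1 ?(scaler0, mulmx0, addr0, add0r) ?fb0 ?(scaler0, mulmx0).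
have hy : h *m (b o0) = (-3) *: (b o0).
  have y3 : (b o0) = f *m (f *m (f *m b o3)) by rewrite fb3 fb2 fb1.
  have k1 (u : cV) : e *m (f *m (f *m (f *m (f *m u)))) = f *m (f *m (f *m (f *m (e *m u)))) +
     4 *: (f *m (f *m (f *m (h *m u)))) - 12 *: (f *m (f *m (f *m u))).
    rewrite !(eF, hF, mulmxDr, mulmxBr, mulmxN, =^~ scalemxAr).
    by cvlmod F.
  have := k1 (b o3); rewrite !f4 mulmx0 add0r -y3 => /esym/eqP; rewrite subr_eq0 => /eqP k2.
  have k3 : f *m (f *m (f *m (h *m b o3))) = 3 *: (b o0).
    have n4 : 4 != 0 :> F by rewrite pnatr_eq0.
    by apply: (scalerI n4); rewrite k2 scalerA; congr (_ *: _); ring.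
  rewrite {1}y3 !(hF, mulmxBr, =^~ scalemxAr) k3 -y3.
  by cvlmod F.
have fy : f *m (b o0) = 0 by [].
have fz : f *m (b o4) = 0 by [].
have [c hz] : exists c, h *m (b o4) = - (b o4) + c *: (b o0).
  have [c hc] := bspan (e *m b o5).
  have ff : f *m (f *m (e *m b o5)) = c o2 *: b o0 + c o3 *: b o1.
    rewrite hc sum6 !mulmxDr -!scalemxAr fb0 fb1 fb2 fb3 fb4 fb5 !(scaler0, mulmx0, addr0, add0r).
    by rewrite ?mulmxDr -?scalemxAr fb0 fb1 fb2 fb4 !(scaler0, addr0, add0r).
  have k0 : f *m (f *m (e *m b o5)) + 2 *: (h *m (b o4)) + 2 *: (b o4) = 0.
    have e1 := eF (b o4); rewrite fz mulmx0 in e1.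
    have e2 := eF (b o5); rewrite fb5 in e2.
    have e3 := hF (b o5); rewrite fb5 in e3.
    rewrite e2 mulmxDr in e1.
    have e4 : f *m (h *m b o5) = h *m b o4 + 2 *: b o4 by rewrite e3 subrK.
    by rewrite e4 in e1; rewrite [RHS]e1; cvlmod F.
  have c3 : c o3 = 0.
    have : f *m (f *m (f *m (e *m b o5)) + 2 *: (h *m (b o4)) + 2 *: (b o4)) = 0 by rewrite k0 mulmx0.
    have := hF (b o4); rewrite fz mulmx0 scaler0 subr0 => fh.
    rewrite ff !mulmxDr -!scalemxAr fb0 fb1 fz -fh !scaler0 add0r !addr0 => k5.
    have := bfree (fun i => if i == o0 then c o3 else 0) _ o0; rewrite eqxx; apply.
    by rewrite sum6 /= !scale0r !addr0.
  exists (- (c o2 / 2)); move: k0; rewrite ff c3 scale0r addr0 => k0.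
  have -> : h *m (b o4) = 2^-1 *: (c o2 *: (b o0) + 2 *: (h *m (b o4)) + 2 *: (b o4)) - (b o4) - (c o2 / 2) *: (b o0).
    by cvlmod F.
  by rewrite k0; cvlmod F.
pose y2 := (b o4) + (c / 2) *: (b o0).
have fy2 : f *m y2 = 0 by rewrite mulmxDr -scalemxAr fz fy scaler0 addr0.
have hy2 : h *m y2 = - y2 by rewrite mulmxDr -scalemxAr hz hy /y2; cvlmod F.
pose q (i : 'I_6) : cV := nth 0 [:: e *m (e *m (e *m (b o0))); 3 *: (e *m (e *m (b o0))); 12 *: (e *m (b o0)); 36 *: (b o0); e *m y2; y2] i.
have h1 : h *m (e *m (b o0)) = - (e *m (b o0)) by rewrite hE hy -scalemxAr; cvlmod F.
have h2 : h *m (e *m (e *m (b o0))) = e *m (e *m (b o0)) by rewrite hE h1 mulmxN; cvlmod F.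
have h3 : h *m (e *m (e *m (e *m (b o0)))) = 3 *: (e *m (e *m (e *m (b o0)))) by rewrite hE h2; cvlmod F.
have f1 : f *m (e *m (b o0)) = 3 *: (b o0) by rewrite fE fy mulmx0 hy; cvlmod F.
have f2 : f *m (e *m (e *m (b o0))) = 4 *: (e *m (b o0)) by rewrite fE f1 -scalemxAr h1; cvlmod F.
have f3 : f *m (e *m (e *m (e *m (b o0)))) = 3 *: (e *m (e *m (b o0))) by rewrite fE f2 -scalemxAr h2; cvlmod F.
have fq (j : 'I_6) : f *m q j = \sum_l f0 l j *: q l.
  rewrite sum6; move: j; apply: ord6P; rewrite !mxE /q /= !(scale0r, scale1r, addr0, add0r) //.
  - by rewrite -scalemxAr f2; cvlmod F.
  - by rewrite -scalemxAr f1; cvlmod F.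
  - by rewrite -scalemxAr fy scaler0.
  - by rewrite fE fy2 mulmx0 hy2; cvlmod F.
have hq (j : 'I_6) : h *m q j = \sum_l (2 *: levm F lev6 - 3%:R *: 1%:M) l j *: q l.
  have -> : \sum_l (2 *: levm F lev6 - 3%:R *: 1%:M) l j *: q l = (2 * (lev6 j)%:R - 3) *: q j.
    rewrite (bigD1 j) //= big1 ?addr0 => [|l ne]; first by rewrite !mxE eqxx mulr1n mulr1.
    by rewrite !mxE (negbTE ne) mulr0n !mulr0 subrr scale0r.
  move: j; apply: ord6P; rewrite /q /lev6 /=.
  - by rewrite h3; cvlmod F.
  - by rewrite -scalemxAr h2; cvlmod F.
  - by rewrite -scalemxAr h1; cvlmod F.
  - by rewrite -scalemxAr hy; cvlmod F.
  - by rewrite hE hy2 mulmxN; cvlmod F.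
  - by rewrite hy2; cvlmod F.
pose Q : M := \matrix_(i, j) q j i 0.
have AQ (A B : M) : (forall j, A *m q j = \sum_l B l j *: q l) -> A *m Q = Q *m B.
  move=> hA; apply/matrixP => i j; rewrite mxE.
  have : (A *m q j) i 0 = (\sum_l B l j *: q l) i 0 by rewrite hA.
  rewrite mxE summxE => h0; transitivity (\sum_l A i l * q j l 0).
    by apply: eq_bigr => l _; rewrite mxE.
  by rewrite h0 mxE; apply: eq_bigr => l _; rewrite !mxE mulrC.
exists Q; last by split; apply: AQ.
have Qx (x : cV) : Q *m x = \sum_j x j 0 *: q j.
  apply/colP => i; rewrite mxE summxE; apply: eq_bigr => j _; by rewrite !mxE mulrC.
have yfree (a d : F) : a *: (b o0) + d *: y2 = 0 -> a = 0 /\ d = 0.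
  move=> h0; have := bfree (fun i => if i == o0 then a + d * (c / 2) else if i == o4 then d else 0).
  rewrite sum6 /= !scale0r !addr0 => hb.
  have hb' : forall i : 'I_6, (if i == o0 then a + d * (c / 2) else if i == o4 then d else 0) = 0.
    by apply: hb; rewrite -h0 /y2; cvlmod F.
  have d0 := hb' o4; have a0 := hb' o0; rewrite /= in d0 a0.
  by move: a0; rewrite d0 mul0r addr0.
have [g0 g1 g2] : [/\ f *m q o0 = q o1, f *m q o1 = q o2 & f *m q o2 = q o3].
  by split; rewrite fq sum6 !mxE [LHS]/= !(scale0r, scale1r, addr0, add0r).
have [g3 g4 g5] : [/\ f *m q o3 = 0, f *m q o4 = q o5 & f *m q o5 = 0].
  by split; rewrite fq sum6 !mxE [LHS]/= !(scale0r, scale1r, addr0, add0r).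
have q3 : q o3 = 36 *: b o0 by [].
have q5 : q o5 = y2 by [].
clearbody q.
have Qker (x : cV) : Q *m x = 0 -> x = 0.
  rewrite Qx sum6 => h0.
  have F1 : x o0 0 *: q o1 + x o1 0 *: q o2 + x o2 0 *: q o3 + x o4 0 *: q o5 = 0.
    have := congr1 (mulmx f) h0; rewrite mulmx0 !mulmxDr -!scalemxAr !(g0, g1, g2, g3, g4, g5) !(addr0, scaler0); exact: id.
  have F2 : x o0 0 *: q o2 + x o1 0 *: q o3 = 0.
    have := congr1 (mulmx f) F1; rewrite mulmx0 !mulmxDr -!scalemxAr !(g0, g1, g2, g3, g4, g5) !(addr0, scaler0); exact: id.
  have F3 : x o0 0 *: q o3 = 0.
    have := congr1 (mulmx f) F2; rewrite mulmx0 !mulmxDr -!scalemxAr !(g0, g1, g2, g3, g4, g5) !(addr0, scaler0); exact: id.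
  have n36 (a : F) : a * 36 = 0 -> a = 0 by move/eqP; rewrite mulf_eq0 pnatr_eq0 orbF => /eqP.
  have x0 : x o0 0 = 0.
    have [|k1 _] := yfree (x o0 0 * 36) 0; last exact: n36.
    by rewrite scale0r addr0 -scalerA -q3.
  rewrite x0 scale0r add0r in F2.
  have x1 : x o1 0 = 0.
    have [|k1 _] := yfree (x o1 0 * 36) 0; last exact: n36.
    by rewrite scale0r addr0 -scalerA -q3.
  have [|k2 x4] := yfree (x o2 0 * 36) (x o4 0).
    by move: F1; rewrite x0 x1 !scale0r !add0r q3 q5 scalerA.
  have x2 := n36 _ k2.
  have [|k3 x5] := yfree (x o3 0 * 36) (x o5 0).
    by move: h0; rewrite x0 x1 x2 x4 !scale0r !add0r addr0 q3 q5 scalerA.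
  have x3 := n36 _ k3.
  by apply/colP; apply: ord6P; rewrite !mxE.
rewrite -unitmx_tr -row_free_unit; apply: inj_row_free => v hv.
have : Q *m v^T = 0 by rewrite -[Q]trmxK -trmx_mul hv trmx0.
by move/Qker => h0; rewrite -[v]trmxK h0 trmx0.
Qed.
End NormalForm.
End NormalForm.
Import NormalForm.

(** * The BRST complex as fields indexed by matrices *)
Module MatrixFields.
Section Interface.
Variables (F : numFieldType) (k : F) (h f Q : 'M[F]_6).
Variables (B : dynkin_bases h) (C : brst_complex k B).
Local Notation M := 'M[F]_6.
Local Notation f0 := (f0 F).
Local Notation levm := (levm F lev6).
Hypothesis Qu : Q \in unitmx.
Hypothesis fQ : f *m Q = Q *m f0.
Hypothesis hQ : h *m Q = Q *m (2 *: levm - 3%:R *: 1%:M).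
Local Notation ud := (ud F).
Local Notation dd := (dd F).
Local Notation pos := (pos lev6).
Local Notation u := (up B).
Local Notation u' := (up' B).

Definition cj (a : M) : M := Q *m a *m invmx Q.
Definition ic (a : M) : M := invmx Q *m a *m Q.
Lemma cj_is_linear : linear cj.
Proof. by move=> c a b; rewrite /cj mulmxDr mulmxDl -scalemxAr -scalemxAl. Qed.
HB.instance Definition _ := GRing.isLinear.Build F M M *:%R cj cj_is_linear.
Lemma ic_is_linear : linear ic.
Proof. by move=> c a b; rewrite /ic mulmxDr mulmxDl -scalemxAr -scalemxAl. Qed.
HB.instance Definition _ := GRing.isLinear.Build F M M *:%R ic ic_is_linear.
Lemma cjK a : ic (cj a) = a.
Proof. by rewrite /ic /cj !mulmxA mulVmx // mul1mx -mulmxA mulVmx // mulmx1. Qed.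
Lemma icK a : cj (ic a) = a.
Proof. by rewrite /ic /cj !mulmxA mulmxV // mul1mx -mulmxA mulmxV // mulmx1. Qed.
Lemma cjM a b : cj (a *m b) = cj a *m cj b.
Proof. by rewrite /cj -!mulmxA (mulmxA (invmx Q) Q) mulVmx // mul1mx. Qed.
Lemma icM a b : ic (a *m b) = ic a *m ic b.
Proof. by rewrite -[LHS]cjK -{1}(icK a) -{1}(icK b) -cjM !cjK || rewrite /ic -!mulmxA (mulmxA Q (invmx Q)) mulmxV // mul1mx. Qed.
Lemma cj_lie a b : cj (lie a b) = lie (cj a) (cj b).
Proof. by rewrite /lie linearB /= !cjM. Qed.
Lemma ic_lie a b : ic (lie a b) = lie (ic a) (ic b).
Proof. by rewrite /lie linearB /= !icM. Qed.
Lemma tr_cj a : \tr (cj a) = \tr a.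
Proof. by rewrite /cj mxtrace_mulC mulmxA mulVmx // mul1mx. Qed.
Lemma tr_ic a : \tr (ic a) = \tr a. Proof. by rewrite -tr_cj icK. Qed.
Lemma tr_cjl a b : \tr (cj a *m b) = \tr (a *m ic b).
Proof. by rewrite -{1}[b]icK -cjM tr_cj. Qed.
Lemma ic_f : ic f = f0. Proof. by rewrite /ic -mulmxA fQ mulmxA mulVmx // mul1mx. Qed.
Lemma ic_h : ic h = 2 *: levm - 3%:R *: 1%:M. Proof. by rewrite /ic -mulmxA hQ mulmxA mulVmx // mul1mx. Qed.

Definition U i := ic (u i).
Definition U' i := ic (u' i).
Lemma lie_hd (a : M) : lie (2 *: levm - 3%:R *: 1%:M) a = 2 *: lie levm a.
Proof.
rewrite lieDl lieZl lieNl lieZl (_ : lie 1%:M a = 0) ?scaler0 ?subr0 //.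
by rewrite /lie mul1mx mulmx1 subrr.
Qed.
Lemma two_inj (W : lmodType F) (x y : W) : 2 *: x = 2 *: y -> x = y.
Proof. by apply: scalerI; rewrite pnatr_eq0. Qed.
Lemma U_lev i : lie levm (U i) = (udeg B i)%:R *: U i.
Proof.
apply: two_inj; rewrite -lie_hd -ic_h -ic_lie up_deg linearZ /= scalerA natrM //.
Qed.
Lemma U'_lev i : lie levm (U' i) = - ((udeg B i)%:R *: U' i).
Proof.
apply: two_inj; rewrite -lie_hd -ic_h -ic_lie up'_deg linearN linearZ /= scalerN scalerA natrM //.
Qed.
Lemma U_plus i : plus lev6 (U i) = U i.
Proof.
apply/matrixP => a b; rewrite mxE; case: ltnP => // le.
have := U_lev i; move/matrixP/(_ a b); rewrite lie_levmE [RHS]mxE => /eqP.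
rewrite -subr_eq0 -mulrBl mulf_eq0 => /orP[|/eqP -> //].
rewrite -addrA -opprD subr_eq0 -natrD eqr_nat => /eqP e; have := udeg_gt0 (d := B) i; lia.
Qed.
Lemma U'_minus i : minus lev6 (U' i) = U' i.
Proof.
apply/matrixP => a b; rewrite mxE; case: ltnP => // le.
have := U'_lev i; move/matrixP/(_ a b); rewrite lie_levmE [RHS]mxE [in RHS]mxE => /eqP.
rewrite -subr_eq0 opprK -mulrDl mulf_eq0 => /orP[|/eqP -> //].
rewrite addrAC subr_eq0 -natrD eqr_nat => /eqP e; have := udeg_gt0 (d := B) i; lia.
Qed.
Lemma U_dual i j : \tr (U i *m U' j) = (i == j)%:R.
Proof. by rewrite /U /U' -icM tr_ic up_dual. Qed.
(** The bases up and up' are only known to be dual and to span each graded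
piece; comparing with the elementary matrices yields the projection on the
positive part. *)
Lemma U_span (a : M) : plus lev6 a = \sum_i \tr (a *m U' i) *: U i.
Proof.
have hE al : pos al -> ud al = \sum_i \tr (ud al *m U' i) *: U i.
  move=> hal; have m0 : (0 < lev6 al.1 - lev6 al.2)%N by rewrite subn_gt0; exact: hal.
  rewrite -{1}[ud al]cjK (@up_span _ _ _ B _ (cj (ud al)) m0).
    by rewrite linear_sum; apply: eq_bigr => i _; rewrite linearZ /= tr_cjl.
  rewrite -{1}[h]icK -cj_lie ic_h lie_hd lie_levm_ud linearZ /= linearZ /= scalerA /mdeg natrM natrB ?(ltnW hal) //.
transitivity (\sum_(al | pos al) \tr (a *m dd al) *: ud al); first exact: plus_sum.
have -> : \sum_i \tr (a *m U' i) *: U i = \sum_(al | pos al) \sum_i (\tr (a *m dd al) * \tr (ud al *m U' i)) *: U i.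
  rewrite exchange_big; apply: eq_bigr => i _; rewrite -scaler_suml; congr (_ *: _).
  rewrite -{1}[U' i]U'_minus -tr_plus plus_sum mulmx_suml linear_sum /=; apply: eq_bigr => al _.
  by rewrite -scalemxAl linearZ.
apply: eq_bigr => al hal; rewrite {1}(hE _ hal) scaler_sumr; apply: eq_bigr => i _.
by rewrite scalerA.
Qed.

(** Passing to the traceless part sets the current of a scalar matrix to zero.
*)
Definition dtr (a : M) : M := a - (\tr a / 6%:R) *: 1%:M.
Lemma dtr_lin : linear dtr.
Proof. by move=> c a b; rewrite /dtr linearP /=; (lmod_on F constr:(M : lmodType F) constr:(M) ltac:(field)). Qed.
Lemma tr_dtr a : \tr (dtr a) = 0.
Proof. by rewrite /dtr linearB /= linearZ /= mxtrace1; field. Qed.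
Lemma dtr_id a : \tr a = 0 -> dtr a = a.
Proof. by rewrite /dtr => ->; rewrite mul0r scale0r subr0. Qed.
Definition Kf (a : M) : C := cur C (cj (dtr a)).
Definition pf (a : M) : C := \sum_i \tr (a *m U' i) *: phi C i.
Definition sf (a : M) : C := \sum_i \tr (a *m U i) *: phis C i.
Lemma Kf_lin : linear Kf.
Proof. by move=> c a b; rewrite /Kf dtr_lin !linearP. Qed.
Lemma pf_lin : linear pf.
Proof.
move=> c a b; rewrite /pf scaler_sumr -big_split; apply: eq_bigr => i _ /=.
by rewrite mulmxDl -scalemxAl linearP /= scalerDl scalerA.
Qed.
Lemma sf_lin : linear sf.
Proof.
move=> c a b; rewrite /sf scaler_sumr -big_split; apply: eq_bigr => i _ /=.
by rewrite mulmxDl -scalemxAl linearP /= scalerDl scalerA.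
Qed.
HB.instance Definition _ := GRing.isLinear.Build F M C *:%R Kf Kf_lin.
HB.instance Definition _ := GRing.isLinear.Build F M C *:%R pf pf_lin.
HB.instance Definition _ := GRing.isLinear.Build F M C *:%R sf sf_lin.

Lemma cur_span (a : M) : \tr a = 0 -> cur C a = \sum_i \tr (a *m bg' B i) *: cur C (bg B i).
Proof.
move=> h0; rewrite {1}(@bg_span _ _ _ B _ h0) linear_sum; apply: eq_bigr => i _.
by rewrite linearZ.
Qed.
Let pgen := fun i : 'I_(dim_g B + (dim_p B + dim_p B)) => if split i is inl _ then false else true.
Let gen := fun i : 'I_(dim_g B + (dim_p B + dim_p B)) => match split i with
   | inl j => cur C (bg B j) | inr j => match split j with inl l => phi C l | inr l => phis C l end end.
Lemma gen_par i : vpar (pgen i) (gen i). Proof. by have [h0 _ _] := brst_free C; exact: h0. Qed.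
Lemma split_l m n (i : 'I_m) : split (lshift n i) = inl i. Proof. exact: (unsplitK (inl i)). Qed.
Lemma split_r m n (i : 'I_n) : split (rshift m i) = inr i. Proof. exact: (unsplitK (inr i)). Qed.
Lemma cur_even (a : M) : \tr a = 0 -> vpar false (cur C a).
Proof.
move=> /cur_span ->; apply: vpar_bigsum => i _; apply: vparZ.
by have := gen_par (lshift _ i); rewrite /pgen /gen split_l.
Qed.
Lemma phi_odd i : vpar true (phi C i).
Proof. by have := gen_par (rshift _ (lshift _ i)); rewrite /pgen /gen split_r split_l. Qed.
Lemma phis_odd i : vpar true (phis C i).
Proof. by have := gen_par (rshift _ (rshift _ i)); rewrite /pgen /gen !split_r. Qed.
Lemma tr_cjd a : \tr (cj (dtr a)) = 0. Proof. by rewrite tr_cj tr_dtr. Qed.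
Lemma lie_dtr a b : lie (dtr a) (dtr b) = lie a b.
Proof.
rewrite /dtr /lie !(mulmxBl, mulmxBr) -!scalemxAl -!scalemxAr !(mul1mx, mulmx1).
move: (a *m b) (b *m a) (1%:M : M) (\tr a / 6%:R) (\tr b / 6%:R) => x y z s t.
by (lmod_on F constr:(M : lmodType F) constr:(M) ltac:(ring)).
Qed.
Lemma Kf_cj a : \tr a = 0 -> Kf (ic a) = cur C a.
Proof. by move=> h0; rewrite /Kf dtr_id ?tr_ic // icK. Qed.
Lemma pf_U i : pf (U i) = phi C i.
Proof.
rewrite /pf (bigD1 i) //= big1 ?addr0 => [|j ne]; first by rewrite U_dual eqxx scale1r.
by rewrite U_dual eq_sym (negbTE ne) scale0r.
Qed.
Lemma sf_U' i : sf (U' i) = phis C i.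
Proof.
rewrite /sf (bigD1 i) //= big1 ?addr0 => [|j ne]; first by rewrite mxtrace_mulC U_dual eqxx scale1r.
by rewrite mxtrace_mulC U_dual (negbTE ne) scale0r.
Qed.
Lemma fin0 (I : finType) (g : I -> C) : (forall i, g i = 0) -> \sum_i g i = 0.
Proof. by move=> h0; apply: big1 => i _. Qed.

(** The relations follow from the given operator products by linearity;
conjugation by Q preserves the bracket and the trace form. *)
Definition ops : brst_ops C lev6 k.
Proof.
apply: (@BrstOps F C 6 lev6 k Kf pf sf).
- by move=> a; apply: cur_even; exact: tr_cjd.
- by move=> a; apply: vpar_bigsum => i _; apply: vparZ; exact: phi_odd.
- by move=> a; apply: vpar_bigsum => i _; apply: vparZ; exact: phis_odd.
- suff e : dtr 1%:M = 0 by rewrite /= /Kf e !linear0.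
  by rewrite /dtr mxtrace1 divff ?scale1r ?subrr // pnatr_eq0.
- by move=> a; apply: eq_bigr => i _; rewrite -[U' i]U'_minus -tr_plus plus_plus tr_plus U'_minus.
- by move=> a; apply: eq_bigr => i _; rewrite tr_minus U_plus.
- move=> a b; have := ope_cur_cur C (tr_cjd a) (tr_cjd b) 0; rewrite /= => ->.
  rewrite -cj_lie lie_dtr /Kf dtr_id //; exact: tr_lie0.
- move=> a b; have := ope_cur_cur C (tr_cjd a) (tr_cjd b) 1; rewrite /= => ->.
  rewrite -cjM tr_cj; congr (_ *: _); congr (_ * _).
  rewrite /dtr !(mulmxBl, mulmxBr) -!scalemxAl -!scalemxAr !(mul1mx, mulmx1) !linearB /= !linearZ /= mxtrace1.
  by rewrite ?linearZ /= ?mxtrace1; field.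
- by move=> a b [|[|j]] // _; have := ope_cur_cur C (tr_cjd a) (tr_cjd b) j.+2; rewrite /= nth_nil.
- move=> a b j; rewrite /pf vprod_sumr; apply: fin0 => i; rewrite vprodZr.
  by rewrite (ope_cur_phi C i (tr_cjd a) j) nth_nil scaler0.
- move=> a b j; rewrite /sf vprod_sumr; apply: fin0 => i; rewrite vprodZr.
  by rewrite (ope_cur_phis C i (tr_cjd a) j) nth_nil scaler0.
- move=> a b j; rewrite /pf vprod_sumr; apply: fin0 => i; rewrite vprodZr vprod_suml fin0 ?scaler0 // => l.
  by rewrite vprodZl (ope_phi_phi C l i j) nth_nil scaler0.
- move=> a b j; rewrite /sf vprod_sumr; apply: fin0 => i; rewrite vprodZr vprod_suml fin0 ?scaler0 // => l.
  by rewrite vprodZl (ope_phis_phis C l i j) nth_nil scaler0.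
- move=> a b; rewrite /pf /sf vprod_suml.
  have -> : \tr (plus lev6 a *m b) = \sum_i \tr (a *m U' i) * \tr (b *m U i).
    rewrite U_span mulmx_suml linear_sum /=; apply: eq_bigr => i _.
    by rewrite -scalemxAl linearZ /= (mxtrace_mulC b).
  rewrite scaler_suml; apply: eq_bigr => i _; rewrite vprodZl vprod_sumr -scalerA; congr (_ *: _).
  rewrite (bigD1 i) //= big1 ?addr0 => [|l ne]; rewrite vprodZr (ope_phi_phis C _ _ 0) /=.
    by rewrite eqxx scale1r.
  by rewrite eq_sym (negbTE ne) scale0r scaler0.
- move=> a b [|j] // _; rewrite /pf /sf vprod_suml; apply: fin0 => i; rewrite vprodZl vprod_sumr fin0 ?scaler0 // => l.
  by rewrite vprodZr (ope_phi_phis C _ _ j.+1) /= nth_nil scaler0.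
Defined.
Local Notation ss := (ss ops).

Lemma tr_up i : \tr (u i) = 0.
Proof.
rewrite -tr_ic -/(U i) -U_plus /mxtrace big1 // => a _; by rewrite mxE ltnn.
Qed.
Lemma lie_linr (x : M) c a b : lie x (c *: a + b) = c *: lie x a + lie x b.
Proof. by rewrite /lie mulmxDr mulmxDl -scalemxAr -scalemxAl scalerBr opprD addrACA. Qed.
Lemma lie_linl (x : M) c a b : lie (c *: a + b) x = c *: lie a x + lie b x.
Proof. by rewrite lieDl lieZl. Qed.

Lemma lin_bigsum (g : M -> C) (I : finType) (P : pred I) (c : I -> F) (x : I -> M) :
  (forall d a b, g (d *: a + b) = d *: g a + g b) ->
  g (\sum_(i | P i) c i *: x i) = \sum_(i | P i) c i *: g (x i).
Proof.
move=> hg; have g0 : g 0 = 0 by have := hg (-1) 0 0; rewrite scaler0 addr0 scaleN1r addNr.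
by elim/big_rec2: _ => // i y z _ <-; rewrite hg.
Qed.
(** A contraction over the given dual bases equals the one over the elementary
matrices. *)
Lemma dual_sum (G : 'I_(dim_p B) -> M -> C) :
  (forall i d a b, G i (d *: a + b) = d *: G i a + G i b) ->
  \sum_(al | pos al) \sum_i \tr (dd al *m U i) *: G i (ud al) = \sum_i G i (U i).
Proof.
move=> hG; rewrite exchange_big; apply: eq_bigr => i _ /=.
rewrite -{2}(U_plus i) plus_sum lin_bigsum //; apply: eq_bigr => al _.
by rewrite mxtrace_mulC.
Qed.

Lemma brst_vectorE : brst_vector C f = Dv ops f0.
Proof.
rewrite /brst_vector /Dv; congr (_ - _ *: _ + _).
- transitivity (\sum_i vnop (Kf (U i)) (phis C i)).
    by apply: eq_bigr => i _; rewrite /U Kf_cj ?tr_up.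
  rewrite -(dual_sum (G := fun i x => vnop (Kf x) (phis C i))) => [|i d a b].
    apply: eq_bigr => al _; rewrite [RHS]vprod_sumr; apply: eq_bigr => i _.
    by rewrite [RHS]vprodZr.
  by rewrite /vnop linearP vprodDl vprodZl.
- transitivity (\sum_j \sum_i vnop (pf (lie (U i) (U j))) (vnop (phis C i) (phis C j))).
    rewrite exchange_big; apply: eq_bigr => j _; apply: eq_bigr => i _ /=.
    rewrite [RHS]vprod_suml; apply: eq_bigr => l _.
    by rewrite [RHS]vprodZl /U /U' -ic_lie -icM tr_ic.
  transitivity (\sum_(al | pos al) \sum_j vnop (pf (lie (ud al) (U j))) (vnop (sf (dd al)) (phis C j))).
    rewrite [RHS]exchange_big /=; apply: eq_bigr => j _.
    rewrite -(dual_sum (G := fun i x => vnop (pf (lie x (U j))) (vnop (phis C i) (phis C j)))) => [|i d a b].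
      apply: eq_bigr => al _.
      have -> : vnop (sf (dd al)) (phis C j) = \sum_i \tr (dd al *m U i) *: vnop (phis C i) (phis C j).
        by rewrite [LHS]vprod_suml; apply: eq_bigr => i _; rewrite [LHS]vprodZl.
      by rewrite [RHS]vprod_sumr; apply: eq_bigr => i _; rewrite [RHS]vprodZr.
    by rewrite lie_linl linearP [LHS]vprodDl vprodZl.
  apply: eq_bigr => al _.
  rewrite -(dual_sum (G := fun j x => vnop (pf (lie (ud al) x)) (vnop (sf (dd al)) (phis C j)))) => [|i d a b].
    apply: eq_bigr => be _; rewrite [in RHS]/ss [in RHS]/= [X in _ ## (_ ## X)]/sf vprod_sumr vprod_sumr; apply: eq_bigr => i _.
    by rewrite vprodZr vprodZr.
  by rewrite lie_linr linearP [LHS]vprodDl vprodZl.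
- by apply: eq_bigr => i _; rewrite -ic_f /U -icM tr_ic.
Qed.

Lemma charge_vectorE : \sum_i vnop (phis C i) (phi C i) = Qv ops.
Proof.
transitivity (\sum_i vnop (phis C i) (pf (U i))); first by apply: eq_bigr => i _; rewrite pf_U.
rewrite -(dual_sum (G := fun i x => vnop (phis C i) (pf x))) => [|i d a b].
  apply: eq_bigr => al _; rewrite [RHS]vprod_suml; apply: eq_bigr => i _.
  by rewrite [RHS]vprodZl.
by rewrite linearP [LHS]vprodDr vprodZr.
Qed.

Lemma tr_dtrl (a b : M) : \tr b = 0 -> \tr (dtr a *m b) = \tr (a *m b).
Proof. by move=> h0; rewrite /dtr mulmxBl -scalemxAl mul1mx linearB /= linearZ /= h0 mulr0 subr0. Qed.
Lemma Kf_span (a : M) : Kf a = \sum_i \tr (a *m ic (bg' B i)) *: cur C (bg B i).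
Proof.
rewrite /Kf (cur_span (tr_cjd a)); apply: eq_bigr => i _.
by rewrite tr_cjl tr_dtrl // tr_ic bg'_sl.
Qed.

(** The term T x is insensitive to the scalar part of h/2, since the current
only depends on the traceless part. *)
Lemma brst_conformalE : \tr h = 0 -> brst_conformal C = om ops.
Proof.
move=> htr; rewrite /brst_conformal /om; congr (_ + _ + _).
- rewrite /sugawara /wS; congr (_ *: _).
  transitivity (\sum_(al : ip 6) \sum_i \tr (ud al *m ic (bg' B i)) *: vnop (cur C (bg B i)) (Kf (dd al))).
    rewrite exchange_big; apply: eq_bigr => i _ /=.
    have -> : cur C (bg' B i) = \sum_al \tr (ud al *m ic (bg' B i)) *: Kf (dd al).
      rewrite -Kf_cj ?bg'_sl // -{1}(sum_dd (ic (bg' B i))) linear_sum; apply: eq_bigr => al _.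
      by rewrite linearZ.
    rewrite /vnop vprod_sumr; apply: eq_bigr => al _; by rewrite vprodZr.
  apply: eq_bigr => al _; rewrite [in RHS]/= [X in X ## _]Kf_span vprod_suml; apply: eq_bigr => i _.
  by rewrite vprodZl.
- congr vT; rewrite linearZ /= -Kf_cj // ic_h.
  by rewrite -[Kf (_ - _)]/(bK ops (_ - _)) K_mod1 scalerA mulVf ?scale1r ?pnatr_eq0.
- pose G i x : C := - vnop (phis C i) (vT (pf (lie levm x))) + vnop (vT (phis C i)) (pf x - pf (lie levm x)).
  transitivity (\sum_i G i (U i)).
    apply: eq_bigr => i _; rewrite /G U_lev.
    have -> : pf ((udeg B i)%:R *: U i) = (udeg B i)%:R *: phi C i by rewrite linearZ /= pf_U.
    rewrite pf_U vTZ /vnop [in RHS]vprodZr; congr (_ + _).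
    by rewrite vprodBr vprodZr scalerBl scale1r.
  rewrite -(dual_sum (G := G)) => [|i d a b].
    apply: eq_bigr => al _; rewrite -[vT (bs _ _)]/(vT (sf _)) -[bs ops _]/(sf _) -[bp ops _]/(pf _).
    set tp := vT (pf (ud al)).
    rewrite [in RHS]/sf /vT !vprod_suml -!/(vT _) scaler_sumr -sumrN scaler_sumr -big_split; apply: eq_bigr => i _ /=.
    rewrite /G lie_levm_ud.
    have -> : pf (mdeg F lev6 al *: ud al) = mdeg F lev6 al *: pf (ud al) by rewrite linearZ.
    rewrite vTZ /vnop !vprodZl vprodBr !vprodZr -!/(vT _) -/tp.
    by lmod.
  have e x y : pf (d *: x + y) = d *: pf x + pf y by rewrite linearP.
  rewrite /G lie_linr !e vTD vTZ /vnop vprodDr vprodZr.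
  have -> : d *: pf a + pf b - (d *: pf (lie levm a) + pf (lie levm b)) =
    d *: (pf a - pf (lie levm a)) + (pf b - pf (lie levm b)) by rewrite scalerBr opprD addrACA.
  by rewrite vprod_linearr opprD scalerDr scalerN addrACA.
Qed.

Definition bletter i : letter F 6 := match split i with
  | inl j => LK (ic (bg B j))
  | inr j => match split j with inl l => LP (U l) | inr l => LS (U' l) end end.
Lemma pf1 : pf 1%:M = 0.
Proof.
rewrite /pf; apply: fin0 => i; rewrite mul1mx -U'_minus /mxtrace big1 ?scale0r // => a _.
by rewrite mxE ltnn.
Qed.
Lemma pf_dtr a : pf (dtr a) = pf a.
Proof. by rewrite /dtr linearB linearZ /= pf1 scaler0 subr0. Qed.
Lemma bgen_letter i : gen i = lev_ ops (bletter i).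
Proof.
rewrite /gen /bletter; case: (split i) => [j|j] /=; first by rewrite Kf_cj ?bg_sl.
by case: (split j) => l /=; rewrite ?pf_U ?sf_U'.
Qed.
Lemma bpar_letter i : pgen i = lodd (bletter i).
Proof. by rewrite /pgen /bletter; case: (split i) => // j; case: (split j). Qed.
Lemma Kspan a : exists c : _ -> F, bK ops a = \sum_(i | ~~ lodd (bletter i)) c i *: gen i /\
   bp ops a = \sum_(i | ~~ lodd (bletter i)) c i *: lder ops (bletter i).
Proof.
exists (fun i => if split i is inl j then \tr (cj (dtr a) *m bg' B j) else 0).
have aux (g : _ -> C) : \sum_(i | ~~ lodd (bletter i)) (if split i is inl j then \tr (cj (dtr a) *m bg' B j) else 0) *: g i =
  \sum_j \tr (cj (dtr a) *m bg' B j) *: g (lshift _ j).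
  rewrite big_mkcond big_split_ord /= [X in _ + X]big1 ?addr0 => [|j _].
    by apply: eq_bigr => j _; rewrite /bletter !split_l.
  by rewrite /bletter !split_r; case: ifP => // _; rewrite scale0r.
rewrite !aux; split.
  rewrite /= /Kf (cur_span (tr_cjd a)); apply: eq_bigr => j _; by rewrite /gen split_l.
rewrite /= -pf_dtr -{1}[dtr a]cjK {1}(@bg_span _ _ _ B _ (tr_cjd a)) linear_sum linear_sum; apply: eq_bigr => j _.
by rewrite /bletter split_l !linearZ.
Qed.
Lemma Pspan a : exists c : _ -> F,
  bp ops a = \sum_(i | lodd (bletter i) && (ldeg (bletter i) == 1%N)) c i *: gen i.
Proof.
exists (fun i => if split i is inr j then if split j is inl l then \tr (a *m U' l) else 0 else 0).
rewrite big_mkcond !big_split_ord /= big1 ?add0r => [|j _]; last by rewrite /bletter !split_l.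
rewrite [X in _ + X]big1 ?addr0 => [|j _]; last by rewrite /bletter !split_r.
by apply: eq_bigr => j _; rewrite /bletter /gen !split_r !split_l.
Qed.
Lemma Sspan a : exists c : _ -> F, bs ops a = \sum_(i | ldeg (bletter i) == 0%N) c i *: gen i.
Proof.
exists (fun i => if split i is inr j then if split j is inr l then \tr (a *m U l) else 0 else 0).
rewrite big_mkcond !big_split_ord /= big1 ?add0r => [|j _]; last by rewrite /bletter !split_l.
rewrite big1 ?add0r => [|j _]; last by rewrite /bletter !split_r !split_l.
by apply: eq_bigr => j _; rewrite /bletter /gen !split_r.
Qed.
Definition ops_homotopy := homotopy (brst_free C) bgen_letter bpar_letter Kspan Pspan Sspan.
Definition ops_fil_all := fil_all (brst_free C) bgen_letter.
End Interface.
End MatrixFields.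
Import MatrixFields.

(** * The conformal level *)
(** Cocycles in the sense of a universal W-algebra are those of the normal
form, so cl followed by the quotient map satisfies what [conformal_iff]
requires. *)
Theorem conformal_level (F : numFieldType) (k : F)
  (e h f : 'M[F]_6) (hefh : sl2_triple e h f) (hf : jordan_type_4_2 f)
  (kn : k + 6 != 0) (k92 : k + 9 / 2 != 0)
  (D : dynkin_bases h) (C : brst_complex k D)
  (Wuniv : vertexSuperAlgType F) (cl : C -> Wuniv)
  (hWuniv : universal_W f cl)
  (W : vertexSuperAlgType F) (q : Wuniv -> W)
  (hW : simple_quotient q) (J : W)
  (hJ1 : vprod 1 (q (cl (brst_conformal C))) J = J)
  (hJ : heisenberg_field J (4 * (k + 9 / 2))) :
  conformal_embedding (heisenberg_algebra J)
     (heisenberg_conformal J (4 * (k + 9 / 2))) (q (cl (brst_conformal C)))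
   <-> k = - (13 / 3).
Proof.
have [Q Qu [fQ hQ]] := normal_form hefh hf.
have htr : \tr h = 0 by case: hefh => _ _ <-; exact: tr_lie0.
pose O := ops C Qu hQ.
have dE v : brst_diff f v = dv O (f0 F) v by rewrite /brst_diff (@brst_vectorE F k h f Q D C Qu fQ hQ).
have cE c v : has_charge c v <-> qv O v = c *: v by rewrite /has_charge (@charge_vectorE F k h Q D C Qu hQ).
have cocE v : coc O v <-> cocycle0 f v.
  by rewrite /coc /cocycle0 dE cE scale0r.
have [[ql qvac qprod qpar] qsurj simpW] := hW.
have fa := @ops_fil_all F k h Q D C Qu hQ.
move: hJ1; rewrite (@brst_conformalE F k h Q D C Qu hQ htr) => hJ1.
apply: (conformal_iff (rho := fun v => q (cl v)) kn k92 fa (@ops_homotopy F k h Q D C Qu hQ)) => //.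
- move=> c u v /cocE hu /cocE hv; by rewrite (cl_linear hWuniv) // ql.
- by rewrite (cl_vac hWuniv).
- move=> i u v /cocE hu /cocE hv; by rewrite (cl_prod hWuniv) // qprod.
- move=> p v /cocE hv hp; apply: qpar; exact: (cl_par hWuniv).
- move=> w; have [u <-] := qsurj w; have [v /cocE hv <-] := cl_surj hWuniv u; by exists v.
- move=> w hw.
  have hc : cocycle0 f (dv O (f0 F) w).
    apply/cocE; split; last exact: (dd0 (@f0_minus F) (@f0_deg F) fa).
    by rewrite qv_dv hw (_ : dv O (f0 F) (- w) = - dv O (f0 F) w) ?addNr //; exact: vprodNr.
  have [_ ->] := cl_ker hWuniv hc.
    by have := ql (-1) 0 0; rewrite scaler0 addr0 scaleN1r addNr.
  by exists w; rewrite ?dE //; apply/cE; rewrite scaleN1r.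
Qed.

Import reals complex.

Theorem proposition6p5 (R : realType) (k : R[i])
  (e h f : 'M[R[i]]_6) (hefh : sl2_triple e h f) (hf : jordan_type_4_2 f)
  (hk6 : k <> - 6) (hk92 : k <> - (9 / 2))
  (D : dynkin_bases h) (C : brst_complex k D)
  (Wuniv : vertexSuperAlgType R[i]) (cl : C -> Wuniv)
  (hWuniv : universal_W f cl)
  (W : vertexSuperAlgType R[i]) (q : Wuniv -> W)
  (hW : simple_quotient q)
  (omega : W) (homega : omega = q (cl (brst_conformal C)))
  (J : W) (hJ1 : vprod 1 omega J = J)
  (hJ : heisenberg_field J (4 * (k + 9 / 2))) :
  (conformal_embedding (heisenberg_algebra J)
     (heisenberg_conformal J (4 * (k + 9 / 2))) omega
   <-> k = - (13 / 3)) /\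
  (k = - (45 / 11) ->
   ~ conformal_embedding (heisenberg_algebra J)
       (heisenberg_conformal J (4 * (k + 9 / 2))) omega).
Proof.
have kn : k + 6 != 0 by rewrite addr_eq0; apply/eqP.
have k92 : k + 9 / 2 != 0 by rewrite addr_eq0; apply/eqP.
rewrite homega in hJ1 *.
have main := conformal_level hefh hf kn k92 hWuniv hW hJ1 hJ.
split=> // k45 /main; rewrite k45 => /oppr_inj e1.
by move/eqP: e1; rewrite eqr_div ?pnatr_eq0 // -!natrM eqr_nat.
Qed.
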